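(* For every integer $n\ge 0$, the quaternionic full-polyanalytic Bargmann transform $\mathfrak B:L^2(\mathbb R,\mathbb H^{n+1})\to\widetilde{\mathcal F}^{n+1}_{Slice}(\mathbb H)$ is an isometric isomorphism.
   Context: $\mathbb H$ is the skew field of quaternions, $\mathbb S=\{q\in\mathbb H: q^2=-1\}$, and for $I\in\mathbb S$, $\mathbb C_I=\mathbb R+\mathbb R I$ with Lebesgue measure $d\lambda_I$; $f_I$ denotes the restriction of $f$ to $\mathbb C_I$. $L^2(\mathbb R,\mathbb H)$ is the right quaternionic Hilbert space with $\langle\varphi,\phi\rangle=\int_{\mathbb R}\overline{\phi(x)}\varphi(x)\,dx$. $L^2(\mathbb R,\mathbb H^{n+1})$ consists of $\vec\varphi=(\varphi_0,\dots,\varphi_n)$ with $\|\vec\varphi\|^2_{L^2(\mathbb R,\mathbb H^{n+1})}=\sum_{j=0}^n\|\varphi_j\|^2_{L^2(\mathbb R,\mathbb H)}<\infty$. A function $f:\mathbb H\to\mathbb H$ is a (left) slice function if $f(x+Iy)=\alpha(x,y)+I\beta(x,y)$ for all $x,y\in\mathbb R$, $I\in\mathbb S$, with $\alpha$ even and $\beta$ odd in $y$ ($\mathbb H$-valued). It is slice polyanalytic of order $m\ge1$ if moreover $\alpha,\beta$ are $C^m$ and $\frac1{2^m}(\partial_x+I\partial_y)^mf_I(x+Iy)=0$ for all $I\in\mathbb S$ (slice regular if $m=1$). The slice derivative is $\partial_s f(x+Iy)=\frac12(\partial_x-I\partial_y)f_I(x+Iy)$. $\widetilde{\mathcal F}^{n+1}_{Slice}(\mathbb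 H)$ is the space of slice polyanalytic functions $f:\mathbb H\to\mathbb H$ of order $n+1$ with $\int_{\mathbb C_I}|f_I(q)|^2e^{-2\pi|q|^2}d\lambda_I(q)<\infty$ for a given $I\in\mathbb S$ (the choice is irrelevant), with inner product $\langle f,g\rangle=\int_{\mathbb C_I}\overline{g_I(q)}f_I(q)e^{-2\pi|q|^2}d\lambda_I(q)$ and the associated norm. The quaternionic Segal–Bargmann transform is $\mathcal B\varphi(q)=2^{3/4}\int_{\mathbb R}e^{-\pi(q^2+x^2)+2\pi\sqrt2\,qx}\varphi(x)\,dx$, a slice regular function of $q\in\mathbb H$. The true quaternionic polyanalytic Bargmann transform of order $j+1$ is $$B^{j+1}\varphi(q)=(-1)^j\sqrt{\tfrac{1}{(2\pi)^j j!}}\sum_{k=0}^j\binom jk(-2\pi\bar q)^k\,\partial_s^{j-k}\mathcal B\varphi(q),$$ and the full-polyanalytic Bargmann transform is $\mathfrak B\vec\varphi(q)=\sum_{j=0}^nB^{j+1}\varphi_j(q)$. *)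

(* Defs.v *)
From HB Require Import structures.
From mathcomp Require Import all_boot all_order all_algebra.
From mathcomp Require Import all_classical all_reals all_analysis.
From mathcomp Require Import ring.
Set Implicit Arguments.
Unset Strict Implicit.
Unset Printing Implicit Defensive.
Import Order.TTheory GRing.Theory Num.Theory.
Import numFieldNormedType.Exports.
Local Open Scope classical_set_scope.
Local Open Scope ring_scope.

Record quat (R : Type) := Quat { qre : R; qim_i : R; qim_j : R; qim_k : R }.

Section QuatChoice.
Variable R : Type.
Definition tuple_of_quat (q : quat R) := (qre q, qim_i q, qim_j q, qim_k q).
Definition quat_of_tuple (t : R * R * R * R) :=
  Quat t.1.1.1 t.1.1.2 t.1.2 t.2.
Lemma tuple_of_quatK : cancel tuple_of_quat quat_of_tuple.
Proof. by case. Qed.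
End QuatChoice.

HB.instance Definition _ (R : eqType) :=
  Equality.copy (quat R) (can_type (@tuple_of_quatK R)).
HB.instance Definition _ (R : choiceType) :=
  Choice.copy (quat R) (can_type (@tuple_of_quatK R)).

Section QuatRing.
Variable R : realType.
Implicit Types (p q r : quat R) (a b : R).

Lemma quat_ext p q : qre p = qre q -> qim_i p = qim_i q ->
  qim_j p = qim_j q -> qim_k p = qim_k q -> p = q.
Proof. by case: p q => ? ? ? ? [? ? ? ?] /= -> -> -> ->. Qed.

Definition quat0 : quat R := Quat 0 0 0 0.
Definition quat1 : quat R := Quat 1 0 0 0.
Definition oppq q := Quat (- qre q) (- qim_i q) (- qim_j q) (- qim_k q).
Definition addq p q := Quat (qre p + qre q) (qim_i p + qim_i q)
  (qim_j p + qim_j q) (qim_k p + qim_k q).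
Definition mulq p q := Quat
  (qre p * qre q - qim_i p * qim_i q - qim_j p * qim_j q - qim_k p * qim_k q)
  (qre p * qim_i q + qim_i p * qre q + qim_j p * qim_k q - qim_k p * qim_j q)
  (qre p * qim_j q - qim_i p * qim_k q + qim_j p * qre q + qim_k p * qim_i q)
  (qre p * qim_k q + qim_i p * qim_j q - qim_j p * qim_i q + qim_k p * qre q).
Definition scaleq a q := Quat (a * qre q) (a * qim_i q) (a * qim_j q) (a * qim_k q).

Lemma addqA : associative addq.
Proof. by move=> p q r; apply: quat_ext => /=; ring. Qed.
Lemma addqC : commutative addq.
Proof. by move=> p q; apply: quat_ext => /=; ring. Qed.
Lemma add0q : left_id quat0 addq.
Proof. by move=> p; apply: quat_ext => /=; ring. Qed.
Lemma addNq : left_inverse quat0 oppq addq.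
Proof. by move=> p; apply: quat_ext => /=; ring. Qed.
Lemma mulqA : associative mulq.
Proof. by move=> p q r; apply: quat_ext => /=; ring. Qed.
Lemma mul1q : left_id quat1 mulq.
Proof. by move=> p; apply: quat_ext => /=; ring. Qed.
Lemma mulq1 : right_id quat1 mulq.
Proof. by move=> p; apply: quat_ext => /=; ring. Qed.
Lemma mulqDl : left_distributive mulq addq.
Proof. by move=> p q r; apply: quat_ext => /=; ring. Qed.
Lemma mulqDr : right_distributive mulq addq.
Proof. by move=> p q r; apply: quat_ext => /=; ring. Qed.
Lemma quat1_neq0 : quat1 != quat0.
Proof. by apply/eqP => -[] /eqP; rewrite oner_eq0. Qed.

HB.instance Definition _ := GRing.isZmodule.Build (quat R) addqA addqC add0q addNq.
HB.instance Definition _ := GRing.Zmodule_isNzRing.Build (quat R)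
  mulqA mul1q mulq1 mulqDl mulqDr quat1_neq0.

Lemma scaleqA a b q : scaleq a (scaleq b q) = scaleq (a * b) q.
Proof. by apply: quat_ext => /=; ring. Qed.
Lemma scale1q : left_id 1 scaleq.
Proof. by move=> q; apply: quat_ext => /=; ring. Qed.
Lemma scaleqDr : right_distributive scaleq +%R.
Proof. by move=> a p q; apply: quat_ext => /=; ring. Qed.
Lemma scaleqDl q : {morph scaleq^~ q : a b / a + b}.
Proof. by move=> a b; apply: quat_ext => /=; ring. Qed.

HB.instance Definition _ := GRing.Zmodule_isLmodule.Build R (quat R)
  scaleqA scale1q scaleqDr scaleqDl.

Lemma scaleqAl a p q : a *: (p * q) = (a *: p) * q.
Proof. by apply: quat_ext => /=; ring. Qed.
Lemma scaleqAr a p q : a *: (p * q) = p * (a *: q).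
Proof. by apply: quat_ext => /=; ring. Qed.

HB.instance Definition _ := GRing.Lmodule_isLalgebra.Build R (quat R) scaleqAl.
HB.instance Definition _ := GRing.Lalgebra_isAlgebra.Build R (quat R) scaleqAr.

Definition qconj q : quat R := Quat (qre q) (- qim_i q) (- qim_j q) (- qim_k q).

Definition qabs q : R :=
  Num.sqrt (qre q ^+ 2 + qim_i q ^+ 2 + qim_j q ^+ 2 + qim_k q ^+ 2).

Definition qim q : quat R := Quat 0 (qim_i q) (qim_j q) (qim_k q).

Definition imag_unit (I : quat R) : Prop := I ^+ 2 = -1.

End QuatRing.

(* Limits, derivatives and integrals of H-valued functions are componentwise. *)
Section QuatAnalysis.
Variable R : realType.

Definition qlim (u : nat -> quat R) : quat R :=
  Quat (limn (fun n => qre (u n))) (limn (fun n => qim_i (u n)))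
       (limn (fun n => qim_j (u n))) (limn (fun n => qim_k (u n))).

Definition qexp (q : quat R) : quat R :=
  qlim (fun n => \sum_(k < n) (k`!%:R^-1 : R) *: q ^+ k).

Definition qderive (v : R * R) (F : R * R -> quat R) (p : R * R) : quat R :=
  Quat ('D_v (fun z => qre (F z)) p) ('D_v (fun z => qim_i (F z)) p)
       ('D_v (fun z => qim_j (F z)) p) ('D_v (fun z => qim_k (F z)) p).

Definition qdx : (R * R -> quat R) -> R * R -> quat R := qderive (1, 0).
Definition qdy : (R * R -> quat R) -> R * R -> quat R := qderive (0, 1).

Fixpoint Cm (m : nat) (u : R * R -> R) : Prop :=
  match m with
  | 0 => continuous u
  | m'.+1 => [/\ continuous u,
      forall p, derivable u p (1, 0) /\ derivable u p (0, 1),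
      Cm m' (fun p => 'D_(1, 0) u p) & Cm m' (fun p => 'D_(0, 1) u p)]
  end.

Definition qCm (m : nat) (F : R * R -> quat R) : Prop :=
  [/\ Cm m (fun p => qre (F p)), Cm m (fun p => qim_i (F p)),
      Cm m (fun p => qim_j (F p)) & Cm m (fun p => qim_k (F p))].

Definition qint d (T : measurableType d) (mu : {measure set T -> \bar R})
    (F : T -> quat R) : quat R :=
  Quat (\int[mu]_x qre (F x)) (\int[mu]_x qim_i (F x))
       (\int[mu]_x qim_j (F x)) (\int[mu]_x qim_k (F x)).

End QuatAnalysis.

Section Slice.
Variable R : realType.
Implicit Types (f g : quat R -> quat R) (I q : quat R) (m : nat).

(* The restriction f_I, in the coordinates (x, y) |-> x + I y of C_I. *)
Definition slice_point I (z : R * R) : quat R := z.1%:A + z.2 *: I.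
Definition restr I f (z : R * R) : quat R := f (slice_point I z).

(* alpha, beta witness that f is a slice function. *)
Definition slice_stem f (alpha beta : R * R -> quat R) : Prop :=
  [/\ forall x y, alpha (x, - y) = alpha (x, y),
      forall x y, beta (x, - y) = - beta (x, y) &
      forall I, imag_unit I -> forall z,
        restr I f z = alpha z + I * beta z].

Definition slice_polyanalytic m f : Prop :=
  (exists alpha beta : R * R -> quat R,
     [/\ slice_stem f alpha beta, qCm m alpha & qCm m beta]) /\
  (forall I, imag_unit I -> forall z,
     (2 ^- m : R) *:
       iter m (fun F w => qdx F w + I * qdy F w) (restr I f) z = 0).

(* The coordinates of q = x + I y with y >= 0; for real q any I will do (the
   slice derivative of a slice function there does not depend on it). *)
Definition unit_of q : quat R :=
  if qim q == 0 then Quat 0 1 0 0 else (qabs (qim q))^-1 *: qim q.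
Definition coord_of q : R * R := (qre q, qabs (qim q)).

Definition slice_deriv f q : quat R :=
  let I := unit_of q in
  (2^-1 : R) *: (qdx (restr I f) (coord_of q) - I * qdy (restr I f) (coord_of q)).

End Slice.

Section Spaces.
Variable R : realType.
Local Notation mu := (@lebesgue_measure R).
Local Notation mu2 := (mu \x mu)%E.
Implicit Types (phi psi : R -> quat R) (f g : quat R -> quat R) (I : quat R).

Definition L2 phi : Prop :=
  [/\ measurable_fun setT (fun x => qre (phi x)),
      measurable_fun setT (fun x => qim_i (phi x)),
      measurable_fun setT (fun x => qim_j (phi x)) &
      measurable_fun setT (fun x => qim_k (phi x))] /\
  (\int[mu]_x (qabs (phi x) ^+ 2)%:E < +oo)%E.

Definition L2_inner phi psi : quat R :=
  qint mu (fun x => qconj (psi x) * phi x).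
Definition L2_norm phi : R := Num.sqrt (qre (L2_inner phi phi)).

Definition L2vec n (phi : 'I_n.+1 -> R -> quat R) : Prop := forall j, L2 (phi j).
Definition L2vec_norm n (phi : 'I_n.+1 -> R -> quat R) : R :=
  Num.sqrt (\sum_j L2_norm (phi j) ^+ 2).
Definition L2vec_eq n (phi psi : 'I_n.+1 -> R -> quat R) : Prop :=
  forall j, ae_eq mu setT (phi j) (psi j).

Definition fock_weight I (z : R * R) : R :=
  expR (- 2 * pi * qabs (slice_point I z) ^+ 2).

(* With m = n.+1, the space of the slice polyanalytic functions of order n + 1
   that are square integrable on the slice C_I. *)
Definition slice_polyFock I (m : nat) f : Prop :=
  slice_polyanalytic m f /\
  (\int[mu2]_z (qabs (restr I f z) ^+ 2 * fock_weight I z)%:E < +oo)%E.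

Definition fock_inner I f g : quat R :=
  qint mu2 (fun z => fock_weight I z *: (qconj (restr I g z) * restr I f z)).
Definition fock_norm I f : R := Num.sqrt (qre (fock_inner I f f)).

End Spaces.

Section Bargmann.
Variable R : realType.
Implicit Types (phi : R -> quat R) (q : quat R).

Definition bargmann phi q : quat R :=
  (2 `^ (3 / 4) : R) *: qint (@lebesgue_measure R) (fun x : R =>
    qexp ((- pi) *: (q ^+ 2 + (x ^+ 2)%:A)
          + (2 * pi * Num.sqrt 2 * x) *: q) * phi x).

(* The transform of order j + 1. *)
Definition true_bargmann (j : nat) phi q : quat R :=
  ((-1) ^+ j * Num.sqrt (((2 * pi) ^+ j * j`!%:R)^-1) : R) *:
    \sum_(k < j.+1) 'C(j, k)%:R *
      (((- (2 * pi)) *: qconj q) ^+ k *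
       iter (j - k) (@slice_deriv R) (bargmann phi) q).

Definition full_bargmann n (phi : 'I_n.+1 -> R -> quat R) q : quat R :=
  \sum_(j < n.+1) true_bargmann j (phi j) q.

End Bargmann.

(* Main.v *)
(* On a slice C_I, a slice function f = alpha + I beta splits into four complex functions alpha_c + i beta_c,
   one per real component, each satisfying F(conj z) = conj F(z); since the cross terms of |f|^2 are odd in y,
   the Fock norm of f on C_I is the sum of the four complex Fock norms.  This reduces everything to complex
   analysis with real coefficients.

   With A = d/dz - 2 pi zbar, the functions A^j z^k are orthogonal in L^2(exp(-2 pi |z|^2)) with squared norm
   (2 pi)^j j! k! / (2 (2 pi)^k), and every polyanalytic function of order n + 1 is a sum of A^j E_j, j <= n,
   with entire E_j.  The Parseval identity for such sums holds in [0, +oo]: it is first proved for compactly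
   supported radial cut-offs of the weight, where components of different angular degree stay orthogonal, and
   follows by monotone convergence.

   The coefficients of the Segal-Bargmann transform of a real phi are its inner products with the Hermite
   functions, whose generating function is the Bargmann kernel.  The Hermite functions are complete: if all
   the coefficients vanish, then so does the Fourier transform of phi(t) exp(-pi t^2), and the Poisson kernel
   shows that phi = 0.  Up to the normalizing constant the true transform of order j + 1 is A^j applied to the
   Segal-Bargmann transform, so both norms equal the same sum of squared coefficients; surjectivity is the
   Riesz-Fischer theorem for these coefficients. *)
Require Import Defs.
From HB Require Import structures.
From mathcomp Require Import all_boot all_order all_algebra.
From mathcomp Require Import all_classical all_reals all_analysis.
From mathcomp Require Import ring lra zify.
From mathcomp Require Import complex.
From mathcomp Require Import measurable_realfun.
Import Order.TTheory GRing.Theory Num.Theory.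
Import numFieldNormedType.Exports.
Set Implicit Arguments.
Unset Strict Implicit.
Unset Printing Implicit Defensive.
Local Open Scope classical_set_scope.
Local Open Scope ring_scope.

(** Surjectivity shapes the proof. A function of the Fock space is given only by smooth stems and a
    finite integral, so a pointwise expansion and a norm identity are needed before any summability
    is known; this is why the Parseval identity takes values in [0, +oo]. Grouping by angular degree
    is forced by the cut-offs: for a radial weight other than the Gaussian, A^j z^k and A^l z^m of
    the same degree need not be orthogonal, while parts of different degree are, by rotation
    invariance alone. The Gaussian relations inside one degree enter only after the cut-off has been
    removed. The constants fit for two reasons. The squared Fock norm of z^k is the inverse of the
    squared norm on the line of the k-th Taylor coefficient of the Bargmann kernel ([hnorm0]), and
    the factor (2 pi)^j j! produced by A^j is cancelled by the normalization of the transform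
    ([tcoef_sqr]). Since d/dz commutes with multiplication by zbar, A^j is arranged so that d/dz
    acts on coefficient sequences only. *)

Notation re := complex.Re.
Notation im := complex.Im.
Notation cplx := complex.complex.
Notation Cpx := complex.Complex.

(** * Complex numbers with a real-valued modulus *)

Section ComplexNorm.
Variable R : realType.
Implicit Types (z w : cplx R) (p : R * R).

Definition nc z : R := Num.sqrt (re z ^+ 2 + im z ^+ 2).

Definition cpt p : cplx R := Cpx p.1 p.2.

Definition cj z : cplx R := Cpx (re z) (- im z).

Definition rc (x : R) : cplx R := Cpx x 0.

Lemma cE z w : re z = re w -> im z = im w -> z = w.
Proof. by case: z w => ? ? [? ?] /= -> ->. Qed.
Lemma reD z w : re (z + w) = re z + re w. Proof. by case: z w => ? ? []. Qed.
Lemma imD z w : im (z + w) = im z + im w. Proof. by case: z w => ? ? []. Qed.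
Lemma reN z : re (- z) = - re z. Proof. by case: z. Qed.
Lemma imN z : im (- z) = - im z. Proof. by case: z. Qed.
Lemma reM z w : re (z * w) = re z * re w - im z * im w.
Proof. by case: z w => ? ? []. Qed.
Lemma imM z w : im (z * w) = re z * im w + im z * re w.
Proof. by case: z w => ? ? []. Qed.
Lemma re0 : re (0 : cplx R) = 0. Proof. by []. Qed.
Lemma im0 : im (0 : cplx R) = 0. Proof. by []. Qed.
Lemma re1 : re (1 : cplx R) = 1. Proof. by []. Qed.
Lemma im1 : im (1 : cplx R) = 0. Proof. by []. Qed.
Lemma ren n : re (n%:R : cplx R) = n%:R.
Proof. by elim: n => // n IH; rewrite -!natr1 reD IH. Qed.
Lemma imn n : im (n%:R : cplx R) = 0.
Proof. by elim: n => // n IH; rewrite -!natr1 imD IH addr0. Qed.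
Lemma re_rc x : re (rc x) = x. Proof. by []. Qed.
Lemma im_rc x : im (rc x) = 0. Proof. by []. Qed.
Lemma re_cj z : re (cj z) = re z. Proof. by []. Qed.
Lemma im_cj z : im (cj z) = - im z. Proof. by []. Qed.
Lemma re_cpt p : re (cpt p) = p.1. Proof. by []. Qed.
Lemma im_cpt p : im (cpt p) = p.2. Proof. by []. Qed.

Lemma re_Cpx (x y : R) : re (Cpx x y) = x. Proof. by []. Qed.
Lemma im_Cpx (x y : R) : im (Cpx x y) = y. Proof. by []. Qed.

Definition cRI := (re_Cpx, im_Cpx, reD, imD, reN, imN, reM, imM, re0, im0, re1, im1, ren, imn,
  re_rc, im_rc, re_cj, im_cj, re_cpt, im_cpt).

Lemma re_sum I (r : seq I) P (F : I -> cplx R) :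
  re (\sum_(i <- r | P i) F i) = \sum_(i <- r | P i) re (F i).
Proof. exact: (big_morph _ reD re0). Qed.
Lemma im_sum I (r : seq I) P (F : I -> cplx R) :
  im (\sum_(i <- r | P i) F i) = \sum_(i <- r | P i) im (F i).
Proof. exact: (big_morph _ imD im0). Qed.

Lemma rcD (x y : R) : rc (x + y) = rc x + rc y.
Proof. by apply: cE; rewrite !cRI /= ?addr0. Qed.
Lemma rcM (x y : R) : rc (x * y) = rc x * rc y.
Proof. by apply: cE; rewrite !cRI /=; ring. Qed.
Lemma rcN (x : R) : rc (- x) = - rc x.
Proof. by apply: cE; rewrite !cRI /= ?oppr0. Qed.
Lemma rc0 : rc 0 = 0. Proof. by []. Qed.
Lemma rcn n : rc n%:R = n%:R. Proof. by apply: cE; rewrite !cRI. Qed.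
Lemma rcX (x : R) n : rc (x ^+ n) = rc x ^+ n.
Proof. by elim: n => // n IH; rewrite !exprS rcM IH. Qed.

Lemma cjD z w : cj (z + w) = cj z + cj w.
Proof. by apply: cE; rewrite /= !cRI /= ?opprD. Qed.
Lemma cjM z w : cj (z * w) = cj z * cj w.
Proof. by apply: cE; rewrite /= !cRI /=; ring. Qed.
Lemma cjN z : cj (- z) = - cj z.
Proof. by apply: cE; rewrite /= !cRI. Qed.
Lemma cjK z : cj (cj z) = z.
Proof. by apply: cE; rewrite /= ?opprK. Qed.
Lemma cj0 : cj 0 = 0. Proof. by apply: cE; rewrite /= ?oppr0. Qed.
Lemma cj_rc x : cj (rc x) = rc x. Proof. by apply: cE; rewrite /= ?oppr0. Qed.
Lemma cjX z n : cj (z ^+ n) = cj z ^+ n.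
Proof. by elim: n => [|n IH]; [exact: cj_rc 1|rewrite !exprS cjM IH]. Qed.
Lemma cjn n : cj n%:R = n%:R. Proof. by rewrite -rcn cj_rc. Qed.
Lemma cj_sum I (r : seq I) P (F : I -> cplx R) :
  cj (\sum_(i <- r | P i) F i) = \sum_(i <- r | P i) cj (F i).
Proof. exact: (big_morph _ cjD cj0). Qed.

Lemma nc_ge0 z : 0 <= nc z. Proof. exact: sqrtr_ge0. Qed.
Lemma sqr_nc z : nc z ^+ 2 = re z ^+ 2 + im z ^+ 2.
Proof. by rewrite sqr_sqrtr // addr_ge0 // sqr_ge0. Qed.
Lemma mul_cj z : cj z * z = rc (nc z ^+ 2).
Proof. by rewrite sqr_nc; apply: cE; rewrite !cRI; ring. Qed.
Lemma ncM z w : nc (z * w) = nc z * nc w.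
Proof.
rewrite /nc -sqrtrM ?addr_ge0 ?sqr_ge0 //; congr Num.sqrt.
by rewrite !cRI; ring.
Qed.
Lemma nc_rc x : nc (rc x) = `|x|.
Proof. by rewrite /nc /= expr0n /= addr0 sqrtr_sqr. Qed.
Lemma nc0 : nc 0 = 0. Proof. by rewrite -rc0 nc_rc normr0. Qed.
Lemma nc1 : nc 1 = 1. Proof. by rewrite -[1]/(rc 1) nc_rc normr1. Qed.
Lemma ncX z n : nc (z ^+ n) = nc z ^+ n.
Proof. by elim: n => [|n IH]; rewrite ?expr0 ?nc1 // !exprS ncM IH. Qed.
Lemma ncN z : nc (- z) = nc z.
Proof. by rewrite /nc !cRI !sqrrN. Qed.
Lemma nc_cj z : nc (cj z) = nc z.
Proof. by rewrite /nc /= sqrrN. Qed.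
Lemma nc_n n : nc n%:R = n%:R.
Proof. by rewrite -rcn nc_rc ger0_norm. Qed.

Lemma ler_norm_re z : `|re z| <= nc z.
Proof. by rewrite -sqrtr_sqr ler_wsqrtr // lerDl sqr_ge0. Qed.
Lemma ler_norm_im z : `|im z| <= nc z.
Proof. by rewrite -sqrtr_sqr ler_wsqrtr // lerDr sqr_ge0. Qed.

Lemma ler_ncD z w : nc (z + w) <= nc z + nc w.
Proof.
rewrite -(@ler_pXn2r _ 2) ?nnegrE ?addr_ge0 ?nc_ge0 //.
have h : re z * re w + im z * im w <= nc z * nc w.
  rewrite -[nc w]nc_cj -ncM; apply: le_trans (ler_norm_re _).
  by apply: le_trans (ler_norm _); rewrite !cRI mulrN opprK.
by move: h; rewrite sqrrD !sqr_nc !cRI => h; nra.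
Qed.

Lemma nc_le z : nc z <= `|re z| + `|im z|.
Proof.
have -> : z = rc (re z) + rc (im z) * Cpx 0 1 by apply: cE; rewrite !cRI /=; ring.
apply: le_trans (ler_ncD _ _) _; rewrite ncM !nc_rc !cRI /=.
have -> : nc (Cpx 0 1) = 1 by rewrite /nc /= expr0n expr1n add0r sqrtr1.
by rewrite !(mulr0, mul0r, mulr1, addr0, subr0, add0r).
Qed.

Lemma ler_nc_sum n (F : nat -> cplx R) :
  nc (\sum_(i < n) F i) <= \sum_(i < n) nc (F i).
Proof.
elim: n => [|n IH]; first by rewrite !big_ord0 nc0.
by rewrite !big_ord_recr /=; apply: le_trans (ler_ncD _ _) _; rewrite lerD2r.
Qed.

Lemma cptE z : cpt (re z, im z) = z. Proof. by case: z. Qed.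

End ComplexNorm.

Section Expansion.
Variable R : realType.
Implicit Types (z h : cplx R).

(** Induction on k gives the second-order remainder bound k^2 rho^k |h|^2; k^2 <= 4^k then turns it
    into a geometric bound, which the coefficients of an entire series can absorb. *)
Lemma exprD_taylor z h (rho : R) k : 1 <= rho -> nc z + nc h <= rho ->
  nc ((z + h) ^+ k - z ^+ k - k%:R * z ^+ k.-1 * h)
    <= nc h ^+ 2 * (4 * rho) ^+ k.
Proof.
move=> rho1 zh; have rho0 : 0 <= rho by apply: le_trans rho1.
have hz : nc z <= rho by apply: le_trans zh; rewrite lerDl nc_ge0.
suff H : nc ((z + h) ^+ k - z ^+ k - k%:R * z ^+ k.-1 * h)
    <= nc h ^+ 2 * (k%:R ^+ 2 * rho ^+ k).
  apply: le_trans H _; rewrite ler_wpM2l ?sqr_ge0 // exprMn ler_wpM2r ?exprn_ge0 //.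
  elim: k {zh hz} => [|k IH]; first by rewrite expr0n /= ler01.
  have e0 : 1 <= (4 : R) ^+ k by rewrite exprn_ege1 // ler1n.
  rewrite [4 ^+ k.+1]exprS -natr1; move: IH e0; set X := 4 ^+ k; set y := k%:R.
  by move=> IH X1; have := sqr_ge0 (y - 1); nra.
elim: k => [|k IH].
  by rewrite !expr0 mul0r mul0r subr0 subrr nc0 !mulr_ge0 ?exprn_ge0 ?nc_ge0.
have -> : (z + h) ^+ k.+1 - z ^+ k.+1 - k.+1%:R * z ^+ k.+1.-1 * h =
  (z + h) * ((z + h) ^+ k - z ^+ k - k%:R * z ^+ k.-1 * h)
    + k%:R * z ^+ k.-1 * h ^+ 2.
  case: k {IH} => [|k] /=; first by rewrite !expr0 expr1 /=; ring.
  by rewrite !exprS -natr1; ring.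
apply: le_trans (ler_ncD _ _) _; rewrite !ncM !ncX nc_n.
apply: (@le_trans _ _ (rho * (nc h ^+ 2 * (k%:R ^+ 2 * rho ^+ k)) +
   k%:R * rho ^+ k.+1 * nc h ^+ 2)).
  apply: lerD.
    apply: ler_pM; rewrite ?nc_ge0 //.
    by apply: le_trans zh; exact: ler_ncD.
  rewrite ler_wpM2r ?sqr_ge0 // ler_wpM2l //.
  apply: (@le_trans _ _ (rho ^+ k.-1)); first by rewrite lerXn2r ?nnegrE ?nc_ge0.
  by apply: ler_weXn2l => //; case: (k) => // m; exact: leqW.
rewrite [rho ^+ k.+1]exprS -natr1.
set X := rho ^+ k; set Y := nc h ^+ 2; set y := k%:R.
have -> : rho * (Y * (y ^+ 2 * X)) + y * (rho * X) * Y = (rho * X * Y) * (y ^+ 2 + y) by ring.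
have -> : Y * ((y + 1) ^+ 2 * (rho * X)) = (rho * X * Y) * ((y + 1) ^+ 2) by ring.
apply: ler_wpM2l; first by rewrite !mulr_ge0 ?exprn_ge0 ?nc_ge0.
have : 0 <= y by []. nra.
Qed.

End Expansion.

(** * Entire power series *)

Section ComplexLimits.
Variable R : realType.
Implicit Types (z w l : cplx R) (u v : nat -> cplx R).

Definition ccvg u l :=
  (re (u n) @[n --> \oo] --> re l) /\ (im (u n) @[n --> \oo] --> im l).

Lemma ccvg_unique u l l' : ccvg u l -> ccvg u l' -> l = l'.
Proof.
move=> [a b] [c d]; apply: cE.
  by rewrite -(cvg_lim (@Rhausdorff R) a) (cvg_lim (@Rhausdorff R) c).
by rewrite -(cvg_lim (@Rhausdorff R) b) (cvg_lim (@Rhausdorff R) d).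
Qed.

Lemma ccvg_cst l : ccvg (fun=> l) l.
Proof. by split; apply: cvg_cst. Qed.

Lemma ccvgD u v l l' : ccvg u l -> ccvg v l' -> ccvg (fun n => u n + v n) (l + l').
Proof.
move=> [a b] [c d]; rewrite /ccvg !cRI; under eq_fun do rewrite reD.
by under [X in _ /\ (X @ _ --> _)]eq_fun do rewrite imD; split; apply: cvgD.
Qed.

Lemma ccvgM u v l l' : ccvg u l -> ccvg v l' -> ccvg (fun n => u n * v n) (l * l').
Proof.
move=> [a b] [c d]; rewrite /ccvg !cRI; under eq_fun do rewrite reM.
under [X in _ /\ (X @ _ --> _)]eq_fun do rewrite imM.
by split; [apply: cvgB|apply: cvgD]; apply: cvgM.
Qed.

Lemma ccvgS u l : ccvg u l -> ccvg (fun n => u n.+1) l.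
Proof.
move=> [a b]; split.
  by rewrite (cvg_shiftS (fun n => re (u n))).
by rewrite (cvg_shiftS (fun n => im (u n))).
Qed.

Lemma ccvgN u l : ccvg u l -> ccvg (fun n => - u n) (- l).
Proof.
move=> h; rewrite -mulN1r.
under eq_fun do rewrite -mulN1r.
exact: ccvgM (ccvg_cst _) h.
Qed.

Lemma ccvg_nc_le u l (B : R) : ccvg u l -> (forall n, nc (u n) <= B) -> nc l <= B.
Proof.
move=> [a b] h.
have B0 : 0 <= B by apply: le_trans (h 0%N); apply: nc_ge0.
rewrite -(@ler_pXn2r _ 2) ?nnegrE ?nc_ge0 // sqr_nc.
have : (re (u n) ^+ 2 + im (u n) ^+ 2) @[n --> \oo] --> re l ^+ 2 + im l ^+ 2.
  by under eq_fun do rewrite !expr2; rewrite !expr2; apply: cvgD; apply: cvgM.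
move=> /cvgr_to_le; apply; apply: nearW => n.
by rewrite -sqr_nc lerXn2r ?nnegrE ?nc_ge0.
Qed.

Lemma ccvg0P u : (nc (u n) @[n --> \oo] --> (0 : R)) <-> ccvg u 0.
Proof.
split=> [h|[a b]].
  split; apply/norm_cvg0P; apply: (@squeeze_cvgr _ _ _ _ (fun=> 0) (fun n => nc (u n))) => //;
    try exact: cvg_cst;
    by apply: nearW => n; rewrite normr_ge0 /= (ler_norm_re, ler_norm_im).
apply: (@squeeze_cvgr _ _ _ _ (fun=> 0) (fun n => `|re (u n)| + `|im (u n)|)).
- by apply: nearW => n; rewrite nc_ge0 nc_le.
- exact: cvg_cst.
- by rewrite -[0](addr0 0); apply: cvgD; apply/norm_cvg0P.
Qed.

End ComplexLimits.

Section Entire.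
Variable R : realType.
Implicit Types (a b : nat -> R) (z w h : cplx R) (p : R * R).

(** Infinite radius of convergence: boundedness at every radius is equivalent to summability at
    every radius, by comparing the radii rho and 2 rho. *)
Definition entire a :=
  forall rho : R, 0 <= rho -> exists C, forall k, `|a k| * rho ^+ k <= C.

Definition psum a z N : cplx R := \sum_(k < N) rc (a k) * z ^+ k.

Definition esum a z : cplx R :=
  Cpx (limn (fun N => re (psum a z N))) (limn (fun N => im (psum a z N))).

Definition dseq a k : R := k.+1%:R * a k.+1.

Lemma entire_scale a (c : R) : entire a -> entire (fun k => c * a k).
Proof.
move=> ea rho rho0; have [C h] := ea rho rho0; exists (`|c| * C) => k.
by rewrite normrM -mulrA ler_wpM2l.
Qed.

Lemma entireD a b : entire a -> entire b -> entire (fun k => a k + b k).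
Proof.
move=> ea eb rho rho0; have [C h] := ea rho rho0; have [D h'] := eb rho rho0.
exists (C + D) => k; apply: le_trans (lerD (h k) (h' k)).
by rewrite -mulrDl ler_wpM2r ?exprn_ge0 // ler_normD.
Qed.

Lemma entire0 : entire (fun=> 0).
Proof. by move=> rho _; exists 0 => k; rewrite normr0 mul0r. Qed.

Lemma geo_pow (k : nat) : (k%:R : R) <= 2 ^+ k.
Proof.
elim: k => // k IH; rewrite exprS -natr1.
have : 1 <= (2 : R) ^+ k by rewrite exprn_ege1 // ler1n.
by move: IH; lra.
Qed.

Lemma entire_dseq a : entire a -> entire (dseq a).
Proof.
move=> ea rho rho0.
(* The factor 2 absorbs k + 1 <= 2^(k+1), and a radius at least 1 allows the extra power that comes
   with the shifted index. *)
have [C h] := ea (2 * rho + 1) (ltW (ltr_wpDl (mulr_ge0 (ler0n _ 2) rho0) ltr01)).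
exists (2 * C) => k; rewrite /dseq normrM ger0_norm //.
have C0 : 0 <= C by apply: le_trans (h 0%N); rewrite expr0 mulr1.
have := h k.+1; rewrite exprS => hk.
have e1 : k.+1%:R * rho ^+ k <= 2 * (2 * rho + 1) ^+ k.
  apply: (@le_trans _ _ (2 ^+ k.+1 * rho ^+ k)).
    by rewrite ler_wpM2r ?exprn_ge0 // geo_pow.
  rewrite exprS -mulrA -exprMn ler_pM2l ?ltr0n // lerXn2r ?nnegrE //; lra.
have e2 : (2 * rho + 1) ^+ k <= (2 * rho + 1) * (2 * rho + 1) ^+ k.
  by rewrite ler_peMl ?exprn_ge0 //; lra.
have e3 : `|a k.+1| * ((2 * rho + 1) ^+ k) <= C by apply: le_trans hk; rewrite ler_wpM2l.
rewrite [_ * `|_|]mulrC -mulrA; apply: le_trans (ler_wpM2l (normr_ge0 _) e1) _.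
by rewrite mulrCA ler_wpM2l.
Qed.

Lemma half_sum N : \sum_(k < N) (2^-1 : R) ^+ k <= 2.
Proof.
suff -> : \sum_(k < N) (2^-1 : R) ^+ k = 2 - 2 * 2^-1 ^+ N.
  by rewrite gerBl mulr_ge0 ?exprn_ge0 ?invr_ge0.
elim: N => [|N IH]; first by rewrite big_ord0 expr0; ring.
by rewrite big_ord_recr /= IH exprS; field.
Qed.

(** The bound C at radius 2 rho makes the k-th term at most C 2^-k on the disc of radius rho, hence
    the uniform bound 2 C. *)
Lemma psum_le a (rho : R) : entire a -> 0 <= rho ->
  exists M, forall z, nc z <= rho -> forall N, \sum_(k < N) `|a k| * nc z ^+ k <= M.
Proof.
move=> ea rho0; have [C h] := ea (2 * rho) (mulr_ge0 (ler0n _ 2) rho0).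
exists (2 * C) => z zr N.
have C0 : 0 <= C by apply: le_trans (h 0%N); rewrite expr0 mulr1.
apply: (@le_trans _ _ (\sum_(k < N) C * (2^-1) ^+ k)).
  apply: ler_sum => k _; apply: (@le_trans _ _ (`|a k| * rho ^+ k)).
    by rewrite ler_wpM2l // lerXn2r ?nnegrE ?nc_ge0.
  by rewrite -ler_pdivrMr ?exprn_gt0 ?invr_gt0 // exprVn invrK -mulrA -exprMn mulrC [rho * _]mulrC mulrC.
by rewrite -mulr_sumr mulrC ler_wpM2r // half_sum.
Qed.

End Entire.

(** * Quadratic remainders, Lipschitz bounds, and the derivatives of an entire series *)

Section Criteria.
Variable R : realType.

(** A remainder of order h^2 identifies a directional derivative. Power series and coordinate
    functions are differentiated through this criterion. *)
Lemma is_derive_quad (V : normedModType R) (f : V -> R) (p v : V) (l C : R) :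
  (forall h : R, `|h| <= 1 -> `|f (h *: v + p) - f p - h * l| <= C * h ^+ 2) ->
  is_derive p v f l.
Proof.
move=> H.
have cv : h^-1 *: (f (h *: v + p) - f p) @[h --> 0^'] --> l.
  apply/cvgrPdist_le => e e0; near=> h.
  have h0 : h != 0 by near: h; exact: nbhs_dnbhs_neq.
  have h1 : `|h| <= 1 by near: h; apply: dnbhs0_le.
  have hC : `|h| <= e / (`|C| + 1).
    by near: h; apply: dnbhs0_le; rewrite divr_gt0 // ltr_wpDl.
  have -> : l - h^-1 *: (f (h *: v + p) - f p) =
    - (h^-1 * (f (h *: v + p) - f p - h * l)).
    by rewrite /GRing.scale /=; field.
  rewrite normrN normrM normfV ler_pdivrMl ?normr_gt0 //.
  apply: le_trans (H h h1) _; rewrite -[h ^+ 2]real_normK ?num_real // expr2 mulrCA.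
  rewrite ler_wpM2l //; move: hC; rewrite ler_pdivlMr ?ltr_wpDl // => hC.
  apply: le_trans hC; rewrite mulrC ler_wpM2l //.
  by apply: le_trans (ler_norm C) _; rewrite lerDl.
by split; [apply: cvgP cv|apply: cvg_lim cv].
Unshelve. all: by end_near. Qed.

Lemma continuous_lip (V : normedModType R) (f : V -> R) (p : V) (L : R) :
  (forall q, `|q - p| <= 1 -> `|f q - f p| <= L * `|q - p|) ->
  {for p, continuous f}.
Proof.
move=> H; apply/cvgrPdist_le => e e0; near=> q.
have d1 : `|q - p| <= 1.
  by rewrite distrC; near: q; apply: cvgr_dist_le => //; apply: cvg_id.
have d2 : `|q - p| <= e / (`|L| + 1).
  rewrite distrC; near: q; apply: cvgr_dist_le; first exact: cvg_id.
  by rewrite divr_gt0 // ltr_wpDl.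
rewrite distrC; apply: le_trans (H _ d1) _.
move: d2; rewrite ler_pdivlMr ?ltr_wpDl // mulrC => d2; apply: le_trans d2.
by rewrite ler_wpM2r //; apply: le_trans (ler_norm L) _; rewrite lerDl.
Unshelve. all: by end_near. Qed.

End Criteria.

Section EntireSum.
Variable R : realType.
Implicit Types (a b : nat -> R) (z w h : cplx R) (p : R * R).

(** With u = (|u| + u) - |u|, both series have nonnegative terms and bounded partial sums, so
    monotone convergence applies to each. *)
Lemma abs_cvg_series (u : nat -> R) (M : R) :
  (forall N, \sum_(k < N) `|u k| <= M) -> cvgn (fun N => \sum_(k < N) u k).
Proof.
move=> H.
have H0 (v : nat -> R) (B : R) : (forall k, 0 <= v k) -> (forall N, \sum_(k < N) v k <= B) ->
    cvgn (fun N => \sum_(k < N) v k).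
  move=> v0 vB; apply: nondecreasing_is_cvgn; last by exists B => _ [N _ <-].
  by apply/nondecreasing_seqP => n; rewrite big_ord_recr //= lerDl.
have -> : (fun N => \sum_(k < N) u k) =
  (fun N => \sum_(k < N) (`|u k| + u k) - \sum_(k < N) `|u k|).
  by apply/funext => N; rewrite -sumrB; apply: eq_bigr => k _; rewrite addrC addKr.
have c2 := H0 (fun k => `|u k|) M (fun k => normr_ge0 _) H.
suff c1 : cvgn (fun N => \sum_(k < N) (`|u k| + u k)) by exact: is_cvgB c1 c2.
refine (H0 (fun k => `|u k| + u k) (M + M) _ _).
  by move=> k; rewrite -lerBlDr sub0r -normrN ler_norm.
move=> N; apply: le_trans (lerD (H N) (H N)); rewrite -big_split /=.
by apply: ler_sum => k _; rewrite lerD2l ler_norm.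
Qed.

Lemma esum_cvg a z : entire a -> ccvg (psum a z) (esum a z).
Proof.
move=> ea; have [M hM] := psum_le ea (nc_ge0 z).
split => /=.
  under eq_fun do rewrite re_sum.
  refine (@abs_cvg_series (fun k => re (rc (a k) * z ^+ k)) M _) => N; apply: le_trans (hM z (lexx _) N).
  by apply: ler_sum => k _; rewrite -ncX -[`|a k|]nc_rc -ncM ler_norm_re.
under eq_fun do rewrite im_sum.
refine (@abs_cvg_series (fun k => im (rc (a k) * z ^+ k)) M _) => N; apply: le_trans (hM z (lexx _) N).
by apply: ler_sum => k _; rewrite -ncX -[`|a k|]nc_rc -ncM ler_norm_im.
Qed.

(** The derived series stops one term earlier: with N.+1 terms on one side and N on the other, the
    identity is exact term by term. *)
Lemma psum_taylor a z h N :
  psum a (z + h) N.+1 - psum a z N.+1 - psum (dseq a) z N * h =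
  \sum_(k < N.+1) rc (a k) * ((z + h) ^+ k - z ^+ k - k%:R * z ^+ k.-1 * h).
Proof.
have -> : psum (dseq a) z N = \sum_(k < N.+1) rc (a k) * (k%:R * z ^+ k.-1).
  rewrite big_ord_recl mul0r mulr0 add0r; apply: eq_bigr => k _ /=.
  by rewrite /bump leq0n add1n /= /dseq rcM rcn mulrCA mulrA.
rewrite /psum mulr_suml -!sumrB; apply: eq_bigr => k _; ring.
Qed.

Lemma esum_taylor a (rho : R) : entire a -> 1 <= rho -> exists M, 0 <= M /\
  forall z h, nc z + nc h <= rho ->
    nc (esum a (z + h) - esum a z - esum (dseq a) z * h) <= M * nc h ^+ 2.
Proof.
move=> ea rho1; have rho0 : 0 <= 4 * rho by rewrite mulr_ge0 // (le_trans _ rho1).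
(* The radius 4 rho is the base of the geometric bound in [exprD_taylor]; the sum of the absolute
   terms at that radius is the Taylor constant. *)
have [M hM] := psum_le ea rho0.
have ncr : nc (rc (4 * rho)) = 4 * rho by rewrite nc_rc ger0_norm.
exists M; split.
  by apply: le_trans (hM (rc (4 * rho)) _ 0%N); rewrite ?big_ord0 ?ncr.
move=> z h zh.
apply: (@ccvg_nc_le _ (fun N => psum a (z + h) N.+1 - psum a z N.+1 - psum (dseq a) z N * h)).
  apply: ccvgD; first apply: ccvgD.
  - exact/(@ccvgS _ (psum a (z + h)))/esum_cvg.
  - by apply: ccvgN; apply/(@ccvgS _ (psum a z))/esum_cvg.
  - by apply: ccvgN; apply: ccvgM (ccvg_cst _); apply/esum_cvg/entire_dseq.
move=> N; rewrite psum_taylor.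
have := hM (rc (4 * rho)) _ N.+1; rewrite ncr lexx => /(_ isT) hN.
apply: le_trans (ler_wpM2r (sqr_ge0 _) hN); rewrite mulr_suml.
apply: le_trans (ler_nc_sum N.+1 (fun k => rc (a k) *
  ((z + h) ^+ k - z ^+ k - k%:R * z ^+ k.-1 * h))) _.
apply: ler_sum => k _; rewrite ncM nc_rc -[leRHS]mulrA ler_wpM2l // [leRHS]mulrC.
exact: exprD_taylor.
Qed.

Definition U a p : R := re (esum a (cpt p)).
Definition V a p : R := im (esum a (cpt p)).

Lemma cpt_shift (t : R) (v p : R * R) : cpt (t *: v + p) = cpt p + rc t * cpt v.
Proof. by apply: cE; rewrite !cRI /= /GRing.scale /= !mul0r ?subr0 ?addr0 addrC. Qed.

Lemma esum_dir a p v : entire a -> nc (cpt v) <= 1 -> exists M, forall t : R, `|t| <= 1 ->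
    nc (esum a (cpt (t *: v + p)) - esum a (cpt p)
       - rc t * (esum (dseq a) (cpt p) * cpt v)) <= M * t ^+ 2.
Proof.
move=> ea v1.
have [|M [M0 hM]] := @esum_taylor a (nc (cpt p) + 1) ea.
  by rewrite lerDr nc_ge0.
exists M => t t1; rewrite cpt_shift.
have nt : nc (rc t * cpt v) <= `|t| by rewrite ncM nc_rc ler_piMr.
have -> : rc t * (esum (dseq a) (cpt p) * cpt v) = esum (dseq a) (cpt p) * (rc t * cpt v) by ring.
apply: le_trans (hM _ _ _) _; first by rewrite lerD2l (le_trans nt).
rewrite ler_wpM2l // -[t ^+ 2]real_normK ?num_real //.
by rewrite lerXn2r ?nnegrE ?nc_ge0.
Qed.

Lemma is_derive_U a p v : entire a -> nc (cpt v) <= 1 ->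
  is_derive p v (U a) (re (esum (dseq a) (cpt p) * cpt v)).
Proof.
move=> ea v1; have [M hM] := esum_dir p ea v1.
apply: (@is_derive_quad _ _ _ _ _ _ M) => h h1; apply: le_trans (hM h h1).
by apply: le_trans (ler_norm_re _); rewrite !cRI mul0r subr0.
Qed.

Lemma is_derive_V a p v : entire a -> nc (cpt v) <= 1 ->
  is_derive p v (V a) (im (esum (dseq a) (cpt p) * cpt v)).
Proof.
move=> ea v1; have [M hM] := esum_dir p ea v1.
apply: (@is_derive_quad _ _ _ _ _ _ M) => h h1; apply: le_trans (hM h h1).
by apply: le_trans (ler_norm_im _); rewrite !cRI mul0r addr0.
Qed.

Lemma nc_e1 : nc (cpt (1, 0) : cplx R) <= 1.
Proof. by rewrite -[cpt _]/(rc 1) nc_rc normr1. Qed.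
Lemma nc_e2 : nc (cpt (0, 1) : cplx R) <= 1.
Proof. by rewrite /nc /= expr0n expr1n add0r sqrtr1. Qed.

Lemma dxU a p : entire a -> is_derive p (1, 0) (U a) (U (dseq a) p).
Proof.
move=> ea; apply: is_derive_eq (is_derive_U p ea nc_e1) _.
by rewrite /U !cRI mulr1 mulr0 subr0.
Qed.
Lemma dyU a p : entire a -> is_derive p (0, 1) (U a) (- V (dseq a) p).
Proof.
move=> ea; apply: is_derive_eq (is_derive_U p ea nc_e2) _.
by rewrite /V !cRI mulr1 mulr0 sub0r.
Qed.
Lemma dxV a p : entire a -> is_derive p (1, 0) (V a) (V (dseq a) p).
Proof.
move=> ea; apply: is_derive_eq (is_derive_V p ea nc_e1) _.
by rewrite /V !cRI mulr1 mulr0 add0r.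
Qed.
Lemma dyV a p : entire a -> is_derive p (0, 1) (V a) (U (dseq a) p).
Proof.
move=> ea; apply: is_derive_eq (is_derive_V p ea nc_e2) _.
by rewrite /U !cRI mulr1 mulr0 addr0.
Qed.

Lemma nc_cpt_le p : nc (cpt p) <= 2 * `|p|.
Proof.
apply: le_trans (nc_le _) _; rewrite !cRI mulr_natl mulr2n.
by apply: lerD; rewrite prod_normE le_max lexx ?orbT.
Qed.

Lemma esum_lip a p : entire a -> exists L, forall q, `|q - p| <= 1 ->
  nc (esum a (cpt q) - esum a (cpt p)) <= L * `|q - p|.
Proof.
move=> ea; have [|M [M0 hM]] := @esum_taylor a (nc (cpt p) + 2) ea.
  by have := nc_ge0 (cpt p); lra.
set D := nc (esum (dseq a) (cpt p)).
exists (4 * M + 2 * D) => q q1.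
have -> : cpt q = cpt p + cpt (q - p) by apply: cE; rewrite !cRI /= addrC subrK.
have h := nc_cpt_le (q - p).
have h2 : nc (cpt (q - p)) <= 2 by lra.
have := hM (cpt p) (cpt (q - p)); rewrite lerD2l => /(_ h2) h3.
rewrite -[X in nc X](subrK (esum (dseq a) (cpt p) * cpt (q - p))).
apply: le_trans (ler_ncD _ _) _; rewrite ncM -/D.
have D0 : 0 <= D by exact: nc_ge0.
have h0 : 0 <= nc (cpt (q - p)) by exact: nc_ge0.
rewrite mulrDl; apply: lerD.
  apply: le_trans h3 _; rewrite [4 * M]mulrC -mulrA ler_wpM2l //; nra.
by rewrite [2 * D]mulrC -mulrA ler_wpM2l.
Qed.

Lemma continuous_U a : entire a -> continuous (U a).
Proof.
move=> ea p; have [L hL] := esum_lip p ea; apply: (@continuous_lip _ _ _ _ L) => q q1.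
by apply: le_trans (hL q q1); apply: le_trans (ler_norm_re _); rewrite !cRI.
Qed.

Lemma continuous_V a : entire a -> continuous (V a).
Proof.
move=> ea p; have [L hL] := esum_lip p ea; apply: (@continuous_lip _ _ _ _ L) => q q1.
by apply: le_trans (hL q q1); apply: le_trans (ler_norm_im _); rewrite !cRI.
Qed.

End EntireSum.

(** * Calculus of C^m functions of two real variables *)

Section CmCalculus.
Variable R : realType.
Implicit Types (u v : R * R -> R) (m : nat).

Lemma Cm_continuous m u : Cm m u -> continuous u.
Proof. by case: m => [//|m []]. Qed.

Lemma CmW m u : Cm m.+1 u -> Cm m u.
Proof.
elim: m u => [|m IH] u; first by case.
by move=> [cu du h1 h2]; split; [exact: cu|exact: du|exact: (IH _ h1)|exact: (IH _ h2)].
Qed.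

Lemma Cm_derivable1 m u p : Cm m.+1 u -> derivable u p (1, 0).
Proof. by case=> _ /(_ p) []. Qed.
Lemma Cm_derivable2 m u p : Cm m.+1 u -> derivable u p (0, 1).
Proof. by case=> _ /(_ p) []. Qed.

(** Replaces the abstract partial derivatives in [Cm] by explicit formulas for them. *)
Lemma Cm_intro m u (ux uy : R * R -> R) : continuous u ->
  (forall p : R * R, is_derive p (1, 0) u (ux p)) ->
  (forall p : R * R, is_derive p (0, 1) u (uy p)) ->
  Cm m ux -> Cm m uy -> Cm m.+1 u.
Proof.
move=> cu hx hy cx cy.
have ex : 'D_(1, 0) u = ux by apply/funext => p; case: (hx p).
have ey : 'D_(0, 1) u = uy by apply/funext => p; case: (hy p).
rewrite -ex in cx; rewrite -ey in cy; split; [exact: cu| |exact: cx|exact: cy].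
by move=> p; split; [case: (hx p)|case: (hy p)].
Qed.

Lemma Cm_cst m (c : R) : Cm m (fun=> c).
Proof.
elim: m c => [|m IH] c; first exact: cst_continuous.
apply: (@Cm_intro _ _ (fun=> 0) (fun=> 0)); [exact: cst_continuous|exact: IH|exact: IH].
Qed.

Lemma Cm_fst m : Cm m (fun p : R * R => p.1).
Proof.
case: m => [|m]; first by move=> p; apply: cvg_fst.
apply: (@Cm_intro _ _ (fun=> 1) (fun=> 0)); try exact: Cm_cst.
- by move=> p; apply: cvg_fst.
- move=> p; apply: (@is_derive_quad _ _ _ _ _ _ 0) => h _.
  by rewrite mul0r /= /GRing.scale /= mulr1 addrK subrr normr0.
- move=> p; apply: (@is_derive_quad _ _ _ _ _ _ 0) => h _.
  by rewrite mul0r /= /GRing.scale /= mulr0 add0r subrr subr0 normr0.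
Qed.

Lemma Cm_snd m : Cm m (fun p : R * R => p.2).
Proof.
case: m => [|m]; first by move=> p; apply: cvg_snd.
apply: (@Cm_intro _ _ (fun=> 0) (fun=> 1)); try exact: Cm_cst.
- by move=> p; apply: cvg_snd.
- move=> p; apply: (@is_derive_quad _ _ _ _ _ _ 0) => h _.
  by rewrite mul0r /= /GRing.scale /= mulr0 add0r subrr subr0 normr0.
- move=> p; apply: (@is_derive_quad _ _ _ _ _ _ 0) => h _.
  by rewrite mul0r /= /GRing.scale /= mulr1 addrK subrr normr0.
Qed.

Lemma CmD m u v : Cm m u -> Cm m v -> Cm m (fun p => u p + v p).
Proof.
elim: m u v => [|m IH] u v; first by move=> cu cv p; apply: cvgD; [exact: cu|exact: cv].
move=> hu hv; have [cu _ ux uy] := hu; have [cv _ vx vy] := hv.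
apply: (Cm_intro _ _ _ (IH _ _ ux vx) (IH _ _ uy vy)).
- by move=> p; apply: cvgD; [exact: cu|exact: cv].
- by move=> p; apply: is_deriveD; apply: derivableP; apply: Cm_derivable1; eassumption.
- by move=> p; apply: is_deriveD; apply: derivableP; apply: Cm_derivable2; eassumption.
Qed.

Lemma CmM m u v : Cm m u -> Cm m v -> Cm m (fun p => u p * v p).
Proof.
elim: m u v => [|m IH] u v; first by move=> cu cv p; apply: cvgM; [exact: cu|exact: cv].
move=> hu hv; have [cu _ ux uy] := hu; have [cv _ vx vy] := hv.
have [u' v'] := (CmW hu, CmW hv).
apply: (Cm_intro _ _ _ (CmD (IH _ _ u' vx) (IH _ _ v' ux)) (CmD (IH _ _ u' vy) (IH _ _ v' uy))).
- by move=> p; apply: cvgM; [exact: cu|exact: cv].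
- by move=> p; apply: is_deriveM; apply: derivableP; apply: Cm_derivable1; eassumption.
- by move=> p; apply: is_deriveM; apply: derivableP; apply: Cm_derivable2; eassumption.
Qed.

Lemma CmZ m (c : R) u : Cm m u -> Cm m (fun p => c * u p).
Proof. by move=> hu; apply: CmM => //; exact: Cm_cst. Qed.

Lemma CmN m u : Cm m u -> Cm m (fun p => - u p).
Proof. by move=> /(CmZ (-1)); under eq_fun do rewrite mulN1r. Qed.

Lemma CmB m u v : Cm m u -> Cm m v -> Cm m (fun p => u p - v p).
Proof. by move=> hu hv; apply: CmD => //; exact: CmN. Qed.

(** The partial derivatives of [U a] and [V a] are, up to sign, [U] and [V] of the derived sequence,
    so the induction has to run over all entire sequences and both functions at once. *)
Lemma Cm_UV m (a : nat -> R) : entire a -> Cm m (U a) /\ Cm m (V a).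
Proof.
elim: m a => [|m IH] a ea; first by split; [exact: continuous_U|exact: continuous_V].
have [hU hV] := IH _ (entire_dseq ea).
split.
  apply: (Cm_intro (continuous_U ea) _ _ hU (CmN hV)) => p; [exact: dxU|exact: dyU].
apply: (Cm_intro (continuous_V ea) _ _ hV hU) => p; [exact: dxV|exact: dyV].
Qed.

End CmCalculus.

(** * Wirtinger calculus and polyanalytic functions *)

Section Dbar.
Variable R : realType.
Implicit Types (F G : R * R -> cplx R) (m n : nat) (p : R * R) (c : cplx R).

Definition cCm m F := Cm m (fun p => re (F p)) /\ Cm m (fun p => im (F p)).

(** This is d/dx + i d/dy, twice the usual Wirtinger operator, so that it matches the operator
    iterated in [slice_polyanalytic]; it sends zbar to 2. *)
Definition dbar F p : cplx R :=
  Cpx ('D_(1, 0) (fun p => re (F p)) p - 'D_(0, 1) (fun p => im (F p)) p)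
      ('D_(1, 0) (fun p => im (F p)) p + 'D_(0, 1) (fun p => re (F p)) p).

Lemma cCm_dbar m F : cCm m.+1 F -> cCm m (dbar F).
Proof.
move=> [[_ _ a b] [_ _ c d]]; split => /=; first exact: CmB.
exact: CmD.
Qed.

Lemma cCmW m F : cCm m.+1 F -> cCm m F.
Proof. by move=> [a b]; split; apply: CmW. Qed.

Lemma cCm_le m n F : (n <= m)%N -> cCm m F -> cCm n F.
Proof.
move=> nm; rewrite -(subnK nm); elim: (m - n)%N => [//|k IH] /=.
by rewrite addSn => /cCmW.
Qed.

Lemma cCm_cst m c : cCm m (fun=> c).
Proof. by split; apply: Cm_cst. Qed.

Lemma cCmD m F G : cCm m F -> cCm m G -> cCm m (fun p => F p + G p).
Proof.
move=> [a b] [c d]; split; first by under eq_fun do rewrite reD; exact: CmD.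
by under eq_fun do rewrite imD; exact: CmD.
Qed.

Lemma cCmM m F G : cCm m F -> cCm m G -> cCm m (fun p => F p * G p).
Proof.
move=> [a b] [c d]; split.
  by under eq_fun do rewrite reM; apply: CmB; exact: CmM.
by under eq_fun do rewrite imM; apply: CmD; exact: CmM.
Qed.

Lemma cCm_cjcpt m : cCm m (fun p => cj (cpt p)).
Proof. by split => /=; [exact: Cm_fst|apply: CmN; exact: Cm_snd]. Qed.

Lemma cCm_zbarM m F : cCm m F -> cCm m (fun p => cj (cpt p) * F p).
Proof. by move=> h; apply: cCmM => //; exact: cCm_cjcpt. Qed.

Lemma cCmZ m c F : cCm m F -> cCm m (fun p => c * F p).
Proof. by move=> h; apply: cCmM => //; exact: cCm_cst. Qed.

Lemma cCm_sum m I (s : seq I) (F : I -> R * R -> cplx R) :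
  (forall i, cCm m (F i)) -> cCm m (fun p => \sum_(i <- s) F i p).
Proof.
move=> h; elim: s => [|i s IH].
  by under eq_fun do rewrite big_nil; exact: cCm_cst.
by under eq_fun do rewrite big_cons; exact: cCmD.
Qed.

Lemma dbarP F p (a b c d : R) :
  is_derive p (1, 0) (fun p => re (F p)) a -> is_derive p (0, 1) (fun p => im (F p)) b ->
  is_derive p (1, 0) (fun p => im (F p)) c -> is_derive p (0, 1) (fun p => re (F p)) d ->
  dbar F p = Cpx (a - b) (c + d).
Proof. by rewrite /dbar => -[_ ->] [_ ->] [_ ->] [_ ->]. Qed.

Lemma cCm_deriv m F p : cCm m.+1 F ->
  [/\ is_derive p (1, 0) (fun p => re (F p)) ('D_(1, 0) (fun p => re (F p)) p),
      is_derive p (0, 1) (fun p => im (F p)) ('D_(0, 1) (fun p => im (F p)) p),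
      is_derive p (1, 0) (fun p => im (F p)) ('D_(1, 0) (fun p => im (F p)) p) &
      is_derive p (0, 1) (fun p => re (F p)) ('D_(0, 1) (fun p => re (F p)) p)].
Proof.
move=> [a b]; split; apply: derivableP.
- exact: Cm_derivable1 a.
- exact: Cm_derivable2 b.
- exact: Cm_derivable1 b.
- exact: Cm_derivable2 a.
Qed.

Lemma is_derive_ext (V : normedModType R) (f g : V -> R) (p v : V) l :
  f =1 g -> is_derive p v f l -> is_derive p v g l.
Proof. by move=> /funext ->. Qed.

Lemma is_deriveM_fun (V : normedModType R) (f g : V -> R) (p v : V) a b :
  is_derive p v f a -> is_derive p v g b ->
  is_derive p v (fun q => f q * g q) (f p * b + g p * a).
Proof. by move=> ha hb; apply: (is_deriveM ha hb). Qed.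

Lemma is_deriveD_fun (V : normedModType R) (f g : V -> R) (p v : V) a b :
  is_derive p v f a -> is_derive p v g b ->
  is_derive p v (fun q => f q + g q) (a + b).
Proof. by move=> ha hb; apply: (is_deriveD ha hb). Qed.

Lemma is_deriveB_fun (V : normedModType R) (f g : V -> R) (p v : V) a b :
  is_derive p v f a -> is_derive p v g b ->
  is_derive p v (fun q => f q - g q) (a - b).
Proof. by move=> ha hb; apply: (is_deriveB ha hb). Qed.

Lemma dbarD m F G p : cCm m.+1 F -> cCm m.+1 G ->
  dbar (fun p => F p + G p) p = dbar F p + dbar G p.
Proof.
move=> /(cCm_deriv p) [a b c d] /(cCm_deriv p) [a' b' c' d'].
rewrite (@dbarP _ _ _ _ _ _ (is_derive_ext _ (is_deriveD_fun a a'))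
  (is_derive_ext _ (is_deriveD_fun b b')) (is_derive_ext _ (is_deriveD_fun c c'))
  (is_derive_ext _ (is_deriveD_fun d d'))) => [|q|q|q|q]; try by rewrite !cRI.
by apply: cE; rewrite /dbar !cRI; ring.
Qed.

Lemma dbarM m F G p : cCm m.+1 F -> cCm m.+1 G ->
  dbar (fun p => F p * G p) p = dbar F p * G p + F p * dbar G p.
Proof.
move=> /(cCm_deriv p) [a b c d] /(cCm_deriv p) [a' b' c' d'].
rewrite (@dbarP _ _ _ _ _ _
  (is_derive_ext _ (is_deriveB_fun (is_deriveM_fun a a') (is_deriveM_fun c c')))
  (is_derive_ext _ (is_deriveD_fun (is_deriveM_fun d b') (is_deriveM_fun b d')))
  (is_derive_ext _ (is_deriveD_fun (is_deriveM_fun a c') (is_deriveM_fun c a')))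
  (is_derive_ext _ (is_deriveB_fun (is_deriveM_fun d d') (is_deriveM_fun b b'))))
  => [|q|q|q|q]; try by rewrite !cRI.
by apply: cE; rewrite /dbar !cRI; ring.
Qed.

Lemma dbar_cst c p : dbar (fun=> c) p = 0.
Proof.
have h w : is_derive p w (fun=> re c) 0 by apply: is_derive_cst.
have h' w : is_derive p w (fun=> im c) 0 by apply: is_derive_cst.
by rewrite (dbarP (h _) (h' _) (h' _) (h _)); apply: cE; rewrite !cRI /= ?subrr ?addr0.
Qed.

Lemma dbarZ m c F p : cCm m.+1 F -> dbar (fun p => c * F p) p = c * dbar F p.
Proof. by move=> h; rewrite (dbarM p (cCm_cst m.+1 c) h) dbar_cst mul0r add0r. Qed.

Lemma is_derive_fst1 p : is_derive p (1, 0) (fun p : R * R => p.1) 1.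
Proof.
apply: (@is_derive_quad _ _ _ _ _ _ 0) => h _.
by rewrite mul0r /= /GRing.scale /= mulr1 addrK subrr normr0.
Qed.
Lemma is_derive_fst2 p : is_derive p (0, 1) (fun p : R * R => p.1) 0.
Proof.
apply: (@is_derive_quad _ _ _ _ _ _ 0) => h _.
by rewrite mul0r /= /GRing.scale /= mulr0 add0r subrr subr0 normr0.
Qed.
Lemma is_derive_snd1 p : is_derive p (1, 0) (fun p : R * R => p.2) 0.
Proof.
apply: (@is_derive_quad _ _ _ _ _ _ 0) => h _.
by rewrite mul0r /= /GRing.scale /= mulr0 add0r subrr subr0 normr0.
Qed.
Lemma is_derive_snd2 p : is_derive p (0, 1) (fun p : R * R => p.2) 1.
Proof.
apply: (@is_derive_quad _ _ _ _ _ _ 0) => h _.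
by rewrite mul0r /= /GRing.scale /= mulr1 addrK subrr normr0.
Qed.

Lemma dbar_zbar p : dbar (fun p => cj (cpt p)) p = 2.
Proof.
have [a b] := (is_deriveN (is_derive_snd2 p), is_deriveN (is_derive_snd1 p)).
rewrite (@dbarP (fun p => cj (cpt p)) p _ _ _ _ (is_derive_fst1 p) a b (is_derive_fst2 p)).
by apply: cE; rewrite /dbar !cRI; ring.
Qed.

Lemma dbar_zbarM m F p : cCm m.+1 F ->
  dbar (fun p => cj (cpt p) * F p) p = 2 * F p + cj (cpt p) * dbar F p.
Proof. by move=> h; rewrite (dbarM p (cCm_cjcpt m.+1) h) dbar_zbar. Qed.

Lemma cCm_iter_dbar m n F : cCm (m + n) F -> cCm m (iter n dbar F).
Proof.
elim: n m F => [|n IH] m F; first by rewrite addn0.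
by rewrite addnS iterSr => /cCm_dbar/IH.
Qed.

Lemma iter_dbarD m F G : cCm m F -> cCm m G ->
  iter m dbar (fun p => F p + G p) = (fun p => iter m dbar F p + iter m dbar G p).
Proof.
elim: m F G => [//|m IH] F G hF hG; rewrite !iterSr.
rewrite (_ : dbar _ = (fun p => dbar F p + dbar G p)).
  by rewrite IH //; apply: cCm_dbar.
by apply/funext => p; exact: dbarD hF hG.
Qed.

Lemma iter_dbarZ m c F : cCm m F ->
  iter m dbar (fun p => c * F p) = (fun p => c * iter m dbar F p).
Proof.
elim: m F => [//|m IH] F hF; rewrite !iterSr.
rewrite (_ : dbar _ = (fun p => c * dbar F p)).
  by rewrite IH //; apply: cCm_dbar.
by apply/funext => p; exact: dbarZ hF.
Qed.

(** The commutator of [dbar]^m with multiplication by zbar is 2 m [dbar]^(m-1). At m = 0 the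
    coefficient vanishes, which makes the truncated [m.-1] harmless. *)
Lemma iter_dbar_zbar m F : cCm m F ->
  iter m dbar (fun p => cj (cpt p) * F p) =
  (fun p => cj (cpt p) * iter m dbar F p + (2 * m)%:R * iter m.-1 dbar F p).
Proof.
elim: m F => [|m IH] F hF; first by apply/funext => p /=; rewrite muln0 mul0r addr0.
rewrite !iterSr.
rewrite (_ : dbar _ = (fun p => 2 * F p + cj (cpt p) * dbar F p)); last first.
  by apply/funext => p; exact: dbar_zbarM hF.
rewrite iter_dbarD; last 2 first.
- exact/cCmZ/cCmW.
- exact/cCm_zbarM/cCm_dbar.
rewrite iter_dbarZ ?IH; [|exact: cCm_dbar|exact: cCmW].
apply/funext => p /=; case: m {IH hF} => [|m] /=.
  by rewrite muln0 muln1; ring.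
by rewrite -iterSr /= !mulnS !natrD; ring.
Qed.

Lemma iter_dbar0 m : iter m dbar (fun=> 0) = (fun=> 0).
Proof.
elim: m => // m IH; rewrite iterS IH; apply/funext => p; exact: dbar_cst.
Qed.

Lemma iter_dbar_le m n F : (m <= n)%N ->
  iter m dbar F = (fun=> 0) -> iter n dbar F = (fun=> 0).
Proof. by move=> mn h; rewrite -(subnK mn) iterD h iter_dbar0. Qed.

End Dbar.

Section HermiteSum.
Variable R : realType.
Implicit Types (a b : nat -> R) (z w : cplx R) (p : R * R).

Lemma esumD a b z : entire a -> entire b ->
  esum (fun k => a k + b k) z = esum a z + esum b z.
Proof.
move=> ea eb; apply: (ccvg_unique (esum_cvg z (entireD ea eb))).
have := ccvgD (esum_cvg z ea) (esum_cvg z eb).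
rewrite (_ : (fun n => _) = psum (fun k => a k + b k) z) //.
apply/funext => N; rewrite /psum -big_split /=; apply: eq_bigr => k _.
by rewrite rcD mulrDl.
Qed.

Lemma esumZ (c : R) a z : entire a -> esum (fun k => c * a k) z = rc c * esum a z.
Proof.
move=> ea; apply: (ccvg_unique (esum_cvg z (entire_scale c ea))).
have := ccvgM (ccvg_cst (rc c)) (esum_cvg z ea).
rewrite (_ : (fun n => _) = psum (fun k => c * a k) z) //.
apply/funext => N; rewrite /psum mulr_sumr; apply: eq_bigr => k _.
by rewrite rcM mulrA.
Qed.

Lemma ccvg_cj (u : nat -> cplx R) l : ccvg u l -> ccvg (fun n => cj (u n)) (cj l).
Proof. by move=> [a b]; split => //=; apply: cvgN. Qed.

(** Conjugation commutes with the series because its coefficients are real. *)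
Lemma esum_cj a z : entire a -> esum a (cj z) = cj (esum a z).
Proof.
move=> ea; apply: (ccvg_unique (esum_cvg _ ea)).
have := ccvg_cj (esum_cvg z ea).
rewrite (_ : (fun n => _) = psum a (cj z)) //.
apply/funext => N; rewrite /psum cj_sum; apply: eq_bigr => k _.
by rewrite cjM cj_rc cjX.
Qed.

Lemma dbar_esum a p : entire a -> dbar (fun p => esum a (cpt p)) p = 0.
Proof.
move=> ea; rewrite (@dbarP _ (fun p => esum a (cpt p)) p _ _ _ _ (dxU p ea) (dyV p ea) (dxV p ea) (dyU p ea)).
by apply: cE; rewrite !cRI /= subrr.
Qed.

Lemma cCm_esum m a : entire a -> cCm m (fun p => esum a (cpt p)).
Proof. by move=> ea; have [] := Cm_UV m ea. Qed.

Definition tpi : R := 2 * pi.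

Lemma tpi_gt0 : 0 < tpi. Proof. by rewrite mulr_gt0 // pi_gt0. Qed.
Lemma tpi_neq0 : tpi != 0. Proof. by rewrite gt_eqF // tpi_gt0. Qed.

(** [HE j a] is A^j E for the entire series E of [a], with A = d/dz - 2 pi zbar. As d/dz commutes
    with multiplication by zbar, A^(j+1) E = A^j E' - 2 pi zbar A^j E, so no derivative of a
    non-holomorphic function has to be taken. *)
Fixpoint HE j a z : cplx R :=
  if j is j'.+1 then HE j' (dseq a) z - rc tpi * (cj z * HE j' a z) else esum a z.

Lemma cCm_HE m j a : entire a -> cCm m (fun p => HE j a (cpt p)).
Proof.
elim: j a => [|j IH] a ea /=; first exact: cCm_esum.
under eq_fun do rewrite -mulNr.
apply: cCmD; first exact/IH/entire_dseq.
by apply: cCmZ; apply: cCm_zbarM; exact: IH.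
Qed.

(** By the commutator [iter_dbar_zbar], each multiplication by zbar costs one further application of
    [dbar]. *)
Lemma HE_polyanalytic j a : entire a -> iter j.+1 (@dbar R) (fun p => HE j a (cpt p)) = (fun=> 0).
Proof.
elim: j a => [|j IH] a ea; first by apply/funext => p; exact: dbar_esum.
rewrite (_ : (fun p => _) = (fun p => HE j (dseq a) (cpt p) + (- rc tpi) * (cj (cpt p) * HE j a (cpt p)))).
  rewrite iter_dbarD; last 2 first.
  - exact/cCm_HE/entire_dseq.
  - by apply: cCmZ; apply: cCm_zbarM; exact: cCm_HE.
  rewrite iter_dbarZ; last by apply: cCm_zbarM; exact: cCm_HE.
  rewrite iter_dbar_zbar; last exact: cCm_HE.
  rewrite (iter_dbar_le (leqnSn j.+1) (IH _ (entire_dseq ea))).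
  rewrite (iter_dbar_le (leqnSn j.+1) (IH _ ea)) -[j.+2.-1]/(j.+1) (IH _ ea).
  by apply/funext => p; rewrite !(mulr0, addr0).
by apply/funext => p /=; rewrite mulNr.
Qed.

Lemma HED j a b z : entire a -> entire b ->
  HE j (fun k => a k + b k) z = HE j a z + HE j b z.
Proof.
elim: j a b => [|j IH] a b ea eb /=; first exact: esumD.
rewrite (_ : dseq _ = (fun k => dseq a k + dseq b k)).
  by rewrite !IH //; try exact: entire_dseq; ring.
by apply/funext => k; rewrite /dseq mulrDr.
Qed.

Lemma HEZ j (c : R) a z : entire a -> HE j (fun k => c * a k) z = rc c * HE j a z.
Proof.
elim: j a => [|j IH] a ea /=; first exact: esumZ.
rewrite (_ : dseq _ = (fun k => c * dseq a k)).
  by rewrite !IH //; try exact: entire_dseq; ring.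
by apply/funext => k; rewrite /dseq mulrCA.
Qed.

Lemma HE0 j z : HE j (fun=> 0) z = 0.
Proof.
have := @HEZ j 0 (fun=> 0) z (@entire0 R).
by under eq_fun do rewrite mul0r; rewrite rc0 mul0r.
Qed.

Lemma HE_cj j a z : entire a -> HE j a (cj z) = cj (HE j a z).
Proof.
elim: j a => [|j IH] a ea /=; first exact: esum_cj.
by rewrite !IH ?cjD ?cjN ?cjM ?cj_rc //; exact: entire_dseq.
Qed.

(** The two summands of A commute, so A^j expands by the binomial formula; this is the form in which
    [true_bargmann] is given. The induction is Pascal's rule. *)
Lemma HE_binomial j a z : entire a ->
  HE j a z = \sum_(k < j.+1) 'C(j, k)%:R *
     ((- rc tpi * cj z) ^+ k * esum (iter (j - k) (@dseq R) a) z).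
Proof.
set w := - rc tpi * cj z.
elim: j a => [|j IH] a ea /=.
  by rewrite big_ord_recl big_ord0 bin0 expr0 !mul1r addr0.
rewrite (IH _ (entire_dseq ea)) (IH _ ea) mulrA -!mulNr -/w.
pose e i := esum (iter i (@dseq R) a) z.
rewrite (eq_bigr (fun k : 'I_j.+1 => 'C(j, k)%:R * (w ^+ k * e (j.+1 - k)%N))); last first.
  by move=> k _; rewrite /e subSn ?leq_ord // iterSr.
rewrite [RHS]big_ord_recl bin0 expr0 [X in X + _ = _]big_ord_recl bin0 expr0 -addrA; congr (_ + _).
rewrite [RHS](eq_bigr (fun k : 'I_j.+1 => 'C(j, k.+1)%:R * (w ^+ k.+1 * e (j - k)%N) +
   w * ('C(j, k)%:R * (w ^+ k * e (j - k)%N)))); last first.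
  by move=> k _; rewrite lift0 binS natrD subSS exprS /e; ring.
rewrite big_split /= mulr_sumr; congr (_ + _).
rewrite [RHS]big_ord_recr /= bin_small // mul0r addr0.
by apply: eq_bigr => k _; rewrite /bump leq0n add1n subSS.
Qed.

(** Passing from powers of zbar to powers of A is triangular: the recursion for [HE] gives zbar A^j
    E = (A^j E' - A^(j+1) E) / (2 pi), which raises the order by one after zbar is factored out of
    the sum. *)
Lemma HE_span N (a : nat -> nat -> R) : (forall j, entire (a j)) ->
  exists b : nat -> nat -> R, (forall j, entire (b j)) /\
    forall z, \sum_(j < N) cj z ^+ j * esum (a j) z = \sum_(j < N) HE j (b j) z.
Proof.
elim: N a => [|N IH] a ea; first by exists a; split=> // z; rewrite !big_ord0.
have [b [eb hb]] := IH (fun j => a j.+1) (fun j => ea j.+1).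
(* Index 0 receives the term free of zbar; index j also receives the derivative of [b j] from zbar
   A^j and the negative of [b j'] from zbar A^j', where j = j' + 1. *)
pose b' j k : R := (if j == 0%N then a 0%N k else 0) +
   (tpi^-1 * (if (j < N)%N then dseq (b j) k else 0) + - tpi^-1 * (if j is j'.+1 then b j' k else 0)).
have e0 : entire (fun=> 0 : R) by exact: entire0.
have eb' j : entire (b' j).
  apply: entireD; first by case: (j == 0%N).
  apply: entireD; apply: entire_scale.
    by case: (j < N)%N; [exact: entire_dseq|].
  by case: j.
exists b'; split => // z.
have Hb' j : HE j (b' j) z = (if j == 0%N then esum (a 0%N) z else 0) +
   (rc tpi^-1 * (if (j < N)%N then HE j (dseq (b j)) z else 0) +
    - rc tpi^-1 * (if j is j'.+1 then HE j (b j') z else 0)).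
  have eA : entire (fun k => if (j < N)%N then dseq (b j) k else 0).
    by case: (j < N)%N; [exact: (entire_dseq (eb j))|exact: e0].
  have eB : entire (fun k => if j is j'.+1 then b j' k else 0) by case: (j).
  have eC : entire (fun k => if j == 0%N then a 0%N k else 0) by case: (j == 0%N).
  rewrite (HED j z eC (entireD (entire_scale _ eA) (entire_scale _ eB))).
  rewrite (HED j z (entire_scale _ eA) (entire_scale _ eB)) (HEZ j _ z eA) (HEZ j _ z eB).
  rewrite rcN; congr (_ + (_ * _ + _ * _)).
  - by case: eqP => [->|_] //; rewrite HE0.
  - by case: (j < N)%N; rewrite ?HE0.
  - by case: (j) => [|i]; rewrite ?HE0.
under [RHS]eq_bigr => j _ do rewrite Hb'.
rewrite [LHS]big_ord_recl expr0 mul1r !big_split /=.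
rewrite [X in _ = X + _]big_ord_recl /= [X in _ = _ + X + _]big1 // addr0; congr (_ + _).
rewrite -!mulr_sumr [X in rc tpi^-1 * X]big_ord_recr /= ltnn addr0.
rewrite [X in - rc tpi^-1 * X]big_ord_recl /= add0r.
rewrite (eq_bigr (fun j : 'I_N => cj z * (cj z ^+ j * esum (a j.+1) z))); last first.
  by move=> j _; rewrite /bump leq0n add1n exprS mulrA.
rewrite -mulr_sumr hb mulNr -mulrBr -sumrB.
rewrite [X in _ = rc tpi^-1 * X](eq_bigr (fun j : 'I_N => rc tpi * (cj z * HE j (b j) z))); last first.
  by move=> j _; rewrite ltn_ord add0n; ring.
rewrite -!mulr_sumr mulrA -rcM mulVf ?tpi_neq0 //.
by rewrite [rc 1]/(1 : cplx R) !mul1r.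
Qed.

End HermiteSum.

(** * Holomorphic functions are entire series *)

Section OneVariable.
Variable R : realType.
Local Notation mu := (@lebesgue_measure R).
Implicit Types (f g : R -> R) (a b : R).

Lemma is_derive1_continuous f (df : R -> R) :
  (forall x : R, is_derive x 1 f (df x)) -> continuous f.
Proof.
move=> h x; apply: differentiable_continuous; apply/derivable1_diffP.
by case: (h x).
Qed.

(** Locating the intermediate point by its distance to [a] covers both orders of the endpoints and
    the degenerate case. *)
Lemma MVT_dist f (df : R -> R) a b : (forall x : R, is_derive x 1 f (df x)) ->
  exists c, `|c - a| <= `|b - a| /\ f b - f a = df c * (b - a).
Proof.
move=> h; have cf := is_derive1_continuous h.
have [ab|ba|->] := ltgtP a b; last first.
- by exists b; rewrite !subrr mulr0.
- have [c] := MVT ba (fun x _ => h x) (continuous_subspaceT cf).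
  rewrite in_itv /= => /andP[c1 c2] e; exists c; split.
    by rewrite ltr0_norm ?subr_lt0 // ltr0_norm ?subr_lt0 // lerN2 lerD2r ltW.
  by rewrite -opprB e -mulrN opprB.
have [c] := MVT ab (fun x _ => h x) (continuous_subspaceT cf).
rewrite in_itv /= => /andP[c1 c2] e; exists c; split => //.
by rewrite gtr0_norm ?subr_gt0 // gtr0_norm ?subr_gt0 // lerD2r ltW.
Qed.

Lemma integrable_itv f a b : continuous f -> mu.-integrable `[a, b] (EFin \o f).
Proof.
move=> cf; apply: continuous_compact_integrable; first exact: segment_compact.
exact: continuous_subspaceT.
Qed.

Lemma Rintegral_FTC (F f : R -> R) a b : a < b -> continuous f ->
  (forall x : R, is_derive x 1 F (f x)) -> \int[mu]_(x in `[a, b]) f x = F b - F a.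
Proof.
move=> ab cf h; have cF := is_derive1_continuous h.
rewrite /Rintegral (@continuous_FTC2 _ f F) //.
- exact: continuous_subspaceT.
- split; first by move=> x _; case: (h x).
    by apply: cvg_at_right_filter; exact: cF.
  by apply: cvg_at_left_filter; exact: cF.
- by move=> x _; rewrite derive1E; case: (h x).
Qed.

Lemma continuous_bounded_rect (A : R * R -> R) a b c d : continuous A ->
  exists M, forall x y, a <= x <= b -> c <= y <= d -> `|A (x, y)| <= M.
Proof.
move=> cA.
have cpt : compact (`[a, b]%classic `*` `[c, d]%classic).
  by apply: compact_setX; exact: segment_compact.
have /compact_bounded[M [_ hM]] := continuous_compact (continuous_subspaceT cA) cpt.
exists (M + 1) => x y hx hy; apply: (hM (M + 1)); first by rewrite ltrDl.
by exists (x, y) => //; split => /=; rewrite in_itv.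
Qed.

(** The domination is local: the continuous [A] is bounded on the compact rectangle [s - 1, s + 1] x
    [a, b]. *)
Lemma derive_under_integral (f A : R * R -> R) a b (s : R) :
  (forall s, continuous (fun t => f (s, t))) -> continuous A ->
  (forall s t : R, is_derive s 1 (fun s => f (s, t)) (A (s, t))) ->
  is_derive s 1 (fun s => \int[mu]_(t in `[a, b]) f (s, t))
    (\int[mu]_(t in `[a, b]) A (s, t)).
Proof.
move=> cf cA h; have [M hM] := continuous_bounded_rect (s - 1) (s + 1) a b cA.
have sI : `](s - 1), (s + 1)[%classic s by rewrite /= in_itv /= gtrBl ltrDl ltr01.
have e1 x y : partial1of2 (fun s t => f (s, t)) x y = A (x, y).
  by rewrite partial1of2E; case: (h x y).
have mI : measurable (`[a, b]%classic : set R) by exact: measurable_itv.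
have iM : mu.-integrable `[a, b] (EFin \o (fun=> `|M|)).
  by apply: integrable_itv; exact: cst_continuous.
have dc := @cvg_differentiation_under_integral R _ _ mu (fun s t => f (s, t)) _ mI s _ _ sI.
have {}dc : h^-1 *: ((\int[mu]_(t in `[a, b]) f (h + s, t)) - \int[mu]_(t in `[a, b]) f (s, t))
    @[h --> 0^'] --> \int[mu]_(t in `[a, b]) A (s, t).
  rewrite (_ : (\int[mu]_(t in `[a, b]) A (s, t)) =
     \int[mu]_(t in `[a, b]) partial1of2 (fun s t => f (s, t)) s t); last first.
    by apply: eq_Rintegral => t _; rewrite e1.
  apply: dc iM _.
  - by move=> x _; apply: integrable_itv; exact: cf.
  - by move=> x y _ _; case: (h x y).
  - by move=> y; exact: normr_ge0.
  - move=> x y; rewrite /= !in_itv /= => /andP[x1 x2] /andP[y1 y2]; rewrite e1.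
    by apply: le_trans (hM x y _ _) (ler_norm _); rewrite ?y1 ?y2 // !ltW.
have e2 : (fun h => h^-1 *: ((\int[mu]_(t in `[a, b]) f (h *: 1 + s, t)) - \int[mu]_(t in `[a, b]) f (s, t)))
   = (fun h => h^-1 *: ((\int[mu]_(t in `[a, b]) f (h + s, t)) - \int[mu]_(t in `[a, b]) f (s, t))).
  by apply/funext => k; rewrite /GRing.scale /= mulr1.
have dc' : h^-1 *: (((fun s => \int[mu]_(t in `[a, b]) f (s, t)) \o shift s) (h *: 1) -
   (fun s => \int[mu]_(t in `[a, b]) f (s, t)) s)  @[h --> 0^'] --> \int[mu]_(t in `[a, b]) A (s, t).
  by rewrite /= e2.
by split; [apply: cvgP dc'|apply: cvg_lim dc'].
Qed.

Lemma is_derive0_cst f : (forall x : R, is_derive x 1 f 0) -> forall a b, f a = f b.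
Proof. by move=> h a b; have [c [_]] := MVT_dist b a h; rewrite mul0r => /subr0_eq. Qed.

Lemma MVT_dist_itv f (df : R -> R) a b (B : R) : a <= b ->
  (forall x : R, is_derive x 1 f (df x)) -> (forall x, a <= x <= b -> `|df x| <= B) ->
  `|f b - f a| <= B * (b - a).
Proof.
move=> ab h hB.
have [c cI ->] := MVT_segment ab (fun x _ => h x) (continuous_subspaceT (is_derive1_continuous h)).
by rewrite normrM (ger0_norm (_ : 0 <= b - a)) ?subr_ge0 // ler_wpM2r ?subr_ge0 // hB.
Qed.

Lemma Rintegral_itv_le f a b (B : R) : a <= b -> continuous f ->
  (forall x, a <= x <= b -> `|f x| <= B) -> `|\int[mu]_(x in `[a, b]) f x| <= B * (b - a).
Proof.
move=> ab cf hB; have ii := integrable_itv a b cf.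
apply: le_trans (le_normr_Rintegral _ ii) _; first exact: measurable_itv.
have : \int[mu]_(x in `[a, b]) `|f x| <= \int[mu]_(x in `[a, b]) B.
  apply: le_Rintegral => //; first exact: integrable_norm.
    by apply: integrable_itv; exact: cst_continuous.
by rewrite Rintegral_cst //= lebesgue_measure_itv /= lte_fin; case: ltP => //= h; rewrite (le_anti (introT andP (conj ab h))) subrr.
Qed.

End OneVariable.

(** * The chain rule along plane curves *)

Section ChainRule.
Variable R : realType.

Lemma continuous_pairP (u : R * R -> R) (p : R * R) : {for p, continuous u} ->
  forall e : R, 0 < e -> exists2 d : R, 0 < d &
    forall q : R * R, `|q.1 - p.1| < d -> `|q.2 - p.2| < d -> `|u q - u p| < e.
Proof.
move=> /cvgrPdist_lt h e e0; have /nbhs_ballP[d /= d0 hd] := h e e0.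
exists d => // q q1 q2; rewrite distrC; apply: hd.
by split => /=; rewrite /ball /= distrC.
Qed.

Lemma partial_is_derive1 (u : R * R -> R) (x y l : R) :
  is_derive ((x, y) : R * R) (1, 0) u l -> is_derive x 1 (fun x => u (x, y)) l.
Proof.
have e : (fun h : R => h^-1 *: (((fun x => u (x, y)) \o shift x) (h *: 1) - u (x, y))) =
   (fun h : R => h^-1 *: ((u \o shift (x, y)) (h *: (1, 0)) - u (x, y))).
  by apply/funext => h /=; congr (_ *: (u _ - _)); congr pair; rewrite /= /GRing.scale /= mulr0 add0r.
by case=> a b; split; rewrite /derivable /derive e.
Qed.

Lemma partial_is_derive2 (u : R * R -> R) (x y l : R) :
  is_derive ((x, y) : R * R) (0, 1) u l -> is_derive y 1 (fun y => u (x, y)) l.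
Proof.
have e : (fun h : R => h^-1 *: (((fun y => u (x, y)) \o shift y) (h *: 1) - u (x, y))) =
   (fun h : R => h^-1 *: ((u \o shift (x, y)) (h *: (0, 1)) - u (x, y))).
  by apply/funext => h /=; congr (_ *: (u _ - _)); congr pair; rewrite /= /GRing.scale /= mulr0 add0r.
by case=> a b; split; rewrite /derivable /derive e.
Qed.

(** Moves from p to q along a vertical and then a horizontal segment, with the mean value theorem on
    each; continuity of the partial derivatives at p controls the error. *)
Lemma C1_increment (u ux uy : R * R -> R) (p : R * R) :
  (forall q : R * R, is_derive q (1, 0) u (ux q)) ->
  (forall q : R * R, is_derive q (0, 1) u (uy q)) ->
  continuous ux -> continuous uy ->
  forall e : R, 0 < e -> exists2 d : R, 0 < d &
    forall q : R * R, `|q.1 - p.1| < d -> `|q.2 - p.2| < d ->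
    `|u q - u p - (ux p * (q.1 - p.1) + uy p * (q.2 - p.2))|
      <= e * (`|q.1 - p.1| + `|q.2 - p.2|).
Proof.
case: p => x0 y0 hx hy cx cy e e0.
have [d1 d10 h1] := continuous_pairP (cx (x0, y0)) e0.
have [d2 d20 h2] := continuous_pairP (cy (x0, y0)) e0.
exists (Num.min d1 d2); first by rewrite lt_min d10.
case=> x1 y1 /=; rewrite !lt_min => /andP[a1 a2] /andP[b1 b2].
have [c [cI ec]] := @MVT_dist R (fun x => u (x, y1)) (fun x => ux (x, y1)) x0 x1
  (fun x => partial_is_derive1 (hx (x, y1))).
have [c' [cI' ec']] := @MVT_dist R (fun y => u (x0, y)) (fun y => uy (x0, y)) y0 y1
  (fun y => partial_is_derive2 (hy (x0, y))).
have -> : u (x1, y1) - u (x0, y0) - (ux (x0, y0) * (x1 - x0) + uy (x0, y0) * (y1 - y0)) =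
  (ux (c, y1) - ux (x0, y0)) * (x1 - x0) + (uy (x0, c') - uy (x0, y0)) * (y1 - y0).
  have -> : u (x1, y1) - u (x0, y0) = ux (c, y1) * (x1 - x0) + uy (x0, c') * (y1 - y0).
    by rewrite -ec -ec' addrA subrK.
  by ring.
apply: le_trans (ler_normD _ _) _; rewrite [leRHS]mulrDr !normrM; apply: lerD.
  by rewrite ler_wpM2r // ltW // h1 //=; exact: le_lt_trans cI a1.
rewrite ler_wpM2r // ltW // h2 //= ?subrr ?normr0 //; exact: le_lt_trans cI' b2.
Qed.

Lemma is_derive_curve (u ux uy : R * R -> R) (x y : R -> R) (s a b : R) :
  (forall q : R * R, is_derive q (1, 0) u (ux q)) ->
  (forall q : R * R, is_derive q (0, 1) u (uy q)) ->
  continuous ux -> continuous uy ->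
  is_derive s 1 x a -> is_derive s 1 y b ->
  is_derive s 1 (fun s => u (x s, y s)) (ux (x s, y s) * a + uy (x s, y s) * b).
Proof.
move=> hx hy cx cy dx dy; set p := (x s, y s).
have quot (f : R -> R) l : is_derive s 1 f l ->
    h^-1 *: (f (h + s) - f s) @[h --> 0^'] --> l.
  case=> h1 h2.
  have : h^-1 *: ((f \o shift s) (h *: 1) - f s) @[h --> 0^'] --> l.
    by rewrite -h2; apply: h1.
  by rewrite (_ : (fun h => _) = (fun h : R => h^-1 *: (f (h + s) - f s))) //;
    apply/funext => h /=; rewrite /GRing.scale /= mulr1.
have qx := quot _ _ dx; have qy := quot _ _ dy.
have main : h^-1 *: (u (x (h + s), y (h + s)) - u p) @[h --> 0^'] --> ux p * a + uy p * b.
  have lin : ux p * (h^-1 *: (x (h + s) - x s)) + uy p * (h^-1 *: (y (h + s) - y s))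
     @[h --> 0^'] --> ux p * a + uy p * b.
    by apply: cvgD; apply: cvgM => //; exact: cvg_cst.
  refine (cvg_sub0 _ lin); apply/cvgr0Pnorm_le => e e0.
  (* For small h the increments of x and y are at most (|a| + 1) |h| and (|b| + 1) |h|; the constant
     is the sum of these two slopes. *)
  have K0 : 0 < `|a| + `|b| + 2 by rewrite ltr_wpDl // addr_ge0.
  have [d d0 hd] := C1_increment p hx hy cx cy (divr_gt0 e0 K0).
  near=> h.
  have h0 : h != 0 by near: h; exact: nbhs_dnbhs_neq.
  have hh : `|h| < d / (`|a| + `|b| + 2) by near: h; apply: dnbhs0_lt; exact: divr_gt0.
  have ha : `|a - h^-1 *: (x (h + s) - x s)| <= 1.
    by near: h; apply: cvgr_dist_le => //; exact: qx.
  have hb : `|b - h^-1 *: (y (h + s) - y s)| <= 1.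
    by near: h; apply: cvgr_dist_le => //; exact: qy.
  have bound (l q : R) : `|l - h^-1 * q| <= 1 -> `|q| <= (`|l| + 1) * `|h|.
    move=> hl; have -> : q = (l - (l - h^-1 * q)) * h by field.
    by rewrite normrM ler_wpM2r // (le_trans (ler_normB _ _)) // lerD2l.
  have {}ha := bound _ _ ha; have {}hb := bound _ _ hb.
  have h1 : `|h| != 0 by rewrite normr_eq0.
  move: hh; rewrite ltr_pdivlMr // => hh.
  have lt1 : (`|a| + 1) * `|h| < d.
    by apply: le_lt_trans hh; rewrite mulrC ler_wpM2l //; have := normr_ge0 b; lra.
  have lt2 : (`|b| + 1) * `|h| < d.
    by apply: le_lt_trans hh; rewrite mulrC ler_wpM2l //; have := normr_ge0 a; lra.
  have := hd (x (h + s), y (h + s)) (le_lt_trans ha lt1) (le_lt_trans hb lt2).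
  rewrite /p /= !fctE /GRing.scale /= => hD.
  have -> : h^-1 * (u (x (h + s), y (h + s)) - u (x s, y s)) -
     (ux (x s, y s) * (h^-1 * (x (h + s) - x s)) + uy (x s, y s) * (h^-1 * (y (h + s) - y s))) =
     h^-1 * (u (x (h + s), y (h + s)) - u (x s, y s) - (ux (x s, y s) * (x (h + s) - x s) + uy (x s, y s) * (y (h + s) - y s))).
    by ring.
  rewrite normrM normfV ler_pdivrMl ?normr_gt0 // (le_trans hD) //.
  apply: (@le_trans _ _ (e / (`|a| + `|b| + 2) * ((`|a| + `|b| + 2) * `|h|))).
    apply: ler_wpM2l; first exact/ltW/divr_gt0.
    apply: le_trans (lerD ha hb) _.
    by rewrite -mulrDl ler_wpM2r //; lra.
  by rewrite mulrA divfK ?gt_eqF // mulrC.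
have e2 : (fun h : R => h^-1 *: ((fun s => u (x s, y s)) (h *: 1 + s) - u (x s, y s))) =
   (fun h : R => h^-1 *: (u (x (h + s), y (h + s)) - u p)).
  by apply/funext => h; rewrite /GRing.scale /= mulr1.
have main' : h^-1 *: (((fun s => u (x s, y s)) \o shift s) (h *: 1) - (fun s => u (x s, y s)) s)
     @[h --> 0^'] --> ux p * a + uy p * b.
  by rewrite /= e2.
by split; [apply: cvgP main'|apply: cvg_lim main'].
Unshelve. all: by end_near. Qed.

End ChainRule.

(** * Complex-valued functions of a real parameter and circle integrals *)

Section ComplexCurves.
Variable R : realType.
Local Notation mu := (@lebesgue_measure R).
Implicit Types (f g F : R -> cplx R).

(** Stated on a general normed space so that one calculus serves curves (V = R) and partial
    derivatives in the plane (V = R * R). *)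
Definition cderv (V : normedModType R) (v : V) (f : V -> cplx R) (t : V) (l : cplx R) :=
  is_derive t v (fun t => re (f t)) (re l) /\ is_derive t v (fun t => im (f t)) (im l).

Local Notation cder := (@cderv R 1).

Definition ccont (T : topologicalType) (f : T -> cplx R) :=
  continuous (fun t => re (f t)) /\ continuous (fun t => im (f t)).

Definition circ_int f : cplx R :=
  Cpx (\int[mu]_(t in `[0, pi *+ 2]) re (f t)) (\int[mu]_(t in `[0, pi *+ 2]) im (f t)).

Lemma cder_eq (V : normedModType R) (v : V) (f : V -> cplx R) t l l' :
  cderv v f t l -> l = l' -> cderv v f t l'.
Proof. by move=> h <-. Qed.

Lemma cder_cst (V : normedModType R) (v : V) (c : cplx R) (t : V) : cderv v (fun=> c) t 0.
Proof. by split; apply: is_derive_cst. Qed.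

Lemma cderD (V : normedModType R) (v : V) (f g : V -> cplx R) t a b :
  cderv v f t a -> cderv v g t b -> cderv v (fun t => f t + g t) t (a + b).
Proof.
move=> [h1 h2] [h3 h4]; split.
  by rewrite reD; apply: is_derive_ext (is_deriveD_fun h1 h3) => x; rewrite reD.
by rewrite imD; apply: is_derive_ext (is_deriveD_fun h2 h4) => x; rewrite imD.
Qed.

Lemma cderM (V : normedModType R) (v : V) (f g : V -> cplx R) t a b :
  cderv v f t a -> cderv v g t b ->
  cderv v (fun t => f t * g t) t (a * g t + f t * b).
Proof.
move=> [h1 h2] [h3 h4]; split.
  apply: is_derive_eq.
    by apply: is_derive_ext (is_deriveB_fun (is_deriveM_fun h1 h3) (is_deriveM_fun h2 h4)) => x; rewrite reM.
  by rewrite !cRI; ring.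
apply: is_derive_eq.
  by apply: is_derive_ext (is_deriveD_fun (is_deriveM_fun h1 h4) (is_deriveM_fun h2 h3)) => x; rewrite imM.
by rewrite !cRI; ring.
Qed.

Lemma cderZ (V : normedModType R) (v : V) c (f : V -> cplx R) t a :
  cderv v f t a -> cderv v (fun t => c * f t) t (c * a).
Proof. by move=> h; apply: cder_eq (cderM (cder_cst v c t) h) _; rewrite mul0r add0r. Qed.

Lemma cderX (V : normedModType R) (v : V) (f : V -> cplx R) t a n :
  cderv v f t a -> cderv v (fun t => f t ^+ n) t (n%:R * f t ^+ n.-1 * a).
Proof.
move=> h; elim: n => [|n IH]; first by apply: cder_eq (cder_cst _ _ _) _; rewrite !mul0r.
have -> : (fun t => f t ^+ n.+1) = (fun t => f t * f t ^+ n).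
  by apply/funext => x; rewrite exprS.
apply: cder_eq (cderM h IH) _; case: n {IH} => [|n] /=.
  by rewrite !expr0; ring.
by rewrite -!natr1 exprS; ring.
Qed.

Lemma cder0_cst f : (forall t, cder f t 0) -> forall a b, f a = f b.
Proof.
move=> h a b; apply: cE.
  by apply: (@is_derive0_cst R (fun t => re (f t))) => t; have [] := h t.
by apply: (@is_derive0_cst R (fun t => im (f t))) => t; have [] := h t.
Qed.

Lemma cder_real (u : R -> R) (t l : R) : is_derive t 1 u l -> cder (fun t => rc (u t)) t (rc l).
Proof. by move=> h; split => //=; apply: is_derive_cst. Qed.

Lemma cder_rc t : cder (@rc R) t 1.
Proof. by apply: (@cder_real id); apply: is_derive_id. Qed.

Lemma ccont_cst (T : topologicalType) c : ccont (fun _ : T => c).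
Proof. by split; exact: cst_continuous. Qed.

Lemma ccontD (T : topologicalType) (f g : T -> cplx R) : ccont f -> ccont g ->
  ccont (fun t => f t + g t).
Proof.
move=> [a b] [c d]; split => t.
  by under eq_fun do rewrite reD; apply: cvgD; [exact: a|exact: c].
by under eq_fun do rewrite imD; apply: cvgD; [exact: b|exact: d].
Qed.

Lemma ccontM (T : topologicalType) (f g : T -> cplx R) : ccont f -> ccont g ->
  ccont (fun t => f t * g t).
Proof.
move=> [a b] [c d]; split => t.
  under eq_fun do rewrite reM.
  by apply: cvgB; apply: cvgM; [exact: a|exact: c|exact: b|exact: d].
under eq_fun do rewrite imM.
by apply: cvgD; apply: cvgM; [exact: a|exact: d|exact: b|exact: c].
Qed.

Lemma ccontX (T : topologicalType) (f : T -> cplx R) n : ccont f ->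
  ccont (fun t => f t ^+ n).
Proof.
move=> h; elim: n => [|n IH]; first exact: ccont_cst.
by under eq_fun do rewrite exprS; exact: ccontM.
Qed.

Lemma ccont_sum (T : topologicalType) n (f : nat -> T -> cplx R) :
  (forall i, ccont (f i)) -> ccont (fun t => \sum_(i < n) f i t).
Proof.
move=> h; elim: n => [|n IH]; first by under eq_fun do rewrite big_ord0; exact: ccont_cst.
by under eq_fun do rewrite big_ord_recr /=; exact: ccontD.
Qed.

Lemma ccont_real (T : topologicalType) (u : T -> R) : continuous u -> ccont (fun t => rc (u t)).
Proof. by move=> h; split => //=; exact: cst_continuous. Qed.

Lemma ccont_comp (S T : topologicalType) (f : T -> cplx R) (g : S -> T) :
  continuous g -> ccont f -> ccont (fun s => f (g s)).
Proof.
move=> cg [a b]; split => s.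
  exact: (@continuous_comp _ _ _ g (fun t => re (f t)) s (cg s) (a _)).
exact: (@continuous_comp _ _ _ g (fun t => im (f t)) s (cg s) (b _)).
Qed.

Lemma continuous_cpt_of (T : topologicalType) (z : T -> cplx R) : ccont z ->
  continuous (fun t => (re (z t), im (z t)) : R * R).
Proof. by move=> [a b] t; exact: (cvg_pair (a t) (b t)). Qed.

Lemma continuous_pairl (s : R) : continuous (fun t : R => (s, t) : R * R).
Proof.
apply: (@continuous_cpt_of _ (fun t => Cpx s t)); split => /=.
  exact: cst_continuous.
by move=> t; exact: cvg_id.
Qed.

Lemma twopi_gt0 : 0 < (pi : R) *+ 2.
Proof. by rewrite mulrn_wgt0 // pi_gt0. Qed.

Lemma circ_int_FTC F f : ccont f -> (forall t, cder F t (f t)) ->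
  circ_int f = F (pi *+ 2) - F 0.
Proof.
move=> [a b] h; apply: cE; rewrite !cRI.
  exact: (@Rintegral_FTC R (fun t => re (F t)) (fun t => re (f t)) _ _ twopi_gt0 a (fun t => (h t).1)).
exact: (@Rintegral_FTC R (fun t => im (F t)) (fun t => im (f t)) _ _ twopi_gt0 b (fun t => (h t).2)).
Qed.

Lemma circ_int_under (f A : R * R -> cplx R) s :
  (forall s, ccont (fun t => f (s, t))) -> ccont A ->
  (forall s t, cder (fun s => f (s, t)) s (A (s, t))) ->
  cder (fun s => circ_int (fun t => f (s, t))) s (circ_int (fun t => A (s, t))).
Proof.
move=> cf [cA1 cA2] h; split => /=.
  apply: (@derive_under_integral R (fun p => re (f p)) (fun p => re (A p))) => //.
    by move=> s'; have [] := cf s'.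
  by move=> s' t; have [] := h s' t.
apply: (@derive_under_integral R (fun p => im (f p)) (fun p => im (A p))) => //.
  by move=> s'; have [] := cf s'.
by move=> s' t; have [] := h s' t.
Qed.

Lemma circ_intD f g : ccont f -> ccont g ->
  circ_int (fun t => f t + g t) = circ_int f + circ_int g.
Proof.
move=> [a b] [c d]; apply: cE; rewrite !cRI.
  under eq_Rintegral do rewrite reD.
  by rewrite (RintegralD _ (integrable_itv _ _ a) (integrable_itv _ _ c)).
under eq_Rintegral do rewrite imD.
by rewrite (RintegralD _ (integrable_itv _ _ b) (integrable_itv _ _ d)).
Qed.

Lemma circ_intZ c f : ccont f -> circ_int (fun t => c * f t) = c * circ_int f.
Proof.
move=> [a b]; have m : measurable (`[0, pi *+ 2]%classic : set R) by exact: measurable_itv.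
have iZ (x : R) (u : R -> R) : continuous u ->
    mu.-integrable `[0, pi *+ 2] (EFin \o (fun t => x * u t)).
  by move=> cu; apply: integrable_itv => t; apply: cvgM; [exact: cvg_cst|exact: cu].
have lin (x y : R) : \int[mu]_(t in `[0, pi *+ 2]) (x * re (f t) + y * im (f t)) =
  x * \int[mu]_(t in `[0, pi *+ 2]) re (f t) + y * \int[mu]_(t in `[0, pi *+ 2]) im (f t).
  rewrite (RintegralD _ (iZ x _ a) (iZ y _ b)) //.
  by rewrite (RintegralZl _ _ (integrable_itv _ _ a)) // (RintegralZl _ _ (integrable_itv _ _ b)).
apply: cE; rewrite !cRI.
  rewrite -mulNr -lin; apply: eq_Rintegral => t _; rewrite reM; ring.
rewrite addrC [im c * _]mulrC [_ * im c]mulrC -lin.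
by apply: eq_Rintegral => t _; rewrite imM; ring.
Qed.

Lemma circ_int_sum n (f : nat -> R -> cplx R) : (forall i, ccont (f i)) ->
  circ_int (fun t => \sum_(i < n) f i t) = \sum_(i < n) circ_int (f i).
Proof.
move=> h; elim: n => [|n IH].
  rewrite big_ord0 /circ_int; under eq_Rintegral do rewrite big_ord0.
  under [X in Cpx _ X]eq_Rintegral do rewrite big_ord0.
  by rewrite !cRI Rintegral_cst ?mul0r //; exact: measurable_itv.
rewrite big_ord_recr /= -IH -circ_intD //; last exact: ccont_sum.
by congr circ_int; apply/funext => t; rewrite big_ord_recr.
Qed.

(** Twice the length of the interval appears because the real and imaginary parts are estimated
    separately. *)
Lemma circ_int_le f (B : R) : ccont f -> (forall t, nc (f t) <= B) ->
  nc (circ_int f) <= 4 * pi * B.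
Proof.
move=> [a b] h; apply: le_trans (nc_le _) _; rewrite !cRI.
have -> : 4 * pi * B = B * (pi *+ 2 - 0) + B * (pi *+ 2 - 0) by rewrite subr0; ring.
apply: lerD; apply: Rintegral_itv_le => //; try exact/ltW/twopi_gt0.
  by move=> t _; apply: le_trans (h t); exact: ler_norm_re.
by move=> t _; apply: le_trans (h t); exact: ler_norm_im.
Qed.

Definition ii : cplx R := Cpx 0 1.

Definition cis (t : R) : cplx R := Cpx (cos t) (sin t).
(** The inverse of [cis t]; negative powers on the circle become natural powers of [cisi]. *)
Definition cisi (t : R) : cplx R := Cpx (cos t) (- sin t).

Lemma cis_cisi t : cis t * cisi t = 1.
Proof. by apply: cE; rewrite !cRI; [rewrite -(cos2Dsin2 t)|]; ring. Qed.
Lemma nc_cis t : nc (cis t) = 1.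
Proof. by rewrite /nc !cRI cos2Dsin2 sqrtr1. Qed.
Lemma nc_cisi t : nc (cisi t) = 1.
Proof. by rewrite /nc !cRI sqrrN cos2Dsin2 sqrtr1. Qed.

Lemma cder_cis t : cder cis t (ii * cis t).
Proof.
split; first by apply: is_derive_eq (is_derive_cos t) _; rewrite !cRI; ring.
by apply: is_derive_eq (is_derive_sin t) _; rewrite !cRI; ring.
Qed.

Lemma cder_cisi t : cder cisi t (- ii * cisi t).
Proof.
split; first by apply: is_derive_eq (is_derive_cos t) _; rewrite !cRI; ring.
by apply: is_derive_eq (is_deriveN (is_derive_sin t)) _; rewrite !cRI; ring.
Qed.

Lemma ccont_cis : ccont cis.
Proof. by split; [exact: continuous_cos|exact: continuous_sin]. Qed.
Lemma ccont_cisi : ccont cisi.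
Proof.
split; first exact: continuous_cos.
by move=> t; apply: cvgN; exact: continuous_sin.
Qed.

Lemma cis_2pi : cis (pi *+ 2) = cis 0.
Proof. by rewrite /cis cos2pi sin2pi cos0 sin0. Qed.
Lemma cisi_2pi : cisi (pi *+ 2) = cisi 0.
Proof. by rewrite /cisi cos2pi sin2pi cos0 sin0. Qed.

End ComplexCurves.

(** * Cauchy coefficients and the Taylor expansion of a holomorphic function *)

Section Holomorphic.
Variable R : realType.
Local Notation cder := (@cderv R R 1).
Variable F : R * R -> cplx R.
Hypothesis F1 : cCm 1 F.
Hypothesis F_dbar : forall p, dbar F p = 0.
Local Notation Fc z := (F (re z, im z)).

Let F' p : cplx R := Cpx ('D_(1, 0) (fun p => re (F p)) p) ('D_(1, 0) (fun p => im (F p)) p).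

Lemma holo_ccont : ccont F.
Proof. by case: F1 => a b; split; [exact: (Cm_continuous a)|exact: (Cm_continuous b)]. Qed.

Lemma holo_ccont' : ccont F'.
Proof. by case: F1 => -[_ _ a _] [_ _ b _]; split. Qed.

(** By the Cauchy-Riemann equations the real differential of F is multiplication by its
    x-derivative, which turns the real chain rule into the complex one. *)
Lemma cder_holo (z : R -> cplx R) t l : cder z t l ->
  cder (fun t => Fc (z t)) t (F' (re (z t), im (z t)) * l).
Proof.
move=> [hx hy]; have cr p : 'D_(0, 1) (fun p => im (F p)) p = 'D_(1, 0) (fun p => re (F p)) p
   /\ 'D_(0, 1) (fun p => re (F p)) p = - 'D_(1, 0) (fun p => im (F p)) p.
  have := F_dbar p; rewrite /dbar => -[] /eqP; rewrite subr_eq0 => /eqP -> /eqP.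
  by rewrite addrC addr_eq0 => /eqP ->.
have [[_ d1 a1 a2] [_ d2 b1 b2]] := F1.
split; apply: is_derive_eq.
- apply: (@is_derive_curve R (fun p => re (F p)) _ _ _ _ t _ _ _ _ a1 a2 hx hy) => q;
    by apply: derivableP; have [] := d1 q.
- by rewrite reM -mulNr; congr (_ * _ + _ * _); exact: (cr _).2.
- apply: (@is_derive_curve R (fun p => im (F p)) _ _ _ _ t _ _ _ _ b1 b2 hx hy) => q;
    by apply: derivableP; have [] := d2 q.
- by rewrite imM addrC; congr (_ * _ + _ * _); exact: (cr _).1.
Qed.

(** The integrand of the k-th Cauchy coefficient on the circle of radius r, without the factor 1 /
    (2 pi). *)
Let shape k (r : R) t := (rc r^-1 * cisi t) ^+ k * Fc (rc r * cis t).

(** With r = e^s the integrand is a holomorphic function of s + i t, so its t-derivative is i times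
    its s-derivative. The s-derivative of the circle integral is therefore a multiple of the
    integral over a full period of the derivative of a periodic function, which is 0. *)
Lemma circ_coef_const k (r1 r2 : R) : 0 < r1 -> 0 < r2 ->
  circ_int (shape k r1) = circ_int (shape k r2).
Proof.
move=> r10 r20.
pose f (p : R * R) := (rc (expR (- p.1)) * cisi p.2) ^+ k * Fc (rc (expR p.1) * cis p.2).
pose A (p : R * R) := (k%:R * (rc (expR (- p.1)) * cisi p.2) ^+ k.-1 * (- (rc (expR (- p.1)) * cisi p.2)))
    * Fc (rc (expR p.1) * cis p.2) + (rc (expR (- p.1)) * cisi p.2) ^+ k *
    (F' (re (rc (expR p.1) * cis p.2), im (rc (expR p.1) * cis p.2)) * (rc (expR p.1) * cis p.2)).
have c1 : continuous (fst : R * R -> R) by move=> p; exact: cvg_fst.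
have c2 : continuous (snd : R * R -> R) by move=> p; exact: cvg_snd.
have cE1 : ccont (fun p : R * R => rc (expR p.1) * cis p.2).
  apply: ccontM; last exact: (ccont_comp c2 (@ccont_cis R)).
  exact: (ccont_comp c1 (ccont_real (@continuous_expR R))).
have cEi : ccont (fun p : R * R => rc (expR (- p.1)) * cisi p.2).
  apply: ccontM; last exact: (ccont_comp c2 (@ccont_cisi R)).
  have cN : continuous (fun x : R => expR (- x)).
    by move=> x; apply: continuous_comp; [exact: opp_continuous|exact: continuous_expR].
  exact: (ccont_comp c1 (ccont_real cN)).
have cF : ccont (fun p : R * R => Fc (rc (expR p.1) * cis p.2)).
  exact: (ccont_comp (continuous_cpt_of cE1) holo_ccont).
have cF' : ccont (fun p : R * R => F' (re (rc (expR p.1) * cis p.2), im (rc (expR p.1) * cis p.2))).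
  exact: (ccont_comp (continuous_cpt_of cE1) holo_ccont').
have cf : ccont f by apply: ccontM cF; exact: ccontX.
have cA : ccont A.
  apply: ccontD; apply: ccontM; rewrite //; last 2 first.
  - exact: ccontX.
  - exact: ccontM.
  apply: ccontM; last by under eq_fun do rewrite -mulN1r; apply: ccontM => //; exact: ccont_cst.
  by apply: ccontM; [exact: ccont_cst|exact: ccontX].
have slice := @continuous_pairl R.
have dexp (s : R) : is_derive s 1 expR (expR s) by exact: is_derive_expR.
have dexpN (s : R) : is_derive s 1 (fun s => expR (- s)) (- expR (- s)).
  by apply: is_derive_eq (is_derive1_comp (is_derive_expR (- s)) (is_deriveNid s 1)) _; rewrite mulrN1.
have ds s t : cder (fun s => f (s, t)) s (A (s, t)).
  have d1 := cderM (cder_real (dexpN s)) (cder_cst (1 : R) (cisi t) s).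
  have d2 := cderM (cder_real (dexp s)) (cder_cst (1 : R) (cis t) s).
  apply: cder_eq (cderM (cderX k d1) (cder_holo d2)) _.
  by rewrite /A /= !mulr0 !addr0 rcN mulNr.
have dt s t : cder (fun t => f (s, t)) t (ii R * A (s, t)).
  have d1 := cderZ (rc (expR (- s))) (cder_cisi t).
  have d2 := cderZ (rc (expR s)) (cder_cis t).
  apply: cder_eq (cderM (cderX k d1) (cder_holo d2)) _.
  by rewrite /A /=; ring.
have dc s : cder (fun s => circ_int (fun t => f (s, t))) s 0.
  have csl : ccont (fun t => A (s, t)) by exact: (ccont_comp (slice s) cA).
  have h := @circ_int_under R f A s (fun s => ccont_comp (slice s) cf) cA ds.
  apply: (cder_eq h); clear h.
  have : ii R * circ_int (fun t => A (s, t)) = 0.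
    rewrite -circ_intZ //.
    rewrite (@circ_int_FTC _ (fun t => f (s, t))) //.
      suff -> : f (s, pi *+ 2) = f (s, 0) by rewrite subrr.
      by rewrite /f -[(s, pi *+ 2).2]/(pi *+ 2) cis_2pi cisi_2pi.
    by apply: ccontM => //; exact: ccont_cst.
  move=> /(congr1 ( *%R (- ii R))); rewrite mulr0 mulrA => <-.
  by rewrite (_ : - ii R * ii R = 1) ?mul1r //; apply: cE; rewrite !cRI; ring.
have := cder0_cst dc (ln r1) (ln r2).
have e r : 0 < r -> circ_int (shape k r) = circ_int (fun t => f (ln r, t)).
  move=> r0; congr circ_int; apply/funext => t.
  by rewrite /f /shape -[(ln r, t).1]/(ln r) -[(ln r, t).2]/t -lnV ?posrE // !lnK ?posrE ?invr_gt0.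
by rewrite !e.
Qed.

Let C k : cplx R := circ_int (shape k 1).

Lemma ccont_shape k r : ccont (shape k r).
Proof.
apply: ccontM; first by apply/ccontX/ccontM; [exact: ccont_cst|exact: ccont_cisi].
have h : ccont (fun t : R => rc r * cis t) by apply: ccontM; [exact: ccont_cst|exact: ccont_cis].
exact: (ccont_comp (continuous_cpt_of h) holo_ccont).
Qed.

Lemma ccont_bounded_disc (G : R * R -> cplx R) (r : R) : ccont G ->
  exists2 M, 0 <= M & forall z : cplx R, nc z <= r -> nc (G (re z, im z)) <= M.
Proof.
move=> [a b]; have [M1 h1] := continuous_bounded_rect (- r) r (- r) r a.
have [M2 h2] := continuous_bounded_rect (- r) r (- r) r b.
exists (`|M1| + `|M2|); first by rewrite addr_ge0.
move=> z zr; apply: le_trans (nc_le _) _.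
have hr : - r <= re z <= r by rewrite -ler_norml (le_trans (ler_norm_re z)).
have hi : - r <= im z <= r by rewrite -ler_norml (le_trans (ler_norm_im z)).
by apply: lerD; apply: le_trans (ler_norm _); [exact: h1|exact: h2].
Qed.

(** Cauchy's estimate: the coefficient is computed on the circle of radius r rather than on the unit
    circle. *)
Lemma C_bound (r : R) : 0 < r -> exists M, forall k, nc (C k) * r ^+ k <= M.
Proof.
move=> r0; have [M M0 hM] := ccont_bounded_disc r holo_ccont.
exists (4 * pi * M) => k; rewrite /C (circ_coef_const k ltr01 r0).
rewrite -ler_pdivlMr ?exprn_gt0 // -[_ * M / _]mulrA.
apply: (@circ_int_le R (shape k r) (M / r ^+ k)); first exact: ccont_shape.
move=> t; rewrite /shape ncM ncX ncM nc_cisi mulr1 nc_rc gtr0_norm ?invr_gt0 //.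
rewrite [leLHS]mulrC exprVn ler_wpM2r ?invr_ge0 ?exprn_ge0 ?(ltW r0) //.
by apply: hM; rewrite ncM nc_cis mulr1 nc_rc gtr0_norm.
Qed.

(** Contracts the circle g(t) = r e^(i t) to z along z + s (g - z) and follows the integral of u F,
    where u is the N-th partial sum of the geometric series of z / g. At s = 0 the integral is 2 pi
    F(z), at s = 1 it is the Taylor sum. In the s-derivative, (g - z) u = g (1 - (z/g)^N) leaves an
    exact term, which integrates to 0, and a remainder of size (|z|/r)^N. *)
Lemma holo_expansion_bound (z : cplx R) (r : R) : nc z < r -> exists2 B, 0 <= B &
  forall N, (0 < N)%N -> nc (\sum_(k < N) C k * z ^+ k - rc (pi *+ 2) * Fc z) <= B * (nc z / r) ^+ N.
Proof.
move=> zr; have r0 : 0 < r by exact: le_lt_trans (nc_ge0 z) zr.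
have [M M0 hM] := ccont_bounded_disc r holo_ccont'.
exists (8 * pi * r * M); first by rewrite !mulr_ge0 ?pi_ge0 ?(ltW r0).
move=> N NN; pose g t := rc r * cis t; pose gi t := rc r^-1 * cisi t.
have ggi t : g t * gi t = 1.
  by rewrite /g /gi mulrACA cis_cisi -rcM mulfV ?gt_eqF // mulr1.
pose u t := \sum_(k < N) (z * gi t) ^+ k.
have gu t : (g t - z) * u t = g t * (1 - (z * gi t) ^+ N).
  have -> : g t - z = - g t * (z * gi t - 1).
    have -> : - g t * (z * gi t - 1) = - (g t * gi t) * z + g t by ring.
    by rewrite ggi; ring.
  rewrite -mulrA -subrX1; ring.
have ng t : nc (g t) = r by rewrite /g ncM nc_cis mulr1 nc_rc gtr0_norm.
have ngi t : nc (gi t) = r^-1 by rewrite /gi ncM nc_cisi mulr1 nc_rc gtr0_norm ?invr_gt0.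
have cg : ccont g by apply: ccontM; [exact: ccont_cst|exact: ccont_cis].
have cgi : ccont gi by apply: ccontM; [exact: ccont_cst|exact: ccont_cisi].
have czgi k : ccont (fun t => (z * gi t) ^+ k).
  by apply: ccontX; apply: ccontM => //; exact: ccont_cst.
have cu : ccont u := @ccont_sum R R N (fun k t => (z * gi t) ^+ k) czgi.
pose ze (p : R * R) := z + rc p.1 * (g p.2 - z).
pose f (p : R * R) := u p.2 * Fc (ze p).
pose A (p : R * R) := u p.2 * (F' (re (ze p), im (ze p)) * (g p.2 - z)).
have c1 : continuous (fst : R * R -> R) by move=> p; exact: cvg_fst.
have c2 : continuous (snd : R * R -> R) by move=> p; exact: cvg_snd.
have cg2 : ccont (fun p : R * R => g p.2 - z).
  by apply: ccontD; [exact: (ccont_comp c2 cg)|exact: ccont_cst].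
have cze : ccont ze.
  apply: ccontD; first exact: ccont_cst.
  by apply: ccontM cg2; exact: (ccont_real c1).
have cF' : ccont (fun p => F' (re (ze p), im (ze p))).
  exact: (ccont_comp (continuous_cpt_of cze) holo_ccont').
have cf : ccont f.
  apply: ccontM; first exact: (ccont_comp c2 cu).
  exact: (ccont_comp (continuous_cpt_of cze) holo_ccont).
have cA : ccont A by apply: ccontM; [exact: (ccont_comp c2 cu)|exact: ccontM].
have ds s t : cder (fun s => f (s, t)) s (A (s, t)).
  have d1 := cderD (cder_cst (1 : R) z s) (cderM (cder_rc s) (cder_cst (1 : R) (g t - z) s)).
  apply: cder_eq (cderM (cder_cst (1 : R) (u t) s) (cder_holo d1)) _.
  by rewrite /A /ze -[(s, t).1]/s -[(s, t).2]/t; ring.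
have dg s := @circ_int_under R f A s (fun s => ccont_comp (@continuous_pairl R s) cf) cA ds.
have csl s (G : R * R -> cplx R) : ccont G -> ccont (fun t => G (s, t)).
  by move=> cG; exact: (ccont_comp (@continuous_pairl R s) cG).
(* The integrand is, up to the factor i s, the t-derivative of the periodic function F(z + s (g(t) -
   z)). Dividing by s excludes s = 0, where F' is constant and the integral of e^(i t) vanishes. *)
have int0 s : circ_int (fun t => g t * F' (re (ze (s, t)), im (ze (s, t)))) = 0.
  have [->|s0] := eqVneq s 0.
    have e0 t : ze (0, t) = z by rewrite /ze -[(0, t).1]/(0 : R) mul0r addr0.
    under [X in circ_int X]funext => t do rewrite e0.
    rewrite (@circ_int_FTC _ (fun t => (- ii R * rc r * F' (re z, im z)) * cis t)).
    - by rewrite cis_2pi subrr.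
    - by apply: ccontM => //; exact: ccont_cst.
    - move=> t; apply: cder_eq (cderZ _ (cder_cis t)) _.
      rewrite /g; have e : ii R * ii R = -1 by apply: cE; rewrite !cRI; ring.
      by rewrite -[RHS]mul1r -[in RHS](opprK 1) -e; ring.
  have cG : ccont (fun t => F' (re (ze (s, t)), im (ze (s, t)))) by exact: (csl s _ cF').
  rewrite (@circ_int_FTC _ (fun t => (- ii R * rc s^-1) * Fc (ze (s, t)))).
  - rewrite (_ : ze (s, pi *+ 2) = ze (s, 0)) ?subrr //.
    by rewrite /ze -[(s, pi *+ 2).2]/(pi *+ 2) -[(s, 0).2]/(0 : R) /g cis_2pi.
  - exact: ccontM.
  - move=> t; have d1 := cderD (cder_cst (1 : R) z t) (cderZ (rc s) (cderD (cderZ (rc r) (cder_cis t)) (cder_cst (1 : R) (- z) t))).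
    apply: cder_eq (cderZ _ (cder_holo d1)) _.
    rewrite /g /ze -[(s, t).2]/t -[(s, t).1]/s /g.
    have e : ii R * ii R = -1 by apply: cE; rewrite !cRI; ring.
    have e2 : rc s * rc s^-1 = 1 by rewrite -rcM mulfV.
    rewrite -[RHS]mul1r -[in RHS](opprK 1) -e -[in RHS](mulr1 (ii R * ii R)) -e2; ring.
have nze s t : 0 <= s <= 1 -> nc (ze (s, t)) <= r.
  move=> /andP[s0 s1]; rewrite /ze -[(s, t).1]/s -[(s, t).2]/t.
  have -> : z + rc s * (g t - z) = rc (1 - s) * z + rc s * g t by rewrite rcD rcN -[rc 1]/(1 : cplx R); ring.
  apply: le_trans (ler_ncD _ _) _; rewrite (ncM (rc (1 - s)) z) (ncM (rc s) (g t)) !nc_rc ng (ger0_norm s0) ger0_norm ?subr_ge0 //.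
  by apply: (@le_trans _ _ ((1 - s) * r + s * r)); [rewrite lerD2r ler_wpM2l ?subr_ge0 // ltW|rewrite -mulrDl subrK mul1r].
pose B := 4 * pi * (r * (nc z / r) ^+ N * M).
have bA s : 0 <= s <= 1 -> nc (circ_int (fun t => A (s, t))) <= B.
  move=> s01.
  have eA t : A (s, t) = g t * F' (re (ze (s, t)), im (ze (s, t))) +
     (- (g t * (z * gi t) ^+ N * F' (re (ze (s, t)), im (ze (s, t))))).
    rewrite /A -[(s, t).2]/t [LHS]mulrC -[LHS]mulrA gu; ring.
  have cG : ccont (fun t => F' (re (ze (s, t)), im (ze (s, t)))) by exact: (csl s _ cF').
  have cH : ccont (fun t => - (g t * (z * gi t) ^+ N * F' (re (ze (s, t)), im (ze (s, t))))).
    by under eq_fun do rewrite -mulN1r; apply: ccontM (ccont_cst _ _) _; apply: ccontM => //; exact: ccontM.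
  have -> : circ_int (fun t => A (s, t)) =
    circ_int (fun t => - (g t * (z * gi t) ^+ N * F' (re (ze (s, t)), im (ze (s, t))))).
    under [X in circ_int X = _]funext => t do rewrite eA.
    by rewrite circ_intD ?int0 ?add0r //; exact: ccontM.
  apply: circ_int_le => // t; rewrite ncN (ncM (g t * _)) (ncM (g t)) ncX (ncM z) ng ngi.
  by rewrite ler_wpM2l ?mulr_ge0 ?exprn_ge0 ?mulr_ge0 ?nc_ge0 ?invr_ge0 ?(ltW r0) // hM // nze.
have g0 : circ_int (fun t => f (0, t)) = rc (pi *+ 2) * Fc z.
  have e0 t : f (0, t) = Fc z * u t.
    rewrite /f /ze -[(0, t).1]/(0 : R) -[(0, t).2]/t mul0r addr0; ring.
  under [X in circ_int X]funext => t do rewrite e0.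
  rewrite circ_intZ // mulrC; congr (_ * _).
  rewrite (@circ_int_sum R N (fun k t => (z * gi t) ^+ k) czgi).
  (* The only power of [gi] with a nonzero mean; it occurs in the sum because N is positive. *)
  have i0 : circ_int (fun t => (z * gi t) ^+ 0) = rc (pi *+ 2).
    rewrite (@circ_int_FTC _ (@rc R)) ?subr0 //.
    by move=> t; rewrite expr0; exact: cder_rc.
  have iS k : circ_int (fun t => (z * gi t) ^+ k.+1) = 0.
    rewrite (@circ_int_FTC _ (fun t => (ii R * rc k.+1%:R^-1) * (z * gi t) ^+ k.+1)) //.
      by rewrite /gi cisi_2pi subrr.
    move=> t; have d1 := cderX k.+1 (cderZ z (cderZ (rc r^-1) (cder_cisi t))).
    apply: cder_eq (cderZ _ d1) _.
    have e : ii R * ii R = -1 by apply: cE; rewrite !cRI; ring.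
    have e2 : rc (k.+1%:R : R) * rc (k.+1%:R^-1 : R) = 1 by rewrite -rcM mulfV.
    rewrite rcn in e2.
    transitivity (- (ii R * ii R) * (k.+1%:R * rc (k.+1%:R^-1 : R)) * (z * gi t) ^+ k.+1).
      by rewrite exprS /gi -[k.+1.-1]/k; ring.
    by rewrite e e2 opprK !mul1r.
  clear - i0 iS NN; case: N NN => [//|m] _; rewrite big_ord_recl i0 big1 ?addr0 // => j _.
  exact: iS.
have g1 : circ_int (fun t => f (1, t)) = \sum_(k < N) C k * z ^+ k.
  have e1 t : f (1, t) = \sum_(k < N) z ^+ k * shape k r t.
    rewrite /f /ze -[(1, t).1]/1 -[(1, t).2]/t mul1r addrC subrK /u mulr_suml.
    by apply: eq_bigr => k _; rewrite exprMn -mulrA.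
  under [X in circ_int X]funext => t do rewrite e1.
  rewrite (@circ_int_sum R N (fun k t => z ^+ k * shape k r t)); last first.
    by move=> k; apply: ccontM; [exact: ccont_cst|exact: ccont_shape].
  apply: eq_bigr => k _; rewrite circ_intZ; last exact: ccont_shape.
  by rewrite mulrC /C (circ_coef_const k ltr01 r0).
rewrite -g0 -g1.
have B0 : 0 <= B by rewrite !mulr_ge0 ?pi_ge0 ?exprn_ge0 ?mulr_ge0 ?nc_ge0 ?invr_ge0 // ltW.
have h1 : `|re (circ_int (fun t => f (1, t)) - circ_int (fun t => f (0, t)))| <= B.
  rewrite reD reN -[B]mulr1 -[X in B * X](subr0 1).
  apply: (@MVT_dist_itv R (fun s => re (circ_int (fun t => f (s, t))))
    (fun s => re (circ_int (fun t => A (s, t))))) => //.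
    by move=> s; have [] := dg s.
  by move=> s s01; apply: le_trans (bA s s01); exact: ler_norm_re.
have h2 : `|im (circ_int (fun t => f (1, t)) - circ_int (fun t => f (0, t)))| <= B.
  rewrite imD imN -[B]mulr1 -[X in B * X](subr0 1).
  apply: (@MVT_dist_itv R (fun s => im (circ_int (fun t => f (s, t))))
    (fun s => im (circ_int (fun t => A (s, t))))) => //.
    by move=> s; have [] := dg s.
  by move=> s s01; apply: le_trans (bA s s01); exact: ler_norm_im.
apply: le_trans (nc_le _) _; apply: le_trans (lerD h1 h2) _.
by rewrite /B le_eqVlt; apply/orP; left; apply/eqP; ring.
Qed.

Lemma holo_expansion (z : cplx R) :
  ccvg (fun N => \sum_(k < N) (rc (pi *+ 2)^-1 * C k) * z ^+ k) (Fc z).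
Proof.
have zr : nc z < nc z + 1 by rewrite ltrDl.
have [B B0 hB] := holo_expansion_bound zr.
have r0 : 0 < nc z + 1 by rewrite ltr_wpDl // nc_ge0.
have lt1 : `|nc z / (nc z + 1)| < 1.
  by rewrite ger0_norm ?divr_ge0 ?nc_ge0 ?(ltW r0) // ltr_pdivrMr // mul1r.
have tp := twopi_gt0 R.
have h : ccvg (fun N => \sum_(k < N) C k * z ^+ k - rc (pi *+ 2) * Fc z) 0.
  apply/ccvg0P; apply: (@squeeze_cvgr _ _ _ _ (fun=> 0) (fun N => B * (nc z / (nc z + 1)) ^+ N)).
  - by near=> N; rewrite nc_ge0 hB //; near: N; exists 1%N.
  - exact: cvg_cst.
  - by rewrite -[X in _ --> X](mulr0 B); apply: cvgM; [exact: cvg_cst|exact: cvg_expr].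
have := ccvgD (ccvgM (ccvg_cst (rc (pi *+ 2)^-1)) h) (ccvg_cst (Fc z)).
rewrite mulr0 add0r (_ : (fun n => _) = (fun N => \sum_(k < N) (rc (pi *+ 2)^-1 * C k) * z ^+ k)) //.
apply/funext => N; rewrite mulrBr mulrA -rcM mulVf ?gt_eqF //.
rewrite -[rc 1]/(1 : cplx R) mul1r subrK mulr_sumr.
by apply: eq_bigr => k _; rewrite mulrA.
Unshelve. all: by end_near. Qed.

(** The symmetry makes the coefficients real: averaging the expansion at z with the conjugate of the
    expansion at conj z replaces each coefficient by its real part. *)
Lemma holo_entire : (forall x y, F (x, - y) = cj (F (x, y))) ->
  exists a : nat -> R, entire a /\ forall p, F p = esum a (cpt p).
Proof.
move=> Fcj; pose c k := rc (pi *+ 2)^-1 * C k.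
exists (fun k => re (c k)).
have ea : entire (fun k => re (c k)).
  move=> rho rho0; have r0 : 0 < rho + 1 by rewrite ltr_wpDl.
  have [M hM] := C_bound r0; exists (nc (rc (pi *+ 2)^-1 : cplx R) * M) => k.
  apply: le_trans (ler_wpM2l (nc_ge0 _) (hM k)).
  rewrite mulrA -ncM; apply: ler_pM; rewrite ?exprn_ge0 ?ler_norm_re //.
  by rewrite lerXn2r ?nnegrE ?(ltW r0) // lerDl.
split => // -[x y].
have h1 := holo_expansion (cpt (x, y)).
have h2 := ccvg_cj (holo_expansion (cj (cpt (x, y)))).
rewrite !cRI /= Fcj cjK in h2; rewrite !cRI /= in h1.
have h3 := ccvgM (ccvg_cst (rc 2^-1)) (ccvgD h1 h2).
have := esum_cvg (cpt (x, y)) ea.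
rewrite (_ : psum _ _ = (fun n => rc 2^-1 *
  (\sum_(k < n) rc (pi *+ 2)^-1 * C k * cpt (x, y) ^+ k +
   cj (\sum_(k < n) rc (pi *+ 2)^-1 * C k * cj (cpt (x, y)) ^+ k)))).
  move=> h4; rewrite -(ccvg_unique h3 h4).
  have e : rc (2^-1 : R) * rc (2%:R : R) = 1 by rewrite -rcM mulVf.
  by rewrite rcn in e; rewrite -[LHS]mul1r -e; ring.
apply/funext => n; rewrite /psum cj_sum -big_split mulr_sumr; apply: eq_bigr => k _ /=.
rewrite cjM cjX cjK -mulrDl mulrA -/(c k); congr (_ * _).
have half (d : cplx R) : rc (re d) = rc 2^-1 * (d + cj d) by apply: cE; rewrite !cRI; field.
exact: (half (c k)).
Qed.

End Holomorphic.

(** * Decomposition of polyanalytic functions *)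

Section Polyanalytic.
Variable R : realType.
Implicit Types (F G : R * R -> cplx R) (p : R * R).

Definition conj_sym F := forall x y, F (x, - y) = cj (F (x, y)).

Lemma is_derive_uniq (f : R -> R) (x a b : R) :
  is_derive x 1 f a -> is_derive x 1 f b -> a = b.
Proof. by move=> [_ <-] [_ <-]. Qed.

(** Used with s = 1 for real parts and s = -1 for imaginary parts, which are even and odd in y. *)
Lemma derive_reflect (u : R * R -> R) (s : R) : Cm 1 u ->
  (forall x y, u (x, - y) = s * u (x, y)) ->
  (forall x y, 'D_(1, 0) u (x, - y) = s * 'D_(1, 0) u (x, y)) /\
  (forall x y, 'D_(0, 1) u (x, - y) = - (s * 'D_(0, 1) u (x, y))).
Proof.
move=> hu us.
have d1 (p : R * R) : is_derive p (1, 0) u ('D_(1, 0) u p) := (derivableP (@Cm_derivable1 _ _ _ p hu)).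
have d2 (p : R * R) : is_derive p (0, 1) u ('D_(0, 1) u p) := (derivableP (@Cm_derivable2 _ _ _ p hu)).
split=> x y.
  apply: (@is_derive_uniq (fun x => u (x, - y)) x).
    exact: (partial_is_derive1 (d1 (x, - y))).
  apply: (@is_derive_ext _ _ (fun x => s * u (x, y))) => [x'|]; first by rewrite us.
  exact: (is_deriveZ s (partial_is_derive1 (d1 (x, y)))).
apply: oppr_inj; rewrite opprK.
apply: (@is_derive_uniq (fun y => u (x, - y)) y).
  apply: is_derive_eq.
    exact: (is_derive1_comp (partial_is_derive2 (d2 (x, - y))) (is_deriveNid y 1)).
  by rewrite mulrN1.
apply: (@is_derive_ext _ _ (fun y => s * u (x, y))) => [y'|]; first by rewrite us.
exact: (is_deriveZ s (partial_is_derive2 (d2 (x, y)))).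
Qed.

Lemma conj_sym_dbar F : cCm 1 F -> conj_sym F -> conj_sym (dbar F).
Proof.
move=> [cr ci] h x y.
have [|r1 r2] := @derive_reflect (fun p => re (F p)) 1 cr.
  by move=> x' y'; rewrite h mul1r.
have [|i1 i2] := @derive_reflect (fun p => im (F p)) (-1) ci.
  by move=> x' y'; rewrite h mulN1r.
by apply: cE; rewrite /dbar !cRI ?r1 ?r2 ?i1 ?i2; ring.
Qed.

Lemma conj_sym_iter_dbar m F : cCm m F -> conj_sym F -> conj_sym (iter m (@dbar R) F).
Proof.
elim: m F => [//|m IH] F hF h; rewrite iterSr; apply: IH; first exact: cCm_dbar.
by apply: conj_sym_dbar => //; apply: cCm_le hF.
Qed.

Lemma cCm_zbarX m n F : cCm m F -> cCm m (fun p => cj (cpt p) ^+ n * F p).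
Proof.
move=> h; elim: n => [|n IH].
  by under eq_fun do rewrite expr0 mul1r.
by under eq_fun do rewrite exprS -mulrA; exact: cCm_zbarM.
Qed.

Lemma iter_dbar_zbarX m F : (forall k, cCm k F) -> (forall p, dbar F p = 0) ->
  iter m (@dbar R) (fun p => cj (cpt p) ^+ m * F p) = (fun p => (2 ^ m * m`!)%:R * F p).
Proof.
move=> hF dF; elim: m => [|m IH].
  by apply/funext => p /=; rewrite expr0.
rewrite (_ : (fun p => cj (cpt p) ^+ m.+1 * F p) =
  (fun p => cj (cpt p) * (cj (cpt p) ^+ m * F p))); last first.
  by apply/funext => p; rewrite exprS mulrA.
rewrite iter_dbar_zbar; last exact: cCm_zbarX.
rewrite -[m.+1.-1]/m IH iterS IH; apply/funext => p.
rewrite (dbarZ _ _ (hF 1%N)) dF !mulr0 add0r mulrA -natrM; congr (_%:R * _).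
by rewrite factS expnS; lia.
Qed.

(** G = [dbar]^(n+1) F is holomorphic and keeps the symmetry, hence is an entire series. Subtracting
    zbar^(n+1) G with the right constant lowers the order of F by one. *)
Lemma polyanalytic_decomp n F : cCm n.+1 F -> conj_sym F ->
  iter n.+1 (@dbar R) F = (fun=> 0) ->
  exists a : nat -> nat -> R, (forall j, entire (a j)) /\
    forall p, F p = \sum_(j < n.+1) cj (cpt p) ^+ j * esum (a j) (cpt p).
Proof.
elim: n F => [|n IH] F hF sF dF.
  have [|a [ea h]] := @holo_entire R F hF _ sF.
    by move=> p; move: dF => /(congr1 (fun G => G p)).
  exists (fun=> a); split=> // p.
  by rewrite big_ord_recl big_ord0 addr0 expr0 mul1r h.
pose G := iter n.+1 (@dbar R) F.
have hG : cCm 1 G by apply: cCm_iter_dbar; rewrite add1n.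
have sG : conj_sym G by apply: conj_sym_iter_dbar => //; exact: cCmW.
have [|g [eg Gg]] := @holo_entire R G hG _ sG.
  by move=> p; move: dF => /(congr1 (fun G => G p)).
(* The inverse of the constant that [dbar]^(n+1) produces from zbar^(n+1) in [iter_dbar_zbarX]. *)
pose c : R := (2 ^ n.+1 * n.+1`!)%:R^-1.
have c0 : ((2 ^ n.+1 * n.+1`!)%:R : R) != 0.
  by rewrite pnatr_eq0 muln_eq0 negb_or expn_eq0 /= -lt0n fact_gt0.
pose E p := esum (fun k => - c * g k) (cpt p).
have eE : entire (fun k => - c * g k) by exact: entire_scale.
pose F1 p := F p + cj (cpt p) ^+ n.+1 * E p.
have hE m : cCm m (fun p => cj (cpt p) ^+ n.+1 * E p).
  by apply: cCm_zbarX; exact: cCm_esum.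
have [||| a [ea ha]] := IH F1.
- by apply: cCmD => //; exact: cCmW.
- by move=> x y; rewrite /F1 sF cjD cjM cjX /E -esum_cj // cjK.
- rewrite iter_dbarD //; last exact: cCmW.
  rewrite iter_dbar_zbarX; last 2 first.
  - by move=> k; exact: cCm_esum.
  - by move=> p; exact: dbar_esum.
  apply/funext => p; rewrite -/G Gg /E esumZ // mulrA -rcn -rcM.
  by rewrite mulrN divff // rcN mulN1r subrr.
exists (fun j => if j == n.+1 then (fun k => c * g k) else a j); split.
  by move=> j; case: eqP => _ //; exact: entire_scale.
move=> p; rewrite big_ord_recr /= eqxx.
have -> : F p = F1 p - cj (cpt p) ^+ n.+1 * E p by rewrite /F1 addrK.
rewrite ha; congr (_ + _).
  by apply: eq_bigr => j _; rewrite ltn_eqF.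
rewrite -mulrN; congr (_ * _).
by rewrite /E !esumZ // rcN mulNr opprK.
Qed.

Lemma polyanalytic_HE n F : cCm n.+1 F -> conj_sym F ->
  iter n.+1 (@dbar R) F = (fun=> 0) ->
  exists b : nat -> nat -> R, (forall j, entire (b j)) /\
    forall p, F p = \sum_(j < n.+1) HE j (b j) (cpt p).
Proof.
move=> h1 h2 h3; have [a [ea ha]] := polyanalytic_decomp h1 h2 h3.
have [b [eb hb]] := HE_span n.+1 ea; exists b; split=> // p.
by rewrite ha hb.
Qed.

End Polyanalytic.

(** * Integration against Gaussian weights *)

Section PlaneMeasurability.
Variable R : realType.

(** An open set is the countable union of the closed rational boxes it contains, so it belongs to
    the product sigma-algebra on which [mu \x mu] is defined. *)
Lemma open_measurable_prod (O : set (R * R)) : open O ->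
  measurable (O : set (measurableTypeR R * measurableTypeR R)).
Proof.
move=> oO.
pose box (q : rat * rat * rat * rat) : set (R * R) :=
  `]ratr q.1.1.1, ratr q.1.1.2[%classic `*` `]ratr q.1.2, ratr q.2[%classic.
pose B (i : nat) : set (R * R) :=
  if unpickle i is Some q then (if `[< box q `<=` O >] then box q else set0) else set0.
have mB i : measurable (B i : set (measurableTypeR R * measurableTypeR R)).
  rewrite /B; case: unpickle => [q|]; last exact: measurable0.
  case: ifP => _; last exact: measurable0.
  by apply: measurableX; exact: measurable_itv.
suff -> : O = \bigcup_i B i by exact: bigcupT_measurable.
apply/seteqP; split; last first.
  move=> p [i _]; rewrite /B; case: unpickle => [q|//].
  by case: asboolP => [h|_] // /h.
move=> [x y] Op; have /nbhs_ballP[e /= e0 he] := open_nbhs_nbhs (conj oO Op).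
have lt1 (z : R) : z - e < z by rewrite ltrBlDr ltrDl.
have lt2 (z : R) : z < z + e by rewrite ltrDl.
have [a] := rat_in_itvoo (lt1 x); rewrite in_itv /= => /andP[a1 a2].
have [b] := rat_in_itvoo (lt2 x); rewrite in_itv /= => /andP[b1 b2].
have [c] := rat_in_itvoo (lt1 y); rewrite in_itv /= => /andP[c1 c2].
have [d] := rat_in_itvoo (lt2 y); rewrite in_itv /= => /andP[d1 d2].
have [i hi] : exists i, unpickle i = Some (a, b, c, d) by eexists; exact: pickleK.
exists i; [by []|rewrite /B hi].
have -> : `[< box (a, b, c, d) `<=` O >].
  apply/asboolP => -[x' y'] [/=]; rewrite !in_itv /= => /andP[x1 x2] /andP[y1 y2].
  apply: he; split; rewrite /ball /= ltr_distlC.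
    by rewrite (lt_trans a1 x1) (lt_trans x2 b2).
  by rewrite (lt_trans c1 y1) (lt_trans y2 d2).
by split; rewrite /= in_itv /= ?a2 ?b1 ?c2 ?d1.
Qed.

Lemma continuous_measurable_prod (u : R * R -> R) : continuous u ->
  measurable_fun (setT : set (measurableTypeR R * measurableTypeR R)) u.
Proof.
move=> /continuousP cu; apply: (measurability _ (RGenOpens.measurableE R)).
move=> _ [_ [a [b ->] <-]]; rewrite setTI; apply: open_measurable_prod.
exact/cu/interval_open.
Qed.

End PlaneMeasurability.

Section GaussianDomination.
Variable R : realType.
Local Notation mu := (@lebesgue_measure R).
Local Notation mu2 := (mu \x mu)%E.
Implicit Types (u v : R * R -> R) (p : R * R).

Definition sq p : R := p.1 ^+ 2 + p.2 ^+ 2.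

Lemma sq_ge0 p : 0 <= sq p. Proof. by rewrite addr_ge0 // sqr_ge0. Qed.

(** Domination by exp(-|p|^2) rather than exp(-2 pi |p|^2): the slack absorbs any polynomial
    factor. *)
Definition gd u := continuous u /\ exists C, forall p, `|u p| <= C * expR (- sq p).

Lemma continuous_sq : continuous sq.
Proof.
move=> p; apply: cvgD; rewrite /= expr2; under eq_fun do rewrite expr2.
  by apply: cvgM; apply: cvg_fst.
by apply: cvgM; apply: cvg_snd.
Qed.

Lemma integrable_gauss1 : mu.-integrable setT (EFin \o (fun x : R => expR (- x ^+ 2))).
Proof. exact: integrableT_gauss. Qed.

Lemma integrable_gauss2 : mu2.-integrable setT (EFin \o (fun p => expR (- sq p))).
Proof.
have mf : measurable_fun setT (EFin \o (fun p => expR (- sq p))).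
  apply/measurable_EFinP; apply: (@continuous_measurable_prod R) => p.
  apply: continuous_comp; last exact: continuous_expR.
  by apply: cvgN; exact: continuous_sq.
apply/(integrable12ltyP mu mu mf).
have /integrableP[mg ig] := integrable_gauss1.
have E x : (\int[mu]_y `|(EFin \o (fun p => expR (- sq p))) (x, y)| =
    (expR (- x ^+ 2))%:E * \int[mu]_y `|(expR (- (y : R) ^+ 2))%:E|)%E.
  rewrite -ge0_integralZl //.
  - by apply: eq_integral => y _; rewrite /= !ger0_norm ?expR_ge0 // /sq opprD expRD EFinM.
  - exact: measurableT_comp.
under eq_integral do rewrite E.
have fI : (\int[mu]_y `|(expR (- (y : R) ^+ 2))%:E|)%E \is a fin_num.
  by rewrite ge0_fin_numE //; exact: integral_ge0.
have I0 : (0 <= \int[mu]_y `|(expR (- (y : R) ^+ 2))%:E|)%E by exact: integral_ge0.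
move: fI I0 ig; case: (\int[mu]_y _)%E => // c _ c0 _.
under eq_integral do rewrite muleC.
rewrite ge0_integralZl // lte_mul_pinfty // -ge0_fin_numE; last first.
  by apply: integral_ge0 => x _; rewrite lee_fin expR_ge0.
exact: integrable_fin_num integrable_gauss1.
Qed.

Lemma gd_integrable u : gd u -> mu2.-integrable setT (EFin \o u).
Proof.
move=> [cu [C hC]].
have iC : mu2.-integrable setT (EFin \o (fun p => C * expR (- sq p))).
  exact: (integrableZl measurableT C integrable_gauss2).
apply: le_integrable iC => //.
  by apply/measurable_EFinP; exact: (@continuous_measurable_prod R).
by move=> p _; rewrite lee_fin; apply: le_trans (hC p) (ler_norm _).
Qed.

Lemma gdD u v : gd u -> gd v -> gd (fun p => u p + v p).
Proof.
move=> [cu [C hC]] [cv [D hD]]; split; first by move=> p; apply: cvgD; [exact: cu|exact: cv].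
exists (C + D) => p; rewrite mulrDl; apply: le_trans (ler_normD _ _) _.
exact: lerD.
Qed.

Lemma gdZ (c : R) u : gd u -> gd (fun p => c * u p).
Proof.
move=> [cu [C hC]]; split; first by move=> p; apply: cvgM; [exact: cvg_cst|exact: cu].
by exists (`|c| * C) => p; rewrite normrM -mulrA ler_wpM2l.
Qed.

Definition pb u := continuous u /\ exists C N, forall p, `|u p| <= C * (1 + sq p) ^+ N.

Lemma pb_le u (C : R) N M p : (N <= M)%N -> `|u p| <= C * (1 + sq p) ^+ N ->
  `|u p| <= `|C| * (1 + sq p) ^+ M.
Proof.
move=> NM h; apply: le_trans h _; apply: (@le_trans _ _ (`|C| * (1 + sq p) ^+ N)).
  by rewrite ler_wpM2r ?ler_norm // exprn_ge0 // addr_ge0 // sq_ge0.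
by rewrite ler_wpM2l // ler_weXn2l // lerDl sq_ge0.
Qed.

Lemma pbD u v : pb u -> pb v -> pb (fun p => u p + v p).
Proof.
move=> [cu [C [N hC]]] [cv [D [M hD]]].
split; first by move=> p; apply: cvgD; [exact: cu|exact: cv].
exists (`|C| + `|D|), (N + M)%N => p; rewrite mulrDl; apply: le_trans (ler_normD _ _) _.
by apply: lerD; [exact: pb_le (leq_addr _ _) (hC p)|exact: pb_le (leq_addl _ _) (hD p)].
Qed.

Lemma pbM u v : pb u -> pb v -> pb (fun p => u p * v p).
Proof.
move=> [cu [C [N hC]]] [cv [D [M hD]]].
split; first by move=> p; apply: cvgM; [exact: cu|exact: cv].
exists (C * D), (N + M)%N => p; rewrite normrM exprD mulrACA.
by apply: ler_pM.
Qed.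

Lemma pb_cst (c : R) : pb (fun=> c).
Proof.
split; first exact: cst_continuous.
by exists `|c|, 0%N => p; rewrite expr0 mulr1.
Qed.

Lemma pbZ (c : R) u : pb u -> pb (fun p => c * u p).
Proof. by apply: pbM; exact: pb_cst. Qed.

Lemma pbN u : pb u -> pb (fun p => - u p).
Proof. by move=> /(pbZ (-1)); under eq_fun do rewrite mulN1r. Qed.

Lemma ler_norm1D (x y : R) : 0 <= y -> x ^+ 2 <= y -> `|x| <= 1 + y.
Proof.
move=> y0 xy; rewrite -(@ler_pXn2r _ 2) ?nnegrE ?addr_ge0 // real_normK ?num_real //.
nra.
Qed.

Lemma pb_fst : pb fst.
Proof.
split; first by move=> p; apply: cvg_fst.
exists 1, 1%N => p; rewrite mul1r expr1 ler_norm1D ?sq_ge0 //.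
by rewrite /sq lerDl sqr_ge0.
Qed.

Lemma pb_snd : pb snd.
Proof.
split; first by move=> p; apply: cvg_snd.
exists 1, 1%N => p; rewrite mul1r expr1 ler_norm1D ?sq_ge0 //.
by rewrite /sq lerDr sqr_ge0.
Qed.

(** From 1 + s/n <= e^(s/n) with n = N, raised to the n-th power; this is where the constant n^n
    comes from. *)
Lemma pow_expR N : exists C, 0 <= C /\ forall s : R, 0 <= s -> (1 + s) ^+ N <= C * expR s.
Proof.
case: N => [|N].
  by exists 1; split=> // s s0; rewrite expr0 mul1r -expR0 ler_expR.
exists (N.+1%:R ^+ N.+1); split; first by rewrite exprn_ge0.
move=> s s0; have := expR_ge1Dx (s / N.+1%:R) => h.
have -> : expR s = expR (s / N.+1%:R) ^+ N.+1 by rewrite -expRM_natr divfK.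
rewrite -exprMn; apply: lerXn2r; rewrite ?nnegrE ?addr_ge0 ?mulr_ge0 ?expR_ge0 //.
apply: le_trans (ler_wpM2l (ler0n _ _) h); rewrite mulrDr mulr1 mulrCA divff // mulr1.
by rewrite lerD2r ler1n.
Qed.

(** The polynomial is bounded by a multiple of e^|p|^2, and 1 - 2 pi <= -1 leaves the required
    decay. *)
Lemma pb_gd u (W : R * R -> R) : pb u -> continuous W ->
  (forall p, `|W p| <= expR (- 2 * pi * sq p)) -> gd (fun p => u p * W p).
Proof.
move=> [cu [C [N hC]]] cW hW; split; first by move=> p; apply: cvgM; [exact: cu|exact: cW].
have [D [D0 hD]] := pow_expR N; exists (`|C| * D) => p.
rewrite normrM.
have h1 : `|u p| <= `|C| * D * expR (sq p).
  apply: le_trans (hC p) _; rewrite -mulrA.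
  apply: (@le_trans _ _ (`|C| * (1 + sq p) ^+ N)); last by rewrite ler_wpM2l // hD ?sq_ge0.
  by rewrite ler_wpM2r ?ler_norm // exprn_ge0 // addr_ge0 // sq_ge0.
apply: le_trans (ler_pM _ _ h1 (hW p)) _ => //.
rewrite -[leLHS]mulrA -expRD ler_wpM2l ?mulr_ge0 // ler_expR.
have := pi_ge2 R; have := sq_ge0 p; nra.
Qed.

End GaussianDomination.

Section RealDominatedConvergence.
Context d (T : measurableType d) (R : realType) (mu : {measure set T -> \bar R}).

Lemma Rintegral_dominated (f_ : nat -> T -> R) (f g : T -> R) :
  (forall n, measurable_fun setT (f_ n)) -> measurable_fun setT f ->
  (forall x, f_ n x @[n --> \oo] --> f x) ->
  mu.-integrable setT (EFin \o g) -> (forall n x, `|f_ n x| <= g x) ->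
  mu.-integrable setT (EFin \o f) /\
  (\int[mu]_x f_ n x) @[n --> \oo] --> \int[mu]_x f x.
Proof.
move=> mf_ mf f_f ig fg.
have [] := @dominated_convergence _ _ _ mu setT measurableT (fun n => EFin \o f_ n)
  (EFin \o f) (EFin \o g).
- by move=> n; exact/measurable_EFinP.
- exact/measurable_EFinP.
- by apply: aeW => x _; apply: cvg_EFin; [exact: nearW|exact: f_f].
- exact: ig.
- by apply: aeW => x n _; rewrite /= lee_fin.
move=> i1 _ h; split; first exact: i1.
apply: fine_cvg; rewrite /= fineK; first exact: h.
exact: integrable_fin_num i1.
Qed.

End RealDominatedConvergence.

Section GaussianIntegrals.
Variable R : realType.
Local Notation mu := (@lebesgue_measure R).
Local Notation mu2 := (mu \x mu)%E.
Implicit Types (u v : R * R -> R) (p : R * R).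

Lemma cvg_expRN_sqr (C : R) : (C * expR (- (n%:R : R) ^+ 2)) @[n --> \oo] --> (0 : R).
Proof.
rewrite -[X in _ --> X](mulr0 C); apply: cvgM; first exact: cvg_cst.
apply: (@squeeze_cvgr _ _ _ _ (fun=> 0) (fun n => (expR (-1) : R) ^+ n)).
- apply: nearW => n; rewrite expR_ge0 /= -expRM_natr ler_expR mulN1r lerN2.
  by rewrite -natrX ler_nat; case: n => // n; rewrite leq_pmull.
- exact: cvg_cst.
- by apply: cvg_expr; rewrite ger0_norm ?expR_ge0 // expR_lt1 oppr_lt0.
Qed.

(** On [-n, n] the integral is a difference of boundary values, and these vanish in the limit by the
    Gaussian bound. *)
Lemma Rintegral_line_deriv (g dg : R -> R) (C : R) :
  (forall x : R, is_derive x 1 g (dg x)) -> continuous dg ->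
  (forall x, `|g x| <= C * expR (- x ^+ 2)) -> (forall x, `|dg x| <= C * expR (- x ^+ 2)) ->
  \int[mu]_x dg x = 0.
Proof.
move=> h cdg bg bdg.
have mdg : measurable_fun setT dg by exact: continuous_measurable_fun.
have iC : mu.-integrable setT (EFin \o (fun x => C * expR (- x ^+ 2))).
  exact: (integrableZl measurableT C (@integrable_gauss1 R)).
pose f n x : R := (dg \_ `[- n%:R, n%:R]%classic) x.
have [||||_ hc] := @Rintegral_dominated _ _ _ mu f dg _ _ _ _ iC.
- move=> n; apply/(measurable_restrictT _ _).1; first exact: measurable_itv.
  exact: measurable_funTS.
- exact: mdg.
- move=> x; apply: cvg_near_cst; near=> n.
  rewrite /f patchE mem_set //= in_itv /= -ler_norml.
  near: n; exact: nbhs_infty_ger.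
- move=> n x; rewrite /f patchE; case: ifP => // _.
  by rewrite normr0; apply: le_trans (bdg x).
apply: (cvg_unique (@Rhausdorff R) hc).
apply: (@squeeze_cvgr _ _ _ _ (fun n => - (2 * C * expR (- (n%:R : R) ^+ 2)))
   (fun n => 2 * C * expR (- (n%:R : R) ^+ 2))).
- near=> n; rewrite -ler_norml -Rintegral_mkcond.
  have n0 : (- n%:R : R) < n%:R by rewrite gtrN // ltr0n; near: n; exists 1%N.
  rewrite (Rintegral_FTC n0 cdg h); apply: le_trans (ler_normB _ _) _.
  have := lerD (bg n%:R) (bg (- n%:R)); rewrite sqrrN => hh; apply: le_trans hh _.
  by rewrite (_ : _ + _ = 2 * C * expR (- n%:R ^+ 2)) //; ring.
- by rewrite -oppr0; apply: cvgN; exact: cvg_expRN_sqr.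
- exact: cvg_expRN_sqr.
Unshelve. all: by end_near. Qed.

Lemma gd_slice1 u y : gd u -> exists C, forall x, `|u (x, y)| <= C * expR (- x ^+ 2).
Proof.
move=> [_ [C hC]]; exists (C * expR (- y ^+ 2)) => x.
by rewrite -mulrA -expRD addrC -opprD; exact: hC.
Qed.

Lemma gd_slice2 u x : gd u -> exists C, forall y, `|u (x, y)| <= C * expR (- y ^+ 2).
Proof.
move=> [_ [C hC]]; exists (C * expR (- x ^+ 2)) => y.
by rewrite -mulrA -expRD -opprD; exact: hC.
Qed.

Lemma continuous_pairr (y : R) : continuous (fun x : R => (x, y) : R * R).
Proof.
apply: (@continuous_cpt_of _ _ (fun x => Cpx x y)); split => /=.
  by move=> x; exact: cvg_id.
exact: cst_continuous.
Qed.

Lemma continuous_slice1 u y : continuous u -> continuous (fun x => u (x, y)).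
Proof. by move=> cu x; apply: continuous_comp; [exact: continuous_pairr|exact: cu]. Qed.

Lemma continuous_slice2 u x : continuous u -> continuous (fun y => u (x, y)).
Proof. by move=> cu y; apply: continuous_comp; [exact: continuous_pairl|exact: cu]. Qed.

Lemma gaussian_integrable (f : R -> R) (C : R) : continuous f ->
  (forall x, `|f x| <= C * expR (- x ^+ 2)) -> mu.-integrable setT (EFin \o f).
Proof.
move=> cf bf.
have iC : mu.-integrable setT (EFin \o (fun x => C * expR (- x ^+ 2))).
  exact: (integrableZl measurableT C (@integrable_gauss1 R)).
apply: le_integrable iC => //.
  by apply/measurable_EFinP; exact: continuous_measurable_fun.
by move=> x _; rewrite lee_fin; apply: le_trans (bf x) (ler_norm _).
Qed.

Lemma Rintegral_plane_dx u ux : gd u -> gd ux ->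
  (forall p, is_derive p (1, 0) u (ux p)) -> \int[mu2]_p ux p = 0.
Proof.
move=> gu gux h; rewrite /Rintegral.
rewrite -(integral21_prod_meas1 (gd_integrable gux)) /=.
rewrite integral0_eq // => y _.
have [C hC] := gd_slice1 y gu; have [D hD] := gd_slice1 y gux.
have cux := continuous_slice1 (y := y) gux.1.
have i := gaussian_integrable cux hD.
rewrite -[LHS]fineK; last exact: integrable_fin_num i.
congr (_%:E); apply: (@Rintegral_line_deriv (fun x => u (x, y)) (fun x => ux (x, y)) (`|C| + `|D|)) => //.
- by move=> x; apply: partial_is_derive1; exact: h.
- move=> x; apply: le_trans (hC x) _; rewrite ler_wpM2r ?expR_ge0 //.
  by apply: le_trans (ler_norm _) _; rewrite lerDl.
- move=> x; apply: le_trans (hD x) _; rewrite ler_wpM2r ?expR_ge0 //.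
  by apply: le_trans (ler_norm _) _; rewrite lerDr.
Qed.

Lemma Rintegral_plane_dy u uy : gd u -> gd uy ->
  (forall p, is_derive p (0, 1) u (uy p)) -> \int[mu2]_p uy p = 0.
Proof.
move=> gu guy h; rewrite /Rintegral.
rewrite -(integral12_prod_meas1 (gd_integrable guy)) /=.
rewrite integral0_eq // => x _.
have [C hC] := gd_slice2 x gu; have [D hD] := gd_slice2 x guy.
have cuy := continuous_slice2 (x := x) guy.1.
have i := gaussian_integrable cuy hD.
rewrite -[LHS]fineK; last exact: integrable_fin_num i.
congr (_%:E); apply: (@Rintegral_line_deriv (fun y => u (x, y)) (fun y => uy (x, y)) (`|C| + `|D|)) => //.
- by move=> y; apply: partial_is_derive2; exact: h.
- move=> y; apply: le_trans (hC y) _; rewrite ler_wpM2r ?expR_ge0 //.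
  by apply: le_trans (ler_norm _) _; rewrite lerDl.
- move=> y; apply: le_trans (hD y) _; rewrite ler_wpM2r ?expR_ge0 //.
  by apply: le_trans (ler_norm _) _; rewrite lerDr.
Qed.

Definition wt p : R := expR (- 2 * pi * sq p).

Lemma gauss2pi : \int[mu]_x expR (- 2 * pi * x ^+ 2) = (Num.sqrt 2)^-1.
Proof.
(* The normal law of variance 1 / (4 pi) has density sqrt 2 exp(-2 pi x^2). *)
pose s : R := (2 * Num.sqrt pi)^-1.
have sp : 0 < Num.sqrt (pi : R) by rewrite sqrtr_gt0 pi_gt0.
have s0 : s != 0 by rewrite invr_eq0 mulf_neq0 // gt_eqF.
have s2 : s ^+ 2 = (4 * pi)^-1.
  by rewrite exprVn exprMn sqr_sqrtr ?pi_ge0 // -natrX.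
have pi0 : (pi : R) != 0 by rewrite gt_eqF // pi_gt0.
have e x : normal_pdf 0 s x = Num.sqrt 2 * expR (- 2 * pi * x ^+ 2).
  rewrite normal_pdfE // /normal_peak /normal_fun s2; congr (_ * expR _).
    have -> : (4 * pi)^-1 * pi *+ 2 = (2^-1 : R).
      by rewrite -mulr_natl; move: (pi : R) pi0 => q q0; field.
    by rewrite sqrtrV // invrK.
  by rewrite subr0 -mulr_natl; move: (pi : R) pi0 => q q0; field.
have := @integral_normal_pdf R 0 s.
under eq_integral do rewrite e EFinM.
rewrite integralZl //; last first.
  apply: (@gaussian_integrable _ 1).
    move=> x; apply: continuous_comp; last exact: continuous_expR.
    by apply: cvgM; [exact: cvg_cst|exact: exprn_continuous].
  move=> x; rewrite mul1r ger0_norm ?expR_ge0 // ler_expR.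
  by have := pi_ge2 R; have := sqr_ge0 x; nra.
rewrite /Rintegral.
have I0 : (0 <= \int[mu]_x (expR (- 2 * pi * x ^+ 2))%:E)%E.
  by apply: integral_ge0 => x _; rewrite lee_fin expR_ge0.
have sq2 : 0 < Num.sqrt (2 : R) by rewrite sqrtr_gt0.
case: (\int[mu]_x _)%E I0 => [r _|_|//] /=.
  by rewrite -EFinM => -[] h; rewrite -[LHS](mulKf (lt0r_neq0 sq2)) h mulr1.
by rewrite gt0_muley ?lte_fin.
Qed.

Lemma continuous_wt : continuous wt.
Proof.
move=> p; apply: continuous_comp; last exact: continuous_expR.
by apply: cvgM; [exact: cvg_cst|exact: continuous_sq].
Qed.

Lemma wt_ge0 p : 0 <= wt p. Proof. exact: expR_ge0. Qed.

Lemma norm_wt p : `|wt p| <= expR (- 2 * pi * sq p).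
Proof. by rewrite ger0_norm ?wt_ge0. Qed.

Lemma gd_wt : gd wt.
Proof.
have := pb_gd (pb_cst 1) continuous_wt norm_wt.
by under eq_fun do rewrite mul1r.
Qed.

Lemma Rintegral_wt : \int[mu2]_p wt p = 2^-1.
Proof.
rewrite /Rintegral -(integral12_prod_meas1 (gd_integrable gd_wt)) /=.
pose g x : R := expR (- 2 * pi * x ^+ 2).
have ig : mu.-integrable setT (EFin \o g).
  apply: (@gaussian_integrable _ 1).
    move=> x; apply: continuous_comp; last exact: continuous_expR.
    by apply: cvgM; [exact: cvg_cst|exact: exprn_continuous].
  move=> x; rewrite mul1r ger0_norm ?expR_ge0 // ler_expR.
  by have := pi_ge2 R; have := sqr_ge0 x; nra.
have Ig : (\int[mu]_x (g x)%:E)%E = ((Num.sqrt 2)^-1)%:E.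
  by rewrite -gauss2pi /Rintegral fineK //; exact: integrable_fin_num ig.
have E x : (\int[mu]_y (wt (x, y))%:E)%E = (((Num.sqrt 2)^-1)%:E * (g x)%:E)%E.
  rewrite muleC -Ig -integralZl //; apply: eq_integral => y _.
  by rewrite -EFinM /g -expRD -mulrDr.
transitivity (fine (\int[mu]_x (((Num.sqrt 2)^-1)%:E * (g x)%:E))%E).
  by congr fine; apply: eq_integral => x _; exact: E.
by rewrite integralZl // Ig /= -invfM -expr2 sqr_sqrtr //.
Qed.

End GaussianIntegrals.

(** * Radial weights and the orthogonality of monomials of different degree *)

Section WeightedIntegrals.
Variable R : realType.

Lemma of_partial_is_derive1 (u : R * R -> R) (x y l : R) :
  is_derive x 1 (fun x => u (x, y)) l -> is_derive ((x, y) : R * R) (1, 0) u l.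
Proof.
have e : (fun h : R => h^-1 *: (((fun x => u (x, y)) \o shift x) (h *: 1) - u (x, y))) =
   (fun h : R => h^-1 *: ((u \o shift (x, y)) (h *: (1, 0)) - u (x, y))).
  by apply/funext => h /=; congr (_ *: (u _ - _)); congr pair; rewrite /= /GRing.scale /= mulr0 add0r.
by case; rewrite /derivable /derive e => a b; split.
Qed.

Lemma of_partial_is_derive2 (u : R * R -> R) (x y l : R) :
  is_derive y 1 (fun y => u (x, y)) l -> is_derive ((x, y) : R * R) (0, 1) u l.
Proof.
have e : (fun h : R => h^-1 *: (((fun y => u (x, y)) \o shift y) (h *: 1) - u (x, y))) =
   (fun h : R => h^-1 *: ((u \o shift (x, y)) (h *: (0, 1)) - u (x, y))).
  by apply/funext => h /=; congr (_ *: (u _ - _)); congr pair; rewrite /= /GRing.scale /= mulr0 add0r.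
by case; rewrite /derivable /derive e => a b; split.
Qed.

Local Notation mu := (@lebesgue_measure R).
Local Notation mu2 := (mu \x mu)%E.
Implicit Types (p : R * R) (F G : R * R -> cplx R).

Definition pbc F := pb (fun p => re (F p)) /\ pb (fun p => im (F p)).

Lemma pbc_cst c : pbc (fun=> c).
Proof. by split; exact: pb_cst. Qed.

Lemma pbcD F G : pbc F -> pbc G -> pbc (fun p => F p + G p).
Proof.
move=> [a b] [c d]; split; first by under eq_fun do rewrite reD; exact: pbD.
by under eq_fun do rewrite imD; exact: pbD.
Qed.

Lemma pbcM F G : pbc F -> pbc G -> pbc (fun p => F p * G p).
Proof.
move=> [a b] [c d]; split.
  by under eq_fun do rewrite reM; apply: pbD; [exact: pbM|apply: pbN; exact: pbM].
by under eq_fun do rewrite imM; apply: pbD; exact: pbM.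
Qed.

Lemma pbc_cpt : pbc (@cpt R).
Proof. by split; [exact: pb_fst|exact: pb_snd]. Qed.

Lemma pbc_cj F : pbc F -> pbc (fun p => cj (F p)).
Proof. by move=> [a b]; split => //=; exact: pbN. Qed.

Lemma pbcX F n : pbc F -> pbc (fun p => F p ^+ n).
Proof.
move=> h; elim: n => [|n IH]; first exact: pbc_cst.
by under eq_fun do rewrite exprS; exact: pbcM.
Qed.

Lemma pbc_mono u v : pbc (fun p => cpt p ^+ u * cj (cpt p) ^+ v).
Proof.
apply: pbcM; first exact/pbcX/pbc_cpt.
exact/pbcX/pbc_cj/pbc_cpt.
Qed.

(** A weight om(|p|^2), dominated together with its derivative by the Gaussian. The class holds both
    the Gaussian and its cut-offs, and it allows integration by parts. *)
Definition radial_weight (om dom : R -> R) :=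
  [/\ forall s : R, is_derive s 1 om (dom s), continuous dom &
      exists2 C : R, 0 <= C & forall s, 0 <= s ->
        `|om s| <= expR (- 2 * pi * s) /\ `|dom s| <= C * expR (- 2 * pi * s)].

Section Weight.
Variable om dom : R -> R.
Hypothesis hom : radial_weight om dom.
Let W p := om (sq p).

Lemma continuous_weight : continuous W.
Proof.
have [h _ _] := hom; move=> p; apply: continuous_comp; first exact: continuous_sq.
exact: (is_derive1_continuous h).
Qed.

Lemma norm_weight p : `|W p| <= expR (- 2 * pi * sq p).
Proof. by have [_ _ [C _ h]] := hom; have [] := h (sq p) (sq_ge0 p). Qed.

Lemma gd_pbW u : pb u -> gd (fun p => u p * W p).
Proof. move=> h; apply: pb_gd => //; [exact: continuous_weight|exact: norm_weight]. Qed.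

Lemma gd_pbdW u : pb u -> gd (fun p => u p * dom (sq p)).
Proof.
move=> hu; have [h cd [C C0 hC]] := hom.
have c1 : 0 < C + 1 by rewrite ltr_wpDl.
have -> : (fun p => u p * dom (sq p)) = (fun p => (C + 1) * (u p * ((C + 1)^-1 * dom (sq p)))).
  by apply/funext => p; rewrite mulrCA mulVKf ?gt_eqF.
apply/gdZ/pb_gd => //.
  move=> p; apply: cvgM; first exact: cvg_cst.
  by apply: continuous_comp; [exact: continuous_sq|exact: cd].
move=> p; rewrite normrM gtr0_norm ?invr_gt0 // ler_pdivrMl //.
apply: le_trans (hC (sq p) (sq_ge0 p)).2 _.
by rewrite ler_wpM2r ?expR_ge0 // lerDl.
Qed.

Definition cint F : cplx R :=
  Cpx (\int[mu2]_p (re (F p) * W p)) (\int[mu2]_p (im (F p) * W p)).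

Lemma Rintegral_gdD u v : gd u -> gd v ->
  \int[mu2]_p (u p + v p) = \int[mu2]_p u p + \int[mu2]_p v p.
Proof.
by move=> gu gv; rewrite (RintegralD _ (gd_integrable gu) (gd_integrable gv)).
Qed.

Lemma Rintegral_gdZ (c : R) u : gd u -> \int[mu2]_p (c * u p) = c * \int[mu2]_p u p.
Proof. by move=> gu; rewrite (RintegralZl _ _ (gd_integrable gu)). Qed.

Lemma cintD F G : pbc F -> pbc G -> cint (fun p => F p + G p) = cint F + cint G.
Proof.
move=> [a b] [c d]; apply: cE; rewrite !cRI.
  rewrite -Rintegral_gdD; try exact: gd_pbW.
  by apply: eq_Rintegral => p _; rewrite reD mulrDl.
rewrite -Rintegral_gdD; try exact: gd_pbW.
by apply: eq_Rintegral => p _; rewrite imD mulrDl.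
Qed.

Lemma cintZ c F : pbc F -> cint (fun p => c * F p) = c * cint F.
Proof.
move=> [a b]; have lin (x y : R) : \int[mu2]_p (x * (re (F p) * W p) + y * (im (F p) * W p)) =
  x * \int[mu2]_p (re (F p) * W p) + y * \int[mu2]_p (im (F p) * W p).
  by rewrite Rintegral_gdD ?Rintegral_gdZ //; try apply: gdZ; exact: gd_pbW.
apply: cE; rewrite !cRI.
  by rewrite -mulNr -lin; apply: eq_Rintegral => p _; rewrite reM; ring.
by rewrite addrC -lin; apply: eq_Rintegral => p _; rewrite imM; ring.
Qed.

Lemma cpt_dx p : cderv ((1, 0) : R * R) (@cpt R) p 1.
Proof. by split; [exact: is_derive_fst1|exact: is_derive_snd1]. Qed.
Lemma cpt_dy p : cderv ((0, 1) : R * R) (@cpt R) p (ii R).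
Proof. by split; [exact: is_derive_fst2|exact: is_derive_snd2]. Qed.
Lemma cjcpt_dx p : cderv ((1, 0) : R * R) (fun p => cj (@cpt R p)) p 1.
Proof.
split; first exact: is_derive_fst1.
by apply: is_derive_eq (is_deriveN (is_derive_snd1 p)) _; rewrite oppr0.
Qed.
Lemma cjcpt_dy p : cderv ((0, 1) : R * R) (fun p => cj (@cpt R p)) p (- ii R).
Proof.
split; first by apply: is_derive_eq (is_derive_fst2 p) _; rewrite !cRI oppr0.
by apply: is_derive_eq (is_deriveN (is_derive_snd2 p)) _; rewrite !cRI.
Qed.

Let M u v p : cplx R := cpt p ^+ u * cj (cpt p) ^+ v.
Let Mz u v p : cplx R := u%:R * cpt p ^+ u.-1 * cj (cpt p) ^+ v.
Let Mw u v p : cplx R := cpt p ^+ u * (v%:R * cj (cpt p) ^+ v.-1).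

Lemma mono_dx u v p : cderv ((1, 0) : R * R) (M u v) p (Mz u v p + Mw u v p).
Proof.
apply: cder_eq (cderM (cderX u (cpt_dx p)) (cderX v (cjcpt_dx p))) _.
by rewrite /Mz /Mw !mulr1.
Qed.

Lemma mono_dy u v p : cderv ((0, 1) : R * R) (M u v) p (ii R * (Mz u v p - Mw u v p)).
Proof.
apply: cder_eq (cderM (cderX u (cpt_dy p)) (cderX v (cjcpt_dy p))) _.
by rewrite /Mz /Mw; ring.
Qed.

(** The rotation field x d/dy - y d/dx multiplies z^u zbar^v by i (u - v). *)
Lemma euler_mono u v p :
  rc p.1 * (ii R * (Mz u v p - Mw u v p)) - rc p.2 * (Mz u v p + Mw u v p) =
  ii R * ((u%:R - v%:R) * M u v p).
Proof.
have ez : cpt p * Mz u v p = u%:R * M u v p.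
  by rewrite /Mz /M; case: u => [|u]; rewrite ?mul0r ?mulr0 //= exprS; ring.
have ew : cj (cpt p) * Mw u v p = v%:R * M u v p.
  by rewrite /Mw /M; clear ez; case: v => [|v]; rewrite ?(mul0r, mulr0) //= exprS; ring.
have -> : ii R * ((u%:R - v%:R) * M u v p) = ii R * (cpt p * Mz u v p - cj (cpt p) * Mw u v p).
  by rewrite ez ew; ring.
have -> : cpt p = rc p.1 + ii R * rc p.2 by apply: cE; rewrite !cRI; ring.
have -> : cj (rc p.1 + ii R * rc p.2) = rc p.1 - ii R * rc p.2 by apply: cE; rewrite !cRI; ring.
have e : ii R * ii R = -1 by apply: cE; rewrite !cRI; ring.
transitivity (rc p.1 * (ii R * (Mz u v p - Mw u v p)) + (ii R * ii R) * (rc p.2 * (Mz u v p + Mw u v p))).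
  by rewrite e; ring.
by ring.
Qed.

Lemma is_derive_sqx p : is_derive p (1, 0) (@sq R) (2 * p.1).
Proof.
apply: is_derive_eq (is_deriveD_fun (is_deriveM_fun (is_derive_fst1 p) (is_derive_fst1 p))
  (is_deriveM_fun (is_derive_snd1 p) (is_derive_snd1 p))) _.
by ring.
Qed.
Lemma is_derive_sqy p : is_derive p (0, 1) (@sq R) (2 * p.2).
Proof.
apply: is_derive_eq (is_deriveD_fun (is_deriveM_fun (is_derive_fst2 p) (is_derive_fst2 p))
  (is_deriveM_fun (is_derive_snd2 p) (is_derive_snd2 p))) _.
by ring.
Qed.

Lemma weight_dx p : is_derive p (1, 0) W (dom (sq p) * (2 * p.1)).
Proof.
have [h _ _] := hom; case: p => x y.
have h1 := @is_derive1_comp R om (fun x => sq (x, y)) x _ _ (h _) (partial_is_derive1 (is_derive_sqx (x, y))).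
exact: (@of_partial_is_derive1 W x y _ h1).
Qed.
Lemma weight_dy p : is_derive p (0, 1) W (dom (sq p) * (2 * p.2)).
Proof.
have [h _ _] := hom; case: p => x y.
have h1 := @is_derive1_comp R om (fun y => sq (x, y)) y _ _ (h _) (partial_is_derive2 (is_derive_sqy (x, y))).
exact: (@of_partial_is_derive2 W x y _ h1).
Qed.

Lemma pb_Mz u v : pbc (Mz u v).
Proof.
rewrite /Mz; under eq_fun do rewrite -mulrA.
by apply: pbcM; [exact: pbc_cst|exact: pbc_mono].
Qed.
Lemma pb_Mw u v : pbc (Mw u v).
Proof.
rewrite /Mw; under eq_fun do rewrite mulrCA.
by apply: pbcM; [exact: pbc_cst|exact: pbc_mono].
Qed.

(** The rotation field is divergence free and annihilates the radial weight, so the integral of the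
    rotational derivative of P against the weight is 0; in the code the two terms with [dom]
    cancel. *)
Lemma rotation_moment (P Q Px Py : R * R -> R) (c : R) :
  pb P -> pb Q -> pb Px -> pb Py ->
  (forall p, is_derive p (1, 0) P (Px p)) -> (forall p, is_derive p (0, 1) P (Py p)) ->
  (forall p, p.1 * Py p - p.2 * Px p = c * Q p) ->
  c * \int[mu2]_p (Q p * W p) = 0.
Proof.
move=> hP hQ hPx hPy dx dy e.
have fs := @pb_fst R; have sn := @pb_snd R.
pose A p := p.1 * (Py p * W p + P p * (dom (sq p) * (2 * p.2))).
pose B p := p.2 * (Px p * W p + P p * (dom (sq p) * (2 * p.1))).
have dA p : is_derive p (0, 1) (fun p => p.1 * (P p * W p)) (A p).
  apply: is_derive_eq (is_deriveM_fun (is_derive_fst2 p) (is_deriveM_fun (dy p) (weight_dy p))) _.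
  by rewrite /A; ring.
have dB p : is_derive p (1, 0) (fun p => p.2 * (P p * W p)) (B p).
  apply: is_derive_eq (is_deriveM_fun (is_derive_snd1 p) (is_deriveM_fun (dx p) (weight_dx p))) _.
  by rewrite /B; ring.
have g1 : gd (fun p => p.1 * (P p * W p)).
  by under eq_fun do rewrite mulrA; apply: gd_pbW; exact: pbM.
have g2 : gd (fun p => p.2 * (P p * W p)).
  by under eq_fun do rewrite mulrA; apply: gd_pbW; exact: pbM.
have gA : gd A.
  have -> : A = (fun p => (p.1 * Py p) * W p + (p.1 * P p * (2 * p.2)) * dom (sq p)).
    by apply/funext => p; rewrite /A; ring.
  apply: gdD; first by apply: gd_pbW; exact: pbM.
  by apply: gd_pbdW; apply: pbM; [exact: pbM|exact: pbZ].
have gB : gd B.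
  have -> : B = (fun p => (p.2 * Px p) * W p + (p.2 * P p * (2 * p.1)) * dom (sq p)).
    by apply/funext => p; rewrite /B; ring.
  apply: gdD; first by apply: gd_pbW; exact: pbM.
  by apply: gd_pbdW; apply: pbM; [exact: pbM|exact: pbZ].
have iA := Rintegral_plane_dy g1 gA dA.
have iB := Rintegral_plane_dx g2 gB dB.
rewrite -Rintegral_gdZ; last exact: gd_pbW.
have -> : (fun p => c * (Q p * W p)) = (fun p => A p + (-1) * B p).
  by apply/funext => p; rewrite mulrA -e /A /B; ring.
by rewrite Rintegral_gdD ?Rintegral_gdZ ?iA ?iB ?mulr0 ?addr0 //; exact: gdZ.
Qed.

(** The eigenvalue i (u - v) exchanges the components: rotating the imaginary part controls the
    integral of the real part with c = u - v, and rotating the real part controls the imaginary one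
    with c = v - u. *)
Lemma cint_mono0 u v : u != v -> cint (M u v) = 0.
Proof.
move=> uv; have c0 : (u%:R - v%:R : R) != 0 by rewrite subr_eq0 eqr_nat.
have [pz1 pz2] := pb_Mz u v; have [pw1 pw2] := pb_Mw u v.
have [pm1 pm2] := pbc_mono u v.
have eu p := euler_mono u v p.
have pp : pb (fun p => re (Mz u v p + Mw u v p)) /\ pb (fun p => im (Mz u v p + Mw u v p)).
  by apply: pbcD; [exact: pb_Mz|exact: pb_Mw].
have pq : pb (fun p => re (ii R * (Mz u v p - Mw u v p))) /\ pb (fun p => im (ii R * (Mz u v p - Mw u v p))).
  apply: pbcM; first exact: pbc_cst.
  under eq_fun do rewrite -[X in _ + X]mulN1r.
  by apply: pbcD; [exact: pb_Mz|apply: pbcM; [exact: pbc_cst|exact: pb_Mw]].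
apply: cE; rewrite !cRI.
  apply: (mulfI c0); rewrite mulr0.
  apply: (@rotation_moment (fun p => im (M u v p)) _ (fun p => im (Mz u v p + Mw u v p))
     (fun p => im (ii R * (Mz u v p - Mw u v p))) _ pm2 pm1 pp.2 pq.2
     (fun p => (mono_dx u v p).2) (fun p => (mono_dy u v p).2)).
  by move=> p; have := congr1 (@complex.Im R) (eu p); rewrite !cRI; lra.
have c0' : - (u%:R - v%:R : R) != 0 by rewrite oppr_eq0.
apply: (mulfI c0'); rewrite mulr0.
apply: (@rotation_moment (fun p => re (M u v p)) _ (fun p => re (Mz u v p + Mw u v p))
   (fun p => re (ii R * (Mz u v p - Mw u v p))) _ pm1 pm2 pp.1 pq.1
   (fun p => (mono_dx u v p).1) (fun p => (mono_dy u v p).1)).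
by move=> p; have := congr1 (@complex.Re R) (eu p); rewrite !cRI; lra.
Qed.

End Weight.
End WeightedIntegrals.

(** * Complex Hermite polynomials and Parseval identity *)

Section ComplexHermite.
Variable R : realType.
Local Notation mu := (@lebesgue_measure R).
Local Notation mu2 := (mu \x mu)%E.
Local Notation tpi := (tpi R).
Implicit Types (p : R * R) (F G : R * R -> cplx R) (z : cplx R) (a : nat -> R).

(* [Hp j k] is [A^j z^k] for the creation operator [A = d/dz - 2 pi zbar]. *)
Fixpoint Hp j k z : cplx R :=
  if j is j'.+1 then k%:R * Hp j' k.-1 z - rc tpi * (cj z * Hp j' k z) else z ^+ k.

(** The commutation relation of A with multiplication by z, whose commutator is 1. For j = 0 the
    coefficient vanishes and [j.-1] does not matter. *)
Lemma HpSr j k z : Hp j k.+1 z = z * Hp j k z + j%:R * Hp j.-1 k z.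
Proof.
elim: j k => [|j IH] k /=; first by rewrite mul0r addr0 exprS.
rewrite IH; case: k => [|k] /=.
  by case: j {IH} => [|j] /=; rewrite -?natr1; ring.
have e := IH k; have -> : z * (k.+1%:R * Hp j k z - rc tpi * (cj z * Hp j k.+1 z)) =
  k.+1%:R * (Hp j k.+1 z - j%:R * Hp j.-1 k z) - rc tpi * (cj z * (z * Hp j k.+1 z)).
  by rewrite e; ring.
by case: j {IH e} => [|j] /=; rewrite -!natr1; ring.
Qed.

Lemma pbc_Hp j k : pbc (fun p => Hp j k (cpt p)).
Proof.
elim: j k => [|j IH] k /=; first exact/pbcX/pbc_cpt.
under eq_fun do rewrite -mulNr.
apply: pbcD; apply: pbcM; try exact: pbc_cst; try exact: IH.
apply: pbcM; last exact: IH.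
exact/pbc_cj/pbc_cpt.
Qed.

Section Angular.
Variables om dom : R -> R.
Hypothesis hom : radial_weight om dom.

Lemma cint_eq F G : (forall p, F p = G p) -> cint om F = cint om G.
Proof. by move=> e; congr cint; apply/funext. Qed.

Lemma cint_cj F : pbc F -> cint om (fun p => cj (F p)) = cj (cint om F).
Proof.
move=> [a b]; apply: cE; rewrite !cRI //.
rewrite -mulN1r -Rintegral_gdZ; last exact: (gd_pbW hom).
by apply: eq_Rintegral => p _; rewrite !cRI mulN1r mulNr.
Qed.

Lemma cint_lin c d F G : pbc F -> pbc G ->
  cint om (fun p => c * F p + d * G p) = c * cint om F + d * cint om G.
Proof.
move=> hF hG; rewrite (cintD hom) ?(cintZ hom) //; apply: pbcM => //; exact: pbc_cst.
Qed.

(** Under rotation, A^j z^k has degree k - j. The prefactor z^u zbar^v collects the factors released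
    when the creation operators are unfolded one by one, until only monomials remain; the degrees
    are compared without subtraction. *)
Lemma angular_orthogonal u v j k l m : (u + k + l != v + j + m)%N ->
  cint om (fun p => cpt p ^+ u * cj (cpt p) ^+ v * (Hp j k (cpt p) * cj (Hp l m (cpt p)))) = 0.
Proof.
have pm u' v' := pbc_mono R u' v'.
have ph j' k' := pbc_Hp j' k'.
have phc j' k' := pbc_cj (pbc_Hp j' k').
elim: j u v k l m => [|j IHj] u v k l m.
  elim: l u v k m => [|l IHl] u v k m h.
    under cint_eq => p do rewrite /= cjX mulrACA -!exprD.
    apply: (cint_mono0 hom); apply: contra h => /eqP /= h; apply/eqP; lia.
  (* [m.-1] shifts the degree correctly only for positive m; for m = 0 the coefficient of that term
     is 0. *)
  have h1 : (u + k + l != v + 0 + m.-1)%N || (m == 0)%N.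
    by case: m h => [|m] h; [by rewrite eqxx orbT|]; apply/orP; left; apply: contra h => /eqP /= h; apply/eqP; lia.
  have h2 : (u.+1 + k + l != v + 0 + m)%N.
    by apply: contra h => /eqP /= h; apply/eqP; lia.
  transitivity (cint om (fun p =>
     m%:R * (cpt p ^+ u * cj (cpt p) ^+ v * (Hp 0 k (cpt p) * cj (Hp l m.-1 (cpt p)))) +
     - rc tpi * (cpt p ^+ u.+1 * cj (cpt p) ^+ v * (Hp 0 k (cpt p) * cj (Hp l m (cpt p)))))).
    apply: cint_eq => p; rewrite [Hp l.+1 _ _]/=.
    by rewrite cjD cjN !cjM cjn cjK cj_rc exprS; ring.
  rewrite cint_lin; try by apply: pbcM; [exact: pm|apply: pbcM; [exact: ph|exact: phc]].
  rewrite (IHl _ _ _ _ h2) mulr0 addr0.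
  case/orP: h1 => [h1|/eqP ->]; last by rewrite mul0r.
  by rewrite (IHl _ _ _ _ h1) mulr0.
move=> h.
have h1 : (u + k.-1 + l != v + j + m)%N || (k == 0)%N.
  by case: k h => [|k] h; [by rewrite eqxx orbT|]; apply/orP; left; apply: contra h => /eqP /= h; apply/eqP; lia.
have h2 : (u + k + l != v.+1 + j + m)%N.
  by apply: contra h => /eqP /= h; apply/eqP; lia.
transitivity (cint om (fun p =>
   k%:R * (cpt p ^+ u * cj (cpt p) ^+ v * (Hp j k.-1 (cpt p) * cj (Hp l m (cpt p)))) +
   - rc tpi * (cpt p ^+ u * cj (cpt p) ^+ v.+1 * (Hp j k (cpt p) * cj (Hp l m (cpt p)))))).
  by apply: cint_eq => p; rewrite [Hp j.+1 _ _]/= [cj _ ^+ v.+1]exprS; ring.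
rewrite cint_lin; try by apply: pbcM; [exact: pm|apply: pbcM; [exact: ph|exact: phc]].
rewrite (IHj _ _ _ _ _ h2) mulr0 addr0.
case/orP: h1 => [h1|/eqP ->]; last by rewrite mul0r.
by rewrite (IHj _ _ _ _ _ h1) mulr0.
Qed.

Lemma pythagoras N (G : nat -> R * R -> cplx R) : (forall i, pbc (G i)) ->
  (forall i k, i != k -> cint om (fun p => G i p * cj (G k p)) = 0) ->
  \int[mu2]_p (nc (\sum_(i < N) G i p) ^+ 2 * om (sq p)) =
  \sum_(i < N) \int[mu2]_p (nc (G i p) ^+ 2 * om (sq p)).
Proof.
move=> hG orth.
have pn F : pbc F -> pb (fun p => nc (F p) ^+ 2).
  move=> [a b]; under eq_fun do rewrite sqr_nc !expr2.
  by apply: pbD; exact: pbM.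
have pS n : pbc (fun p => \sum_(i < n) G i p).
  elim: n => [|n IH]; first by under eq_fun do rewrite big_ord0; exact: pbc_cst.
  by under eq_fun do rewrite big_ord_recr /=; exact: pbcD.
have oS n k : (n <= k)%N -> cint om (fun p => (\sum_(i < n) G i p) * cj (G k p)) = 0.
  elim: n => [|n IH] nk.
    transitivity (cint om (fun p => 0 * cj (G k p))).
      by apply: cint_eq => p; rewrite big_ord0.
    by rewrite (cintZ hom) ?mul0r //; exact: pbc_cj.
  transitivity (cint om (fun p => (\sum_(i < n) G i p) * cj (G k p) + G n p * cj (G k p))).
    by apply: cint_eq => p; rewrite big_ord_recr /= mulrDl.
  rewrite (cintD hom); try by apply: pbcM => //; exact: pbc_cj.
  by rewrite IH ?(ltnW nk) // orth ?addr0 // neq_ltn nk.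
elim: N => [|N IH].
  rewrite big_ord0 /Rintegral integral0_eq // => p _; by rewrite big_ord0 nc0 expr0n mul0r.
rewrite [RHS]big_ord_recr /= -IH.
have := congr1 (@complex.Re R) (oS N N (leqnn _)); rewrite /= => h0.
transitivity (\int[mu2]_p (nc (\sum_(i < N) G i p) ^+ 2 * om (sq p) +
   (nc (G N p) ^+ 2 * om (sq p) + 2 * (re ((\sum_(i < N) G i p) * cj (G N p)) * om (sq p))))).
  apply: eq_Rintegral => p _; rewrite big_ord_recr /=.
  by rewrite !sqr_nc !cRI; ring.
have [q1 q2] := pbcM (pS N) (pbc_cj (hG N)).
have g1 := gd_pbW hom (pn _ (pS N)); have g2 := gd_pbW hom (pn _ (hG N)).
have g3 := gd_pbW hom q1.
rewrite Rintegral_gdD //; last by apply: gdD => //; exact: gdZ.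
by rewrite Rintegral_gdD ?Rintegral_gdZ ?h0 ?mulr0 ?addr0 //; exact: gdZ.
Qed.

End Angular.
End ComplexHermite.

(** * Gaussian moments and the full orthogonality relations *)

Section GaussianMoments.
Variable R : realType.
Local Notation mu := (@lebesgue_measure R).
Local Notation mu2 := (mu \x mu)%E.
Local Notation tpi := (tpi R).
Implicit Types (p : R * R).

Definition gw (s : R) : R := expR (- 2 * pi * s).

Lemma is_derive_gw (s : R) : is_derive s 1 gw (- tpi * gw s).
Proof.
have h : is_derive s 1 (fun s : R => (- 2 * pi) * s) (- 2 * pi).
  apply: is_derive_eq (is_deriveZ (- 2 * pi : R) (is_derive_id s 1)) _.
  by rewrite /GRing.scale /= mulr1.
have := @is_derive1_comp R expR (fun s => (- 2 * pi) * s) s _ _ (is_derive_expR _) h.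
by move=> k; apply: is_derive_eq k _; rewrite /gw /tpi; ring.
Qed.

Lemma continuous_gw : continuous gw.
Proof. exact: (is_derive1_continuous is_derive_gw). Qed.

Lemma gw_gt0 s : 0 < gw s. Proof. exact: expR_gt0. Qed.

Lemma gw_radial : radial_weight gw (fun s => - tpi * gw s).
Proof.
split; first exact: is_derive_gw.
  by move=> s; apply: cvgM; [exact: cvg_cst|exact: continuous_gw].
exists tpi; first exact/ltW/tpi_gt0.
move=> s _; split; first by rewrite ger0_norm // ltW // gw_gt0.
by rewrite normrM normrN !ger0_norm // ltW // ?tpi_gt0 ?gw_gt0.
Qed.

Definition moment n : R := \int[mu2]_p (sq p ^+ n * wt p).

Lemma pb_sq : pb (@sq R).
Proof. by apply: pbD; under eq_fun do rewrite expr2; apply: pbM; (exact: pb_fst || exact: pb_snd). Qed.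

Lemma pb_sqX n : pb (fun p => sq p ^+ n).
Proof.
elim: n => [|n IH]; first exact: pb_cst.
by under eq_fun do rewrite exprS; apply: pbM => //; exact: pb_sq.
Qed.

Lemma gd_sqX n : gd (fun p => sq p ^+ n * wt p).
Proof. by have := gd_pbW gw_radial (pb_sqX n). Qed.

Lemma is_derive_sqX p v l n : is_derive p v (@sq R) l ->
  is_derive p v (fun p => sq p ^+ n) (n%:R * sq p ^+ n.-1 * l).
Proof.
move=> h; elim: n => [|n IH]; first by rewrite !mul0r; exact: is_derive_cst.
rewrite (_ : (fun q => sq q ^+ n.+1) = (fun q => sq q * sq q ^+ n)); last by apply/funext => q; rewrite exprS.
apply: is_derive_eq (is_deriveM_fun h IH) _.
by case: n {IH} => [|n] /=; rewrite ?exprS -?natr1; ring.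
Qed.

(** The divergence of the field |p|^(2n) e^(-2 pi |p|^2) p integrates to 0; this gives the recursion
    without polar coordinates. *)
Lemma momentS n : moment n.+1 = n.+1%:R / tpi * moment n.
Proof.
have dx p : is_derive p (1, 0) (fun p => p.1 * (sq p ^+ n * wt p))
   (sq p ^+ n * wt p + p.1 * (n%:R * sq p ^+ n.-1 * (2 * p.1)) * wt p
    - 2 * tpi * p.1 ^+ 2 * sq p ^+ n * wt p).
  apply: is_derive_eq (is_deriveM_fun (is_derive_fst1 p)
    (is_deriveM_fun (is_derive_sqX n (is_derive_sqx p)) (weight_dx gw_radial p))) _.
  by rewrite -[wt p]/(gw (sq p)); ring.
have dy p : is_derive p (0, 1) (fun p => p.2 * (sq p ^+ n * wt p))
   (sq p ^+ n * wt p + p.2 * (n%:R * sq p ^+ n.-1 * (2 * p.2)) * wt p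
    - 2 * tpi * p.2 ^+ 2 * sq p ^+ n * wt p).
  apply: is_derive_eq (is_deriveM_fun (is_derive_snd2 p)
    (is_deriveM_fun (is_derive_sqX n (is_derive_sqy p)) (weight_dy gw_radial p))) _.
  by rewrite -[wt p]/(gw (sq p)); ring.
have pn := pb_sqX n; have pn1 := pb_sqX n.-1.
have fs := @pb_fst R; have sn := @pb_snd R.
have gdP u : pb u -> gd (fun p => u p * wt p) by exact: (gd_pbW gw_radial).
have gx (f : R * R -> R) : pb f -> gd (fun p => f p * (sq p ^+ n * wt p)).
  by move=> hf; under eq_fun do rewrite mulrA; apply: gdP; exact: pbM.
have gdx (f : R * R -> R) : pb f -> gd (fun p => sq p ^+ n * wt p +
    f p * (n%:R * sq p ^+ n.-1 * (2 * f p)) * wt p - 2 * tpi * f p ^+ 2 * sq p ^+ n * wt p).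
  move=> hf; have -> : (fun p => sq p ^+ n * wt p +
    f p * (n%:R * sq p ^+ n.-1 * (2 * f p)) * wt p - 2 * tpi * f p ^+ 2 * sq p ^+ n * wt p) =
    (fun p => (sq p ^+ n + (f p * ((n%:R * sq p ^+ n.-1) * (2 * f p))
      + (- (2 * tpi)) * ((f p * f p) * sq p ^+ n))) * wt p).
    by apply/funext => p; ring.
  apply: gdP; apply: pbD => //; apply: pbD; first by apply: pbM => //; apply: pbM; exact: pbZ.
  by apply: pbZ; apply: pbM => //; exact: pbM.
have i1 := Rintegral_plane_dx (gx _ fs) (gdx _ fs) dx.
have i2 := Rintegral_plane_dy (gx _ sn) (gdx _ sn) dy.
have e : 0 = 2 * n.+1%:R * moment n + - (2 * tpi) * moment n.+1.
  rewrite /moment -!Rintegral_gdZ; try exact: gd_sqX.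
  rewrite -Rintegral_gdD; try by apply: gdZ; exact: gd_sqX.
  have i0 := congr2 +%R i1 i2; rewrite addr0 in i0; rewrite -i0 {i0}.
  rewrite -Rintegral_gdD; [|exact: gdx|exact: gdx].
  apply: eq_Rintegral => p _.
  have -> : 2 * n.+1%:R * (sq p ^+ n * wt p) =
    2 * (sq p ^+ n * wt p) + 2 * (n%:R * sq p ^+ n.-1 * sq p) * wt p.
    have -> : n%:R * sq p ^+ n.-1 * sq p = n%:R * sq p ^+ n.
      by case: (n) => [|k]; rewrite ?mul0r //= exprSr mulrA.
    by rewrite -[n.+1%:R]natr1; ring.
  rewrite [sq p ^+ n.+1]exprSr; set X := sq p ^+ n; set Y := _ ^+ n.-1; rewrite /sq; ring.
have t0 := tpi_neq0 R; apply: (mulfI t0).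
by rewrite mulrA mulrCA mulfV // mulr1; lra.
Qed.

Lemma momentE n : moment n = n`!%:R / (2 * tpi ^+ n).
Proof.
have t0 := tpi_neq0 R; elim: n => [|n IH].
  rewrite /moment fact0 expr0 mulr1 div1r -Rintegral_wt.
  by apply: eq_Rintegral => p _; rewrite expr0 mul1r.
rewrite momentS IH factS natrM exprS; field; rewrite ?expf_neq0 ?t0 //.
Qed.

Definition hnorm j k : R := tpi ^+ j * j`!%:R * (k`!%:R / (2 * tpi ^+ k)).

Lemma hnorm_gt0 j k : 0 < hnorm j k.
Proof.
have t0 := tpi_gt0 R.
have f0 n : 0 < (n`!%:R : R) by rewrite ltr0n fact_gt0.
have t n : 0 < tpi ^+ n by rewrite exprn_gt0.
by rewrite mulr_gt0 ?divr_gt0 ?mulr_gt0 // (t, f0).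
Qed.

Let ip j k l m := cint gw (fun p => Hp j k (cpt p) * cj (Hp l m (cpt p))).

Let val j k l m : cplx R := rc ((j == l)%:R * (k == m)%:R * hnorm j k).

Let ip00 k m : ip 0 k 0 m = val 0 k 0 m.
Proof.
rewrite /ip /val eqxx mul1r; have [->|km] := eqVneq k m; last first.
  rewrite !mul0r rc0 -(cint_mono0 gw_radial km).
  by apply: cint_eq => p; rewrite /= cjX.
rewrite mul1r /hnorm fact0 expr0 !mul1r -momentE.
have e p : Hp 0 m (cpt p) * cj (Hp 0 m (cpt p)) = rc (sq p ^+ m).
  by rewrite /= cjX -exprMn [cpt p * _]mulrC mul_cj -rcX sqr_nc.
apply: cE; rewrite !cRI; first by apply: eq_Rintegral => p _; rewrite e.
by rewrite /Rintegral integral0_eq // => p _; rewrite e mul0r.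
Qed.

(** Unfolds one creation operator in the first factor: its zbar becomes a z inside the conjugated
    second factor, where [HpSr] applies. *)
Let ipS j k l m : ip j.+1 k l m =
  k%:R * ip j k.-1 l m - rc tpi * (ip j k l m.+1 - l%:R * ip j k l.-1 m).
Proof.
have ph u v u' v' : pbc (fun p => Hp u v (cpt p) * cj (Hp u' v' (cpt p))).
  by apply: pbcM; [exact: pbc_Hp|exact/pbc_cj/pbc_Hp].
transitivity (cint gw (fun p => 1 * (k%:R * (Hp j k.-1 (cpt p) * cj (Hp l m (cpt p))) +
   - rc tpi * (Hp j k (cpt p) * cj (Hp l m.+1 (cpt p)))) +
   (rc tpi * l%:R) * (Hp j k (cpt p) * cj (Hp l.-1 m (cpt p))))).
  apply: cint_eq => p; rewrite HpSr [Hp j.+1 _ _]/= cjD !cjM cjn; ring.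
rewrite (cint_lin gw_radial) //; last first.
  by apply: pbcD; apply: pbcM => //; exact: pbc_cst.
by rewrite (cint_lin gw_radial) // /ip; ring.
Qed.

(** The hypothesis on [l.-1] carries the factor l, so at l = 0 it holds trivially. *)
Let ip_step j l : (forall k m, ip j k l m = val j k l m) ->
  (forall k m, l%:R * ip j k l.-1 m = l%:R * val j k l.-1 m) ->
  forall k m, ip j.+1 k l m = val j.+1 k l m.
Proof.
move=> h1 h2 k m; rewrite ipS !h1 h2 /val -!rcn -!rcM -!rcN -!rcD -rcM -rcN -rcD.
congr rc; have t0 := tpi_neq0 R.
have f0 n : (n`!%:R : R) != 0 by rewrite pnatr_eq0 -lt0n fact_gt0.
have -> : k%:R * ((j == l)%:R * (k.-1 == m)%:R * hnorm j k.-1) =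
  tpi * ((j == l)%:R * (k == m.+1)%:R * hnorm j k).
  case: k => [|k] /=; first by rewrite mul0r mulr0 mul0r mulr0.
  by rewrite eqSS /hnorm factS natrM exprS; field; rewrite ?expf_neq0 ?t0 //.
rewrite /hnorm; case: l {h1 h2} => [|l] /=; first by ring.
rewrite eqSS; have [->|] := eqVneq j l; last by move=> _; rewrite !mul0r; ring.
by rewrite factS natrM exprS; ring.
Qed.

(** The column l = 0 is settled for every j; conjugate symmetry transfers it to the row j = 0, from
    which the induction on j proceeds for all l. *)
Lemma Hp_orthogonal j k l m :
  cint gw (fun p => Hp j k (cpt p) * cj (Hp l m (cpt p))) =
  rc ((j == l)%:R * (k == m)%:R * hnorm j k).
Proof.
have h0 : forall i k m, ip i k 0 m = val i k 0 m.
  elim=> [|i IH] k' m'; first exact: ip00.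
  by apply: ip_step => // *; rewrite !mul0r.
rewrite -/(ip j k l m) -/(val j k l m); elim: j l k m => [|j IH] l k m.
  transitivity (cj (ip l m 0 k)).
    rewrite /ip -(cint_cj gw_radial); last first.
      by apply: pbcM; [exact: pbc_Hp|exact/pbc_cj/pbc_Hp].
    by apply: cint_eq => p; rewrite cjM cjK mulrC.
  rewrite h0 cj_rc /val; congr rc; rewrite [l == _]eq_sym [m == _]eq_sym.
  by have [<-|] := eqVneq; last rewrite !mul0r //; have [->|] := eqVneq k m; rewrite ?mulr0 ?mul0r.
by apply: ip_step => *; rewrite IH.
Qed.

End GaussianMoments.

(** * Partial sums of A^j E and their grouping by angular degree *)

Section PartialSums.
Variable R : realType.
Local Notation tpi := (tpi R).
Implicit Types (a : nat -> R) (z : cplx R) (b : nat -> nat -> R).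

Definition pH j a N z : cplx R := \sum_(k < N) rc (a k) * Hp j k z.

Lemma pHS j a N z :
  pH j.+1 a N.+1 z = pH j (dseq a) N z - rc tpi * (cj z * pH j a N.+1 z).
Proof.
transitivity (\sum_(k < N.+1) rc (a k) * (k%:R * Hp j k.-1 z) - rc tpi * (cj z * pH j a N.+1 z)).
  by rewrite /pH !mulr_sumr -sumrB; apply: eq_bigr => k _ /=; ring.
congr (_ - _); rewrite big_ord_recl /= mul0r mulr0 add0r.
by apply: eq_bigr => k _; rewrite /dseq /= /bump /= add1n rcM rcn; ring.
Qed.

Lemma ccvg_pH j a z : entire a -> ccvg (fun N => pH j a N z) (HE j a z).
Proof.
elim: j a => [|j IH] a ea; first exact: esum_cvg.
have h : ccvg (fun N => pH j.+1 a N.+1 z) (HE j.+1 a z).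
  under eq_fun do rewrite pHS; apply: ccvgD; first exact/IH/entire_dseq.
  apply: ccvgN; apply: (ccvgM (ccvg_cst _)); apply: (ccvgM (ccvg_cst _)).
  exact: (@ccvgS R (fun N => pH j a N z) _ (IH _ ea)).
move: h => [h1 h2]; split.
  by rewrite -(cvg_shiftS (fun N => re (pH j.+1 a N z))).
by rewrite -(cvg_shiftS (fun N => im (pH j.+1 a N z))).
Qed.

Lemma pH_le j a (rho : R) : entire a -> 0 <= rho ->
  exists M, forall z, nc z <= rho -> forall N, \sum_(k < N) `|a k| * nc (Hp j k z) <= M.
Proof.
move=> + rho0; elim: j a => [|j IH] a ea.
  have [M hM] := psum_le ea rho0; exists M => z hz N.
  by under eq_bigr do rewrite ncX; exact: hM.
have [M hM] := IH _ (entire_dseq ea); have [M' hM'] := IH _ ea.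
exists (M + tpi * rho * M') => z hz N.
have t0 := ltW (tpi_gt0 R).
have M0 : 0 <= M by apply: le_trans (hM z hz 0%N); rewrite big_ord0.
apply: (@le_trans _ _ (\sum_(k < N) (`|a k| * (k%:R * nc (Hp j k.-1 z)) +
     tpi * rho * (`|a k| * nc (Hp j k z))))).
  apply: ler_sum => k _ /=; rewrite [tpi * rho * _]mulrCA -mulrDr ler_wpM2l //.
  apply: le_trans (ler_ncD _ _) _; rewrite ncN !ncM nc_n nc_rc nc_cj lerD2l ger0_norm //.
  by rewrite mulrA ler_wpM2r ?nc_ge0 // ler_wpM2l.
rewrite big_split /= lerD //; last first.
  by rewrite -mulr_sumr ler_wpM2l ?(mulr_ge0 t0 rho0) //; exact: (hM' z hz N).
case: N => [|N]; first by rewrite big_ord0.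
rewrite big_ord_recl /= mul0r mulr0 add0r; apply: le_trans (hM z hz N).
apply: ler_sum => k _; rewrite /dseq normrM ger0_norm //= mulrA.
by rewrite [`|_| * _]mulrC.
Qed.

(* The part of [\sum_j HE j (b j)] of angular degree [m - n]. *)
Definition angular_part n b m z : cplx R :=
  \sum_(j < n.+1) (if (n <= m + j)%N then rc (b j (m + j - n)%N) * Hp j (m + j - n)%N z else 0).

Lemma big_shift (V : nmodType) (g : nat -> V) n j M : (j <= n)%N ->
  \sum_(m < M) (if (n <= m + j)%N then g (m + j - n)%N else 0) = \sum_(k < M + j - n) g k.
Proof.
move=> jn; elim: M => [|M IH].
  by rewrite big_ord0 (_ : (0 + j - n = 0)%N) ?big_ord0 //; lia.
rewrite big_ord_recr /= IH; case: ifP => h.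
  by rewrite (_ : (M.+1 + j - n = (M + j - n).+1)%N) ?big_ord_recr //; lia.
by rewrite addr0 (_ : (M.+1 + j - n = M + j - n)%N) //; lia.
Qed.

(** The first M angular parts contain, for each j, exactly the terms of index below M + j - n. The
    grouping is thus a truncation of each series and no rearrangement is involved. *)
Lemma sum_angular_part n b M z :
  \sum_(m < M) angular_part n b m z = \sum_(j < n.+1) pH j (b j) (M + j - n) z.
Proof.
rewrite exchange_big /=; apply: eq_bigr => j _.
by rewrite (big_shift (fun k => rc (b j k) * Hp j k z)) // -ltnS.
Qed.

Lemma ccvg_angular n b z : (forall j, entire (b j)) ->
  ccvg (fun M => \sum_(m < M) angular_part n b m z) (\sum_(j < n.+1) HE j (b j) z).
Proof.
move=> eb; under eq_fun do rewrite sum_angular_part.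
have sh j : (j <= n)%N -> (fun M => M + j - n)%N @ \oo --> \oo.
  move=> jn; apply/cvgnyPge => A; near=> M.
  suff : (A + n <= M)%N by lia.
  by near: M; exact: nbhs_infty_ge.
have key N : (N <= n.+1)%N ->
    ccvg (fun M => \sum_(j < N) pH j (b j) (M + j - n) z) (\sum_(j < N) HE j (b j) z).
  elim: N => [|N IH] Nn.
    by under eq_fun do rewrite big_ord0; rewrite big_ord0; exact: ccvg_cst.
  under eq_fun do rewrite big_ord_recr /=; rewrite big_ord_recr /=.
  apply: ccvgD; first exact/IH/ltnW.
  have [h1 h2] := ccvg_pH N z (eb N); split.
    exact: (cvg_comp _ (fun k => re (pH N (b N) k z)) (sh N Nn) h1).
  exact: (cvg_comp _ (fun k => im (pH N (b N) k z)) (sh N Nn) h2).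
exact: key.
Unshelve. all: by end_near. Qed.

(** A bound uniform on a disc and in the number of parts; it supplies the dominating function on the
    support of a cut-off. *)
Lemma angular_le n b (rho : R) : (forall j, entire (b j)) -> 0 <= rho ->
  exists M, forall z, nc z <= rho -> forall N, nc (\sum_(m < N) angular_part n b m z) <= M.
Proof.
move=> eb rho0.
have [M hM] := choice (fun j => pH_le j (eb j) rho0).
exists (\sum_(j < n.+1) M j) => z hz N; rewrite sum_angular_part.
apply: le_trans (ler_nc_sum _ (fun j => pH j (b j) (N + j - n) z)) _.
apply: ler_sum => j _; apply: le_trans (hM j z hz (N + j - n)%N).
apply: le_trans (ler_nc_sum _ (fun k => rc (b j k) * Hp j k z)) _.
by apply: ler_sum => k _; rewrite ncM nc_rc.
Qed.

Lemma pbc_sum I (s : seq I) (f : I -> R * R -> cplx R) : (forall i, pbc (f i)) ->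
  pbc (fun p => \sum_(i <- s) f i p).
Proof.
move=> h; elim: s => [|i s IH].
  by rewrite (_ : (fun p => _) = fun=> 0); [exact: pbc_cst|apply/funext => p; rewrite big_nil].
rewrite (_ : (fun p => _) = fun p => f i p + \sum_(j <- s) f j p); first exact: pbcD.
by apply/funext => p; rewrite big_cons.
Qed.

Lemma pbc_angular n b m : pbc (fun p => angular_part n b m (cpt p)).
Proof.
apply: pbc_sum => j; case: (n <= m + j)%N; last exact: pbc_cst.
by apply: pbcM; [exact: pbc_cst|exact: pbc_Hp].
Qed.

End PartialSums.

(** * Compactly supported radial cut-offs of the Gaussian *)

Section CutoffWeight.
Variable R : realType.
Local Notation tpi := (tpi R).

Lemma is_derive_max_sqr (x : R) : is_derive x 1 (fun x => Num.max 0 x ^+ 2) (2 * Num.max 0 x).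
Proof.
apply: (@is_derive_quad _ _ _ _ _ _ 1) => h _; rewrite /GRing.scale /= mulr1 mul1r.
case: (lerP 0 (h + x)) => a; case: (lerP 0 x) => c.
- by rewrite (_ : _ - _ = h ^+ 2) ?normrX ?real_normK ?num_real //; ring.
- rewrite expr0n mulr0 mulr0 !subr0 ger0_norm ?sqr_ge0 //.
  by rewrite lerXn2r ?nnegrE //; lra.
- rewrite expr0n add0r (_ : _ - _ = - (x ^+ 2 + h * (2 * x))); last by ring.
  rewrite normrN ler_norml; apply/andP; split; nra.
- by rewrite expr0n !mulr0 !subr0 normr0 sqr_ge0.
Qed.

(** The positive part is squared to make the cut-off C^1, as integration by parts requires. The
    cut-offs increase with N to the Gaussian and vanish for s >= N + 1. *)
Definition cut N (s : R) : R := Num.max 0 (1 - N.+1%:R^-1 * s) ^+ 2 * gw s.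

Lemma cut_ge0 N s : 0 <= cut N s.
Proof. by rewrite mulr_ge0 ?sqr_ge0 // ltW // gw_gt0. Qed.

Lemma cut_radial N : exists d, radial_weight (cut N) d.
Proof.
pose c : R := N.+1%:R^-1; pose m (s : R) := Num.max 0 (1 - c * s).
have c0 : 0 <= c by rewrite invr_ge0.
have m01 s : 0 <= s -> 0 <= m s <= 1.
  move=> s0; rewrite /m le_max lexx /= ge_max ler01 /= gerBl mulr_ge0 //.
have cm : continuous m.
  move=> s; apply: (@continuous_max _ _ (fun=> 0) (fun s => 1 - c * s) s); first exact: cvg_cst.
  apply: cvgB; first exact: cvg_cst.
  by apply: cvgM; [exact: cvg_cst|exact: cvg_id].
exists (fun s => 2 * m s * - c * gw s + m s ^+ 2 * (- tpi * gw s)); split.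
- move=> s.
  have h : is_derive s 1 (fun s : R => 1 - c * s) (- c).
    have h0 : is_derive s 1 (fun s : R => c * s) c.
      apply: is_derive_eq (is_deriveZ (c : R) (is_derive_id s 1)) _.
      by rewrite /GRing.scale /= mulr1.
    by apply: is_derive_eq (is_deriveB_fun (is_derive_cst (1 : R) s 1) h0) _; rewrite sub0r.
  have h2 := @is_derive1_comp R (fun x => Num.max 0 x ^+ 2) (fun s => 1 - c * s) s _ _
    (is_derive_max_sqr _) h.
  apply: is_derive_eq (is_deriveM_fun h2 (is_derive_gw s)) _.
  by rewrite /m /=; ring.
- move=> s; apply: cvgD; apply: cvgM.
  + by apply: cvgM; [apply: cvgM; [exact: cvg_cst|exact: cm]|exact: cvg_cst].
  + exact: continuous_gw.
  + by rewrite expr2; under eq_fun do rewrite expr2; apply: cvgM; exact: cm.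
  + by apply: cvgM; [exact: cvg_cst|exact: continuous_gw].
have t0' := ltW (tpi_gt0 R).
exists (2 * c + tpi); first by apply: addr_ge0 => //; exact: mulr_ge0.
move=> s s0; have /andP[m0 m1] := m01 s s0; have g0 := gw_gt0 s; have t0 := tpi_gt0 R.
have m2 : m s ^+ 2 <= 1 by rewrite expr_le1.
split.
  by rewrite ger0_norm ?cut_ge0 // -/(gw s) /cut -/c -/(m s) ler_piMl // ltW.
rewrite -/(gw s) (_ : _ + _ = - ((2 * m s * c + m s ^+ 2 * tpi) * gw s)); last by ring.
rewrite normrN ger0_norm; last first.
  by apply: mulr_ge0; [apply: addr_ge0; apply: mulr_ge0 => //; exact: mulr_ge0|exact: ltW].
rewrite ler_wpM2r ?(ltW g0) //; apply: lerD; last by rewrite ler_piMl.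
by rewrite ler_wpM2r // ler_piMr.
Qed.

Lemma cut_le N s : 0 <= s -> cut N s <= gw s.
Proof.
move=> s0; have [d [_ _ [C _ h]]] := cut_radial N.
by have [] := h s s0; rewrite ger0_norm // cut_ge0.
Qed.

Lemma cut_mono N M s : (N <= M)%N -> 0 <= s -> cut N s <= cut M s.
Proof.
move=> NM s0; rewrite /cut ler_wpM2r ?(ltW (gw_gt0 s)) //.
have p0 (x : R) : 0 <= Num.max 0 x by rewrite le_max lexx.
rewrite lerXn2r ?nnegrE ?p0 //.
rewrite ge_max le_max lexx /= le_max; apply/orP; right; rewrite lerD2l lerN2 ler_wpM2r //.
by rewrite lef_pV2 ?posrE ?ltr0n // ler_nat.
Qed.

Lemma cut_supp N s : N.+1%:R <= s -> cut N s = 0.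
Proof.
move=> h; rewrite /cut (_ : Num.max _ _ = 0) ?expr0n ?mul0r //.
by apply/max_idPl; rewrite subr_le0 ler_pdivlMl ?ltr0n // mulr1.
Qed.

Lemma cut_cvg s : cut N s @[N --> \oo] --> gw s.
Proof.
have h : (1 - N.+1%:R^-1 * s) @[N --> \oo] --> (1 : R).
  rewrite -[X in _ --> X]subr0; apply: cvgB; first exact: cvg_cst.
  rewrite -(mul0r s); apply: cvgM; last exact: cvg_cst.
  exact: cvg_harmonic.
have h2 : Num.max 0 (1 - N.+1%:R^-1 * s) @[N --> \oo] --> (1 : R).
  have cm : {for (1 : R), continuous (fun x : R => Num.max 0 x)}.
    by apply: (@continuous_max _ _ (fun=> 0) id 1); [exact: cvg_cst|exact: cvg_id].
  have := cvg_comp _ _ h cm; rewrite [Num.max 0 1]max_r ?ler01 //; exact.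
rewrite -[X in _ --> X]mul1r; apply: cvgM; last exact: cvg_cst.
have := cvgM h2 h2; rewrite mulr1.
exact.
Qed.

End CutoffWeight.

(** * The Parseval identity with values in [0, +oo] *)

Section Parseval.
Variable R : realType.
Local Notation mu := (@lebesgue_measure R).
Local Notation mu2 := (mu \x mu)%E.
Implicit Types (p : R * R) (F G : R * R -> cplx R).

Lemma cint_sum om dom I (s : seq I) (f : I -> R * R -> cplx R) : radial_weight om dom ->
  (forall i, pbc (f i)) ->
  cint om (fun p => \sum_(i <- s) f i p) = \sum_(i <- s) cint om (f i).
Proof.
move=> hom h; elim: s => [|i s IH].
  rewrite big_nil (cint_eq _ (G := fun=> 0 * 0)); last by move=> p; rewrite big_nil mul0r.
  by rewrite (cintZ hom) ?mul0r //; exact: pbc_cst.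
rewrite big_cons -IH -(cintD hom) //; last exact: pbc_sum.
by apply: cint_eq => p; rewrite big_cons.
Qed.

Variables (n : nat) (b : nat -> nat -> R).
Hypothesis eb : forall j, entire (b j).
Let T m p := angular_part n b m (cpt p).
Let Phi p := \sum_(j < n.+1) HE j (b j) (cpt p).
Let ac m j : R := if (n <= m + j)%N then b j (m + j - n)%N else 0.

Let TE m p : T m p = \sum_(j < n.+1) rc (ac m j) * Hp j (m + j - n) (cpt p).
Proof. by apply: eq_bigr => j _; rewrite /ac; case: ifP => // _; rewrite rc0 mul0r. Qed.

Let cint_TT om dom m l : radial_weight om dom ->
  cint om (fun p => T m p * cj (T l p)) = \sum_(j < n.+1) \sum_(i < n.+1)
    (rc (ac m j) * rc (ac l i)) *
    cint om (fun p => Hp j (m + j - n) (cpt p) * cj (Hp i (l + i - n) (cpt p))).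
Proof.
move=> hom.
have pj j i : pbc (fun p => Hp j (m + j - n) (cpt p) * cj (Hp i (l + i - n) (cpt p))).
  by apply: pbcM; [exact: pbc_Hp|exact/pbc_cj/pbc_Hp].
have pc j i : pbc (fun p => (rc (ac m j) * rc (ac l i)) *
    (Hp j (m + j - n) (cpt p) * cj (Hp i (l + i - n) (cpt p)))).
  by apply: pbcM => //; exact: pbc_cst.
transitivity (cint om (fun p => \sum_(j < n.+1) \sum_(i < n.+1) (rc (ac m j) * rc (ac l i)) *
    (Hp j (m + j - n) (cpt p) * cj (Hp i (l + i - n) (cpt p))))).
  apply: cint_eq => p; rewrite !TE cj_sum mulr_suml; apply: eq_bigr => j _.
  by rewrite mulr_sumr; apply: eq_bigr => i _; rewrite cjM cj_rc mulrACA.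
rewrite (cint_sum _ hom); last by move=> j; apply: pbc_sum => i; exact: pc.
apply: eq_bigr => j _; rewrite (cint_sum _ hom); last by move=> i; exact: pc.
by apply: eq_bigr => i _; rewrite (cintZ hom).
Qed.

(** Only rotation invariance is used, so the statement covers the cut-off weights. *)
Let T_orth om dom m l : radial_weight om dom -> m != l ->
  cint om (fun p => T m p * cj (T l p)) = 0.
Proof.
move=> hom ml; rewrite (cint_TT _ _ hom) big1 // => j _; rewrite big1 // => i _.
rewrite /ac; case: ifP => h1; last by rewrite rc0 !mul0r.
case: ifP => h2; last by rewrite rc0 mulr0 mul0r.
have h : (0 + (m + j - n) + i != 0 + j + (l + i - n))%N.
  by apply: contra ml => /eqP e; apply/eqP; lia.
rewrite -[cint _ _](_ : cint om (fun p => cpt p ^+ 0 * cj (cpt p) ^+ 0 *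
  (Hp j (m + j - n) (cpt p) * cj (Hp i (l + i - n) (cpt p)))) = _).
  by rewrite (angular_orthogonal hom h) mulr0.
by apply: cint_eq => p; rewrite !expr0 !mul1r.
Qed.

(** Inside one angular degree the cross terms vanish by the relations for the Gaussian weight. *)
Let T_norm m : \int[mu2]_p (nc (T m p) ^+ 2 * wt p) =
  \sum_(j < n.+1) ac m j ^+ 2 * hnorm R j (m + j - n).
Proof.
have gr := gw_radial R.
transitivity (re (cint (@gw R) (fun p => T m p * cj (T m p)))).
  by apply: eq_Rintegral => p _; rewrite [T m p * _]mulrC mul_cj re_rc.
rewrite (cint_TT _ _ gr) re_sum; apply: eq_bigr => j _.
rewrite (bigD1 j) //= big1 ?addr0 => [|i ij].
  by rewrite Hp_orthogonal -!rcM re_rc !eqxx !mul1r expr2.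
by rewrite Hp_orthogonal eq_sym [nat_of_ord i == j](negPf ij) !mul0r rc0 mulr0.
Qed.

Let cPhi : continuous (fun p => nc (Phi p) ^+ 2).
Proof.
have [c1 c2] : cCm 0 Phi by apply: cCm_sum => j; exact: cCm_HE.
move=> p; under eq_fun do rewrite sqr_nc !expr2.
by apply: cvgD; apply: cvgM; (exact: c1 || exact: c2).
Qed.

Let gdT om dom M : radial_weight om dom ->
  gd (fun p => nc (\sum_(m < M) T m p) ^+ 2 * om (sq p)).
Proof.
move=> hom; apply: (gd_pbW hom).
have [a c] : pbc (fun p => \sum_(m < M) T m p) by apply: pbc_sum => m; exact: pbc_angular.
by under eq_fun do rewrite sqr_nc !expr2; apply: pbD; exact: pbM.
Qed.

Let gdT1 om dom m : radial_weight om dom -> gd (fun p => nc (T m p) ^+ 2 * om (sq p)).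
Proof.
move=> hom; apply: (gd_pbW hom); have [a c] : pbc (T m) by exact: pbc_angular.
by under eq_fun do rewrite sqr_nc !expr2; apply: pbD; exact: pbM.
Qed.

(** With N fixed, the partial sums are uniformly bounded on the support of the cut-off and the
    weight is 0 outside it, so dominated convergence passes from finite sums to Phi. Nothing is
    assumed about the global integrability of Phi. *)
Let cvg_cutT N : mu2.-integrable setT (EFin \o (fun p => nc (Phi p) ^+ 2 * cut N (sq p))) /\
  (\sum_(m < M) \int[mu2]_p (nc (T m p) ^+ 2 * cut N (sq p))) @[M --> \oo] -->
  \int[mu2]_p (nc (Phi p) ^+ 2 * cut N (sq p)).
Proof.
have [d hd] := cut_radial R N.
have [K hK] := angular_le n eb (ler0n R N.+1).
have K0 : 0 <= K.
  by apply: le_trans (hK 0 _ 0%N); rewrite ?nc0 // big_ord0 nc0.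
have lim p : nc (\sum_(m < M) T m p) ^+ 2 @[M --> \oo] --> nc (Phi p) ^+ 2.
  have [c1 c2] := ccvg_angular n (cpt p) eb.
  under eq_fun do rewrite sqr_nc !expr2; rewrite sqr_nc !expr2.
  by apply: cvgD; apply: cvgM; (exact: c1 || exact: c2).
have [] := @Rintegral_dominated _ _ R mu2
  (fun M p => nc (\sum_(m < M) T m p) ^+ 2 * cut N (sq p))
  (fun p => nc (Phi p) ^+ 2 * cut N (sq p)) (fun p => K ^+ 2 * wt p).
- by move=> M; apply: (@continuous_measurable_prod R); have [] := gdT M hd.
- apply: (@continuous_measurable_prod R) => p; apply: cvgM; first exact: cPhi.
  exact: (continuous_weight hd).
- by move=> p; apply: cvgM; [exact: lim|exact: cvg_cst].
- by apply: gd_integrable; apply: gdZ; exact: gd_wt.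
- move=> M p; rewrite normrM normrX [X in X ^+ 2]ger0_norm ?nc_ge0 //.
  rewrite [`|cut _ _|]ger0_norm ?cut_ge0 //.
  have [h|h] := lerP N.+1%:R (sq p).
    by rewrite cut_supp // mulr0 mulr_ge0 ?sqr_ge0 // ltW // expR_gt0.
  apply: ler_pM; rewrite ?sqr_ge0 ?cut_ge0 //; last exact: cut_le (sq_ge0 p).
  rewrite lerXn2r ?nnegrE ?nc_ge0 //; apply: hK.
  rewrite -(@ler_pXn2r _ 2) ?nnegrE ?nc_ge0 // sqr_nc.
  by apply: le_trans (ltW h) _; rewrite expr2 ler_peMr // ler1n.
move=> i1 i2; split => //.
have e M : \sum_(m < M) \int[mu2]_p (nc (T m p) ^+ 2 * cut N (sq p)) =
   \int[mu2]_p (nc (\sum_(m < M) T m p) ^+ 2 * cut N (sq p)).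
  rewrite (pythagoras hd) // => [m|m l ml]; first exact: pbc_angular.
  exact: (T_orth hd ml).
by under eq_fun do rewrite e.
Qed.

Let cvg_T m : \int[mu2]_p (nc (T m p) ^+ 2 * cut N (sq p)) @[N --> \oo] -->
  \int[mu2]_p (nc (T m p) ^+ 2 * wt p).
Proof.
have [] := @Rintegral_dominated _ _ R mu2
  (fun N p => nc (T m p) ^+ 2 * cut N (sq p))
  (fun p => nc (T m p) ^+ 2 * wt p) (fun p => nc (T m p) ^+ 2 * wt p).
- move=> N; have [d hd] := cut_radial R N.
  by apply: (@continuous_measurable_prod R); have [] := gdT1 m hd.
- by apply: (@continuous_measurable_prod R); have [] := gdT1 m (gw_radial R).
- by move=> p; apply: cvgM; [exact: cvg_cst|exact: cut_cvg].
- exact: (gd_integrable (gdT1 m (gw_radial R))).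
- move=> N p; rewrite ger0_norm; last by apply: mulr_ge0; [exact: sqr_ge0|exact: cut_ge0].
  by rewrite ler_wpM2l ?sqr_ge0 //; exact: cut_le (sq_ge0 p).
by move=> _; exact.
Qed.

Let cut_int N : (\int[mu2]_p (nc (Phi p) ^+ 2 * cut N (sq p))%:E)%E =
  (\int[mu2]_p (nc (Phi p) ^+ 2 * cut N (sq p)))%:E.
Proof.
have [i _] := cvg_cutT N; rewrite /Rintegral fineK //.
exact: (integrable_fin_num measurableT i).
Qed.

Let B m : \bar R := (\int[mu2]_p (nc (T m p) ^+ 2 * wt p))%:E.

Let B_ge0 m : (0 <= B m)%E.
Proof.
by rewrite lee_fin; apply: Rintegral_ge0 => p _; rewrite mulr_ge0 ?sqr_ge0 ?wt_ge0.
Qed.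

(** Upper bound: each cut-off integral is a sum of cut-off norms, at most the full norms. Lower
    bound: a finite sum of full norms is the limit of its cut-off versions, each below the cut-off
    integral of Phi. Monotone convergence removes the cut-off on the left. *)
Let parseval_angular :
  (\int[mu2]_p (nc (Phi p) ^+ 2 * wt p)%:E)%E = (\sum_(0 <= m <oo) B m)%E.
Proof.
pose A N : \bar R := (\int[mu2]_p (nc (Phi p) ^+ 2 * cut N (sq p)))%:E.
have cvA : A @ \oo --> (\int[mu2]_p (nc (Phi p) ^+ 2 * wt p)%:E)%E.
  have h1 N : measurable_fun setT (fun p => (nc (Phi p) ^+ 2 * cut N (sq p))%:E).
    have [d hd] := cut_radial R N; apply/measurable_EFinP.
    apply: (@continuous_measurable_prod R) => p; apply: cvgM; first exact: cPhi.
    exact: (continuous_weight hd).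
  have h2 N p : setT p -> (0 <= (nc (Phi p) ^+ 2 * cut N (sq p))%:E)%E.
    by move=> _; rewrite lee_fin mulr_ge0 ?sqr_ge0 ?cut_ge0.
  have h3 p : setT p -> {homo (fun N => (nc (Phi p) ^+ 2 * cut N (sq p))%:E) :
      N M / (N <= M)%N >-> (N <= M)%E}.
    by move=> _ N M NM; rewrite lee_fin ler_wpM2l ?sqr_ge0 // cut_mono // sq_ge0.
  have := @cvg_monotone_convergence _ _ R mu2 setT measurableT
    (fun N p => (nc (Phi p) ^+ 2 * cut N (sq p))%:E) h1 h2 h3.
  under eq_fun do rewrite cut_int.
  rewrite (_ : (fun x => _) = (fun p => (nc (Phi p) ^+ 2 * wt p)%:E)) //.
  apply/funext => p; apply/cvg_lim => //; apply: cvg_EFin; first exact: nearW.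
  by apply: cvgM; [exact: cvg_cst|exact: cut_cvg].
have Tle N m : \int[mu2]_p (nc (T m p) ^+ 2 * cut N (sq p)) <=
    \int[mu2]_p (nc (T m p) ^+ 2 * wt p).
  have [d hd] := cut_radial R N.
  apply: le_Rintegral => //; try exact: (gd_integrable (gdT1 m _)).
  - exact: (gd_integrable (gdT1 m hd)).
  - exact: (gd_integrable (gdT1 m (gw_radial R))).
  - by move=> p _; rewrite ler_wpM2l ?sqr_ge0 //; exact: cut_le (sq_ge0 p).
have Tge0 N m : 0 <= \int[mu2]_p (nc (T m p) ^+ 2 * cut N (sq p)).
  by apply: Rintegral_ge0 => p _; rewrite mulr_ge0 ?sqr_ge0 ?cut_ge0.
rewrite -(cvg_lim (@ereal_hausdorff R) cvA); apply/eqP; rewrite eq_le; apply/andP; split.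
  apply: lime_le; first by apply/cvg_ex; eexists; exact: cvA.
  apply: nearW => N; have [_ h] := cvg_cutT N.
  have h' : (\sum_(m < M) \int[mu2]_p (nc (T m p) ^+ 2 * cut N (sq p)))%:E @[M --> \oo] --> A N.
    by apply: cvg_EFin; [exact: nearW|exact: h].
  rewrite -(cvg_lim (@ereal_hausdorff R) h'); apply: lime_le.
    by apply/cvg_ex; eexists; exact: h'.
  apply: nearW => M; apply: le_trans (nneseries_lim_ge M _) => //.
  by rewrite big_mkord sumEFin lee_fin; apply: ler_sum => m _; exact: Tle.
apply: lime_le; first exact: is_cvg_nneseries.
apply: nearW => M; rewrite big_mkord sumEFin.
have h : (\sum_(m < M) \int[mu2]_p (nc (T m p) ^+ 2 * cut N (sq p)))%:E @[N --> \oo] -->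
    (\sum_(m < M) \int[mu2]_p (nc (T m p) ^+ 2 * wt p))%:E.
  apply: cvg_EFin; first exact: nearW.
  elim: M => [|M IH]; first by rewrite big_ord0 /comp; under eq_fun do rewrite big_ord0; exact: cvg_cst.
  rewrite big_ord_recr /comp /=; under eq_fun do rewrite big_ord_recr /=.
  by apply: cvgD; [exact: IH|exact: cvg_T].
rewrite -(cvg_lim (@ereal_hausdorff R) h); apply: lee_lim.
- by apply/cvg_ex; eexists; exact: h.
- by apply/cvg_ex; eexists; exact: cvA.
apply: nearW => N; have [_ hN] := cvg_cutT N; rewrite lee_fin.
rewrite -(cvg_lim (@Rhausdorff R) hN).
apply: nondecreasing_cvgn_le; last by apply/cvg_ex; eexists; exact: hN.
apply/nondecreasing_seqP => k; rewrite big_ord_recr /= lerDl.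
exact: Tge0.
Qed.

Lemma nneseries_shift (g : nat -> R) j : (j <= n)%N -> (forall k, 0 <= g k) ->
  (\sum_(0 <= m <oo) (if (n <= m + j)%N then g (m + j - n)%N else 0)%:E =
   \sum_(0 <= k <oo) (g k)%:E)%E.
Proof.
move=> jn g0.
have sh : (fun M => M + j - n)%N @ \oo --> \oo.
  apply/cvgnyPge => A; near=> M.
  suff : (A + n <= M)%N by lia.
  by near: M; exact: nbhs_infty_ge.
have /cvg_ex[l hl] := @is_cvg_nneseries R (fun k => (g k)%:E) xpredT 0 (fun k _ _ => g0 k).
rewrite (cvg_lim (@ereal_hausdorff R) hl); apply/cvg_lim => //.
have := cvg_comp _ _ sh hl.
rewrite (_ : _ \o _ = fun M => (\sum_(0 <= m < M) (if (n <= m + j)%N then g (m + j - n)%N else 0)%:E)%E) //.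
by apply/funext => M /=; rewrite !sumEFin !big_mkord big_shift.
Unshelve. all: by end_near. Qed.

Theorem HE_parseval : (\int[mu2]_p (nc (Phi p) ^+ 2 * wt p)%:E)%E =
  (\sum_(j < n.+1) \sum_(0 <= k <oo) (b j k ^+ 2 * hnorm R j k)%:E)%E.
Proof.
rewrite parseval_angular.
under eq_eseriesr do rewrite /B T_norm -sumEFin.
rewrite nneseries_sum; last first.
  by move=> j k _; rewrite lee_fin mulr_ge0 ?sqr_ge0 // ltW // hnorm_gt0.
apply: eq_bigr => j _.
have jn : (j <= n)%N by rewrite -ltnS.
have g0 k : 0 <= b j k ^+ 2 * hnorm R j k by rewrite mulr_ge0 ?sqr_ge0 // ltW // hnorm_gt0.
rewrite -(nneseries_shift jn g0).
by apply: eq_eseriesr => m _; rewrite /ac; case: ifP => // _; rewrite expr0n mul0r.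
Qed.

End Parseval.

(** * Quaternions *)

Section QuaternionNorm.
Variable R : realType.
Implicit Types (q I : quat R) (c : nat).

(** Components are indexed by natural numbers so that statements can be uniform in c. Every c >= 3
    reads the last component, which is why the bound c < 4 appears with [of_qc]. *)
Definition qc c q : R :=
  match c with 0 => qre q | 1 => qim_i q | 2 => qim_j q | _ => qim_k q end.

Lemma qcP q q' : (forall c, qc c q = qc c q') -> q = q'.
Proof.
by move=> h; apply: quat_ext; [exact: (h 0%N)|exact: (h 1%N)|exact: (h 2%N)|exact: (h 3%N)].
Qed.

Lemma qcD c q q' : qc c (q + q') = qc c q + qc c q'.
Proof. by case: c => [|[|[|c]]]. Qed.
Lemma qcN c q : qc c (- q) = - qc c q.
Proof. by case: c => [|[|[|c]]]. Qed.
Lemma qcZ c (a : R) q : qc c (a *: q) = a * qc c q.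
Proof. by case: c => [|[|[|c]]]. Qed.

Definition of_qc (f : nat -> R) : quat R := Quat (f 0%N) (f 1%N) (f 2%N) (f 3%N).

Lemma sum4 (V : nmodType) (f : nat -> V) : \sum_(c < 4) f c = f 0%N + f 1%N + f 2%N + f 3%N.
Proof. by rewrite !big_ord_recl big_ord0 /= /bump /= addr0 !addrA. Qed.

Definition qbasis d : quat R := of_qc (fun c => (c == d)%:R).

(** Left multiplication as a real matrix acting on the components of the right factor; real limits,
    derivatives and integrals then pass through it. *)
Lemma qc_mull c q q' : qc c (q * q') = \sum_(d < 4) qc c (q * qbasis d) * qc d q'.
Proof.
rewrite (sum4 (fun d => qc c (q * qbasis d) * qc d q')).
by case: q q' => ? ? ? ? [? ? ? ?]; case: c => [|[|[|c]]] /=; ring.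
Qed.

Lemma sqr_qabs q : qabs q ^+ 2 = qre q ^+ 2 + qim_i q ^+ 2 + qim_j q ^+ 2 + qim_k q ^+ 2.
Proof. by rewrite sqr_sqrtr // !addr_ge0 ?sqr_ge0. Qed.

Lemma qre_conjM q : qre (qconj q * q) = qabs q ^+ 2.
Proof. by rewrite sqr_qabs /=; ring. Qed.

(** A nonzero real part would force the imaginary components to vanish, leaving a real number of
    square -1. *)
Lemma imag_unitP I : imag_unit I -> qre I = 0 /\ qim_i I ^+ 2 + qim_j I ^+ 2 + qim_k I ^+ 2 = 1.
Proof.
case: I => a b c d; rewrite /imag_unit expr2 => -[/= h1 h2 h3 h4].
have [a0|a0] := eqVneq a 0; first by split => //; rewrite a0 in h1; lra.
have z (x : R) : a * x = 0 -> x = 0 by move=> /eqP; rewrite mulf_eq0 (negPf a0) => /eqP.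
have eb : b = 0 by apply: z; lra.
have ec : c = 0 by apply: z; lra.
have ed : d = 0 by apply: z; lra.
by move: h1; rewrite eb ec ed; have := sqr_ge0 a; rewrite expr2; lra.
Qed.

Lemma sqr_qabs_slice_point I p : imag_unit I -> qabs (slice_point I p) ^+ 2 = sq p.
Proof.
move=> /imag_unitP[]; rewrite sqr_qabs /sq /=; case: I => a b c d /= -> h.
rewrite !mulr0 !mulr1 !add0r addr0 -[X in _ = _ + X]mulr1 -h; ring.
Qed.

Lemma qabs_parallelogram I q q' : imag_unit I ->
  qabs (q + I * q') ^+ 2 + qabs (q - I * q') ^+ 2 =
  \sum_(c < 4) 2 * nc (Cpx (qc c q) (qc c q')) ^+ 2.
Proof.
move=> /imag_unitP[]; rewrite !sqr_qabs (sum4 (fun c => 2 * nc (Cpx (qc c q) (qc c q')) ^+ 2)) !sqr_nc /=.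
case: I q q' => a b c d [q0 q1 q2 q3] [r0 r1 r2 r3] /= -> h.
transitivity (2 * (q0 ^+ 2 + q1 ^+ 2 + q2 ^+ 2 + q3 ^+ 2) +
  2 * ((b ^+ 2 + c ^+ 2 + d ^+ 2) * (r0 ^+ 2 + r1 ^+ 2 + r2 ^+ 2 + r3 ^+ 2))); first by ring.
by rewrite h; ring.
Qed.

End QuaternionNorm.

(** * The norm on a slice as a sum of four complex norms *)

Section SliceNorm.
Variable R : realType.
Local Notation mu := (@lebesgue_measure R).
Local Notation mu2 := (mu \x mu)%E.
Implicit Types (I : quat R) (p : R * R).

Lemma integral_reflect (f : R -> \bar R) : measurable_fun setT f -> (forall x, (0 <= f x)%E) ->
  (\int[mu]_x f (- x)%R = \int[mu]_x f x)%E.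
Proof.
move=> mf f0.
have e := @ge0_integral_pushforward _ _ (measurableTypeR R) (measurableTypeR R) R
  (-%R : measurableTypeR R -> measurableTypeR R) (@oppr_measurable R setT) mu setT f measurableT mf (fun x _ => f0 x).
rewrite preimage_setT in e; transitivity (\int[pushforward mu (-%R : measurableTypeR R -> measurableTypeR R)]_x f x)%E.
  by rewrite e.
by apply: eq_measure_integral => A mA _; exact: lebesgue_measureN.
Qed.

Lemma integral_plane_reflect (f : R * R -> R) : continuous f -> (forall p, 0 <= f p) ->
  (\int[mu2]_p (f (p.1, - p.2))%:E = \int[mu2]_p (f p)%:E)%E.
Proof.
move=> cf f0.
have cr : continuous (fun p : R * R => f (p.1, - p.2)).
  move=> p; apply: (@continuous_comp _ _ _ (fun p : R * R => (p.1, - p.2)) f); last exact: cf.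
  apply: (@continuous_cpt_of _ _ (fun p => Cpx p.1 (- p.2))); split => /= q.
    exact: cvg_fst.
  by apply: cvgN; exact: cvg_snd.
have mE (g : R * R -> R) : continuous g -> measurable_fun setT
    (fun p : measurableTypeR R * measurableTypeR R => (g p)%:E).
  by move=> cg; apply/measurable_EFinP; exact: (@continuous_measurable_prod R).
have r0 p : (0 <= (f (p.1, - p.2))%:E)%E by rewrite lee_fin.
have p0 p : (0 <= (f p)%:E)%E by rewrite lee_fin.
have e1 := @fubini_tonelli1 _ _ (measurableTypeR R) (measurableTypeR R) R mu mu _ (mE _ cr) r0.
have e2 := @fubini_tonelli1 _ _ (measurableTypeR R) (measurableTypeR R) R mu mu _ (mE _ cf) p0.
rewrite e1 e2.
apply: eq_integral => x _; rewrite /fubini_F /=.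
apply: (@integral_reflect (fun y => (f (x, y))%:E)) => [|y]; last by rewrite lee_fin.
by apply/measurable_EFinP; apply: continuous_measurable_fun; exact: continuous_slice2.
Qed.

(** Needed because the norm integrals may be +oo, where one cannot cancel by subtraction. *)
Lemma ereal_double_inj (x y : \bar R) : (0 <= x)%E -> (0 <= y)%E -> (x + x = y + y)%E -> x = y.
Proof.
case: x y => [x| |] [y| |] //= _ _; rewrite -?EFinD //.
by move=> [h]; congr EFin; lra.
Qed.

(* The cross terms are odd in [y], so that the four components decouple. *)
Lemma slice_norm_integral I (al be : R * R -> quat R) : imag_unit I ->
  (forall c, continuous (fun p => qc c (al p))) ->
  (forall c, continuous (fun p => qc c (be p))) ->
  (forall x y, al (x, - y) = al (x, y)) -> (forall x y, be (x, - y) = - be (x, y)) ->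
  (\int[mu2]_p (qabs (al p + I * be p) ^+ 2 * wt p)%:E =
   \sum_(c < 4) \int[mu2]_p (nc (Cpx (qc c (al p)) (qc c (be p))) ^+ 2 * wt p)%:E)%E.
Proof.
move=> hI ca cb ea ob.
pose N p := qabs (al p + I * be p) ^+ 2 * wt p.
pose S c p := nc (Cpx (qc c (al p)) (qc c (be p))) ^+ 2 * wt p.
have S0 c p : 0 <= S c p by rewrite mulr_ge0 ?sqr_ge0 ?wt_ge0.
have N0 p : 0 <= N p by rewrite mulr_ge0 ?sqr_ge0 ?wt_ge0.
have cmul (u v : R * R -> R) : continuous u -> continuous v -> continuous (fun p => u p * v p).
  by move=> cu cv p; apply: cvgM; [exact: cu|exact: cv].
have cadd (u v : R * R -> R) : continuous u -> continuous v -> continuous (fun p => u p + v p).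
  by move=> cu cv p; apply: cvgD; [exact: cu|exact: cv].
have ccst (x : R) : continuous (fun _ : R * R => x) by move=> p; exact: cvg_cst.
have cS c : continuous (S c).
  refine (cmul _ _ _ (@continuous_wt R)); under eq_fun do rewrite sqr_nc /= !expr2.
  by refine (cadd _ _ (cmul _ _ (ca c) (ca c)) (cmul _ _ (cb c) (cb c))).
pose M c d := qc c (I * qbasis R d).
have cZ c d : continuous (fun p => M c d * qc d (be p)) by refine (cmul _ _ (ccst _) (cb d)).
have cq c : continuous (fun p => qc c (al p + I * be p)).
  rewrite (_ : (fun p => _) = fun p => qc c (al p) + (((M c 0%N * qc 0 (be p) + M c 1%N * qc 1 (be p)) +
    M c 2%N * qc 2 (be p)) + M c 3%N * qc 3 (be p))); last first.
    by apply/funext => p; rewrite qcD qc_mull (sum4 (fun d => M c d * qc d (be p))).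
  exact: (cadd _ _ (ca c) (cadd _ _ (cadd _ _ (cadd _ _ (cZ c 0%N) (cZ c 1%N)) (cZ c 2%N)) (cZ c 3%N))).
have cN : continuous N.
  pose s c p := qc c (al p + I * be p) * qc c (al p + I * be p).
  have cs c : continuous (s c) by exact: (cmul _ _ (cq c) (cq c)).
  rewrite (_ : N = fun p => (((s 0%N p + s 1%N p) + s 2%N p) + s 3%N p) * wt p); last first.
    by apply/funext => p; rewrite /N sqr_qabs !expr2.
  exact: (cmul _ _ (cadd _ _ (cadd _ _ (cadd _ _ (cs 0%N) (cs 1%N)) (cs 2%N)) (cs 3%N)) (@continuous_wt R)).
have cNr : continuous (fun p => N (p.1, - p.2)).
  move=> p; apply: (@continuous_comp _ _ _ (fun p : R * R => (p.1, - p.2)) N); last exact: cN.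
  apply: (@continuous_cpt_of _ _ (fun p => Cpx p.1 (- p.2))); split => /= q.
    exact: cvg_fst.
  by apply: cvgN; exact: cvg_snd.
have mS c : measurable_fun setT (fun p : measurableTypeR R * measurableTypeR R => (S c p)%:E).
  by apply/measurable_EFinP; exact: (@continuous_measurable_prod R).
have mN : measurable_fun setT (fun p : measurableTypeR R * measurableTypeR R => (N p)%:E).
  by apply/measurable_EFinP; exact: (@continuous_measurable_prod R).
have mNr : measurable_fun setT (fun p : measurableTypeR R * measurableTypeR R => (N (p.1, - p.2))%:E).
  by apply/measurable_EFinP; exact: (@continuous_measurable_prod R).
(* Doubling and reflecting one copy in y turns I into -I in the integrand; the parallelogram
   identity then removes the cross terms pointwise, so they never have to be integrated. *)
apply: ereal_double_inj.
- by apply: integral_ge0 => p _; rewrite lee_fin; (exact: N0 || exact: S0).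
- by apply: sume_ge0 => c _; apply: integral_ge0 => p _; rewrite lee_fin; (exact: N0 || exact: S0).
rewrite -{2}(integral_plane_reflect cN N0) -ge0_integralD //=; last 2 first.
- by move=> p _; rewrite lee_fin; (exact: N0 || exact: S0).
- by move=> p _; rewrite lee_fin; (exact: N0 || exact: S0).
rewrite -ge0_integral_sum //; [|by move=> c; exact: mS|by move=> c p _; rewrite lee_fin; exact: S0].
rewrite -ge0_integralD //=; last 4 first.
- by move=> p _; apply: sume_ge0 => c _; rewrite lee_fin; (exact: N0 || exact: S0).
- by apply: emeasurable_sum => c; exact: mS.
- by move=> p _; apply: sume_ge0 => c _; rewrite lee_fin; (exact: N0 || exact: S0).
- by apply: emeasurable_sum => c; exact: mS.
apply: eq_integral => -[x y] _; rewrite !sumEFin -!EFinD; congr EFin.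
rewrite /N ea ob mulrN /wt (_ : sq (x, - y) = sq (x, y)); last by rewrite /sq /= sqrrN.
rewrite -mulrDl qabs_parallelogram // mulr_suml -big_split /=; apply: eq_bigr => c _.
by rewrite /S /wt; ring.
Qed.

End SliceNorm.

(** * Hermite functions on the line *)

Section GeneratingFunction.
Variable R : realType.
Local Notation cder := (@cderv R R 1).
Implicit Types (A B : R) (z w : cplx R) (a : nat -> R).

Definition cexp z : cplx R := Cpx (expR (re z) * cos (im z)) (expR (re z) * sin (im z)).

Lemma cexpD z w : cexp (z + w) = cexp z * cexp w.
Proof.
by apply: cE; rewrite ?(reM, imM) /cexp /= reD imD expRD (cosD, sinD); ring.
Qed.
Lemma cexp0 : cexp 0 = 1.
Proof. by apply: cE; rewrite /= expR0 (cos0, sin0) ?mulr1 ?mulr0. Qed.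
Lemma cexp_rc (x : R) : cexp (rc x) = rc (expR x).
Proof. by apply: cE; rewrite /= (cos0, sin0) ?mulr1 ?mulr0. Qed.

Lemma cder_cexp (w : R -> cplx R) t l : cder w t l -> cder (fun t => cexp (w t)) t (cexp (w t) * l).
Proof.
move=> [h1 h2].
have e := @is_derive1_comp R expR (fun t => re (w t)) t _ _ (is_derive_expR _) h1.
have c := @is_derive1_comp R cos (fun t => im (w t)) t _ _ (is_derive_cos _) h2.
have s := @is_derive1_comp R sin (fun t => im (w t)) t _ _ (is_derive_sin _) h2.
split; first by apply: is_derive_eq (is_deriveM_fun e c) _; rewrite reM /cexp /=; ring.
by apply: is_derive_eq (is_deriveM_fun e s) _; rewrite imM /cexp /=; ring.
Qed.

Lemma cder_esum a (z : R -> cplx R) t l : entire a -> cder z t l ->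
  cder (fun t => esum a (z t)) t (esum (dseq a) (z t) * l).
Proof.
move=> ea hz.
have := cder_holo (cCm_esum 1 ea) (fun p => dbar_esum p ea) hz.
rewrite (_ : (fun t => esum a (cpt (re (z t), im (z t)))) = (fun t => esum a (z t))); last first.
  by apply/funext => x; rewrite cptE.
move=> h; apply: cder_eq h _; congr (_ * _).
have v1 : nc (cpt ((1, 0) : R * R)) <= 1 by rewrite nc1.
set p := (re (z t), im (z t)).
have [_ d1] := is_derive_U p ea v1; have [_ d2] := is_derive_V p ea v1.
have e : cpt ((1, 0) : R * R) = 1 by [].
by rewrite -[z t]cptE -/p; apply: cE => /=; rewrite (d1, d2) e mulr1.
Qed.

(* The coefficients of [exp (A z + B z^2)], paired with their shift. *)
Fixpoint gen_pair A B k : R * R :=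
  if k is k'.+1 then ((A * (gen_pair A B k').1 + 2 * B * (gen_pair A B k').2) / k'.+1%:R,
    (gen_pair A B k').1) else (1, 0).
Definition gen A B k : R := (gen_pair A B k).1.
Definition genm A B k : R := (gen_pair A B k).2.

(** The coefficientwise form of E' = (A + 2 B z) E for E = exp(A z + B z^2). *)
Lemma genS A B k : k.+1%:R * gen A B k.+1 = A * gen A B k + 2 * B * genm A B k.
Proof. by rewrite /gen /= mulrC divfK // pnatr_eq0. Qed.
Lemma genmS A B k : genm A B k.+1 = gen A B k. Proof. by []. Qed.

Lemma gen_ge0 A B k : 0 <= A -> 0 <= B -> 0 <= gen A B k /\ 0 <= genm A B k.
Proof.
move=> A0 B0; elim: k => [|k [h1 h2]]; first by split; rewrite /gen /genm /= ?ler01.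
by split; rewrite ?genmS // /gen /= divr_ge0 // addr_ge0 ?mulr_ge0.
Qed.

Lemma ler_norm_gen A B k : `|gen A B k| <= gen `|A| `|B| k /\ `|genm A B k| <= genm `|A| `|B| k.
Proof.
elim: k => [|k [h1 h2]]; first by split; rewrite /gen /genm /= ?normr1 ?normr0.
split; rewrite ?genmS // /gen /= normrM normfV normr_nat ler_wpM2r ?invr_ge0 //.
apply: le_trans (ler_normD _ _) _; rewrite !normrM normr_nat.
by apply: lerD; rewrite ler_wpM2l ?mulr_ge0.
Qed.

(** At radius rho the scaled terms satisfy (k + 1) x_(k+1) <= D max(x_k, x_(k-1)), so they stop
    growing once k + 1 > D. *)
Lemma entire_gen A B : entire (gen A B) /\ entire (genm A B).
Proof.
suff h rho : 0 <= rho -> exists C, forall k, `|gen A B k| * rho ^+ k <= C.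
  split => rho rho0; first exact: h.
  have [C hC] := h rho rho0; exists (`|C| * (1 + rho)) => -[|k].
    by rewrite /genm /= normr0 mul0r mulr_ge0 // addr_ge0.
  rewrite genmS exprS mulrCA mulrC ler_pM ?mulr_ge0 ?exprn_ge0 //.
    exact: le_trans (hC k) (ler_norm _).
  by rewrite lerDr.
move=> rho0; pose x k : R := `|gen A B k| * rho ^+ k.
pose y k : R := `|genm A B k| * rho ^+ k.-1.
have x0 k : 0 <= x k by rewrite mulr_ge0 ?exprn_ge0.
have y0 k : 0 <= y k by rewrite mulr_ge0 ?exprn_ge0.
pose D := `|A| * rho + 2 * `|B| * rho ^+ 2.
have D0 : 0 <= D by rewrite addr_ge0 ?mulr_ge0 ?exprn_ge0.
have step k : k.+1%:R * x k.+1 <= D * Num.max (x k) (y k).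
  rewrite /x mulrA -[X in X * `|_|]normr_nat -normrM genS.
  apply: (@le_trans _ _ ((`|A| * `|gen A B k| + 2 * `|B| * `|genm A B k|) * rho ^+ k.+1)).
    rewrite ler_wpM2r ?exprn_ge0 //; apply: le_trans (ler_normD _ _) _.
    by rewrite !normrM normr_nat.
  have -> : (`|A| * `|gen A B k| + 2 * `|B| * `|genm A B k|) * rho ^+ k.+1 =
     `|A| * rho * x k + 2 * `|B| * rho ^+ 2 * y k.
    rewrite /x /y; case: k => [|k] /=; last by rewrite !exprS; ring.
    by rewrite /genm /= normr0 expr0 expr1; ring.
  rewrite /D [leRHS]mulrDl; apply: lerD; rewrite ler_wpM2l ?mulr_ge0 ?exprn_ge0 ?le_max ?lexx ?orbT //.
have [K hK] : exists K : nat, D <= K%:R.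
  by exists (Num.bound D); apply/ltW; have := archi_boundP D0.
suff [C hC] : exists C, forall k, x k <= C /\ y k <= C by exists C => k; have [] := hC k.
(* The sum bounds each of the first K + 1 terms; from there on the recursion no longer increases the
   bound. *)
exists (\sum_(i < K.+1) x i) => k.
have C0 : 0 <= \sum_(i < K.+1) x i by apply: sumr_ge0.
elim: k => [|k [h1 h2]].
  split; last by rewrite /y /genm /= normr0 mul0r.
  by rewrite big_ord_recl lerDl sumr_ge0.
split; last by rewrite /y genmS.
have [kK|Kk] := leqP k.+1 K.
  rewrite (bigD1 (Ordinal (kK : (k.+1 < K.+1)%N))) //= lerDl; exact: sumr_ge0.
have k1 : (0 : R) < k.+1%:R by rewrite ltr0n.
rewrite -(ler_pM2l k1); apply: le_trans (step k) _.
apply: ler_pM => //; first by rewrite le_max x0.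
  by apply: le_trans hK _; rewrite ler_nat ltnW.
by rewrite ge_max h1 h2.
Qed.

Lemma esum_genm A B z : esum (genm A B) z = z * esum (gen A B) z.
Proof.
have [e1 e2] := entire_gen A B.
apply: (ccvg_unique (u := fun N => psum (genm A B) z N.+1)).
  exact: (@ccvgS R (psum (genm A B) z) _ (esum_cvg z e2)).
have -> : (fun N => psum (genm A B) z N.+1) = (fun N => z * psum (gen A B) z N).
  apply/funext => N; rewrite /psum big_ord_recl /= rc0 mul0r add0r mulr_sumr.
  by apply: eq_bigr => k _; rewrite /= /bump /= add1n genmS exprS; ring.
exact: (ccvgM (ccvg_cst _) (esum_cvg z e1)).
Qed.

(** Along the ray t z, the product of the series with exp(-w(t)) has derivative 0 by [genS], and it
    equals 1 at t = 0. *)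
Lemma esum_gen A B z : esum (gen A B) z = cexp (rc A * z + rc B * z ^+ 2).
Proof.
have [e1 e2] := entire_gen A B.
pose w t := rc A * (rc t * z) + rc B * (rc t * z) ^+ 2.
have dz t : cder (fun t => rc t * z) t z.
  by apply: cder_eq (cderM (cder_rc t) (cder_cst _ z t)) _; ring.
have dE t := cder_esum e1 (dz t).
have dw t : cder (fun t => - 1 * w t) t (- (rc A * z + rc B * (2 * (rc t * z) * z))).
  apply: cder_eq (cderZ _ (cderD (cderZ _ (dz t)) (cderZ _ (cderX 2 (dz t))))) _.
  by rewrite -[2.-1]/1%N; ring.
have d0 t : cder (fun t => esum (gen A B) (rc t * z) * cexp (- 1 * w t)) t 0.
  apply: cder_eq (cderM (dE t) (cder_cexp (dw t))) _.
  have -> : dseq (gen A B) = (fun k => A * gen A B k + (2 * B) * genm A B k).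
    by apply/funext => k; rewrite /dseq genS.
  rewrite esumD; [|exact: entire_scale|exact: entire_scale].
  rewrite !esumZ // esum_genm rcM rcn; ring.
have := cder0_cst d0 1 0; rewrite -[rc 1]/(1 : cplx R) rc0 mul1r mul0r.
have -> : esum (gen A B) 0 = 1.
  apply: (ccvg_unique (u := fun N => psum (gen A B) 0 N.+1)).
    exact: (@ccvgS R (psum (gen A B) 0) _ (esum_cvg 0 e1)).
  have -> : (fun N => psum (gen A B) 0 N.+1) = (fun=> 1).
    apply/funext => N; rewrite /psum big_ord_recl big1 => [|k _]; last by rewrite exprS mul0r mulr0.
    by rewrite expr0 mulr1 addr0.
  exact: ccvg_cst.
have w0 : w 0 = 0 by rewrite /w rc0 mul0r expr0n !mulr0 addr0.
have w1 : w 1 = rc A * z + rc B * z ^+ 2 by rewrite /w -[rc 1]/(1 : cplx R) mul1r.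
rewrite w0 w1 mulr0 cexp0 mulr1 => h.
set W := rc A * z + _ in h *.
have c1 : cexp (-1 * W) * cexp W = 1 by rewrite -cexpD (_ : -1 * W + W = 0) ?cexp0 //; ring.
by rewrite -[LHS]mulr1 -c1 mulrA h mul1r.
Qed.

Lemma sum_gen_le A B (r : R) N : 0 <= A -> 0 <= B -> 0 <= r ->
  \sum_(k < N) gen A B k * r ^+ k <= expR (A * r + B * r ^+ 2).
Proof.
move=> A0 B0 r0; have [e1 _] := entire_gen A B.
have [h _] := esum_cvg (rc r) e1.
have e M : re (psum (gen A B) (rc r) M) = \sum_(k < M) gen A B k * r ^+ k.
  by rewrite /psum re_sum; apply: eq_bigr => k _; rewrite -rcX -rcM.
rewrite esum_gen -rcX -!rcM -rcD cexp_rc re_rc in h.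
have {}h : (fun M => \sum_(k < M) gen A B k * r ^+ k) @ \oo --> expR (A * r + B * r ^+ 2).
  by under eq_fun do rewrite -e.
rewrite -(cvg_lim (@Rhausdorff R) h).
apply: (@nondecreasing_cvgn_le _ (fun M => \sum_(k < M) gen A B k * r ^+ k)).
  apply/nondecreasing_seqP => k; rewrite big_ord_recr /= lerDl mulr_ge0 ?exprn_ge0 //.
  by have [] := gen_ge0 k A0 B0.
by apply/cvg_ex; eexists; exact: h.
Qed.

End GeneratingFunction.

Section HermiteFunctions.
Variable R : realType.
Local Notation mu := (@lebesgue_measure R).
Local Notation tpi := (tpi R).
Implicit Types (t r : R) (z : cplx R).

Definition ksl : R := 2 * pi * Num.sqrt 2.
Definition kc : R := 2 `^ (3 / 4).

(** The coefficient of z^k in the Bargmann kernel [bkernel t z]: a Hermite function, not normalized.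
    [kapm] is the same sequence shifted by one index, and [kapG] dominates the sums of |kap k t|
    r^k. *)
Definition kap k t : R := kc * expR (- pi * t ^+ 2) * gen (ksl * t) (- pi) k.
Definition kapm k t : R := kc * expR (- pi * t ^+ 2) * genm (ksl * t) (- pi) k.
Definition kapG r t : R := kc * expR (- pi * t ^+ 2 + ksl * `|t| * r + pi * r ^+ 2).

Definition bkernel t z : cplx R :=
  rc kc * cexp (- rc pi * (z ^+ 2 + rc t ^+ 2) + rc (ksl * t) * z).

Lemma kc_gt0 : 0 < kc. Proof. exact: powR_gt0. Qed.
Lemma kc4 : kc ^+ 2 = 2 * Num.sqrt 2.
Proof.
rewrite /kc -powR_mulrn ?powR_ge0 // -powRrM (_ : 3 / 4 * 2 = 1 + 2^-1 :> R); last by field.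
by rewrite powRD ?pnatr_eq0 ?implybT // powRr1 // powR12_sqrt.
Qed.
Lemma ksl_ge0 : 0 <= ksl.
Proof. by rewrite !mulr_ge0 ?sqrtr_ge0 // pi_ge0. Qed.

Lemma psum_kap z t N :
  \sum_(k < N) rc (kap k t) * z ^+ k = rc (kc * expR (- pi * t ^+ 2)) * psum (gen (ksl * t) (- pi)) z N.
Proof. by rewrite mulr_sumr; apply: eq_bigr => k _; rewrite /kap rcM mulrA. Qed.

Lemma ccvg_kap z t : ccvg (fun N => \sum_(k < N) rc (kap k t) * z ^+ k) (bkernel t z).
Proof.
have [e _] := entire_gen (ksl * t) (- pi).
have := ccvgM (ccvg_cst (rc (kc * expR (- pi * t ^+ 2)))) (esum_cvg z e).
rewrite esum_gen rcM -cexp_rc -mulrA -cexpD.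
rewrite (_ : rc (- pi * t ^+ 2) + _ = - rc pi * (z ^+ 2 + rc t ^+ 2) + rc (ksl * t) * z); last first.
  by rewrite !rcM rcN; ring.
by move=> h; under eq_fun do rewrite psum_kap rcM -cexp_rc.
Qed.

Lemma sum_kap_le t r N : 0 <= r -> \sum_(k < N) `|kap k t| * r ^+ k <= kapG r t.
Proof.
move=> r0; have p0 := pi_ge0 R.
have h := @sum_gen_le R (ksl * `|t|) pi r N (mulr_ge0 ksl_ge0 (normr_ge0 _)) p0 r0.
have c0 : 0 <= kc * expR (- pi * t ^+ 2) by rewrite mulr_ge0 ?expR_ge0 // ltW // kc_gt0.
rewrite /kapG -addrA expRD mulrA; apply: le_trans (ler_wpM2l c0 h).
rewrite mulr_sumr; apply: ler_sum => k _; rewrite /kap normrM ger0_norm // -mulrA ler_wpM2l //.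
rewrite ler_wpM2r ?exprn_ge0 //; have [h1 _] := ler_norm_gen (ksl * t) (- pi) k.
by move: h1; rewrite normrM normrN (ger0_norm p0) (ger0_norm ksl_ge0).
Qed.

Lemma kap_le k t : `|kap k t| <= kapG 1 t.
Proof.
apply: le_trans (sum_kap_le t k.+1 ler01); rewrite big_ord_recr /= expr1n mulr1 lerDr.
by apply: sumr_ge0 => i _; rewrite mulr_ge0 ?exprn_ge0.
Qed.

Lemma kapG_ge0 r t : 0 <= kapG r t.
Proof. by rewrite mulr_ge0 ?expR_ge0 // ltW // kc_gt0. Qed.

Lemma kapm0 t : kapm 0 t = 0. Proof. by rewrite /kapm /genm /= mulr0. Qed.
Lemma kapmS k t : kapm k.+1 t = kap k t. Proof. by []. Qed.

Lemma kapm_le k t : `|kapm k t| <= kapG 1 t.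
Proof. by case: k => [|k]; rewrite ?kapm0 ?normr0 ?kapG_ge0 ?kapmS ?kap_le. Qed.

(** In the exponent of the square, 2 ksl r |t| <= (ksl r)^2 + t^2, and -2 pi + 1 <= -1. *)
Lemma kapG_gauss r : exists C, forall t, kapG r t ^+ 2 <= C * expR (- t ^+ 2).
Proof.
exists (kc ^+ 2 * expR ((ksl * r) ^+ 2 + 2 * pi * r ^+ 2)) => t.
rewrite /kapG exprMn -[leRHS]mulrA -expRD ler_wpM2l ?sqr_ge0 // -expRM_natr ler_expR.
have pi1 : 1 <= pi :> R by apply: le_trans (pi_ge2 R); rewrite ler1n.
have := sqr_ge0 (ksl * r - `|t|); have := sqr_ge0 t; rewrite -[t ^+ 2]real_normK ?num_real //.
have := pi1; move: (ksl) (pi) `|t| => a p u p1 u0 h; nra.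
Qed.

(** Differentiating the generating function in t multiplies it by ksl z, which shifts the
    coefficients. The recursion involves two consecutive coefficients, so two consecutive statements
    are carried in the induction. *)
Lemma is_derive_gen k t :
  is_derive t 1 (fun t => gen (ksl * t) (- pi) k) (ksl * genm (ksl * t) (- pi) k).
Proof.
have dk : is_derive t 1 (fun t : R => ksl * t) ksl.
  apply: is_derive_eq (is_deriveZ (ksl : R) (is_derive_id t 1)) _.
  by rewrite /GRing.scale /= mulr1.
suff h j : is_derive t 1 (fun t => gen (ksl * t) (- pi) j) (ksl * genm (ksl * t) (- pi) j) /\
    is_derive t 1 (fun t => gen (ksl * t) (- pi) j.+1) (ksl * gen (ksl * t) (- pi) j).
  by have [] := h k.
have step i d : is_derive t 1 (fun t => gen (ksl * t) (- pi) i) (ksl * genm (ksl * t) (- pi) i) ->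
    is_derive t 1 (fun t => genm (ksl * t) (- pi) i) d ->
    is_derive t 1 (fun t => gen (ksl * t) (- pi) i.+1)
      ((ksl * gen (ksl * t) (- pi) i + ksl * t * (ksl * genm (ksl * t) (- pi) i) + 2 * - pi * d) / i.+1%:R).
  move=> h1 h2.
  have h3 := is_deriveM_fun dk h1.
  have h4 := is_deriveM_fun (is_derive_cst (2 * - pi : R) t 1) h2.
  apply: is_derive_eq (is_deriveM_fun (is_deriveD_fun h3 h4) (is_derive_cst (i.+1%:R^-1 : R) t 1)) _.
  by rewrite /cst; set v := i.+1%:R^-1; ring.
elim: j => [|j [h1 h2]]; split.
- by apply: is_derive_eq (is_derive_cst (1 : R) t 1) _; rewrite /genm /= mulr0.
- have h0 : is_derive t 1 (fun t => gen (ksl * t) (- pi) 0) (ksl * genm (ksl * t) (- pi) 0).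
    by apply: is_derive_eq (is_derive_cst (1 : R) t 1) _; rewrite /genm /= mulr0.
  apply: is_derive_eq (step 0%N 0 h0 (is_derive_cst (0 : R) t 1)) _.
  by rewrite /genm /= !mulr0 !addr0 divr1.
- exact: h2.
apply: is_derive_eq (step j.+1 _ h2 h1) _.
have e : k.+1 = k.+1 by [].
have j2 : (j.+2%:R : R) != 0 by rewrite pnatr_eq0.
apply: (mulIf j2); rewrite divfK // genmS.
have := genS (ksl * t) (- pi) j; set g := gen _ _ j; set g1 := gen _ _ j.+1; set gm := genm _ _ j.
rewrite -[j.+2%:R]natr1 => h.
transitivity (ksl * (g1 + (ksl * t * g + 2 * - pi * gm))); first by ring.
by rewrite -h; ring.
Qed.

Lemma is_derive_kap k t : is_derive t 1 (kap k) (- tpi * t * kap k t + ksl * kapm k t).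
Proof.
have h : is_derive t 1 (fun t : R => - pi * t ^+ 2) (- pi * (2 * t)).
  apply: is_derive_eq (is_deriveM_fun (is_derive_cst (- pi : R) t 1)
    (is_deriveM_fun (is_derive_id t 1) (is_derive_id t 1))) _.
  by rewrite /cst; ring.
have e := @is_derive1_comp R expR (fun t => - pi * t ^+ 2) t _ _ (is_derive_expR _) h.
apply: is_derive_eq (is_deriveM_fun (is_deriveM_fun (is_derive_cst (kc : R) t 1) e) (is_derive_gen k t)) _.
by rewrite /cst /comp /kap /kapm /tpi; ring.
Qed.

Lemma continuous_kap k : continuous (kap k).
Proof. exact: (is_derive1_continuous (is_derive_kap k)). Qed.

Lemma continuous_kapm k : continuous (kapm k).
Proof.
case: k => [|k]; last exact: continuous_kap.
by rewrite (_ : kapm 0 = fun=> 0); [exact: cst_continuous|apply/funext => t; rewrite kapm0].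
Qed.

Lemma kapS k t : k.+1%:R * kap k.+1 t = ksl * t * kap k t - tpi * kapm k t.
Proof. by rewrite /kap mulrCA genS /kapm /tpi; ring. Qed.

Definition knorm k : R := 2 * tpi ^+ k / k`!%:R.

Lemma kap_integrable (f g : R -> R) : continuous f -> continuous g ->
  (forall t, `|f t| <= kapG 1 t) -> (forall t, `|g t| <= kapG 1 t) ->
  mu.-integrable setT (EFin \o (fun t => f t * g t)).
Proof.
move=> cf cg hf hg; have [C hC] := kapG_gauss 1.
apply: (@gaussian_integrable R _ C).
  by move=> t; apply: cvgM; [exact: cf|exact: cg].
move=> t; apply: le_trans (hC t); rewrite normrM expr2.
by apply: ler_pM.
Qed.

(** The integral of the derivative of [kap k * kap l] is 0; the terms containing t are eliminated by
    the three-term recursion [kapS], using ksl = sqrt 2 (2 pi). *)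
Lemma kap_ladder k l :
  l.+1%:R * \int[mu]_t (kap k t * kap l.+1 t) = tpi * \int[mu]_t (kapm k t * kap l t).
Proof.
have [C hC] := kapG_gauss 1.
have i1 := kap_integrable (@continuous_kap k) (@continuous_kap l.+1) (kap_le k) (kap_le l.+1).
have i2 := kap_integrable (@continuous_kapm k) (@continuous_kap l) (kapm_le k) (kap_le l).
have b1 t : `|kap k t * kap l.+1 t| <= C * expR (- t ^+ 2).
  by apply: le_trans (hC t); rewrite normrM expr2 ler_pM ?kap_le.
have b2 t : `|kapm k t * kap l t| <= C * expR (- t ^+ 2).
  by apply: le_trans (hC t); rewrite normrM expr2 ler_pM ?kap_le ?kapm_le.
have b3 t : `|kap k t * kap l t| <= C * expR (- t ^+ 2).
  by apply: le_trans (hC t); rewrite normrM expr2 ler_pM ?kap_le.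
pose u : R := l.+1%:R; pose a := Num.sqrt 2 * u; pose b := Num.sqrt 2 * tpi.
have d t : is_derive t 1 (fun t => kap k t * kap l t)
    (- a * (kap k t * kap l.+1 t) + b * (kapm k t * kap l t)).
  apply: is_derive_eq (is_deriveM_fun (is_derive_kap k t) (is_derive_kap l t)) _.
  have e : ksl * kapm l t = 2 * tpi * t * kap l t - Num.sqrt 2 * (u * kap l.+1 t).
    have q : ksl = Num.sqrt 2 * tpi by rewrite /ksl /tpi; ring.
    rewrite kapS q; have s2 : Num.sqrt 2 * Num.sqrt 2 = 2 :> R by rewrite -expr2 sqr_sqrtr.
    transitivity ((Num.sqrt 2 * Num.sqrt 2) * (tpi * t * kap l t) -
      Num.sqrt 2 * (Num.sqrt 2 * tpi * t * kap l t - tpi * kapm l t)); first by ring.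
    by rewrite s2; ring.
  rewrite e /a /b (_ : ksl = Num.sqrt 2 * tpi); last by rewrite /ksl /tpi; ring.
  ring.
have D0 : 0 <= `|a| + `|b| by rewrite addr_ge0.
have i0 := @Rintegral_line_deriv R (fun t => kap k t * kap l t) _ (C + (`|a| * C + `|b| * C)) d.
have C0 : 0 <= C.
  by have := le_trans (normr_ge0 _) (b1 0); rewrite expr0n oppr0 expR0 mulr1.
have {}i0 : \int[mu]_t (- a * (kap k t * kap l.+1 t) + b * (kapm k t * kap l t)) = 0.
  apply: i0.
  - move=> t; apply: cvgD; (apply: cvgM; first exact: cvg_cst).
      by apply: cvgM; exact: continuous_kap.
    by apply: cvgM; [exact: continuous_kapm|exact: continuous_kap].
  - move=> t; apply: le_trans (b3 t) _; rewrite ler_wpM2r ?expR_ge0 // lerDl.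
    by rewrite addr_ge0 ?mulr_ge0.
  - move=> t; apply: le_trans (ler_normD _ _) _; rewrite (normrM (- a)) (normrM b) normrN.
    apply: (@le_trans _ _ (`|a| * (C * expR (- t ^+ 2)) + `|b| * (C * expR (- t ^+ 2)))).
      by apply: lerD; apply: ler_wpM2l.
    by rewrite !mulrA -mulrDl ler_wpM2r ?expR_ge0 // lerDr.
have s20 : Num.sqrt 2 != 0 :> R by rewrite gt_eqF // sqrtr_gt0.
have j1 : mu.-integrable setT (EFin \o (fun t => - a * (kap k t * kap l.+1 t))).
  exact: (integrableZl measurableT (- a) i1).
have j2 : mu.-integrable setT (EFin \o (fun t => b * (kapm k t * kap l t))).
  exact: (integrableZl measurableT b i2).
rewrite (RintegralD measurableT j1 j2) (RintegralZl _ _ i1) // (RintegralZl _ _ i2) // in i0.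
rewrite mulNr addrC in i0; move/subr0_eq: i0 => i0.
by apply: (mulfI s20); rewrite [LHS]mulrA [RHS]mulrA; exact: esym i0.
Qed.

(** Since [kapm k.+1] is [kap k], the ladder lowers both indices, and [kapm 0 = 0] ends the descent
    off the diagonal. The base value 2 is kc^2 = 2 sqrt 2 times the Gaussian integral. *)
Lemma kap_orthogonal k l : \int[mu]_t (kap k t * kap l t) = (k == l)%:R * knorm k.
Proof.
have sym i j : \int[mu]_t (kap i t * kap j t) = \int[mu]_t (kap j t * kap i t).
  by apply: eq_Rintegral => t _; rewrite mulrC.
have z j : \int[mu]_t (kap 0 t * kap j.+1 t) = 0.
  have j0 : (j.+1%:R : R) != 0 by rewrite pnatr_eq0.
  apply: (mulfI j0); rewrite kap_ladder mulr0 /Rintegral integral0_eq ?mulr0 // => t _.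
  by rewrite kapm0 mul0r.
elim: k l => [|k IH] [|l]; last first.
- have l0 : (l.+1%:R : R) != 0 by rewrite pnatr_eq0.
  apply: (mulfI l0); rewrite kap_ladder.
  transitivity (tpi * \int[mu]_t (kap k t * kap l t)); first by [].
  rewrite IH eqSS; have [->|] := eqVneq k l; last by rewrite !mul0r !mulr0.
  have f0 : (l`!%:R : R) != 0 by rewrite pnatr_eq0 -lt0n fact_gt0.
  rewrite /knorm factS natrM exprS !mul1r; field; rewrite f0.
  by rewrite addrC natr1 pnatr_eq0.
- by rewrite sym z mul0r.
- by rewrite z mul0r.
rewrite mul1r /knorm expr0 fact0 mulr1 divr1.
have e t : kap 0 t * kap 0 t = 2 * Num.sqrt 2 * expR (- 2 * pi * t ^+ 2).
  rewrite /kap /gen /= !mulr1 mulrACA -expr2 kc4 -expRD; congr (_ * expR _); ring.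
transitivity (2 * Num.sqrt 2 * \int[mu]_t expR (- 2 * pi * t ^+ 2)); last first.
  by rewrite gauss2pi -mulrA mulfV ?mulr1 // gt_eqF // sqrtr_gt0.
rewrite -RintegralZl //; first by apply: eq_Rintegral => t _; rewrite e.
apply: (@gaussian_integrable R _ 1).
  move=> x; apply: continuous_comp; last exact: continuous_expR.
  by apply: cvgM; [exact: cvg_cst|exact: exprn_continuous].
move=> x; rewrite mul1r ger0_norm ?expR_ge0 // ler_expR.
have pi1 : 1 <= pi :> R by apply: le_trans (pi_ge2 R); rewrite ler1n.
by have := sqr_ge0 x; move: (pi : R) pi1 => p p1; nra.
Qed.

Lemma knorm_gt0 k : 0 < knorm k.
Proof. by rewrite divr_gt0 ?mulr_gt0 ?exprn_gt0 ?tpi_gt0 // ltr0n fact_gt0. Qed.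

(** This duality of the norms of z^k and of [kap k] is what makes the Segal-Bargmann transform
    isometric. *)
Lemma hnorm0 k : hnorm R 0 k = (knorm k)^-1.
Proof. by rewrite /hnorm /knorm expr0 fact0 !mul1r invf_div. Qed.

End HermiteFunctions.

(** * Real square-integrable functions and their completeness *)

Section SquareIntegrable.
Variable R : realType.
Local Notation mu := (@lebesgue_measure R).
Implicit Types (f g : R -> R) (S : nat -> R -> R).

Definition l2 f := measurable_fun setT f /\ mu.-integrable setT (EFin \o (fun t => f t * f t)).

Definition ip f g : R := \int[mu]_t (f t * g t).

Lemma l2_le f g : measurable_fun setT f -> mu.-integrable setT (EFin \o g) ->
  (forall t, f t * f t <= g t) -> l2 f.
Proof.
move=> mf ig h; split => //; apply: le_integrable ig => //.
  by apply/measurable_EFinP; exact: measurable_funM.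
move=> t _; rewrite lee_fin ger0_norm -?expr2 ?sqr_ge0 // expr2.
exact: le_trans (h t) (ler_norm _).
Qed.

Lemma l2_mul f g : l2 f -> l2 g -> mu.-integrable setT (EFin \o (fun t => f t * g t)).
Proof.
move=> [mf hf] [mg hg].
have i : mu.-integrable setT (EFin \o (fun t => f t * f t + g t * g t)).
  exact: (integrableD measurableT hf hg).
apply: le_integrable i => //.
  by apply/measurable_EFinP; exact: measurable_funM.
move=> t _; rewrite lee_fin [leRHS]ger0_norm ?addr_ge0 // -?expr2 ?sqr_ge0 //.
rewrite normrM -(real_normK (num_real (f t))) -(real_normK (num_real (g t))).
by have := sqr_ge0 (`|f t| - `|g t|); have := sqr_ge0 (`|f t| + `|g t|); nra.
Qed.

Lemma l2D f g : l2 f -> l2 g -> l2 (fun t => f t + g t).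
Proof.
move=> [mf hf] [mg hg].
apply: (@l2_le _ (fun t => 2 * (f t * f t + g t * g t))).
- exact: measurable_funD.
- exact: (integrableZl measurableT 2 (integrableD measurableT hf hg)).
- by move=> t; have := sqr_ge0 (f t - g t); nra.
Qed.

Lemma l2Z (c : R) f : l2 f -> l2 (fun t => c * f t).
Proof.
move=> [mf hf]; apply: (@l2_le _ (fun t => (c * c) * (f t * f t))).
- by apply: measurable_funM => //; exact: measurable_cst.
- exact: (integrableZl measurableT (c * c) hf).
- by move=> t; rewrite mulrACA.
Qed.

Lemma l2_0 : l2 (fun=> 0).
Proof.
split; first exact: measurable_cst.
apply: (eq_integrable measurableT (cst 0%E)); last exact: integrable0.
by move=> t _ /=; rewrite mulr0.
Qed.

Lemma l2_sum n S : (forall i, l2 (S i)) -> l2 (fun t => \sum_(i < n) S i t).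
Proof.
move=> h; elim: n => [|n IH].
  by rewrite (_ : (fun t => _) = fun=> 0); [exact: l2_0|apply/funext => t; rewrite big_ord0].
rewrite (_ : (fun t => _) = fun t => \sum_(i < n) S i t + S n t); first exact: l2D.
by apply/funext => t; rewrite big_ord_recr.
Qed.

Lemma ipC f g : ip f g = ip g f.
Proof. by apply: eq_Rintegral => t _; rewrite mulrC. Qed.

Lemma ipD f g h : l2 f -> l2 g -> l2 h -> ip f (fun t => g t + h t) = ip f g + ip f h.
Proof.
move=> hf hg hh; rewrite /ip -(RintegralD measurableT (l2_mul hf hg) (l2_mul hf hh)).
by apply: eq_Rintegral => t _; rewrite mulrDr.
Qed.

Lemma ipZ f g (c : R) : l2 f -> l2 g -> ip f (fun t => c * g t) = c * ip f g.
Proof.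
move=> hf hg; rewrite /ip -(RintegralZl _ _ (l2_mul hf hg)) //.
by apply: eq_Rintegral => t _; rewrite mulrCA.
Qed.

Lemma ip_ge0 f : 0 <= ip f f.
Proof. by apply: Rintegral_ge0 => t _; rewrite -expr2 sqr_ge0. Qed.

Lemma ip_sum f S n : l2 f -> (forall i, l2 (S i)) ->
  ip f (fun t => \sum_(i < n) S i t) = \sum_(i < n) ip f (S i).
Proof.
move=> hf hS; elim: n => [|n IH].
  rewrite big_ord0 /ip /Rintegral integral0_eq // => t _.
  by rewrite big_ord0 mulr0.
rewrite big_ord_recr /= -IH -ipD //; last exact: l2_sum.
by apply: eq_Rintegral => t _; rewrite big_ord_recr.
Qed.

Lemma ip_ae f g g' : l2 f -> l2 g -> l2 g' -> ae_eq mu setT g g' -> ip f g = ip f g'.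
Proof.
move=> [mf _] [mg _] [mg' _] e; rewrite /ip /Rintegral; congr fine.
apply: ae_eq_integral => //.
- by apply/measurable_EFinP; exact: measurable_funM.
- by apply/measurable_EFinP; exact: measurable_funM.
by apply: filterS e => t h /h ->.
Qed.

(* The weights [4 ^ i] turn the geometric decay of the increments into a square-integrable majorant. *)
Lemma l2_complete S : (forall i, l2 (S i)) ->
  (forall i, ip (fun t => S i.+1 t - S i t) (fun t => S i.+1 t - S i t) <= (16^-1) ^+ i) ->
  exists2 psi, l2 psi & forall f, l2 f -> (ip f (S i) @[i --> \oo] --> ip f psi).
Proof.
move=> hS hd; pose d i t := S i.+1 t - S i t.
have hdl i : l2 (d i).
  rewrite (_ : d i = fun t => S i.+1 t + (-1) * S i t); first by apply: l2D => //; exact: l2Z.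
  by apply/funext => t; rewrite mulN1r.
pose u i t : \bar R := (4 ^+ i * (d i t * d i t))%:E.
have u0 i t : (0 <= u i t)%E by rewrite lee_fin mulr_ge0 ?exprn_ge0 // -expr2 sqr_ge0.
have mu_ i : measurable_fun setT (u i).
  apply/measurable_EFinP; apply: measurable_funM; first exact: measurable_cst.
  by apply: measurable_funM; have [] := hdl i.
pose G t := (\sum_(0 <= i <oo) u i t)%E.
have G0 t : (0 <= G t)%E by apply: nneseries_ge0 => i _ _; exact: u0.
have mG : measurable_fun setT G by apply: ge0_emeasurable_sum => // i t _ _; exact: u0.
(* 4^i 16^-i = 4^-i <= 2^-i, so the weighted increments remain summable. *)
have intu i : (\int[mu]_t u i t <= ((2^-1 : R) ^+ i)%:E)%E.
  have -> : (\int[mu]_t u i t = (4 ^+ i * ip (d i) (d i))%:E)%E.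
    rewrite /u; under eq_integral do rewrite EFinM.
    have [_ ii] := hdl i; rewrite integralZl // EFinM; congr (_ * _)%E.
    by rewrite /ip /Rintegral fineK //; exact: (integrable_fin_num measurableT ii).
  rewrite lee_fin; apply: le_trans (ler_wpM2l _ (hd i)) _; first by rewrite exprn_ge0.
  rewrite -exprMn lerXn2r ?nnegrE ?mulr_ge0 ?invr_ge0 //; lra.
have intG : (\int[mu]_t G t <= 2%:E)%E.
  rewrite /G integral_nneseries //.
  apply: lime_le; first by apply: is_cvg_nneseries => i _ _; apply: integral_ge0 => t _; exact: u0.
  apply: nearW => N; rewrite big_mkord.
  apply: (@le_trans _ _ (\sum_(i < N) ((2^-1 : R) ^+ i)%:E)%E).
    by apply: lee_sum => i _; exact: intu.
  by rewrite sumEFin lee_fin half_sum.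
have iG : mu.-integrable setT G.
  apply/integrableP; split => //; apply: le_lt_trans (ltry 2).
  by under eq_integral => t _ do rewrite gee0_abs //.
pose E := [set t | G t \is a fin_num].
have mE : measurable E.
  by rewrite -[E]setTI; exact: emeasurable_fin_num.
have aeE : {ae mu, forall t, E t}.
  by apply: filterS (integrable_ae measurableT iG) => t h; exact: h.
pose h t : R := fine (G t).
have h0 t : 0 <= h t by rewrite fine_ge0.
have mh : measurable_fun setT h by exact: measurableT_comp.
have ih : mu.-integrable setT (EFin \o h).
  apply: (le_integrable _ _ _ iG) => //; first exact/measurable_EFinP.
  by move=> t _; rewrite /h /=; case: (G t) => [r| |] //=; rewrite normr0 leey.
(* Restriction to the full-measure set where the majorant is finite makes the sequence converge at
   every point without changing any inner product. *)
pose T i t : R := S i t * \1_E t.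
have hT i : l2 (T i).
  have [mS iS] := hS i; apply: (@l2_le _ (fun t => S i t * S i t)) => //.
    apply: measurable_funM => //; exact: measurable_indic.
  move=> t; rewrite /T indicE; case: (t \in E) => /=; rewrite ?mulr1 ?mulr0 //.
  by rewrite -expr2 sqr_ge0.
have ST i : ae_eq mu setT (S i) (T i).
  have fl := ae_filter_ringOfSetsType mu; move: aeE; apply: filterS => t Et _.
  by rewrite /T indicE mem_set // mulr1.
have db i t : E t -> `|d i t| <= (2^-1) ^+ i * Num.sqrt (h t).
  move=> Et; have : (4 : R) ^+ i * (d i t * d i t) <= h t.
    rewrite -lee_fin /h fineK //.
    apply: le_trans (nneseries_lim_ge i.+1 (fun i _ _ => u0 i t)).
    rewrite big_mkord big_ord_recr /= -[leLHS]add0e leeD //.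
    by apply: sume_ge0 => j _; exact: u0.
  move=> k; rewrite -(@ler_pXn2r _ 2) ?nnegrE ?mulr_ge0 ?sqrtr_ge0 ?exprn_ge0 ?invr_ge0 //.
  rewrite exprMn sqr_sqrtr // real_normK ?num_real // -exprM mulnC exprM.
  rewrite -(@ler_pM2l _ (4 ^+ i)) ?exprn_gt0 // [leRHS]mulrA -exprMn.
  by rewrite (_ : 4 * 2^-1 ^+ 2 = 1 :> R) ?expr1n ?mul1r ?expr2 //; field.
have Te i t : T i t = \1_E t * S 0%N t + \sum_(j < i) \1_E t * d j t.
  elim: i => [|i IH]; first by rewrite big_ord0 addr0 mulrC.
  by rewrite big_ord_recr /= addrA -IH /T /d; ring.
have Tb i t : `|T i t| <= `|S 0%N t| + 2 * Num.sqrt (h t).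
  have [Et|nE] := pselect (E t); last first.
    by rewrite /T indicE memNset // mulr0 normr0 addr_ge0 ?mulr_ge0 ?sqrtr_ge0.
  rewrite Te indicE mem_set // mul1r; apply: le_trans (ler_normD _ _) _; rewrite lerD2l.
  apply: le_trans (ler_norm_sum _ _ _) _.
  apply: (@le_trans _ _ (\sum_(j < i) (2^-1) ^+ j * Num.sqrt (h t))).
    by apply: ler_sum => j _; rewrite mul1r; exact: db.
  by rewrite -mulr_suml ler_wpM2r ?sqrtr_ge0 // half_sum.
have cT t : cvgn (T ^~ t).
  rewrite (_ : T ^~ t = fun i => \1_E t * S 0%N t + \sum_(j < i) \1_E t * d j t); last first.
    by apply/funext => i; exact: Te.
  apply: is_cvgD; first exact: is_cvg_cst.
  apply: (@abs_cvg_series R (fun j => \1_E t * d j t) (2 * Num.sqrt (h t))) => N.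
  apply: (@le_trans _ _ (\sum_(j < N) (2^-1) ^+ j * Num.sqrt (h t))); last first.
    by rewrite -mulr_suml ler_wpM2r ?sqrtr_ge0 // half_sum.
  apply: ler_sum => j _; rewrite indicE; have [Et|nE] := pselect (E t).
    by rewrite mem_set // mul1r; exact: db.
  by rewrite memNset // mul0r normr0 mulr_ge0 ?sqrtr_ge0 ?exprn_ge0 ?invr_ge0.
pose psi t := limn (T ^~ t).
have Tpsi t : T i t @[i --> \oo] --> psi t by exact: cT.
have mpsi : measurable_fun setT psi.
  apply: (@measurable_fun_cvg _ _ _ setT T) => [i|t _]; first by have [] := hT i.
  exact: Tpsi.
(* From |T i| <= |S 0| + 2 sqrt h and (a + b)^2 <= 2 (a^2 + b^2): an integrable bound for all the
   squares. *)
pose g t := 2 * (S 0%N t * S 0%N t + 4 * h t).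
have ig : mu.-integrable setT (EFin \o g).
  have [_ iS] := hS 0%N.
  exact: (integrableZl measurableT 2 (integrableD measurableT iS (integrableZl measurableT 4 ih))).
have Tg i t : T i t * T i t <= g t.
  have b := Tb i t; rewrite -expr2 -real_normK ?num_real // /g.
  have s0 := sqrtr_ge0 (h t); rewrite -[in leRHS](sqr_sqrtr (h0 t)).
  rewrite -[S 0%N t * _]expr2 -[S 0%N t ^+ 2]real_normK ?num_real //.
  apply: (@le_trans _ _ ((`|S 0%N t| + 2 * Num.sqrt (h t)) ^+ 2)).
    by rewrite lerXn2r ?nnegrE ?addr_ge0 ?mulr_ge0.
  by have := sqr_ge0 (`|S 0%N t| - 2 * Num.sqrt (h t)); nra.
have psig t : psi t * psi t <= g t.
  have c : (T i t * T i t) @[i --> \oo] --> psi t * psi t by apply: cvgM; exact: Tpsi.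
  rewrite -(cvg_lim (@Rhausdorff R) c); apply: limr_le; first by apply/cvg_ex; eexists; exact: c.
  by apply: nearW => i; exact: Tg.
have hpsi : l2 psi by exact: l2_le mpsi ig psig.
exists psi => // f hf.
have [mf i_f] := hf.
have [|||||_] := @Rintegral_dominated _ _ R mu (fun i t => f t * T i t) (fun t => f t * psi t)
    (fun t => f t * f t + g t).
- by move=> i; apply: measurable_funM => //; have [] := hT i.
- exact: measurable_funM.
- by move=> t; apply: cvgM; [exact: cvg_cst|exact: Tpsi].
- exact: (integrableD measurableT i_f ig).
- move=> i t; apply: le_trans (_ : `|f t| ^+ 2 + `|T i t| ^+ 2 <= _); last first.
    by rewrite !real_normK ?num_real // !expr2 lerD2l.
  rewrite normrM; have := sqr_ge0 (`|f t| - `|T i t|); have := sqr_ge0 (`|f t| + `|T i t|); nra.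
move=> c; rewrite (_ : (fun i => ip f (S i)) = fun i => \int[mu]_t (f t * T i t)) //.
by apply/funext => i; exact: ip_ae (hS i) (hT i) (ST i).
Qed.

End SquareIntegrable.

(** * Uniqueness for the Fourier transform through the Poisson kernel *)

Section Completeness.
Variable R : realType.
Local Notation mu := (@lebesgue_measure R).
Local Notation tpi := (tpi R).

Lemma integral_zero_derivative (f df : R -> R -> R) (G : R -> R) :
  (forall s, mu.-integrable setT (EFin \o f s)) ->
  (forall s t : R, is_derive s 1 (f ^~ t) (df s t)) ->
  mu.-integrable setT (EFin \o G) -> (forall s t, `|df s t| <= G t) ->
  (forall s, \int[mu]_t df s t = 0) ->
  forall a b, \int[mu]_t f a t = \int[mu]_t f b t.
Proof.
move=> fi hd iG dG z.
have G0 t : 0 <= G t by apply: le_trans (dG 0 t).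
have e1 x y : partial1of2 f x y = df x y by rewrite partial1of2E; case: (hd x y).
apply: (@is_derive0_cst R (fun s => \int[mu]_t f s t)) => s.
have sI : `](s - 1), (s + 1)[%classic s by rewrite /= in_itv /= gtrBl ltrDl ltr01.
have h1 x : `](s - 1), (s + 1)[%classic x -> mu.-integrable setT (EFin \o f x) by move=> _.
have h2 x y : `](s - 1), (s + 1)[%classic x -> setT y -> derivable (f ^~ y) x 1.
  by move=> _ _; have [] := hd x y.
have h3 x y : `](s - 1), (s + 1)[%classic x -> setT y -> `|partial1of2 f x y| <= G y.
  by move=> _ _; rewrite e1.
split; first exact: (derivable_under_integral measurableT sI h1 h2 G0 iG h3).
rewrite -derive1E (differentiation_under_integral measurableT sI h1 h2 G0 iG h3).
by rewrite -[RHS](z s); apply: eq_Rintegral => t _; rewrite e1.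
Qed.

Variable g : R -> R.
Hypothesis mg : measurable_fun setT g.
Hypothesis ig : mu.-integrable setT (EFin \o g).

Let gM_integrable (u : R -> R) (C : R) : continuous u -> (forall t, `|u t| <= C) ->
  mu.-integrable setT (EFin \o (fun t => g t * u t)).
Proof.
move=> cu hu; apply: (le_integrable _ _ _ (integrableZl measurableT C ig)) => //.
  by apply/measurable_EFinP; apply: measurable_funM => //; exact: continuous_measurable_fun.
move=> t _; rewrite lee_fin /= normrM normrM mulrC ler_wpM2r //.
exact: le_trans (hu t) (ler_norm _).
Qed.

Let abs_integrable (C : R) : mu.-integrable setT (EFin \o (fun t => C * `|g t|)).
Proof.
have i : mu.-integrable setT (EFin \o (fun t => `|g t|)).
  apply: (le_integrable _ _ _ ig) => //; first by apply/measurable_EFinP; exact: measurableT_comp.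
  by move=> t _; rewrite lee_fin /= normr_id.
exact: (integrableZl measurableT C i).
Qed.

Let cont_lin (a b : R) : continuous (fun t : R => a * t + b).
Proof.
move=> t; apply: cvgD; last exact: cvg_cst.
by apply: cvgM; [exact: cvg_cst|exact: cvg_id].
Qed.

Hypothesis gcos : forall y : R, \int[mu]_t (g t * cos (y * t)) = 0.
Hypothesis gsin : forall y : R, \int[mu]_t (g t * sin (y * t)) = 0.

Let cont_cos (y s : R) : continuous (fun t : R => cos (y * (t - s))).
Proof.
rewrite (_ : (fun t => _) = cos \o (fun t => y * t + - (y * s))).
  by move=> t; apply: continuous_comp; [exact: cont_lin|exact: continuous_cos].
by apply/funext => t /=; congr cos; ring.
Qed.

Let cont_sin (y s : R) : continuous (fun t : R => sin (y * (t - s))).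
Proof.
rewrite (_ : (fun t => _) = sin \o (fun t => y * t + - (y * s))).
  by move=> t; apply: continuous_comp; [exact: cont_lin|exact: continuous_sin].
by apply/funext => t /=; congr sin; ring.
Qed.

Let abs_cos (x : R) : `|cos x| <= 1.
Proof. by rewrite ler_norml cos_geN1 cos_le1. Qed.
Let abs_sin (x : R) : `|sin x| <= 1.
Proof. by rewrite ler_norml sin_geN1 sin_le1. Qed.

(** The addition formula reduces a translated cosine to the two vanishing transforms. *)
Let gcos_shift (y s : R) : \int[mu]_t (g t * cos (y * (t - s))) = 0.
Proof.
have i1 : mu.-integrable setT (EFin \o (fun t => g t * cos (y * t))).
  apply: (@gM_integrable (fun t => cos (y * t)) 1) => [|t]; last exact: abs_cos.
  by have h := @cont_cos y 0; rewrite (_ : (fun t => _) = (fun t => cos (y * (t - 0)))) //; apply/funext => t; rewrite subr0.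
have i2 : mu.-integrable setT (EFin \o (fun t => g t * sin (y * t))).
  apply: (@gM_integrable (fun t => sin (y * t)) 1) => [|t]; last exact: abs_sin.
  by have h := @cont_sin y 0; rewrite (_ : (fun t => _) = (fun t => sin (y * (t - 0)))) //; apply/funext => t; rewrite subr0.
transitivity (\int[mu]_t (cos (y * s) * (g t * cos (y * t)) + sin (y * s) * (g t * sin (y * t)))).
  by apply: eq_Rintegral => t _; rewrite mulrBr cosB; ring.
have j1 : mu.-integrable setT (EFin \o (fun t => cos (y * s) * (g t * cos (y * t)))).
  exact: (integrableZl measurableT _ i1).
have j2 : mu.-integrable setT (EFin \o (fun t => sin (y * s) * (g t * sin (y * t)))).
  exact: (integrableZl measurableT _ i2).
by rewrite (RintegralD measurableT j1 j2) (RintegralZl _ _ i1) // (RintegralZl _ _ i2) // gcos gsin !mulr0 addr0.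
Qed.

(* Antiderivative in [y] of [e^(- eps y) cos (y u)], up to the additive constant making it vanish at infinity. *)
Let PK (e u y : R) : R := expR (- e * y) * (u * sin (y * u) - e * cos (y * u)) / (e ^+ 2 + u ^+ 2).

Let den_gt0 (e u : R) : 0 < e -> 0 < e ^+ 2 + u ^+ 2.
Proof. by move=> e0; rewrite ltr_pwDl ?exprn_gt0 ?sqr_ge0. Qed.

Let PK_derive (e u y : R) : 0 < e -> is_derive y 1 (PK e u) (expR (- e * y) * cos (y * u)).
Proof.
move=> e0; have d0 := den_gt0 u e0.
have lin (c : R) : is_derive y 1 (fun y => y * c) c.
  apply: is_derive_eq (is_deriveM_fun (is_derive_id y 1) (is_derive_cst (c : R) y 1)) _.
  by rewrite /cst; ring.
have de : is_derive y 1 (fun y => - e * y) (- e).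
  apply: is_derive_eq (is_deriveM_fun (is_derive_cst (- e : R) y 1) (is_derive_id y 1)) _.
  by rewrite /cst; ring.
have hE := @is_derive1_comp R expR (fun y => - e * y) y _ _ (is_derive_expR _) de.
have hS := @is_derive1_comp R sin (fun y => y * u) y _ _ (is_derive_sin _) (lin u).
have hC := @is_derive1_comp R cos (fun y => y * u) y _ _ (is_derive_cos _) (lin u).
have h := is_deriveM_fun (is_deriveM_fun hE (is_deriveB_fun
   (is_deriveM_fun (is_derive_cst (u : R) y 1) hS) (is_deriveM_fun (is_derive_cst (e : R) y 1) hC)))
   (is_derive_cst ((e ^+ 2 + u ^+ 2)^-1 : R) y 1).
apply: is_derive_eq h _; rewrite /cst /comp; field.
by rewrite gt_eqF.
Qed.

Let PK_bound (e u y : R) : 0 < e -> 0 <= y -> `|PK e u y| <= 2 / e * expR (- e * y).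
Proof.
move=> e0 y0; have d0 := den_gt0 u e0.
rewrite /PK !normrM normfV (gtr0_norm d0) (gtr0_norm (expR_gt0 _)).
rewrite -mulrA mulrC ler_wpM2r ?expR_ge0 // ler_pdivrMr //.
apply: (@le_trans _ _ (`|u| + e)).
  apply: le_trans (ler_normB _ _) _; rewrite !normrM (gtr0_norm e0).
  by apply: lerD; rewrite ler_piMr // ltW.
rewrite mulrAC ler_pdivlMr // -[u ^+ 2]real_normK ?num_real //.
have := normr_ge0 u; move: `|u| => v v0; have := sqr_ge0 (e - v); nra.
Qed.

Let cont_PK (e s y : R) : 0 < e -> continuous (fun t : R => PK e (t - s) y).
Proof.
move=> e0 t; have cl : {for t, continuous (fun t : R => t - s)}.
  by apply: cvgB; [exact: cvg_id|exact: cvg_cst].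
apply: cvgM.
  apply: cvgM; first exact: cvg_cst.
  apply: cvgB; apply: cvgM; first exact: cl.
  - exact: cont_sin.
  - exact: cvg_cst.
  - exact: cont_cos.
apply: cvgV; first by rewrite gt_eqF // den_gt0.
apply: cvgD; first exact: cvg_cst.
by under eq_fun do rewrite expr2; apply: cvgM; exact: cl.
Qed.

(** The y-derivative of the integral of g times [PK] is a damped cosine transform, hence 0, so this
    integral does not depend on y >= 0. It tends to 0 at infinity, and at y = 0 the function [PK] is
    minus the Poisson kernel. *)
Let poisson_zero (e s : R) : 0 < e -> \int[mu]_t (g t * (e / (e ^+ 2 + (t - s) ^+ 2))) = 0.
Proof.
move=> e0.
have C0 : 0 <= 2 / e by rewrite divr_ge0 // ltW.
have key N : \int[mu]_t (g t * PK e (t - s) (N%:R)) = \int[mu]_t (g t * PK e (t - s) 0).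
  (* Squaring the parameter keeps it nonnegative on the whole line, so that the bounds for [PK] and
     its derivative are uniform there. *)
  pose F y t := g t * (PK e (t - s) (y ^+ 2)).
  have hF (y t : R) : is_derive y 1 (F ^~ t) (g t * (expR (- e * y ^+ 2) * cos (y ^+ 2 * (t - s)) * (2 * y))).
    have dy : is_derive y 1 (fun y : R => y ^+ 2) (2 * y).
      apply: is_derive_eq (is_deriveM_fun (is_derive_id y 1) (is_derive_id y 1)) _.
      by ring.
    have h := @is_derive1_comp R (PK e (t - s)) (fun y => y ^+ 2) y _ _ (PK_derive _ _ e0) dy.
    by apply: is_derive_eq (is_deriveM_fun (is_derive_cst (g t : R) y 1) h) _; rewrite /cst; ring.
  have eb (x : R) : 0 <= x -> expR (- e * x ^+ 2) * (2 * x) <= 1 + e^-1.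
    move=> x0; rewrite mulNr expRN mulrC ler_pdivrMr ?expR_gt0 //.
    have := expR_ge1Dx (e * x ^+ 2); set E := expR _ => hE.
    have ei : 0 < e^-1 by rewrite invr_gt0.
    have ee : e * e^-1 = 1 by rewrite mulfV // gt_eqF.
    have : (1 + e^-1) * (1 + e * x ^+ 2) <= (1 + e^-1) * E.
      by rewrite ler_wpM2l // addr_ge0 // ltW.
    apply: le_trans; have -> : (1 + e^-1) * (1 + e * x ^+ 2) = 1 + e^-1 + e * x ^+ 2 + (e * e^-1) * x ^+ 2 by ring.
    rewrite ee; have := sqr_ge0 (x - 1); have : 0 <= e * x ^+ 2 by rewrite mulr_ge0 ?sqr_ge0 // ltW.
    nra.
  have := @integral_zero_derivative F _ (fun t => (1 + e^-1) * `|g t|) _ hF (abs_integrable _).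
  move=> h; have {}h : forall a b, \int[mu]_t F a t = \int[mu]_t F b t.
    apply: h => [y|y t|y].
    - apply: (@gM_integrable _ (2 / e)); first exact: cont_PK.
      move=> t; apply: le_trans (PK_bound _ e0 (sqr_ge0 y)) _.
      by rewrite ler_piMr // expR_le1 mulNr oppr_le0 mulr_ge0 ?sqr_ge0 // ltW.
    - rewrite normrM mulrC ler_wpM2r // !normrM (gtr0_norm (expR_gt0 _)).
      rewrite mulrAC; apply: (@le_trans _ _ (expR (- e * y ^+ 2) * (`|2| * `|y|))).
        by rewrite ler_piMr // ?mulr_ge0 ?expR_ge0.
      by rewrite normr_nat -[y ^+ 2]real_normK ?num_real //; exact: eb.
    - transitivity (\int[mu]_t ((expR (- e * y ^+ 2) * (2 * y)) * (g t * cos (y ^+ 2 * (t - s))))).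
        by apply: eq_Rintegral => t _; ring.
      rewrite (RintegralZl _ _ _) // ?gcos_shift ?mulr0 //.
      by apply: (@gM_integrable _ 1) => [|t]; [exact: cont_cos|exact: abs_cos].
  have := h (Num.sqrt N%:R) 0; rewrite /F.
  by under eq_Rintegral => t _ do rewrite sqr_sqrtr //; under [RHS]eq_Rintegral => t _ do rewrite expr0n /=.
have PKle N t : `|g t * PK e (t - s) N%:R| <= 2 / e * `|g t| * expR (- e) ^+ N.
  rewrite normrM -expRM_natr mulrAC mulrC ler_wpM2r //.
  exact: PK_bound.
have lt1 : `|expR (- e)| < 1 by rewrite gtr0_norm ?expR_gt0 // expR_lt1 oppr_lt0.
have [||||_ h] := @Rintegral_dominated _ _ R mu (fun N t => g t * PK e (t - s) N%:R) (fun=> 0)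
  (fun t => 2 / e * `|g t|) _ _ _ (abs_integrable _).
- by move=> N; apply: measurable_funM => //; apply: continuous_measurable_fun; exact: cont_PK.
- exact: measurable_cst.
- move=> t; apply/norm_cvg0P.
  apply: (@squeeze_cvgr _ _ _ _ (fun=> 0) (fun N => 2 / e * `|g t| * expR (- e) ^+ N)).
  + by apply: nearW => N; rewrite normr_ge0 PKle.
  + exact: cvg_cst.
  + rewrite -(mulr0 (2 / e * `|g t|)); apply: cvgM; first exact: cvg_cst.
    exact: cvg_expr.
- move=> N t; apply: le_trans (PKle N t) _; rewrite ler_piMr ?(mulr_ge0 C0 (normr_ge0 _)) //.
  by rewrite exprn_ile1 ?expR_ge0 // ltW // -[ltLHS]gtr0_norm ?expR_gt0.
have z : \int[mu]_t (g t * PK e (t - s) 0) = 0.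
  have c : (fun N => \int[mu]_t (g t * PK e (t - s) N%:R)) @ \oo --> \int[mu]_t (g t * PK e (t - s) 0).
    by under eq_fun do rewrite key; exact: cvg_cst.
  rewrite -(cvg_lim (@Rhausdorff R) c) (cvg_lim (@Rhausdorff R) h).
  by rewrite /Rintegral integral0.
have i0 : mu.-integrable setT (EFin \o (fun t => g t * PK e (t - s) 0)).
  apply: (@gM_integrable _ (2 / e)); first exact: cont_PK.
  move=> t; apply: le_trans (PK_bound _ e0 (lexx 0)) _.
  by rewrite mulr0 expR0 mulr1.
transitivity (-1 * \int[mu]_t (g t * PK e (t - s) 0)); last by rewrite z mulr0.
rewrite -(RintegralZl _ _ i0) //; apply: eq_Rintegral => t _.
by rewrite /PK !mulr0 !mul0r expR0 sin0 cos0 mulr0 mulr1 mul1r sub0r; ring.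
Qed.

(** The derivative of atan((s - t) / e) in s is the Poisson kernel, so the integral is constant in
    s. *)
Let atan_zero (e p q : R) : 0 < e ->
  \int[mu]_t (g t * atan ((p - t) / e)) = \int[mu]_t (g t * atan ((q - t) / e)).
Proof.
move=> e0; have e1 : e != 0 by rewrite gt_eqF.
have := @integral_zero_derivative (fun s t => g t * atan ((s - t) / e))
  (fun s t => g t * (e / (e ^+ 2 + (t - s) ^+ 2))) (fun t => e^-1 * `|g t|).
apply.
- move=> s; apply: (@gM_integrable _ (pi / 2)).
    move=> t; apply: continuous_comp; last exact: continuous_atan.
    apply: cvgM; last exact: cvg_cst.
    by apply: cvgB; [exact: cvg_cst|exact: cvg_id].
  by move=> t; rewrite ler_norml !ltW ?atan_ltpi2 ?atan_gtNpi2.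
- move=> s t.
  have dl : is_derive s 1 (fun s => (s - t) / e) e^-1.
    apply: is_derive_eq (is_deriveM_fun (is_deriveB_fun (is_derive_id s 1) (is_derive_cst (t : R) s 1))
       (is_derive_cst (e^-1 : R) s 1)) _.
    by rewrite /cst; ring.
  have h := @is_derive1_comp R atan (fun s => (s - t) / e) s _ _ (is_derive1_atan _) dl.
  apply: is_derive_eq (is_deriveM_fun (is_derive_cst (g t : R) s 1) h) _.
  rewrite /cst mulr0 addr0; congr (_ * _).
  have d1 := den_gt0 (t - s) e0.
  have d2 : 0 < 1 + ((s - t) / e) ^+ 2 by rewrite ltr_pwDl ?sqr_ge0.
  have -> : e ^+ 2 + (t - s) ^+ 2 = e ^+ 2 * (1 + ((s - t) / e) ^+ 2) by field.
  by move: (1 + _) d2 => v d2; field; rewrite !gt_eqF.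
- exact: abs_integrable.
- move=> s t; have d1 := den_gt0 (t - s) e0.
  rewrite normrM mulrC ler_wpM2r // ger0_norm; last by rewrite divr_ge0 // ltW.
  rewrite ler_pdivrMr // mulrDr expr2 mulKf // lerDl mulr_ge0 ?sqr_ge0 //.
  by rewrite invr_ge0 ltW.
- by move=> s; exact: poisson_zero.
Qed.

(** As e tends to 0 the arctangents become a sign function, so the integral of g against the sign of
    q - t is independent of q. The primitive of g is then constant, and Lebesgue differentiation
    gives g = 0 almost everywhere. *)
Lemma fourier_unique : ae_eq mu setT g (fun=> 0).
Proof.
have itail q : mu.-integrable `]-oo, q] (EFin \o g).
  by apply: integrableS ig => //; exact: measurable_itv.
pose F q := \int[mu]_(t in `]-oo, q]) g t.
have irest q : mu.-integrable setT (EFin \o (g \_ `]-oo, q])).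
  have -> : g \_ `]-oo, q] = (fun t => g t * (if t <= q then 1 else 0)).
    by apply/funext => t; rewrite patchE mem_setE in_itv /=; case: (t <= q); rewrite ?mulr1 ?mulr0.
  apply: (le_integrable _ _ _ ig) => //.
    apply/measurable_EFinP; apply: measurable_funM => //.
    by apply: measurable_fun_ifT => //; exact: measurable_fun_ler.
  move=> t _; rewrite lee_fin /= normrM.
  by case: (t <= q); rewrite ?normr1 ?normr0 ?mulr1 ?mulr0.
pose sg (q t : R) : R := if t <= q then 1 else -1.
have sgnE q : \int[mu]_t (g t * sg q t) = 2 * F q + -1 * \int[mu]_t g t.
  have j1 : mu.-integrable setT (EFin \o (fun t => 2 * (g \_ `]-oo, q]) t)).
    exact: (integrableZl measurableT 2 (irest q)).
  have j2 : mu.-integrable setT (EFin \o (fun t => -1 * g t)).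
    exact: (integrableZl measurableT (-1) ig).
  have r1 : \int[mu]_t (2 * (g \_ `]-oo, q]) t) = 2 * F q.
    by rewrite (RintegralZl _ _ (irest q)) // /F [in RHS]Rintegral_mkcond.
  have r2 : \int[mu]_t (-1 * g t) = -1 * \int[mu]_t g t by rewrite (RintegralZl _ _ ig).
  rewrite -r1 -r2 -(RintegralD measurableT j1 j2).
  apply: eq_Rintegral => t _; rewrite /sg patchE mem_setE in_itv /=.
  case: (t <= q); first by ring.
  by rewrite -[point]/(0 : R) mulr0 add0r mulrC.
(* The width 1/(n+1)^2 shrinks faster than the shift 1/(n+1), so that the point t = q also has the
   limit pi/2, as in [sg]. *)
have lim q : (\int[mu]_t (g t * atan ((q + n.+1%:R^-1 - t) / (n.+1%:R^-1 ^+ 2)))) @[n --> \oo] -->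
    \int[mu]_t (pi / 2 * (g t * sg q t)).
  have [||||_] := @Rintegral_dominated _ _ R mu
    (fun n t => g t * atan ((q + n.+1%:R^-1 - t) / (n.+1%:R^-1 ^+ 2)))
    (fun t => pi / 2 * (g t * sg q t)) (fun t => pi / 2 * `|g t|) _ _ _ (abs_integrable _); last exact.
  - move=> n; apply: measurable_funM => //; apply: continuous_measurable_fun => t.
    apply: continuous_comp; last exact: continuous_atan.
    apply: cvgM; last exact: cvg_cst.
    by apply: cvgB; [exact: cvg_cst|exact: cvg_id].
  - apply: measurable_funM; first exact: measurable_cst.
    apply: measurable_funM => //; apply: measurable_fun_ifT => //.
    exact: measurable_fun_ler.
  - move=> t; rewrite [X in _ --> X]mulrCA; apply: cvgM; first exact: cvg_cst.
    have e n : (q + n.+1%:R^-1 - t) / (n.+1%:R^-1 ^+ 2) = n.+1%:R ^+ 2 * (q - t) + n.+1%:R.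
      have : (n.+1%:R : R) != 0 by rewrite pnatr_eq0.
      by move: (n.+1%:R : R) => x x0; field.
    under eq_fun do rewrite e.
    have up (d : R) : 0 <= d -> (n.+1%:R ^+ 2 * d + n.+1%:R : R) @[n --> \oo] --> +oo.
      move=> d0; apply/cvgryPge => A; near=> n.
      apply: (@le_trans _ _ (n.+1%:R)); last by rewrite lerDr mulr_ge0 ?exprn_ge0.
      apply: (@le_trans _ _ n%:R); last by rewrite ler_nat.
      by near: n; exact: nbhs_infty_ger.
    rewrite /sg; case: (lerP t q) => tq.
      rewrite mulr1; apply: (cvg_comp _ _ _ (@cvgy_atan R)).
      by apply: up; rewrite subr_ge0.
    have d0 : 0 < t - q by rewrite subr_gt0.
    under eq_fun do rewrite -[_ + _]opprK atanN.
    rewrite mulrN1; apply: cvgN; apply: (cvg_comp _ _ _ (@cvgy_atan R)).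
    apply/cvgryPge => A; near=> n.
    have h1 : 2 / (t - q) <= n%:R by near: n; exact: nbhs_infty_ger.
    have h2 : A <= n%:R by near: n; exact: nbhs_infty_ger.
    rewrite ler_pdivrMr // in h1.
    apply: le_trans h2 _; rewrite -natr1; move: h1 (ler0n R n); set x := n%:R => h1 x0.
    by nra.
  - move=> n t; rewrite normrM mulrC ler_wpM2r //.
    by rewrite ler_norml !ltW ?atan_ltpi2 ?atan_gtNpi2.
have const q : F q = F 0.
  have c : (fun n => \int[mu]_t (g t * atan ((q + n.+1%:R^-1 - t) / (n.+1%:R^-1 ^+ 2)))) =
           (fun n => \int[mu]_t (g t * atan ((0 + n.+1%:R^-1 - t) / (n.+1%:R^-1 ^+ 2)))).
    by apply/funext => n; apply: atan_zero; rewrite exprn_gt0 // invr_gt0 ltr0n.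
  have l1 := lim q; rewrite c in l1.
  have e := etrans (esym (cvg_lim (@Rhausdorff R) (lim 0))) (cvg_lim (@Rhausdorff R) l1).
  have isg r : mu.-integrable setT (EFin \o (fun t => g t * sg r t)).
    apply: (le_integrable _ _ _ ig) => //.
      apply/measurable_EFinP; apply: measurable_funM => //.
      by apply: measurable_fun_ifT => //; exact: measurable_fun_ler.
    by move=> t _; rewrite lee_fin /= /sg normrM; case: ifP => _; rewrite ?normrN normr1 mulr1.
  rewrite !(RintegralZl _ _ (isg _)) // !sgnE in e.
  have p0 : (pi : R) / 2 != 0 by rewrite mulf_neq0 ?invr_eq0 ?pnatr_eq0 // gt_eqF // pi_gt0.
  have two0 : (2 : R) != 0 by rewrite pnatr_eq0.
  exact/esym/(mulfI two0)/(addIr _ (mulfI p0 (e _ _))).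
have locg : locally_integrable setT g.
  by have := integrable_locally measurableT ig; rewrite patch_setT.
have fl := ae_filter_ringOfSetsType mu; have := FTC1Ny itail locg.
apply: filterS => x [_ <-] _.
rewrite (_ : (fun x => _) = cst (F 0)); first by rewrite derive1_cst.
by apply/funext => y; exact: const.
Unshelve. all: by end_near. Qed.

End Completeness.

(** * Hermite coefficients as Taylor coefficients of the Segal-Bargmann transform *)

Section HermiteExpansion.
Variable R : realType.
Local Notation mu := (@lebesgue_measure R).
Local Notation kap := (@kap R).
Implicit Types (f g : R -> R) (a : nat -> R) (z : cplx R).

Lemma l2_kap k : l2 (kap k).
Proof.
split; first by apply: continuous_measurable_fun; exact: continuous_kap.
by apply: kap_integrable; (exact: continuous_kap || exact: kap_le).
Qed.

Lemma l2_kapG r : l2 (@kapG R r).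
Proof.
have [C hC] := @kapG_gauss R r.
have cG : continuous (@kapG R r).
  move=> t; apply: cvgM; first exact: cvg_cst.
  apply: continuous_comp; last exact: continuous_expR.
  apply: cvgD; last exact: cvg_cst.
  apply: cvgD; first by apply: cvgM; [exact: cvg_cst|exact: exprn_continuous].
  by apply: cvgM; [apply: cvgM; [exact: cvg_cst|exact: norm_continuous]|exact: cvg_cst].
have cG2 : continuous (fun t => kapG r t * kapG r t) by move=> t; apply: cvgM; exact: cG.
split; first exact: continuous_measurable_fun.
apply: (@gaussian_integrable R _ C) => // t.
by rewrite -expr2 ger0_norm ?sqr_ge0.
Qed.

Definition coef f k : R := ip (kap k) f.

Lemma coefD f g k : l2 f -> l2 g -> coef (fun t => f t + g t) k = coef f k + coef g k.
Proof. by move=> hf hg; rewrite /coef ipD //; exact: l2_kap. Qed.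

Lemma coefZ f (c : R) k : l2 f -> coef (fun t => c * f t) k = c * coef f k.
Proof. by move=> hf; rewrite /coef ipZ //; exact: l2_kap. Qed.

Lemma coef_ae f g k : l2 f -> l2 g -> ae_eq mu setT f g -> coef f k = coef g k.
Proof. by move=> hf hg e; apply: ip_ae => //; exact: l2_kap. Qed.

(* [knorm k] is the squared norm of [kap k], so the dual expansion carries [(knorm k)^-1]. *)
Definition expansion a N (t : R) : R := \sum_(k < N) (a k / knorm R k) * kap k t.

Lemma l2_expansion a N : l2 (expansion a N).
Proof. by apply: (@l2_sum _ N (fun k t => a k / knorm R k * kap k t)) => k; exact/l2Z/l2_kap. Qed.

Lemma coef_expansion a N k : coef (expansion a N) k = if (k < N)%N then a k else 0.
Proof.
have hk := l2_kap; have hs i : l2 (fun t => a i / knorm R i * kap i t) by exact: l2Z.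
rewrite /coef /expansion (ip_sum N (hk k) hs).
have e i : ip (kap k) (fun t => a i / knorm R i * kap i t) = (k == i)%:R * a i.
  rewrite ipZ // /ip kap_orthogonal; have [->|_] := eqVneq k i; last by rewrite !mul0r mulr0.
  by rewrite !mul1r divfK // gt_eqF // knorm_gt0.
rewrite (eq_bigr (fun i : 'I_N => (k == i)%:R * a i)); last by move=> i _; exact: e.
case: ltnP => kN; last first.
  by rewrite big1 // => i _; rewrite gtn_eqF ?mul0r // (leq_trans (ltn_ord i) kN).
rewrite (bigD1 (Ordinal kN)) //= eqxx mul1r big1 ?addr0 // => i.
by rewrite -val_eqE /= eq_sym => /negPf ->; rewrite mul0r.
Qed.

Lemma ip_expansion f a N : l2 f -> ip f (expansion a N) = \sum_(k < N) a k * hnorm R 0 k * coef f k.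
Proof.
move=> hf; rewrite /expansion (ip_sum N hf (fun i => l2Z (a i / knorm R i) (l2_kap i))).
apply: eq_bigr => k _; rewrite ipZ //; last exact: l2_kap.
by rewrite hnorm0 /coef [ip f _]ipC.
Qed.

(** The squared norm of f minus its partial expansion is nonnegative, and the cross terms equal the
    norm of the expansion. *)
Lemma bessel f N : l2 f -> \sum_(k < N) coef f k ^+ 2 * hnorm R 0 k <= ip f f.
Proof.
move=> hf; pose S := expansion (coef f) N; have hS : l2 S := l2_expansion _ _.
have hS' : l2 (fun t => -1 * S t) by exact: l2Z.
have hd : l2 (fun t => f t + -1 * S t) by exact: l2D.
have e1 : ip f S = \sum_(k < N) coef f k ^+ 2 * hnorm R 0 k.
  by rewrite /S ip_expansion //; apply: eq_bigr => k _; ring.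
have e2 : ip S S = \sum_(k < N) coef f k ^+ 2 * hnorm R 0 k.
  rewrite {2}/S ip_expansion //; apply: eq_bigr => k _.
  by rewrite coef_expansion ltn_ord; ring.
have exp g : l2 g -> ip (fun t => f t + -1 * S t) g = ip f g - ip S g.
  by move=> hg; rewrite ipC ipD // ipZ // mulN1r [ip g f]ipC [ip g S]ipC.
have := ip_ge0 (fun t => f t + -1 * S t).
by rewrite ipD // ipZ // !exp // [ip S f]ipC e1 e2; lra.
Qed.

Lemma sum_coef_integral f z N : l2 f ->
  \sum_(k < N) rc (coef f k) * z ^+ k =
  Cpx (\int[mu]_t (f t * re (\sum_(k < N) rc (kap k t) * z ^+ k)))
      (\int[mu]_t (f t * im (\sum_(k < N) rc (kap k t) * z ^+ k))).
Proof.
move=> hf; have hs (c : nat -> R) i : l2 (fun t => c i * kap i t) by exact/l2Z/l2_kap.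
have s (c : nat -> R) : \sum_(k < N) coef f k * c k = \int[mu]_t (f t * \sum_(k < N) c k * kap k t).
  rewrite -[RHS]/(ip f (fun t => \sum_(k < N) c k * kap k t)) (ip_sum N hf (hs c)).
  by apply: eq_bigr => k _; rewrite ipZ //; [rewrite mulrC /coef ipC|exact: l2_kap].
apply: cE; rewrite ?re_sum ?im_sum /=.
  rewrite (eq_bigr (fun k : 'I_N => coef f k * re (z ^+ k))) => [|k _]; last by rewrite !cRI mul0r subr0.
  rewrite (s (fun k => re (z ^+ k))); apply: eq_Rintegral => t _; congr (_ * _); rewrite re_sum; apply: eq_bigr => k _.
  by rewrite !cRI mul0r subr0 mulrC.
rewrite (eq_bigr (fun k : 'I_N => coef f k * im (z ^+ k))) => [|k _]; last by rewrite !cRI mul0r addr0.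
rewrite (s (fun k => im (z ^+ k))); apply: eq_Rintegral => t _; congr (_ * _); rewrite im_sum; apply: eq_bigr => k _.
by rewrite !cRI mul0r addr0 mulrC.
Qed.

(** The series of the kernel is integrated term by term; its partial sums are dominated by
    [kapG (nc z)], which is square integrable. *)
Lemma ccvg_coef f z : l2 f ->
  [/\ mu.-integrable setT (EFin \o (fun t => f t * re (bkernel t z))),
      mu.-integrable setT (EFin \o (fun t => f t * im (bkernel t z))) &
      ccvg (psum (coef f) z)
        (Cpx (\int[mu]_t (f t * re (bkernel t z))) (\int[mu]_t (f t * im (bkernel t z))))].
Proof.
move=> hf; have hG := l2_kapG (nc z); have [mf _] := hf.
have b N t : nc (\sum_(k < N) rc (kap k t) * z ^+ k) <= kapG (nc z) t.
  apply: le_trans (ler_nc_sum _ (fun k => rc (kap k t) * z ^+ k)) _.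
  apply: le_trans (sum_kap_le t N (nc_ge0 z)).
  by apply: ler_sum => k _; rewrite ncM nc_rc ncX.
have mS (P : cplx R -> R) N : (forall t, P (\sum_(k < N) rc (kap k t) * z ^+ k) =
    \sum_(k < N) P (z ^+ k) * kap k t) ->
    measurable_fun setT (fun t => P (\sum_(k < N) rc (kap k t) * z ^+ k)).
  move=> e; under eq_fun do rewrite e.
  have [//] : l2 (fun t => \sum_(k < N) P (z ^+ k) * kap k t).
  by apply: (@l2_sum _ N (fun k t => P (z ^+ k) * kap k t)) => k; exact/l2Z/l2_kap.
have iG : mu.-integrable setT (EFin \o (fun t => `|f t| * kapG (nc z) t)).
  have := l2_mul hf hG; apply: le_integrable => //.
    apply/measurable_EFinP; apply: measurable_funM; first exact: measurableT_comp.
    by have [] := hG.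
  by move=> t _; rewrite lee_fin /= !normrM normr_id.
have dom (P : cplx R -> R) : (forall w, `|P w| <= nc w) ->
    (forall N t, P (\sum_(k < N) rc (kap k t) * z ^+ k) = \sum_(k < N) P (z ^+ k) * kap k t) ->
    (forall t, P (\sum_(k < N) rc (kap k t) * z ^+ k) @[N --> \oo] --> P (bkernel t z)) ->
    mu.-integrable setT (EFin \o (fun t => f t * P (bkernel t z))) /\
    (\int[mu]_t (f t * P (\sum_(k < N) rc (kap k t) * z ^+ k))) @[N --> \oo] -->
      \int[mu]_t (f t * P (bkernel t z)).
  move=> hP eP cP; apply: (Rintegral_dominated _ _ _ iG).
  - by move=> N; apply: measurable_funM => //; apply: mS => t; exact: eP.
  - apply: measurable_funM => //.
    apply: (@measurable_fun_cvg _ _ _ setT (fun N t => P (\sum_(k < N) rc (kap k t) * z ^+ k))) => [N|t _].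
      by apply: mS => t; exact: eP.
    exact: cP.
  - by move=> t; apply: cvgM; [exact: cvg_cst|exact: cP].
  - move=> N t; rewrite normrM ler_wpM2l //; apply: le_trans (hP _) (b N t).
have reE N t : re (\sum_(k < N) rc (kap k t) * z ^+ k) = \sum_(k < N) re (z ^+ k) * kap k t.
  by rewrite re_sum; apply: eq_bigr => k _; rewrite !cRI mul0r subr0 mulrC.
have imE N t : im (\sum_(k < N) rc (kap k t) * z ^+ k) = \sum_(k < N) im (z ^+ k) * kap k t.
  by rewrite im_sum; apply: eq_bigr => k _; rewrite !cRI mul0r addr0 mulrC.
have [i1 c1] := dom (@complex.Re R) (@ler_norm_re R) reE (fun t => (ccvg_kap z t).1).
have [i2 c2] := dom (@complex.Im R) (@ler_norm_im R) imE (fun t => (ccvg_kap z t).2).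
split => //; rewrite /psum; split.
  by under eq_fun do rewrite sum_coef_integral //.
by under eq_fun do rewrite sum_coef_integral //.
Qed.

Lemma entire_coef f : l2 f -> entire (coef f).
Proof.
move=> hf rho rho0; exists (\int[mu]_t (`|f t| * kapG rho t)) => k.
have [mf _] := hf.
have iG : mu.-integrable setT (EFin \o (fun t => `|f t| * kapG rho t)).
  have := l2_mul hf (l2_kapG rho); apply: le_integrable => //.
    apply/measurable_EFinP; apply: measurable_funM; first exact: measurableT_comp.
    by have [] := l2_kapG rho.
  by move=> t _; rewrite lee_fin /= !normrM normr_id.
have ik := l2_mul (l2_kap k) hf.
have hle t : `|rho ^+ k * (kap k t * f t)| <= `|f t| * kapG rho t.
  rewrite (normrM (rho ^+ k)) (normrM (kap k t)) [`|rho ^+ k|]ger0_norm ?exprn_ge0 //.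
  rewrite (_ : rho ^+ k * _ = `|f t| * (`|kap k t| * rho ^+ k)); last by ring.
  apply: ler_wpM2l => //; apply: le_trans (sum_kap_le t k.+1 rho0).
  rewrite big_ord_recr /= lerDr.
  by apply: sumr_ge0 => i _; rewrite mulr_ge0 ?exprn_ge0.
rewrite /coef /ip -[rho ^+ k]ger0_norm ?exprn_ge0 // -normrM mulrC.
rewrite -(RintegralZl _ _ ik) //; apply: le_trans (le_normr_Rintegral _ _) _ => //.
  exact: (integrableZl measurableT _ ik).
apply: le_Rintegral => //.
  apply: integrable_norm; exact: (integrableZl measurableT _ ik).
Qed.

Lemma bargmann_integral f z : l2 f ->
  esum (coef f) z = Cpx (\int[mu]_t (f t * re (bkernel t z))) (\int[mu]_t (f t * im (bkernel t z))).
Proof.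
move=> hf; have [_ _ c] := ccvg_coef z hf.
exact: (ccvg_unique (esum_cvg z (entire_coef hf)) c).
Qed.

(** On the imaginary axis the kernel is a constant times exp(-pi t^2) e^(i y t), so a vanishing
    transform means a vanishing Fourier transform of f(t) exp(-pi t^2), which is integrable as a
    product of two square-integrable functions. *)
Lemma coef_injective f : l2 f -> (forall k, coef f k = 0) -> ae_eq mu setT f (fun=> 0).
Proof.
move=> hf h0; have [mf _] := hf.
pose e (t : R) : R := expR (- pi * t ^+ 2).
have e0 t : 0 < e t by exact: expR_gt0.
have me : measurable_fun setT e.
  apply: continuous_measurable_fun => t; apply: continuous_comp; last exact: continuous_expR.
  by apply: cvgM; [exact: cvg_cst|exact: exprn_continuous].
have c0 := kc_gt0 R.
have ek t : kap 0 t = kc R * e t by rewrite /kap /gen /= mulr1.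
have ig : mu.-integrable setT (EFin \o (fun t => f t * e t)).
  have := integrableZl measurableT (kc R)^-1 (l2_mul hf (l2_kap 0)).
  apply: eq_integrable => // t _; rewrite /= ek -EFinM; congr EFin.
  by rewrite mulrCA mulKf ?gt_eqF.
have mg : measurable_fun setT (fun t => f t * e t) by exact: measurable_funM.
have z0 w : esum (coef f) w = 0.
  rewrite (_ : coef f = fun k => 0 * coef f k); last by apply/funext => k; rewrite h0 mulr0.
  by rewrite esumZ ?rc0 ?mul0r //; exact: entire_coef.
have s0 : ksl R != 0 by rewrite gt_eqF // !mulr_gt0 ?pi_gt0 // sqrtr_gt0.
(* Division by [ksl] makes the linear term of the exponent exactly i y t; the square of the
   imaginary argument gives the positive factor. *)
have key (y t : R) : bkernel t (Cpx 0 (y / ksl R)) =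
    rc (kc R * expR (pi * (y / ksl R) ^+ 2)) * (rc (e t) * Cpx (cos (y * t)) (sin (y * t))).
  rewrite /bkernel; have -> : - rc pi * (Cpx 0 (y / ksl R) ^+ 2 + rc t ^+ 2) + rc (ksl R * t) * Cpx 0 (y / ksl R) =
     rc (pi * (y / ksl R) ^+ 2) + (rc (- pi * t ^+ 2) + Cpx 0 (y * t)).
    apply: cE; rewrite !cRI; first by ring.
    by field.
  rewrite !cexpD !cexp_rc rcM -mulrA; congr (_ * (_ * (_ * _))).
  by rewrite /cexp /= expR0 !mul1r.
have vanish (y : R) (P : cplx R -> R) : (forall x w, P (rc x * w) = x * P w) ->
    \int[mu]_t (f t * P (bkernel t (Cpx 0 (y / ksl R)))) = 0 ->
    mu.-integrable setT (EFin \o (fun t => f t * P (bkernel t (Cpx 0 (y / ksl R))))) ->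
    \int[mu]_t (f t * e t * P (Cpx (cos (y * t)) (sin (y * t)))) = 0.
  move=> hP h i; set A := kc R * expR (pi * (y / ksl R) ^+ 2).
  have A0 : A != 0 by rewrite mulf_neq0 ?gt_eqF ?expR_gt0.
  transitivity (A^-1 * \int[mu]_t (f t * P (bkernel t (Cpx 0 (y / ksl R))))); last by rewrite h mulr0.
  rewrite -(RintegralZl _ _ i) //; apply: eq_Rintegral => t _.
  by rewrite key !hP -/A; field.
have reZ x (w : cplx R) : re (rc x * w) = x * re w by rewrite !cRI mul0r subr0.
have imZ x (w : cplx R) : im (rc x * w) = x * im w by rewrite !cRI mul0r addr0.
have hE (y : R) := bargmann_integral (Cpx 0 (y / ksl R)) hf.
have ic (y : R) := ccvg_coef (Cpx 0 (y / ksl R)) hf.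
have gc (y : R) : \int[mu]_t (f t * e t * cos (y * t)) = 0.
  have [i1 _ _] := ic y; apply: (vanish y (@complex.Re R) reZ _ i1).
  by have := hE y; rewrite z0 => -[].
have gs (y : R) : \int[mu]_t (f t * e t * sin (y * t)) = 0.
  have [_ i2 _] := ic y; apply: (vanish y (@complex.Im R) imZ _ i2).
  by have := hE y; rewrite z0 => -[].
have fl := ae_filter_ringOfSetsType mu; have := fourier_unique mg ig gc gs.
apply: filterS => t h /h /eqP; rewrite mulf_eq0 [e t == 0]gt_eqF // orbF => /eqP.
exact.
Qed.

End HermiteExpansion.

(** * The Riesz-Fischer theorem and Parseval's identity on the line *)

Section RieszFischer.
Variable R : realType.
Local Notation mu := (@lebesgue_measure R).
Implicit Types (f g : R -> R) (a : nat -> R).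

(** Chooses indices along which the blocks of the series decay like 16^-i, the rate required by
    [l2_complete]; i <= n i makes the indices tend to infinity. *)
Lemma bounded_sum_tails (e : nat -> R) (C : R) : (forall k, 0 <= e k) ->
  (forall N, \sum_(k < N) e k <= C) ->
  exists n : nat -> nat, (forall i, (i <= n i)%N) /\ (forall i, (n i <= n i.+1)%N) /\
    forall i, \sum_(k < n i.+1) e k - \sum_(k < n i) e k <= (16^-1) ^+ i.
Proof.
move=> e0 hC; pose P N := \sum_(k < N) e k.
have mono : {homo P : n m / (n <= m)%N >-> n <= m}.
  by apply/nondecreasing_seqP => n; rewrite /P big_ord_recr /= lerDl.
have cP : cvgn P.
  apply: nondecreasing_is_cvgn => //.
  by exists C => _ [N _ <-]; exact: hC.
have lim N : P N <= limn P by exact: nondecreasing_cvgn_le.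
have tail (i : nat) : exists m, forall N, (m <= N)%N -> limn P - P N <= (16^-1) ^+ i.
  have p0 : (0 : R) < (16^-1) ^+ i by rewrite exprn_gt0 // invr_gt0.
  move/cvgrPdist_le : (cP) => /(_ _ p0)[m _ hm].
  exists m => N mN; have := hm N mN; rewrite ger0_norm // subr_ge0; exact: lim.
have [m hm] := choice tail.
exists (fun i => \sum_(j < i.+1) m j + i)%N; split; first by move=> i; exact: leq_addl.
split; first by move=> i; rewrite [in leqRHS]big_ord_recr /= -addnA leq_add2l; lia.
move=> i; apply: le_trans (hm i (\sum_(j < i.+1) m j + i)%N _).
  by rewrite lerD2r; exact: lim.
by rewrite big_ord_recr /= -addnA [(m i + i)%N]addnC addnA leq_addl.
Qed.

(** Weak convergence of a subsequence of expansions suffices: testing against [kap k] gives the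
    coefficients, and testing against the limit itself gives its norm. *)
Lemma riesz_fischer a (C : R) : (forall N, \sum_(k < N) a k ^+ 2 * hnorm R 0 k <= C) ->
  exists2 f, l2 f & (forall k, coef f k = a k) /\
    (\sum_(k < N) a k ^+ 2 * hnorm R 0 k) @[N --> \oo] --> ip f f.
Proof.
move=> hC; pose e k : R := a k ^+ 2 * hnorm R 0 k.
have e0 k : 0 <= e k by rewrite mulr_ge0 ?sqr_ge0 // ltW // hnorm_gt0.
have [n [ni [nS hn]]] := bounded_sum_tails e0 hC.
pose S i := expansion a (n i).
have hS i : l2 (S i) by exact: l2_expansion.
have ipS i j : (i <= j)%N -> ip (expansion a i) (expansion a j) = \sum_(k < i) e k.
  move=> ij; rewrite ipC ip_expansion; last exact: l2_expansion.
  apply: eq_bigr => k _; rewrite coef_expansion (leq_trans (ltn_ord k) ij) /e; ring.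
have hd i : ip (fun t => S i.+1 t - S i t) (fun t => S i.+1 t - S i t) <= (16^-1) ^+ i.
  apply: le_trans (hn i).
  have -> : (fun t => S i.+1 t - S i t) = (fun t => S i.+1 t + -1 * S i t).
    by apply/funext => t; rewrite mulN1r.
  have hm : l2 (fun t => -1 * S i t) by exact: l2Z.
  have hd : l2 (fun t => S i.+1 t + -1 * S i t) by exact: l2D.
  have exp g : l2 g -> ip (fun t => S i.+1 t + -1 * S i t) g = ip (S i.+1) g - ip (S i) g.
    by move=> hg; rewrite ipC ipD // ipZ // mulN1r [ip g _]ipC [ip g (S i)]ipC.
  rewrite ipD // ipZ // !exp // [ip (S i.+1) (S i)]ipC /S !ipS //.
  rewrite /e; lra.
have [f hf cf] := l2_complete hS hd; exists f => //.
have ck k : coef f k = a k.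
  have c := cf _ (l2_kap R k).
  have c' : ip (kap k) (S i) @[i --> \oo] --> a k.
    apply: cvg_near_cst.
    near=> i; rewrite -[ip _ _]/(coef (expansion a (n i)) k) coef_expansion ifT //.
    apply: leq_trans (ni i); near: i; exact: nbhs_infty_gt.
  by rewrite /coef -(cvg_lim (@Rhausdorff R) c) (cvg_lim (@Rhausdorff R) c').
split => //.
have cfn := cf _ hf.
have cP : cvgn (fun N => \sum_(k < N) e k).
  apply: nondecreasing_is_cvgn; last by exists C => _ [N _ <-]; exact: hC.
  by apply/nondecreasing_seqP => k; rewrite big_ord_recr /= lerDl.
have sn : n @ \oo --> \oo.
  apply/cvgnyPge => A; near=> i; apply: leq_trans (ni i); near: i; exact: nbhs_infty_ge.
have c2 := cvg_comp _ _ sn cP.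
have E i : ip f (S i) = \sum_(k < n i) e k.
  by rewrite ip_expansion //; apply: eq_bigr => k _; rewrite ck /e; ring.
have c3 : ip f (S i) @[i --> \oo] --> limn (fun N => \sum_(k < N) e k).
  by under eq_fun do rewrite E.
have -> : ip f f = limn (fun N => \sum_(k < N) e k).
  by rewrite -(cvg_lim (@Rhausdorff R) cfn) (cvg_lim (@Rhausdorff R) c3).
exact: cP.
Unshelve. all: by end_near. Qed.

(** The function rebuilt from the coefficients of f satisfies the identity and equals f almost
    everywhere by [coef_injective]. *)
Lemma coef_parseval f : l2 f ->
  (\sum_(0 <= k <oo) (coef f k ^+ 2 * hnorm R 0 k)%:E = (ip f f)%:E)%E.
Proof.
move=> hf; have [g hg [ck cg]] := riesz_fischer (fun N => bessel N hf).
have hN : l2 (fun t => -1 * g t) by exact: l2Z.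
have hd : l2 (fun t => f t + -1 * g t) by exact: l2D.
have ae0 : ae_eq mu setT (fun t => f t + -1 * g t) (fun=> 0).
  by apply: coef_injective => // k; rewrite coefD // coefZ // ck mulN1r subrr.
have fl := ae_filter_ringOfSetsType mu.
have fg : ae_eq mu setT f g.
  move: ae0; apply: filterS => t h /h /eqP; rewrite mulN1r subr_eq0 => /eqP; exact.
have -> : ip f f = ip g g.
  by rewrite (ip_ae hf hf hg fg) ipC (ip_ae hg hf hg fg).
apply/cvg_lim => //; under eq_fun do rewrite big_mkord sumEFin.
by apply: cvg_EFin; [exact: nearW|exact: cg].
Qed.

End RieszFischer.

(** * Slice functions and the Bargmann transforms *)

Section SliceFunctions.
Variable R : realType.
Implicit Types (q I J : quat R) (p : R * R) (z w : cplx R) (Phi Psi : nat -> R * R -> cplx R).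

Lemma qc_of_qc c (f : nat -> R) : (c < 4)%N -> qc c (of_qc f) = f c.
Proof. by case: c => [|[|[|[|c]]]]. Qed.

Lemma of_qc_qc q : of_qc (fun c => qc c q) = q.
Proof. by case: q. Qed.

Lemma qc_ext q q' : (forall c, (c < 4)%N -> qc c q = qc c q') -> q = q'.
Proof. by move=> h; apply: quat_ext; [exact: (h 0%N)|exact: (h 1%N)|exact: (h 2%N)|exact: (h 3%N)]. Qed.

Lemma eq_of_qc (f g : nat -> R) : (forall c, (c < 4)%N -> f c = g c) -> of_qc f = of_qc g.
Proof. by move=> h; rewrite /of_qc !h. Qed.

Lemma of_qcD (f g : nat -> R) : of_qc (fun c => f c + g c) = of_qc f + of_qc g.
Proof. exact: quat_ext. Qed.
Lemma of_qcN (f : nat -> R) : of_qc (fun c => - f c) = - of_qc f.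
Proof. exact: quat_ext. Qed.
Lemma of_qcZ (x : R) (f : nat -> R) : of_qc (fun c => x * f c) = x *: of_qc f.
Proof. exact: quat_ext. Qed.
Lemma of_qc0 : of_qc (fun=> 0 : R) = 0. Proof. by []. Qed.

Lemma qc_mulr c q q' : qc c (q * q') = \sum_(d < 4) qc c (qbasis R d * q') * qc d q.
Proof.
rewrite (sum4 (fun d => qc c (qbasis R d * q') * qc d q)).
by case: q q' => ? ? ? ? [? ? ? ?]; case: c => [|[|[|c]]] /=; ring.
Qed.

Lemma mul_imag_unit I q : imag_unit I -> I * (I * q) = - q.
Proof. by move=> h; rewrite mulrA -expr2 h mulN1r. Qed.

(* The embedding [x + i y |-> x + I y] of the complex numbers as the slice [C_I]. *)
Definition iot I z : quat R := slice_point I (re z, im z).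

Lemma iotE I z : iot I z = (re z)%:A + im z *: I. Proof. by []. Qed.

Lemma iot_cpt I p : iot I (cpt p) = slice_point I p. Proof. by case: p. Qed.

Lemma iotM I z w : imag_unit I -> iot I (z * w) = iot I z * iot I w.
Proof.
move=> hI; rewrite !iotE mulrDl !mulrDr -!scalerAl -!scalerAr !mul1r !mulr1 -expr2 hI !cRI.
by apply: qcP => c; rewrite !(qcD, qcN, qcZ); ring.
Qed.

Lemma iotD I z w : iot I (z + w) = iot I z + iot I w.
Proof. by rewrite !iotE !cRI !scalerDl addrACA. Qed.

Lemma iotZ I (x : R) z : iot I (rc x * z) = x *: iot I z.
Proof. by rewrite !iotE !cRI !mul0r subr0 addr0 scalerDr !scalerA. Qed.

Lemma iot_rc I (x : R) : iot I (rc x) = x%:A.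
Proof. by rewrite iotE scale0r addr0. Qed.

Lemma iotX I z n : imag_unit I -> iot I (z ^+ n) = iot I z ^+ n.
Proof.
move=> hI; elim: n => [|n IH]; first by rewrite !expr0 -[1]/(rc 1) iot_rc scale1r.
by rewrite !exprS iotM // IH.
Qed.

Lemma iot_sum I N (F : nat -> cplx R) : iot I (\sum_(k < N) F k) = \sum_(k < N) iot I (F k).
Proof.
elim: N => [|N IH]; first by rewrite !big_ord0 iotE !cRI !scale0r addr0.
by rewrite !big_ord_recr /= iotD IH.
Qed.

Lemma qconj_iot I z : imag_unit I -> qconj (iot I z) = iot I (cj z).
Proof.
move=> /imag_unitP[]; case: I => a b c d /= -> _.
by apply: quat_ext => /=; ring.
Qed.

(** The value on the slice of I of the function whose four complex stems are [Phi 0] to [Phi 3].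
    Left multiplication by x + I y on the slice corresponds to multiplication by x + i y on each
    stem. *)
Definition sl I Phi p : quat R :=
  of_qc (fun c => re (Phi c p)) + I * of_qc (fun c => im (Phi c p)).

Lemma eq_sl I Phi Psi p : (forall c, (c < 4)%N -> Phi c p = Psi c p) -> sl I Phi p = sl I Psi p.
Proof. by move=> h; congr (_ + _ * _); apply: eq_of_qc => c hc; rewrite h. Qed.

Lemma slD I Phi Psi p : sl I (fun c p => Phi c p + Psi c p) p = sl I Phi p + sl I Psi p.
Proof.
rewrite /sl (@eq_of_qc _ (fun c => re (Phi c p) + re (Psi c p))); last by move=> c _; rewrite reD.
rewrite (@eq_of_qc (fun c => im _) (fun c => im (Phi c p) + im (Psi c p))); last by move=> c _; rewrite imD.
by rewrite !of_qcD mulrDr addrACA.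
Qed.

Lemma sl0 I p : sl I (fun _ _ => 0) p = 0.
Proof. by rewrite /sl /= of_qc0 mulr0 addr0. Qed.

Lemma sl_sum I N (Phi : nat -> nat -> R * R -> cplx R) p :
  sl I (fun c p => \sum_(j < N) Phi j c p) p = \sum_(j < N) sl I (Phi j) p.
Proof.
elim: N => [|N IH].
  by rewrite big_ord0 -[RHS](sl0 I p); apply: eq_sl => c _; rewrite big_ord0.
rewrite big_ord_recr /= -IH -slD; apply: eq_sl => c _.
by rewrite big_ord_recr.
Qed.

Lemma sl_iot I w Phi p : imag_unit I -> sl I (fun c p => w * Phi c p) p = iot I w * sl I Phi p.
Proof.
move=> hI; rewrite /sl iotE.
rewrite (@eq_of_qc _ (fun c => re w * re (Phi c p) + - (im w * im (Phi c p)))); last by move=> c _; rewrite reM.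
rewrite (@eq_of_qc (fun c => im _) (fun c => re w * im (Phi c p) + im w * re (Phi c p))); last by move=> c _; rewrite imM.
rewrite !of_qcD of_qcN !of_qcZ mulrDl !mulrDr -!scalerAl -!scalerAr !mul1r mul_imag_unit // scalerN.
by apply: qcP => c; rewrite !(qcD, qcN, qcZ); ring.
Qed.

Lemma slZ I (x : R) Phi p : imag_unit I -> sl I (fun c p => rc x * Phi c p) p = x *: sl I Phi p.
Proof. by move=> hI; rewrite sl_iot // iot_rc -scalerAl mul1r. Qed.

(** The slices of I and -I give A + I B and A - I B, from which A and B are recovered. *)
Lemma sl_inj Phi Psi p I : imag_unit I -> sl I Phi p = sl I Psi p -> sl (- I) Phi p = sl (- I) Psi p ->
  forall c, (c < 4)%N -> Phi c p = Psi c p.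
Proof.
rewrite /sl !mulNr; set A := of_qc _; set B := of_qc _; set A' := of_qc _; set B' := of_qc _.
move=> hI h1 h2.
have two (x y : quat R) : x + x = y + y -> x = y.
  by move=> h; apply: qcP => c; have := congr1 (qc c) h; rewrite !qcD; lra.
have eA : A = A'.
  apply: two; have := congr2 +%R h1 h2.
  by rewrite [A + _ + _]addrACA subrr addr0 [A' + _ + _]addrACA subrr addr0.
have eB : B = B'.
  move: h1; rewrite eA => /addrI h; have := congr1 (fun x => - (I * x)) h.
  by rewrite !mul_imag_unit // !opprK.
move=> c hc; apply: cE.
  by have := congr1 (qc c) eA; rewrite !qc_of_qc.
by have := congr1 (qc c) eB; rewrite !qc_of_qc.
Qed.

Lemma imag_unitN I : imag_unit I -> imag_unit (- I).
Proof. by rewrite /imag_unit sqrrN. Qed.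

Lemma qderive_sl I Phi (v : R * R) p (r s : nat -> R) :
  (forall c, is_derive p v (fun p => re (Phi c p)) (r c)) ->
  (forall c, is_derive p v (fun p => im (Phi c p)) (s c)) ->
  qderive v (sl I Phi) p = of_qc r + I * of_qc s.
Proof.
move=> hr hs.
have D c : 'D_v (fun x : R * R => qc c (sl I Phi x)) p = qc c (of_qc r + I * of_qc s).
  have -> : (fun x : R * R => qc c (sl I Phi x)) =
     (fun x : R * R => qc c (of_qc (fun c => re (Phi c x))) + (\sum_(d < 4) qc c (I * qbasis R d) * qc d (of_qc (fun c => im (Phi c x))))).
    by apply/funext => x; rewrite /sl qcD [qc c (I * _)]qc_mull.
  rewrite qcD [qc c (I * _)]qc_mull.
  pose M d := qc c (I * qbasis R d).
  rewrite !(sum4 (fun d => M d * qc d (of_qc s))).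
  have -> : (fun x : R * R => qc c (of_qc (fun c => re (Phi c x))) + (\sum_(d < 4) qc c (I * qbasis R d) * qc d (of_qc (fun c => im (Phi c x))))) =
    (fun x : R * R => qc c (of_qc (fun c => re (Phi c x))) + (((M 0%N * im (Phi 0%N x) + M 1%N * im (Phi 1%N x)) + M 2%N * im (Phi 2%N x)) + M 3%N * im (Phi 3%N x))).
    by apply/funext => x; rewrite (sum4 (fun d => M d * qc d (of_qc (fun c => im (Phi c x))))).
  have hM d : is_derive p v (fun x : R * R => M d * im (Phi d x)) (M d * s d).
    exact: (is_deriveZ (M d) (hs d)).
  have hc : is_derive p v (fun x : R * R => qc c (of_qc (fun c => re (Phi c x)))) (qc c (of_qc r)).
    by case: (c) => [|[|[|k]]] /=; [exact: (hr 0%N)|exact: (hr 1%N)|exact: (hr 2%N)|exact: (hr 3%N)].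
  have [_ ->] := is_deriveD_fun hc (is_deriveD_fun (is_deriveD_fun (is_deriveD_fun (hM 0%N) (hM 1%N)) (hM 2%N)) (hM 3%N)).
  by [].
by apply: quat_ext; [exact: (D 0%N)|exact: (D 1%N)|exact: (D 2%N)|exact: (D 3%N)].
Qed.

Definition qdbar I (F : R * R -> quat R) p := qdx F p + I * qdy F p.

(** Because I (I q) = -q, left multiplication by I acts as i on the stems, and the slice operator
    becomes [dbar] on each of them. *)
Lemma qdbar_sl m I Phi : imag_unit I -> (forall c, cCm m.+1 (Phi c)) ->
  qdbar I (sl I Phi) = sl I (fun c => dbar (Phi c)).
Proof.
move=> hI h; apply/funext => p.
have dr v : v = (1, 0) \/ v = (0, 1) -> forall c,
    is_derive p v (fun p => re (Phi c p)) ('D_v (fun p => re (Phi c p)) p) /\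
    is_derive p v (fun p => im (Phi c p)) ('D_v (fun p => im (Phi c p)) p).
  move=> hv c; have [[_ d1 _ _] [_ d2 _ _]] := h c.
  have [e1 e2] := d1 p; have [e3 e4] := d2 p.
  by case: hv => ->; split; apply: derivableP; [exact: e1|exact: e3|exact: e2|exact: e4].
have h1 c := dr _ (or_introl erefl) c; have h2 c := dr _ (or_intror erefl) c.
rewrite /qdbar /qdx /qdy (qderive_sl I (fun c => (h1 c).1) (fun c => (h1 c).2)).
rewrite (qderive_sl I (fun c => (h2 c).1) (fun c => (h2 c).2)) mulrDr mul_imag_unit // /sl /dbar /=.
rewrite of_qcD of_qcN of_qcD [in RHS]mulrDr.
by apply: qcP => c; rewrite !(qcD, qcN, qcZ); ring.
Qed.

Lemma iter_qdbar_sl m I Phi : imag_unit I -> (forall c, cCm m (Phi c)) ->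
  iter m (qdbar I) (sl I Phi) = sl I (fun c => iter m (@dbar R) (Phi c)).
Proof.
move=> hI h; elim: m h => [|m IH] h //.
rewrite iterS IH; last by move=> c; exact/cCmW/h.
by rewrite (@qdbar_sl 0) // => c; apply: cCm_iter_dbar; exact: h.
Qed.

Definition is_slice f Phi := forall J, imag_unit J -> forall p, restr J f p = sl J Phi p.

Lemma qabs_qim_eq0 q : qabs (qim q) = 0 -> qim q = 0.
Proof.
move=> h; have := sqr_qabs (qim q); rewrite h /= !expr0n /= add0r => /esym/eqP.
rewrite !paddr_eq0 ?addr_ge0 ?sqr_ge0 // !expf_eq0 /= => /andP[/andP[/eqP a /eqP b] /eqP c].
by rewrite /qim a b c.
Qed.

Lemma imag_unit_of q : imag_unit (unit_of q).
Proof.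
rewrite /unit_of; case: eqP => [_|/eqP q0].
  by rewrite /imag_unit expr2; apply: quat_ext => /=; ring.
pose N := qabs (qim q).
have N2 : N ^+ 2 = qim_i q ^+ 2 + qim_j q ^+ 2 + qim_k q ^+ 2.
  by rewrite /N sqr_qabs /= expr0n add0r.
have N0 : N != 0.
  by apply: contra q0 => /eqP /qabs_qim_eq0 ->.
rewrite -/N /imag_unit exprZn; have -> : qim q ^+ 2 = (- N ^+ 2) *: 1.
  by rewrite N2 expr2; apply: quat_ext => /=; ring.
rewrite scalerA exprVn mulrN mulVf ?expf_neq0 // scaleN1r //.
Qed.

Lemma coord_ofK q : slice_point (unit_of q) (coord_of q) = q.
Proof.
rewrite /slice_point /coord_of /unit_of /=; case: eqP => [h|/eqP q0].
  have h0 : qabs (qim q) = 0 by rewrite h /qabs /= !expr0n !addr0 sqrtr0.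
  rewrite h0 scale0r addr0; move: h; case: q {h0} => a b c d [-> -> ->].
  by apply: quat_ext => /=; ring.
have N0 : qabs (qim q) != 0.
  by apply: contra q0 => /eqP /qabs_qim_eq0 ->.
rewrite scalerA mulfV // scale1r; case: q {q0 N0} => a b c d.
by apply: quat_ext => /=; ring.
Qed.

Lemma is_sliceE f Phi q : is_slice f Phi -> f q = sl (unit_of q) Phi (coord_of q).
Proof. by move=> h; rewrite -(h _ (imag_unit_of q)) /restr coord_ofK. Qed.

(** The normalization y >= 0 leaves three cases: a real point with a default unit, the upper half
    slice, and the lower half, where the unit is -J and y changes sign. *)
Lemma coord_of_slice_point J p : imag_unit J ->
  [\/ p.2 = 0 /\ coord_of (slice_point J p) = p,
      unit_of (slice_point J p) = J /\ coord_of (slice_point J p) = p |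
      unit_of (slice_point J p) = - J /\ coord_of (slice_point J p) = (p.1, - p.2)].
Proof.
move=> hJ; have [j0 j1] := imag_unitP hJ.
have eq_im : qim (slice_point J p) = p.2 *: J.
  by case: J hJ j0 j1 => a b c d _ /= -> _; apply: quat_ext => /=; ring.
have eq_re : qre (slice_point J p) = p.1 by rewrite /= j0; ring.
have eq_abs : qabs (p.2 *: J) = `|p.2|.
  rewrite /qabs /= j0 mulr0 expr0n add0r !exprMn -!mulrDr j1 mulr1 sqrtr_sqr //.
rewrite /unit_of /coord_of eq_im eq_re eq_abs; case: p {eq_im eq_re eq_abs} => x y /=.
have [y0|y0|->] := ltgtP y 0; last by constructor 1; rewrite normr0.
- constructor 3; rewrite ltr0_norm //; split => //.
  case: eqP => [h|_]; last by rewrite scalerA invrN mulNr mulVf ?ltr0_neq0 // scaleN1r.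
  exfalso; have := congr1 (fun q => y^-1 *: q) h; rewrite scalerA mulVf ?ltr0_neq0 // scale1r scaler0 => e.
  by move: j1; rewrite e /= !expr0n !addr0 => /eqP; rewrite eq_sym oner_eq0.
- constructor 2; rewrite gtr0_norm //; split => //.
  case: eqP => [h|_]; last by rewrite scalerA mulVf ?gt_eqF // scale1r.
  exfalso; have := congr1 (fun q => y^-1 *: q) h; rewrite scalerA mulVf ?gt_eqF // scale1r scaler0 => e.
  by move: j1; rewrite e /= !expr0n !addr0 => /eqP; rewrite eq_sym oner_eq0.
Qed.

(** Conjugation symmetry makes the value invariant under (J, y) to (-J, -y). At a real point it also
    kills the imaginary stems, so the default unit has no effect. *)
Lemma slice_of_coord f Phi : (forall c, conj_sym (Phi c)) ->
  (forall q, f q = sl (unit_of q) Phi (coord_of q)) -> is_slice f Phi.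
Proof.
move=> cs h J hJ p; rewrite /restr h.
have slN I (w : R * R) : sl (- I) Phi (w.1, - w.2) = sl I Phi w.
  rewrite /sl; case: w => x y /=.
  rewrite (@eq_of_qc _ (fun c => re (Phi c (x, y)))); last by move=> c _; rewrite cs.
  rewrite (@eq_of_qc (fun c => im _) (fun c => - im (Phi c (x, y)))); last by move=> c _; rewrite cs.
  by rewrite of_qcN mulrNN.
case: (coord_of_slice_point p hJ) => [[p0 ->]|[-> ->] //|[-> ->]]; last exact: slN.
have z c : im (Phi c p) = 0.
  case: p p0 => x y /= ->; have := congr1 (@complex.Im R) (cs c x 0); rewrite oppr0 /=; lra.
by rewrite /sl (@eq_of_qc (fun c => im _) (fun=> 0)) ?of_qc0 ?mulr0.
Qed.

(** On holomorphic stems (d/dx - I d/dy) / 2 is d/dz, that is, the derived coefficient sequence. *)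
Lemma slice_deriv_esum f (a : nat -> nat -> R) : (forall c, entire (a c)) ->
  is_slice f (fun c p => esum (a c) (cpt p)) ->
  is_slice (slice_deriv f) (fun c p => esum (dseq (a c)) (cpt p)).
Proof.
move=> ea h; apply: slice_of_coord => [c x y|q].
  rewrite -esum_cj; last exact/entire_dseq/ea.
  by congr esum; apply: cE.
rewrite /slice_deriv; set I := unit_of q; set p := coord_of q.
have hI : imag_unit I := imag_unit_of q.
have -> : restr I f = sl I (fun c p => esum (a c) (cpt p)) by apply/funext => z; exact: h.
rewrite /qdx /qdy.
rewrite (qderive_sl I (fun c => dxU p (ea c)) (fun c => dxV p (ea c))).
rewrite (qderive_sl I (fun c => dyU p (ea c)) (fun c => dyV p (ea c))).
rewrite of_qcN [I * (- _ + _)]mulrDr mul_imag_unit // mulrN /sl /U /V.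
by apply: qcP => c; rewrite !(qcD, qcN, qcZ); lra.
Qed.

End SliceFunctions.

(** * The Bargmann transforms on a slice *)

Section BargmannSlices.
Variable R : realType.
Local Notation mu := (@lebesgue_measure R).
Local Notation tpi := (tpi R).
Implicit Types (q I J : quat R) (p : R * R) (z w : cplx R) (phi psi : R -> quat R).

(** The exponential series is the case A = 1, B = 0 of the generating function, so [esum_gen] also
    evaluates [qexp]. *)
Lemma gen_exp k : gen 1 0 k = (k`!%:R^-1 : R).
Proof.
elim: k => [|k IH]; first by rewrite /gen /= fact0 invr1.
have := genS (1 : R) 0 k; rewrite mul1r mulr0 mul0r addr0 IH => h.
have k0 : (k.+1%:R : R) != 0 by rewrite pnatr_eq0.
by apply: (mulfI k0); rewrite h factS natrM invfM mulVKf.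
Qed.

Lemma qlim_iot J (u : nat -> cplx R) l : ccvg u l -> qlim (fun n => iot J (u n)) = iot J l.
Proof.
move=> [h1 h2].
have c k : limn (fun n => qc k (iot J (u n))) = qc k (iot J l).
  apply/cvg_lim => //; rewrite iotE qcD !qcZ.
  under eq_fun do rewrite iotE qcD !qcZ.
  by apply: cvgD; apply: cvgM => //; exact: cvg_cst.
by apply: quat_ext; [exact: (c 0%N)|exact: (c 1%N)|exact: (c 2%N)|exact: (c 3%N)].
Qed.

Lemma qexp_iot J w : imag_unit J -> qexp (iot J w) = iot J (cexp w).
Proof.
move=> hJ; rewrite /qexp -(@qlim_iot J (psum (gen 1 0) w) (cexp w)).
  congr (qlim _); apply/funext => n.
  rewrite /psum (iot_sum J n (fun k => rc (gen 1 0 k) * w ^+ k)); apply: eq_bigr => k _.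
  by rewrite gen_exp iotZ iotX.
have [e _] := entire_gen (1 : R) 0.
by have := esum_cvg w e; rewrite esum_gen rc0 mul0r addr0 -[rc 1]/(1 : cplx R) mul1r.
Qed.

Lemma L2_l2 phi : L2 phi <-> forall c, l2 (fun t => qc c (phi t)).
Proof.
split=> [[[m0 m1 m2 m3] fin]|h].
  have m c : measurable_fun setT (fun t => qc c (phi t)) by case: c => [|[|[|c]]].
  have mq : measurable_fun setT (fun t => qabs (phi t) ^+ 2).
    under eq_fun do rewrite sqr_qabs !expr2.
    by do 3 (apply: measurable_funD; last exact: measurable_funM); exact: measurable_funM.
  have iq : mu.-integrable setT (EFin \o (fun t => qabs (phi t) ^+ 2)).
    apply/integrableP; split; first exact/measurable_EFinP.
    apply: le_lt_trans fin; rewrite le_eqVlt; apply/orP; left; apply/eqP/eq_integral => t _.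
    by rewrite /= ger0_norm ?sqr_ge0.
  move=> c; apply: (@l2_le _ _ (fun t => qabs (phi t) ^+ 2)) => // t.
  rewrite sqr_qabs; have := (sqr_ge0 (qre (phi t)), sqr_ge0 (qim_i (phi t)),
    sqr_ge0 (qim_j (phi t)), sqr_ge0 (qim_k (phi t))).
  by case: c => [|[|[|c]]] /= [[[a0 a1] a2] a3]; rewrite -expr2; lra.
split; first by split; [have [] := h 0%N|have [] := h 1%N|have [] := h 2%N|have [] := h 3%N].
have i : mu.-integrable setT (EFin \o (fun t => (((qre (phi t) * qre (phi t) + qim_i (phi t) * qim_i (phi t))
   + qim_j (phi t) * qim_j (phi t)) + qim_k (phi t) * qim_k (phi t)))).
  exact: (integrableD measurableT (integrableD measurableT (integrableD measurableT (h 0%N).2 (h 1%N).2) (h 2%N).2) (h 3%N).2).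
move/integrableP: i => [_]; apply: le_lt_trans; rewrite le_eqVlt; apply/orP; left.
apply/eqP/eq_integral => t _.
by rewrite /= sqr_qabs -!expr2 ger0_norm // !addr_ge0 ?sqr_ge0.
Qed.

Definition qcoef phi c k : R := coef (fun t => qc c (phi t)) k.

Lemma entire_qcoef phi c : L2 phi -> entire (qcoef phi c).
Proof. by move=> /L2_l2 h; exact: entire_coef. Qed.

Lemma qc_qint c (F : R -> quat R) : qc c (qint mu F) = \int[mu]_t qc c (F t).
Proof. by case: c => [|[|[|c]]]. Qed.

Lemma integral_sum4 (f : nat -> R -> R) : (forall d, mu.-integrable setT (EFin \o f d)) ->
  \int[mu]_t (\sum_(d < 4) f d t) = \sum_(d < 4) \int[mu]_t f d t.
Proof.
move=> h; rewrite (sum4 (fun d => \int[mu]_t f d t)).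
have i2 := integrableD measurableT (h 0%N) (h 1%N).
have i3 := integrableD measurableT i2 (h 2%N).
rewrite -(RintegralD measurableT (h 0%N) (h 1%N)) -(RintegralD measurableT i2 (h 2%N)).
rewrite -(RintegralD measurableT i3 (h 3%N)).
by apply: eq_Rintegral => t _; rewrite (sum4 (fun d => f d t)).
Qed.

(** At a point of the slice of J the kernel is u + J v with real u and v, the components of the
    complex kernel. Hence each real component of phi contributes its own complex transform. *)
Lemma bargmann_slice phi : L2 phi -> is_slice (bargmann phi) (fun c p => esum (qcoef phi c) (cpt p)).
Proof.
move=> /L2_l2 hphi J hJ p; set z := cpt p.
have hc d := ccvg_coef z (hphi d).
rewrite /restr -iot_cpt -/z /bargmann -/(kc R).
have e t : qexp (- pi *: (iot J z ^+ 2 + (t ^+ 2)%:A) + (2 * pi * Num.sqrt 2 * t) *: iot J z) =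
   iot J (cexp (- rc pi * (z ^+ 2 + rc t ^+ 2) + rc (ksl R * t) * z)).
  rewrite -qexp_iot //; congr qexp; rewrite -iotX // -(iot_rc J) -iotD -!iotZ -iotD; congr (iot J _).
  by rewrite -rcX rcN.
have kE t w : kc R *: (iot J (cexp w) * phi t) = iot J (rc (kc R) * cexp w) * phi t.
  by rewrite iotZ scalerAl.
pose u t := re (bkernel t z); pose v t := im (bkernel t z).
have iu d : mu.-integrable setT (EFin \o (fun t => qc d (phi t) * u t)) by have [] := hc d.
have iv d : mu.-integrable setT (EFin \o (fun t => qc d (phi t) * v t)) by have [] := hc d.
have kc0 : kc R != 0 by rewrite gt_eqF // kc_gt0.
have bE t : bkernel t z = rc (kc R) * cexp (- rc pi * (z ^+ 2 + rc t ^+ 2) + rc (ksl R * t) * z) by [].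
apply: qc_ext => c c4; rewrite qcZ qc_qint.
pose M d := qc c (J * qbasis R d).
have iM d : mu.-integrable setT (EFin \o (fun t => M d * (qc d (phi t) * v t))).
  exact: (integrableZl measurableT (M d) (iv d)).
have iS : mu.-integrable setT (EFin \o (fun t => \sum_(d < 4) M d * (qc d (phi t) * v t))).
  have i2 := integrableD measurableT (iM 0%N) (iM 1%N).
  have i3 := integrableD measurableT i2 (iM 2%N).
  have := integrableD measurableT i3 (iM 3%N).
  apply: eq_integrable => // t _.
  by rewrite /= (sum4 (fun d => M d * (qc d (phi t) * v t))).
have integrandE t : qc c (qexp (- pi *: (iot J z ^+ 2 + (t ^+ 2)%:A) + (2 * pi * Num.sqrt 2 * t) *: iot J z) * phi t)
   = (kc R)^-1 * (qc c (phi t) * u t + \sum_(d < 4) M d * (qc d (phi t) * v t)).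
  apply: (mulfI kc0); rewrite mulVKf // -qcZ e kE -bE iotE mulrDl qcD -!scalerAl mul1r !qcZ.
  rewrite [re _ * _]mulrC; congr (_ + _); rewrite qc_mull mulr_sumr; apply: eq_bigr => d _.
  by rewrite /v mulrCA; congr (_ * _); rewrite mulrC.
have iUS : mu.-integrable setT (EFin \o (fun t => qc c (phi t) * u t + \sum_(d < 4) M d * (qc d (phi t) * v t))).
  exact: (integrableD measurableT (iu c) iS).
have -> : \int[mu]_t qc c (qexp (- pi *: (iot J z ^+ 2 + (t ^+ 2)%:A) + (2 * pi * Num.sqrt 2 * t) *: iot J z) * phi t)
  = (kc R)^-1 * \int[mu]_t (qc c (phi t) * u t + \sum_(d < 4) M d * (qc d (phi t) * v t)).
  by rewrite -(RintegralZl _ _ iUS) //; apply: eq_Rintegral => t _; exact: integrandE.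
rewrite mulVKf // (RintegralD measurableT (iu c) iS) (integral_sum4 iM).
rewrite /sl qcD qc_of_qc // [qc c (J * _)]qc_mull.
have E d := bargmann_integral z (hphi d).
congr (_ + _); first by rewrite /qcoef E.
rewrite (sum4 (fun d => \int[mu]_t (M d * (qc d (phi t) * v t)))).
rewrite (sum4 (fun d => qc c (J * qbasis R d) * qc d (of_qc (fun d => im (esum (qcoef phi d) z))))).
have Md d : \int[mu]_t (M d * (qc d (phi t) * v t)) = M d * im (esum (qcoef phi d) z).
  by rewrite (RintegralZl _ _ (iv d)) // /qcoef E.
by rewrite !Md.
Qed.

Lemma iter_slice_deriv m phi : L2 phi ->
  is_slice (iter m (@slice_deriv R) (bargmann phi)) (fun c p => esum (iter m (@dseq R) (qcoef phi c)) (cpt p)).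
Proof.
move=> hphi; have ei i c : entire (iter i (@dseq R) (qcoef phi c)).
  by elim: i => [|i IH]; [exact: entire_qcoef|exact: entire_dseq].
elim: m => [|m IH]; first exact: bargmann_slice.
rewrite iterS; exact: (slice_deriv_esum (a := fun c => iter m (@dseq R) (qcoef phi c)) (ei m) IH).
Qed.

Definition tcoef j : R := (-1) ^+ j * Num.sqrt (((2 * pi) ^+ j * j`!%:R)^-1).

(** The normalization cancels exactly the factor (2 pi)^j j! by which [hnorm R j k] exceeds
    [hnorm R 0 k]. *)
Lemma tcoef_sqr j : tcoef j ^+ 2 * (tpi ^+ j * j`!%:R) = 1.
Proof.
have h : 0 < (2 * pi) ^+ j * j`!%:R :> R.
  by rewrite mulr_gt0 ?exprn_gt0 ?mulr_gt0 ?pi_gt0 // ltr0n fact_gt0.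
rewrite /tcoef exprMn sqr_sqrtr ?invr_ge0 ?ltW // sqrr_sign mul1r.
by rewrite mulVf // gt_eqF.
Qed.

Lemma tcoef_neq0 j : tcoef j != 0.
Proof. by apply/eqP => h; have := tcoef_sqr j; rewrite h expr0n mul0r => /esym/eqP; rewrite oner_eq0. Qed.

(** Quaternionic conjugation on a slice is complex conjugation of the coordinate, so the defining
    sum is the binomial form of A^j. *)
Lemma true_bargmann_slice j phi : L2 phi ->
  is_slice (true_bargmann j phi) (fun c p => rc (tcoef j) * HE j (qcoef phi c) (cpt p)).
Proof.
move=> hphi J hJ p; set z := cpt p; rewrite slZ //.
rewrite /restr -iot_cpt -/z /true_bargmann -/(tcoef j); congr (_ *: _).
have -> : sl J (fun c p => HE j (qcoef phi c) (cpt p)) p =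
   sl J (fun c p => \sum_(k < j.+1) ('C(j, k)%:R * (- rc tpi * cj z) ^+ k) *
      esum (iter (j - k) (@dseq R) (qcoef phi c)) (cpt p)) p.
  apply: eq_sl => c _; rewrite HE_binomial; last exact: entire_qcoef.
  by apply: eq_bigr => k _; rewrite mulrA.
rewrite (sl_sum J j.+1 (fun k c p => ('C(j, k)%:R * (- rc tpi * cj z) ^+ k) *
      esum (iter (j - k) (@dseq R) (qcoef phi c)) (cpt p))).
apply: eq_bigr => k _; rewrite sl_iot // -(iter_slice_deriv (j - k) hphi hJ) /restr -iot_cpt -/z.
rewrite qconj_iot // -iotZ -iotX // rcN mulrA; congr (_ * _).
by rewrite -[in RHS]rcn iotZ scaler_nat mulr_natl.
Qed.

End BargmannSlices.

(** * The full transform: isometry, injectivity, linearity, surjectivity *)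

Section FullTransform.
Variable R : realType.
Local Notation mu := (@lebesgue_measure R).
Local Notation mu2 := (mu \x mu)%E.
Implicit Types (I J : quat R) (p : R * R) (f : quat R -> quat R).

(* [c |-> sum_j HE j (b j c)]: the stems, one complex function for each of the four real components. *)
Definition stem n (b : nat -> nat -> nat -> R) c p : cplx R :=
  \sum_(j < n.+1) HE j (b j c) (cpt p).

(** [inord] lets j range over all natural numbers, so that the sequence of coefficient sequences has
    the type expected by [stem]; only j <= n matters there. *)
Definition fcoef n (phi : 'I_n.+1 -> R -> quat R) j c k : R := tcoef R j * qcoef (phi (inord j)) c k.

Lemma entire_fcoef n (phi : 'I_n.+1 -> R -> quat R) j c : L2vec phi -> entire (fcoef phi j c).
Proof. by move=> h; apply: entire_scale; exact: entire_qcoef. Qed.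

Lemma full_bargmann_slice n (phi : 'I_n.+1 -> R -> quat R) : L2vec phi ->
  is_slice (full_bargmann phi) (stem n (fcoef phi)).
Proof.
move=> h J hJ p; rewrite (sl_sum J n.+1 (fun j c p => HE j (fcoef phi j c) (cpt p))).
rewrite /restr /full_bargmann; apply: eq_bigr => j _.
have := true_bargmann_slice j (h j) hJ p; rewrite /restr => ->; apply: eq_sl => c _.
by rewrite /fcoef inord_val HEZ //; exact: entire_qcoef.
Qed.

Section Stem.
Variables (n : nat) (b : nat -> nat -> nat -> R).
Hypothesis eb : forall j c, entire (b j c).

Lemma cCm_stem m c : cCm m (stem n b c).
Proof. by apply: cCm_sum => j; exact: cCm_HE. Qed.

Lemma conj_sym_stem c : conj_sym (stem n b c).
Proof.
move=> x y; rewrite /stem cj_sum; apply: eq_bigr => j _.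
by rewrite -HE_cj //; congr HE; apply: cE.
Qed.

Lemma stem_polyanalytic c : iter n.+1 (@dbar R) (stem n b c) = (fun=> 0).
Proof.
have key N : (N <= n.+1)%N ->
    iter n.+1 (@dbar R) (fun p => \sum_(j < N) HE j (b j c) (cpt p)) = (fun=> 0).
  elim: N => [|N IH] hN.
    rewrite (_ : (fun p => _) = fun=> 0) ?iter_dbar0 //.
    by apply/funext => p; rewrite big_ord0.
  rewrite (_ : (fun p => _) = fun p => (\sum_(j < N) HE j (b j c) (cpt p)) + HE N (b N c) (cpt p)); last first.
    by apply/funext => p; rewrite big_ord_recr.
  rewrite (iter_dbarD (m := n.+1)); last 2 first.
  - by apply: (@cCm_sum R n.+1 'I_N (index_enum _) (fun j p => HE j (b j c) (cpt p))) => j; exact: cCm_HE.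
  - exact: cCm_HE.
  rewrite IH; last exact: ltnW.
  rewrite (iter_dbar_le (m := N.+1) (n := n.+1)) //; last exact: HE_polyanalytic.
  by apply/funext => p; rewrite addr0.
exact: key.
Qed.

Lemma stem_norm I f : imag_unit I -> is_slice f (stem n b) ->
  (\int[mu2]_z (qabs (restr I f z) ^+ 2 * fock_weight I z)%:E =
   \sum_(c < 4) \sum_(j < n.+1) \sum_(0 <= k <oo) (b j c k ^+ 2 * hnorm R j k)%:E)%E.
Proof.
move=> hI hf.
pose al p := of_qc (fun c => re (stem n b c p)); pose be p := of_qc (fun c => im (stem n b c p)).
have cS c : continuous (fun p => re (stem n b c p)) /\ continuous (fun p => im (stem n b c p)).
  by have [c1 c2] := cCm_stem 0 c.
have ca c : continuous (fun p => qc c (al p)).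
  by case: c => [|[|[|c]]]; [exact: (cS 0%N).1|exact: (cS 1%N).1|exact: (cS 2%N).1|exact: (cS 3%N).1].
have cb c : continuous (fun p => qc c (be p)).
  by case: c => [|[|[|c]]]; [exact: (cS 0%N).2|exact: (cS 1%N).2|exact: (cS 2%N).2|exact: (cS 3%N).2].
have ea x y : al (x, - y) = al (x, y) by apply: eq_of_qc => c _; rewrite conj_sym_stem.
have ob x y : be (x, - y) = - be (x, y).
  by rewrite -of_qcN; apply: eq_of_qc => c _; rewrite conj_sym_stem.
have := slice_norm_integral hI ca cb ea ob.
rewrite (_ : (\int[mu2]_p (qabs (al p + I * be p) ^+ 2 * wt p)%:E)%E =
  (\int[mu2]_z (qabs (restr I f z) ^+ 2 * fock_weight I z)%:E)%E); last first.
  apply: eq_integral => p _; congr (_ * _)%:E; first by rewrite hf.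
  by rewrite /fock_weight sqr_qabs_slice_point.
move=> ->; apply: eq_bigr => c _; rewrite -(HE_parseval n (b := fun j => b j c)) //.
by apply: eq_integral => p _; rewrite !qc_of_qc //; case: (stem n b c p) => x y.
Qed.

Lemma stem_slice_polyanalytic f : is_slice f (stem n b) -> slice_polyanalytic n.+1 f.
Proof.
move=> hf; split.
  exists (fun p => of_qc (fun c => re (stem n b c p))), (fun p => of_qc (fun c => im (stem n b c p))).
  have h c := cCm_stem n.+1 c.
  split; last 2 first.
  - by split; [exact: (h 0%N).1|exact: (h 1%N).1|exact: (h 2%N).1|exact: (h 3%N).1].
  - by split; [exact: (h 0%N).2|exact: (h 1%N).2|exact: (h 2%N).2|exact: (h 3%N).2].
  split => [x y|x y|J hJ z].
  - by apply: eq_of_qc => c _; rewrite conj_sym_stem.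
  - by rewrite -of_qcN; apply: eq_of_qc => c _; rewrite conj_sym_stem.
  - exact: hf.
move=> J hJ z; rewrite (_ : restr J f = sl J (stem n b)); last by apply/funext => p; exact: hf.
rewrite -/(iter n.+1 (qdbar J) _ z) (iter_qdbar_sl (m := n.+1) hJ (cCm_stem n.+1)).
rewrite (@eq_sl _ _ _ (fun _ _ => 0)) ?sl0 ?scaler0 // => c _.
by rewrite stem_polyanalytic.
Qed.

End Stem.

(** By [tcoef_sqr] the order j disappears from the weighted coefficients, and the identity reduces
    to Parseval on the line. *)
Lemma fcoef_parseval n (phi : 'I_n.+1 -> R -> quat R) (j : 'I_n.+1) c : L2vec phi ->
  (\sum_(0 <= k <oo) (fcoef phi j c k ^+ 2 * hnorm R j k)%:E =
   (ip (fun t => qc c (phi j t)) (fun t => qc c (phi j t)))%:E)%E.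
Proof.
move=> h; have hl := (L2_l2 (phi j)).1 (h j) c; rewrite -(coef_parseval hl).
apply: eq_eseriesr => k _; congr EFin; rewrite /fcoef inord_val exprMn /qcoef.
have t := tcoef_sqr R j; rewrite /hnorm expr0 fact0 !mul1r; set X := _ / (2 * _).
transitivity ((tcoef R j ^+ 2 * (tpi R ^+ j * j`!%:R)) * (coef (fun t => qc c (phi j t)) k ^+ 2 * X)).
  by ring.
by rewrite t mul1r.
Qed.

Lemma L2_norm_sqr (phi : R -> quat R) : L2 phi ->
  L2_norm phi ^+ 2 = \sum_(c < 4) ip (fun t => qc c (phi t)) (fun t => qc c (phi t)).
Proof.
move=> /L2_l2 h; rewrite /L2_norm sqr_sqrtr.
  rewrite /ip -(@integral_sum4 _ (fun c t => qc c (phi t) * qc c (phi t))); last by move=> d; have [] := h d.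
  apply: eq_Rintegral => t _; rewrite qre_conjM sqr_qabs.
  by rewrite (sum4 (fun c => qc c (phi t) * qc c (phi t))) -!expr2.
by apply: Rintegral_ge0 => t _; rewrite qre_conjM sqr_ge0.
Qed.

Lemma fock_norm_sqr I f (x : R) :
  (\int[mu2]_z (qabs (restr I f z) ^+ 2 * fock_weight I z)%:E = x%:E)%E ->
  fock_norm I f = Num.sqrt x.
Proof.
move=> h; rewrite /fock_norm; congr Num.sqrt.
have e z : qre (fock_weight I z *: (qconj (restr I f z) * restr I f z)) =
    qabs (restr I f z) ^+ 2 * fock_weight I z.
  transitivity (qc 0 (fock_weight I z *: (qconj (restr I f z) * restr I f z))); first by [].
  by rewrite qcZ mulrC -qre_conjM.
transitivity (fine (\int[mu2]_z (qre (fock_weight I z *: (qconj (restr I f z) * restr I f z)))%:E)%E).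
  by [].
by rewrite -[RHS]/(fine x%:E) -h; congr fine; apply: eq_integral => z _; rewrite e.
Qed.

(** Uniqueness of the decomposition follows from Parseval: the difference of the stems is 0, so the
    sum of its weighted squared coefficients vanishes term by term. *)
Lemma stem_inj n I (b b' : nat -> nat -> nat -> R) f :
  (forall j c, entire (b j c)) -> (forall j c, entire (b' j c)) ->
  imag_unit I -> is_slice f (stem n b) -> is_slice f (stem n b') ->
  forall j c k, (j < n.+1)%N -> (c < 4)%N -> b j c k = b' j c k.
Proof.
move=> eb eb' hI hf hf' j c k hj hc.
have e p : stem n b c p = stem n b' c p.
  by apply: (@sl_inj R _ _ p I hI) => //; rewrite -hf ?hf' //; exact: imag_unitN.
pose d j k := b j c k + -1 * b' j c k.
have en i : entire (fun k => -1 * b' i c k) by exact: entire_scale.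
have ed i : entire (d i) by exact: entireD.
have d0 p : \sum_(i < n.+1) HE i (d i) (cpt p) = 0.
  transitivity (stem n b c p + -1 * stem n b' c p); last by rewrite e mulN1r subrr.
  rewrite /stem mulr_sumr -big_split /=; apply: eq_bigr => i _.
  by rewrite HED // HEZ // rcN.
have := HE_parseval n ed; rewrite integral0_eq => [|p _]; last by rewrite d0 nc0 expr0n mul0r.
pose S i := (\sum_(0 <= k <oo) (d i k ^+ 2 * hnorm R i k)%:E)%E.
have t0 i m : (0 <= (d i m ^+ 2 * hnorm R i m)%:E)%E.
  by rewrite lee_fin mulr_ge0 ?sqr_ge0 // ltW // hnorm_gt0.
have S0 i : (0 <= S i)%E by apply: nneseries_ge0.
move=> /esym z.
have Sj : (S j <= 0)%E.
  rewrite -z (bigD1 (Ordinal hj)) //= -[X in (X <= _)%E]adde0 leeD //.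
  by apply: sume_ge0 => i _; exact: S0.
have tk : ((d j k ^+ 2 * hnorm R j k)%:E <= 0)%E.
  apply: le_trans Sj; apply: le_trans (nneseries_lim_ge k.+1 (fun i _ _ => t0 j i)).
  rewrite big_mkord big_ord_recr /= -[X in (X <= _)%E]add0e leeD //.
  by apply: sume_ge0 => m _; exact: t0.
have h0 := hnorm_gt0 R j k.
move: tk; rewrite lee_fin pmulr_lle0 // => h; have /eqP : d j k ^+ 2 = 0.
  by apply/eqP; rewrite eq_le h sqr_ge0.
by rewrite expf_eq0 /= /d mulN1r subr_eq0 => /eqP.
Qed.

Lemma full_bargmann_ext n (phi psi : 'I_n.+1 -> R -> quat R) : L2vec phi -> L2vec psi ->
  (forall j c k, fcoef phi j c k = fcoef psi j c k) -> full_bargmann phi = full_bargmann psi.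
Proof.
move=> hphi hpsi h; apply/funext => q.
rewrite (is_sliceE q (full_bargmann_slice hphi)) (is_sliceE q (full_bargmann_slice hpsi)).
apply: eq_sl => c _; apply: eq_bigr => j _; congr HE; apply/funext => k; exact: h.
Qed.

Lemma full_bargmann_inj n I (phi psi : 'I_n.+1 -> R -> quat R) : imag_unit I ->
  L2vec phi -> L2vec psi -> full_bargmann phi = full_bargmann psi -> L2vec_eq phi psi.
Proof.
move=> hI hphi hpsi e j.
have eq c : (c < 4)%N -> ae_eq mu setT (fun t => qc c (phi j t)) (fun t => qc c (psi j t)).
  move=> hc; have l1 := (L2_l2 (phi j)).1 (hphi j) c; have l2' := (L2_l2 (psi j)).1 (hpsi j) c.
  have l3 : l2 (fun t => -1 * qc c (psi j t)) by exact: l2Z.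
  have ck k : qcoef (phi j) c k = qcoef (psi j) c k.
    have hf' : is_slice (full_bargmann phi) (stem n (fcoef psi)) by rewrite e; exact: full_bargmann_slice.
    have := stem_inj (fun i d => entire_fcoef i d hphi) (fun i d => entire_fcoef i d hpsi) hI
      (full_bargmann_slice hphi) hf' k (ltn_ord j) hc.
    rewrite /fcoef inord_val.
    exact/mulfI/tcoef_neq0.
  have : ae_eq mu setT (fun t => qc c (phi j t) + -1 * qc c (psi j t)) (fun=> 0).
    apply: coef_injective; first exact: l2D.
    move=> k; rewrite coefD // coefZ // -[coef _ k]/(qcoef (phi j) c k) ck.
    by rewrite -[coef _ k]/(qcoef (psi j) c k) mulN1r subrr.
  have fl := ae_filter_ringOfSetsType mu; apply: filterS => t h /h /eqP.
  by rewrite mulN1r subr_eq0 => /eqP.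
have fl := ae_filter_ringOfSetsType mu.
pose P c t := qc c (phi j t) = qc c (psi j t).
have ae c : (c < 4)%N -> {ae mu, forall t, P c t}.
  by move=> hc; move: (eq c hc); apply: filterS => t h; exact: h.
have E01 : {ae mu, forall t, P 0%N t /\ P 1%N t}.
  by apply: (filterS2 _ _ (ae 0%N isT) (ae 1%N isT)) => t h0 h1; split.
have E23 : {ae mu, forall t, P 2%N t /\ P 3%N t}.
  by apply: (filterS2 _ _ (ae 2%N isT) (ae 3%N isT)) => t h0 h1; split.
suff : {ae mu, forall t, phi j t = psi j t} by apply: filterS => t h _.
apply: (filterS2 _ _ E01 E23) => t [h0 h1] [h2 h3].
by apply: quat_ext; [exact: h0|exact: h1|exact: h2|exact: h3].
Qed.

Lemma full_bargmann_ae n (phi psi : 'I_n.+1 -> R -> quat R) : L2vec phi -> L2vec psi ->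
  L2vec_eq phi psi -> full_bargmann phi = full_bargmann psi.
Proof.
move=> hphi hpsi e; apply: full_bargmann_ext => // j c k; rewrite /fcoef; congr (_ * _).
apply: coef_ae; [exact: (L2_l2 _).1 (hphi _) c|exact: (L2_l2 _).1 (hpsi _) c|].
have fl := ae_filter_ringOfSetsType mu; move: (e (inord j)); apply: filterS => t h ht.
by rewrite (h ht).
Qed.

Lemma full_bargmann_norm n I (phi : 'I_n.+1 -> R -> quat R) : imag_unit I -> L2vec phi ->
  (\int[mu2]_z (qabs (restr I (full_bargmann phi) z) ^+ 2 * fock_weight I z)%:E =
   (\sum_j L2_norm (phi j) ^+ 2)%:E)%E.
Proof.
move=> hI h; rewrite (stem_norm (fun j c => entire_fcoef j c h) hI (full_bargmann_slice h)).
under eq_bigr do under eq_bigr do rewrite fcoef_parseval //.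
rewrite exchange_big /= -sumEFin; apply: eq_bigr => j _.
by rewrite L2_norm_sqr // -sumEFin.
Qed.

Lemma L2_linear (phi psi : R -> quat R) (a b : quat R) : L2 phi -> L2 psi ->
  L2 (fun x => phi x * a + psi x * b).
Proof.
move=> /L2_l2 hphi /L2_l2 hpsi; apply/L2_l2 => c.
have l (f : R -> quat R) (d : quat R) : (forall c, l2 (fun t => qc c (f t))) ->
    l2 (fun t => qc c (f t * d)).
  move=> hf; rewrite (_ : (fun t => _) = fun t => \sum_(i < 4) qc c (qbasis R i * d) * qc i (f t)).
    by apply: (@l2_sum _ 4 (fun i t => qc c (qbasis R i * d) * qc i (f t))) => i; exact: l2Z.
  by apply/funext => t; rewrite qc_mulr.
rewrite (_ : (fun t => _) = fun t => qc c (phi t * a) + qc c (psi t * b)); first by apply: l2D; exact: l.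
by apply/funext => t; rewrite qcD.
Qed.

Lemma qcoef_linear (phi psi : R -> quat R) (a b : quat R) c k : L2 phi -> L2 psi ->
  qcoef (fun x => phi x * a + psi x * b) c k =
  \sum_(d < 4) (qc c (qbasis R d * a) * qcoef phi d k + qc c (qbasis R d * b) * qcoef psi d k).
Proof.
move=> /L2_l2 hphi /L2_l2 hpsi.
pose F d t := qc c (qbasis R d * a) * qc d (phi t) + qc c (qbasis R d * b) * qc d (psi t).
have hF d : l2 (F d) by apply: l2D; exact: l2Z.
rewrite /qcoef /coef; have -> : (fun t => qc c (phi t * a + psi t * b)) = (fun t => \sum_(d < 4) F d t).
  by apply/funext => t; rewrite qcD (qc_mulr c (phi t)) (qc_mulr c (psi t)) -big_split.
rewrite (ip_sum 4 (l2_kap R k) hF); apply: eq_bigr => d _.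
rewrite -[LHS]/(coef (F d) k) coefD; [|exact: l2Z|exact: l2Z].
by rewrite !coefZ.
Qed.

(** Right multiplication by a quaternion mixes the four components through a real matrix, and [HE]
    is linear over the reals in its coefficients. On each slice it commutes with left multiplication
    by the unit. *)
Lemma full_bargmann_linear n (phi psi : 'I_n.+1 -> R -> quat R) (a b : quat R) :
  L2vec phi -> L2vec psi ->
  forall q, full_bargmann (fun j x => phi j x * a + psi j x * b) q =
            full_bargmann phi q * a + full_bargmann psi q * b.
Proof.
move=> hphi hpsi q.
have hsum : L2vec (fun j x => phi j x * a + psi j x * b) by move=> j; exact: L2_linear.
rewrite (is_sliceE q (full_bargmann_slice hsum)) (is_sliceE q (full_bargmann_slice hphi)).
rewrite (is_sliceE q (full_bargmann_slice hpsi)); set J := unit_of q; set p := coord_of q.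
pose A c d : R := qc c (qbasis R d * a); pose B c d : R := qc c (qbasis R d * b).
have eS (c : nat) : stem n (fcoef (fun j x => phi j x * a + psi j x * b)) c p =
    \sum_(d < 4) (rc (A c d) * stem n (fcoef phi) d p + rc (B c d) * stem n (fcoef psi) d p).
  rewrite /stem; under [RHS]eq_bigr do rewrite !mulr_sumr -big_split.
  rewrite exchange_big /=; apply: eq_bigr => j _.
  have e1 (d : nat) : entire (fun k => A c d * fcoef phi j d k) by apply: entire_scale; exact: entire_fcoef.
  have e2 (d : nat) : entire (fun k => B c d * fcoef psi j d k) by apply: entire_scale; exact: entire_fcoef.
  pose G d k := A c d * fcoef phi j d k + B c d * fcoef psi j d k.
  have eG d : entire (G d) by exact: entireD.
  have -> : fcoef (fun j x => phi j x * a + psi j x * b) j c = (fun k => ((G 0%N k + G 1%N k) + G 2%N k) + G 3%N k).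
    apply/funext => k; rewrite /fcoef qcoef_linear //.
    rewrite (sum4 (fun d => qc c (qbasis R d * a) * qcoef (phi (inord j)) d k + qc c (qbasis R d * b) * qcoef (psi (inord j)) d k)).
    by rewrite /G /fcoef -/(A c _) /A /B; ring.
  have HG d : HE j (G d) (cpt p) = rc (A c d) * HE j (fcoef phi j d) (cpt p) + rc (B c d) * HE j (fcoef psi j d) (cpt p).
    rewrite HED; [|exact: e1|exact: e2].
    rewrite (HEZ j (A c d) (cpt p) (entire_fcoef j d hphi)).
    by rewrite (HEZ j (B c d) (cpt p) (entire_fcoef j d hpsi)).
  rewrite (sum4 (fun d => rc (A c d) * HE j (fcoef phi j d) (cpt p) + rc (B c d) * HE j (fcoef psi j d) (cpt p))).
  rewrite -!HG HED //; last by do 2 apply: entireD.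
  by rewrite HED ?HED //; exact: entireD.
have key (P : cplx R -> R) : (forall x w, P (rc x * w) = x * P w) -> (forall x y, P (x + y) = P x + P y) ->
    of_qc (fun c => P (stem n (fcoef (fun j x => phi j x * a + psi j x * b)) c p)) =
    of_qc (fun c => P (stem n (fcoef phi) c p)) * a + of_qc (fun c => P (stem n (fcoef psi) c p)) * b.
  move=> hZ hD; apply: qc_ext => c c4; rewrite qc_of_qc // qcD !(qc_mulr c (of_qc _)) eS.
  rewrite (sum4 (fun d => rc (A c d) * stem n (fcoef phi) d p + rc (B c d) * stem n (fcoef psi) d p)).
  rewrite (sum4 (fun d => A c d * qc d (of_qc (fun c => P (stem n (fcoef phi) c p))))).
  rewrite (sum4 (fun d => B c d * qc d (of_qc (fun c => P (stem n (fcoef psi) c p))))).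
  by rewrite !hD !hZ /=; ring.
have reZ (x : R) (w : cplx R) : re (rc x * w) = x * re w by rewrite !cRI mul0r subr0.
have imZ (x : R) (w : cplx R) : im (rc x * w) = x * im w by rewrite !cRI mul0r addr0.
rewrite /sl (key (@complex.Re R) reZ (@reD R)) (key (@complex.Im R) imZ (@imD R)).
by rewrite mulrDr !mulrDl !mulrA addrACA.
Qed.

(** The stems of f are polyanalytic, hence sums of A^j E_j. The norm identity turns the finite Fock
    integral into summability of every coefficient sequence, and Riesz-Fischer supplies the preimage
    component by component. *)
Lemma full_bargmann_onto n I f : imag_unit I -> slice_polyFock I n.+1 f ->
  exists2 phi : 'I_n.+1 -> R -> quat R, L2vec phi & full_bargmann phi = f.
Proof.
move=> hI [[[al [be [[ea ob hf] cal cbe]]] poly] fin].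
pose Phi c p := Cpx (qc c (al p)) (qc c (be p)).
have sPhi : is_slice f Phi.
  by move=> J hJ p; rewrite (hf J hJ p) /sl /= !of_qc_qc.
have cPhi c : cCm n.+1 (Phi c).
  have [a0 a1 a2 a3] := cal; have [b0 b1 b2 b3] := cbe.
  by case: c => [|[|[|c]]]; split.
have csym c : conj_sym (Phi c).
  by move=> x y; rewrite /Phi ea ob qcN.
have pPhi c : (c < 4)%N -> iter n.+1 (@dbar R) (Phi c) = (fun=> 0).
  move=> c4; apply/funext => p.
  have z J : imag_unit J -> sl J (fun c => iter n.+1 (@dbar R) (Phi c)) p = sl J (fun _ _ => 0) p.
    move=> hJ; rewrite sl0 -(iter_qdbar_sl (m := n.+1) hJ cPhi).
    have := poly J hJ p; rewrite (_ : restr J f = sl J Phi); last by apply/funext => w; exact: sPhi.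
    move=> /eqP; rewrite scaler_eq0 => /orP[|/eqP //].
    by rewrite invr_eq0 expf_eq0 /= pnatr_eq0.
  exact: (sl_inj hI (z I hI) (z _ (imag_unitN hI)) c4).
have [b hb] : exists b : nat -> nat -> nat -> R, forall c, (c < 4)%N ->
    (forall j, entire (b c j)) /\ forall p, Phi c p = \sum_(j < n.+1) HE j (b c j) (cpt p).
  have ex c : exists b : nat -> nat -> R, (c < 4)%N ->
      (forall j, entire (b j)) /\ forall p, Phi c p = \sum_(j < n.+1) HE j (b j) (cpt p).
    have [c4|c4] := boolP (c < 4)%N; last by exists (fun _ _ => 0).
    by have [b hb] := polyanalytic_HE (cPhi c) (csym c) (pPhi c c4); exists b.
  by have [b hb] := choice ex; exists b.
(* Set to 0 for c >= 4, where [b] is not controlled, so that every sequence is entire as the lemmas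
   on [stem] require. *)
pose b' j c k := if (c < 4)%N then b c j k else 0.
have eb' j c : entire (b' j c).
  have [h|h] := boolP (c < 4)%N.
    by rewrite (_ : b' j c = b c j); [exact: (hb c h).1|apply/funext => k; rewrite /b' h].
  by rewrite (_ : b' j c = fun=> 0); [exact: entire0|apply/funext => k; rewrite /b' (negPf h)].
have sb : is_slice f (stem n b').
  move=> J hJ p; rewrite (sPhi J hJ p); apply: eq_sl => c c4.
  by rewrite (hb c c4).2; apply: eq_bigr => j _; rewrite /b' c4.
have t0 j c k : (0 <= (b' j c k ^+ 2 * hnorm R j k)%:E)%E.
  by rewrite lee_fin mulr_ge0 ?sqr_ge0 // ltW // hnorm_gt0.
pose S j c := (\sum_(0 <= k <oo) (b' j c k ^+ 2 * hnorm R j k)%:E)%E.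
have S0 j c : (0 <= S j c)%E by apply: nneseries_ge0.
have finS (j : 'I_n.+1) c : (S j c < +oo)%E.
  have [c4|c4] := boolP (c < 4)%N; last first.
    rewrite /S (_ : (fun N => _) = fun=> 0%E) ?lim_cst ?ltry //.
    by apply/funext => N; rewrite big1 // => k _; rewrite /b' (negPf c4) expr0n mul0r.
  apply: le_lt_trans fin; rewrite (stem_norm eb' hI sb).
  rewrite (bigD1 (Ordinal c4)) //= (bigD1 j) //= -addeA leeDl // adde_ge0 //.
    by apply: sume_ge0 => i _; exact: (S0 i c).
  by apply: sume_ge0 => d _; apply: sume_ge0 => i _; exact: (S0 i d).
(* Dividing by [tcoef] undoes the normalization in [fcoef]; in the weight of order 0 the new squares
   then have the same sum. *)
pose a j c k := (tcoef R j)^-1 * b' j c k.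
have tc j k c : a j c k ^+ 2 * hnorm R 0 k = b' j c k ^+ 2 * hnorm R j k.
  have t := tcoef_sqr R j; have tn := tcoef_neq0 R j.
  rewrite /a exprMn exprVn /hnorm expr0 fact0 !mul1r; set X := _ / (2 * _).
  have -> : (tcoef R j ^+ 2)^-1 = tpi R ^+ j * j`!%:R.
    by apply: (mulfI (expf_neq0 2 tn)); rewrite mulfV ?expf_neq0 // t.
  by ring.
have rf (j : 'I_n.+1) c : exists g, l2 g /\ forall k, coef g k = a j c k.
  have fS : S j c \is a fin_num by rewrite ge0_fin_numE.
  have [N|g hg [ck _]] := @riesz_fischer R (a j c) (fine (S j c)); last by exists g.
  rewrite -lee_fin fineK //; apply: le_trans (nneseries_lim_ge N (fun i _ _ => t0 j c i)).
  by rewrite big_mkord sumEFin lee_fin; apply: ler_sum => k _; rewrite tc.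
have [g hg] := choice (fun jc : 'I_n.+1 * nat => rf jc.1 jc.2).
pose phi (j : 'I_n.+1) t := of_qc (fun c => g (j, c) t).
have hphi : L2vec phi.
  move=> j; apply/L2_l2; case=> [|[|[|c]]].
  - exact: (hg (j, 0%N)).1.
  - exact: (hg (j, 1%N)).1.
  - exact: (hg (j, 2%N)).1.
  - exact: (hg (j, 3%N)).1.
exists phi => //; apply/funext => q.
rewrite (is_sliceE q (full_bargmann_slice hphi)) (is_sliceE q sb); apply: eq_sl => c c4.
apply: eq_bigr => j _; congr HE; apply/funext => k.
rewrite /fcoef inord_val /qcoef (_ : (fun t => qc c (phi j t)) = g (j, c)); last first.
  by apply/funext => t; rewrite qc_of_qc.
by rewrite (hg (j, c)).2 /a mulVKf // tcoef_neq0.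
Qed.

End FullTransform.

Theorem theorem3p15 (R : realType) (n : nat) (I : quat R)
    (hI : imag_unit I) :
  [/\ (* well defined from L2 classes to the Fock space, and injective *)
      (forall phi : 'I_n.+1 -> R -> quat R, L2vec phi ->
         slice_polyFock I n.+1 (full_bargmann phi)) /\
      (forall phi psi : 'I_n.+1 -> R -> quat R, L2vec phi -> L2vec psi ->
         (L2vec_eq phi psi <-> full_bargmann phi = full_bargmann psi)),
      (* right linear *)
      forall (phi psi : 'I_n.+1 -> R -> quat R) (a b : quat R),
         L2vec phi -> L2vec psi ->
         forall q, full_bargmann (fun j x => phi j x * a + psi j x * b) q
                   = full_bargmann phi q * a + full_bargmann psi q * b,
      (* isometric *)
      forall phi : 'I_n.+1 -> R -> quat R, L2vec phi ->
         fock_norm I (full_bargmann phi) = L2vec_norm phi &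
      (* onto *)
      forall f : quat R -> quat R, slice_polyFock I n.+1 f ->
         exists2 phi : 'I_n.+1 -> R -> quat R, L2vec phi & full_bargmann phi = f].
Proof.
split.
- split=> [phi h|phi psi h1 h2].
    split; last by rewrite full_bargmann_norm // ltry.
    apply: (@stem_slice_polyanalytic R n (fcoef phi)); last exact: full_bargmann_slice.
    by move=> j c; exact: entire_fcoef.
  by split; [exact: full_bargmann_ae|exact: full_bargmann_inj hI h1 h2].
- exact: full_bargmann_linear.
- by move=> phi h; rewrite (fock_norm_sqr (full_bargmann_norm hI h)).
- by move=> f; exact: full_bargmann_onto.
Qed.
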